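(* With the notation defined in the context (where $t_0=u+iv$ and the quantities $A,B,a,b,C_s,D_s$ all depend on $n$), neglecting exponentially smaller terms, $$\gamma_n\sim\frac{Be^{nA}}{\sqrt{n}}\left\{\cos(na+b)\sum_{s=0}^\infty \frac{C_s\,(\tfrac12)_s}{n^s}-\sin(na+b)\sum_{s=1}^\infty \frac{D_s\,(\tfrac12)_s}{n^s}\right\}\qquad (n\to\infty).$$ That is, for every fixed integer $N\ge 0$, as $n\to\infty$ through the positive integers, $$\gamma_n=\frac{Be^{nA}}{\sqrt{n}}\left\{\cos(na+b)\sum_{s=0}^{N} \frac{C_s\,(\tfrac12)_s}{n^s}-\sin(na+b)\sum_{s=1}^{N} \frac{D_s\,(\tfrac12)_s}{n^s}+o(n^{-N})\right\}.$$
   Context: The Stieltjes constants $\gamma_n$ are defined by the Laurent expansion of the Riemann zeta function about $s=1$: $\zeta(s)=\frac{1}{s-1}+\sum_{n=0}^\infty \frac{(-1)^n}{n!}\gamma_n (s-1)^n$. $(x)_s=\Gamma(x+s)/\Gamma(x)$ is the Pochhammer symbol. For a positive integer $n$, let $$\psi(t)=-\frac{2\pi i}{n}e^t-\log t,\qquad f(t)=\frac{e^{-t}}{t}\left(1-\frac{t}{n}\right),$$ and let $t_0=t_0(n)=u+iv$ ($u,v$ real) be the principal solution of $t e^t=\frac{ni}{2\pi}$, i.e. $t_0=W_0(ni/(2\pi))$ with $W_0$ the principal branch of the Lambert function (so $u>0$, $0<v<\pi/2$). It satisfies $\psi'(t_0)=0$. Define $$A=\tfrac12\log(u^2+v^2)-\frac{u}{u^2+v^2},\qquad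 a=\arctan\left(\frac{v}{u}\right)+\frac{v}{u^2+v^2},$$ $$B=2\sqrt{2\pi}\left|\frac{t_0}{\sqrt{1+t_0}}\right|,\qquad b=\tfrac12\pi-v-\tfrac12\arctan\left(\frac{v}{1+u}\right).$$ Let $\alpha_r,\beta_r$ ($r\ge 0$), which depend on $n$, be the coefficients of the expansions near $t_0$ $$\psi(t)-\psi(t_0)=\sum_{r=0}^\infty\alpha_r(t-t_0)^{r+2},\qquad f(t)=\sum_{r=0}^\infty\beta_r(t-t_0)^r .$$ Let the partial ordinary Bell polynomials $\mathcal{B}_{kj}=\mathcal{B}_{kj}(\alpha_1,\dots,\alpha_{k-j+1})$ be generated by $\mathcal{B}_{k0}=\delta_{k0}$ (Kronecker symbol) and $\mathcal{B}_{kj}=\sum_{r=1}^{k-j+1}\alpha_r\mathcal{B}_{k-r,j-1}$ for $1\le j\le k$. For $s\ge 0$ define $$\hat c_{2s}=\alpha_0^{-s}\sum_{k=0}^{2s}\frac{\beta_{2s-k}}{\beta_0}\sum_{j=0}^k\frac{(-1)^j(s+\frac12)_j}{j!\,\alpha_0^j}\mathcal{B}_{kj}$$ (so $\hat c_0=1$), and for $s\ge1$ $$c'_{2s}=\hat c_{2s}-\frac{2t_0}{2s-1}\hat c_{2s-2}.$$ The real numbers $C_s,D_s$ are defined by $C_0=1$, $D_0=0$, and $c'_{2s}=C_s+iD_s$ for $s\ge1$. *)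

(* Defs.v *)
(* Stdlib reals with Coquelicot's complex numbers [C]. *)
From Stdlib Require Import Reals Factorial.
From Coquelicot Require Import Coquelicot.
Open Scope R_scope.

Definition Cexp (z : C) : C :=
  (exp (Re z) * cos (Im z), exp (Re z) * sin (Im z)).

(* Principal argument, in ]-PI, PI] for z <> 0. *)
Definition Carg (z : C) : R :=
  if Rle_dec 0 (Im z) then acos (Re z / Cmod z) else - acos (Re z / Cmod z).

Definition Clog (z : C) : C := (ln (Cmod z), Carg z).

Definition Cpower (z w : C) : C := Cexp (w * Clog z)%C.

Definition Csqrt (z : C) : C := Cpower z (RtoC (1 / 2)).

(* Only the values for x > 0, where the integral converges, are used. *)
Definition Gamma (x : R) : R :=
  RInt_gen (fun t => Rpower t (x - 1) * exp (- t))
    (at_right 0) (Rbar_locally p_infty).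

Definition pochhammer (x : R) (s : nat) : R := Gamma (x + INR s) / Gamma x.

(* The analytic continuation of the Dirichlet series to C \ {1}; the value at
   1 is irrelevant. *)
Definition is_Riemann_zeta (zeta : C -> C) : Prop :=
  (forall s : C, 1 < Re s ->
     is_series (K := C_AbsRing) (V := C_NormedModule)
       (fun k => Cpower (RtoC (INR (S k))) (- s)%C) (zeta s)) /\
  (forall s : C, s <> RtoC 1 ->
     ex_derive (K := C_AbsRing) (V := C_NormedModule) zeta s).

Definition is_Stieltjes (zeta : C -> C) (gamma : nat -> C) : Prop :=
  locally' (T := C_UniformSpace) (RtoC 1) (fun s =>
    is_series (K := C_AbsRing) (V := C_NormedModule)
      (fun n => RtoC ((-1) ^ n / INR (fact n)) * gamma n * (s - 1) ^ n)%C
      (zeta s - 1 / (s - 1))%C).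

(* w = W_0(z).  The range of the principal branch is the part of the strip
   |eta| < PI to the right of the curve xi = - eta cot eta (w = xi + i eta),
   which w |-> w e^w maps onto the branch cut ]-oo, -1/e]; the part of the
   curve with eta >= 0 belongs to the range (the cut is closed from above). *)
Definition is_LambertW0 (z w : C) : Prop :=
  (w * Cexp w)%C = z /\
  - PI < Im w < PI /\
  ((0 < Im w /\ - Im w * (cos (Im w) / sin (Im w)) <= Re w) \/
   (Im w = 0 /\ -1 <= Re w) \/
   (Im w < 0 /\ - Im w * (cos (Im w) / sin (Im w)) < Re w)).

Definition psi (n : nat) (t : C) : C :=
  (- (RtoC (2 * PI) * Ci / RtoC (INR n)) * Cexp t - Clog t)%C.

Definition f (n : nat) (t : C) : C :=
  (Cexp (- t) / t * (1 - t / RtoC (INR n)))%C.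

Definition is_psi_expansion (n : nat) (t0 : C) (alpha : nat -> C) : Prop :=
  locally (T := C_UniformSpace) t0 (fun t =>
    is_series (K := C_AbsRing) (V := C_NormedModule)
      (fun r => alpha r * (t - t0) ^ (r + 2))%C (psi n t - psi n t0)%C).

Definition is_f_expansion (n : nat) (t0 : C) (beta : nat -> C) : Prop :=
  locally (T := C_UniformSpace) t0 (fun t =>
    is_series (K := C_AbsRing) (V := C_NormedModule)
      (fun r => beta r * (t - t0) ^ r)%C (f n t)).

Definition coefA (t0 : C) : R :=
  let u := Re t0 in let v := Im t0 in
  1 / 2 * ln (u ^ 2 + v ^ 2) - u / (u ^ 2 + v ^ 2).

Definition coefa (t0 : C) : R :=
  let u := Re t0 in let v := Im t0 in
  atan (v / u) + v / (u ^ 2 + v ^ 2).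

Definition coefB (t0 : C) : R :=
  2 * sqrt (2 * PI) * Cmod (t0 / Csqrt (1 + t0))%C.

Definition coefb (t0 : C) : R :=
  let u := Re t0 in let v := Im t0 in
  1 / 2 * PI - v - 1 / 2 * atan (v / (1 + u)).

(* [bell alpha j k] is the partial ordinary Bell polynomial B_{kj} (note the
   order of the indices); it is meaningful for j <= k only. *)
Fixpoint bell (alpha : nat -> C) (j k : nat) : C :=
  match j with
  | O => match k with O => RtoC 1 | S _ => RtoC 0 end
  | S j' =>
      sum_n_m (fun r => alpha r * bell alpha j' (k - r)%nat)%C
        1 (k - j + 1)
  end.

(* [chat alpha beta s] and [cprime t0 alpha beta s] carry the index 2s. *)
Definition chat (alpha beta : nat -> C) (s : nat) : C :=
  (/ (alpha 0%nat ^ s) *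
   sum_n_m (fun k =>
     beta (2 * s - k)%nat / beta 0%nat *
     sum_n_m (fun j =>
       RtoC ((-1) ^ j * pochhammer (INR s + 1 / 2) j) /
       (RtoC (INR (fact j)) * alpha 0%nat ^ j) * bell alpha j k) 0 k)
     0 (2 * s))%C.

Definition cprime (t0 : C) (alpha beta : nat -> C) (s : nat) : C :=
  (chat alpha beta s -
   RtoC 2 * t0 / RtoC (2 * INR s - 1) * chat alpha beta (s - 1))%C.

Definition coefC (t0 : C) (alpha beta : nat -> C) (s : nat) : R :=
  match s with O => 1 | S _ => Re (cprime t0 alpha beta s) end.

Definition coefD (t0 : C) (alpha beta : nat -> C) (s : nat) : R :=
  match s with O => 0 | S _ => Im (cprime t0 alpha beta s) end.

(* Main.v *)
Require Import Defs.
From Stdlib Require Import Reals Lra Lia Factorial.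
From Coquelicot Require Import Coquelicot.
Open Scope R_scope.

(** Let q (z) = e^(2 pi i z) and kern = q / (1 - q).  For Im z = y > 0 the
    function 1 + 2 Re kern is the Poisson kernel; as y -> 0 it concentrates at
    the integers, so that

      sum_(k >= 2) k^(-1-xi) = lim_(y -> 0) int_(3/2)^oo x^(-1-xi) (1 + 2 Re kern (x + i y)) dx.

    The integral of x^(-1-xi) alone is elementary.  In the other one put
    x = e^t and move t, by Cauchy's theorem, to the path that rises from
    lam = ln (3/2) to lam + i v and then follows the line Im t = v.  There
    kern (e^t) decreases like exp (- 2 pi e^(Re t) sin v), so y = 0 is allowed
    ([zeta_path_integral]) and e^(- xi t) may be expanded in powers of xi.
    Comparing with the Laurent expansion of zeta at 1 gives, for n >= 1 and any
    v in [1, pi/2[ ([stieltjes_path_integral]),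

      gamma_n = 2 Re int t^n kern (e^t) dt - lam^(n+1) / (n+1).

    Now let v be the imaginary part of t0.  On the line kern is q up to its
    square, t^n q (e^t) = e^(- n psi t), and t0 is the saddle on the line.  The
    rest of the path is smaller than e^(- n psi t0) by a factor exponentially
    small in H = |n / t0| = 2 pi e^u ([stieltjes_saddle]), which leaves

      gamma_n ~ 2 Re (e^(- n psi t0) int_(-1)^1 e^(- n (psi (t0 + x) - psi t0)) dx).

    Integrating d (e^(-t) t^n q) = (n f + 2 pi i) t^n q dt replaces the
    amplitude 1 by f, with a factor 1 - t0 / n ([line_to_amplitude]).  With
    the amplitude f, Laplace's method yields the series with coefficients
    (1/2)_s chat_s / n^s ([laplace], [chat_sum_local]), and the factor
    1 - t0 / n turns chat into cprime ([chat_telescope]).  The leading factor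
    and the phase are the polar form of e^(- n psi t0) and of the square root
    of 1 / (n alpha_0) ([main_term_t0], [inv_root_sqr]).

    The expansion point moves with n, so every estimate has to be uniform.
    This works because the saddle equation removes n from the phase,

      psi (t0 + x) - psi t0 = w (e^x - 1) - log (1 + w x),   w = 1 / t0,

    so that alpha_r is w times a quantity bounded uniformly for |w| <= 1/20,
    and the large parameter is H.  The relative error after the term N is
    O (H^(- N - 1/2)) ([remainder_bound]), and this is o (n^(-N)) because
    n = H |t0| while |t0| is only of the order of log H. *)

(** * Complex-valued functions of a real variable *)

(** Derivatives, continuity and integrals of maps R -> C are taken by
    components: only integrals along segments occur, and the real theory then
    applies to each component. *)
Definition Cderiv (f : R -> C) (x : R) (l : C) : Prop :=
  is_derive (fun t => Re (f t)) x (Re l) /\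
  is_derive (fun t => Im (f t)) x (Im l).

Definition Ccont (f : R -> C) (x : R) : Prop :=
  continuous (fun t => Re (f t)) x /\ continuous (fun t => Im (f t)) x.

Definition Cint (f : R -> C) (a b : R) : C :=
  (RInt (fun t => Re (f t)) a b, RInt (fun t => Im (f t)) a b).

Lemma C_ext (a b : C) : Re a = Re b -> Im a = Im b -> a = b.
Proof. destruct a, b; simpl; intros; subst; reflexivity. Qed.

Lemma re_minus (a b : C) : Re (a - b)%C = Re a - Re b.
Proof. reflexivity. Qed.
Lemma im_minus (a b : C) : Im (a - b)%C = Im a - Im b.
Proof. reflexivity. Qed.

Lemma Re_conj_mult (c d : C) : Re (Cconj c * d)%C = Re c * Re d + Im c * Im d.
Proof. unfold Cconj, Re, Im; simpl; ring. Qed.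

Lemma exp_le a b : a <= b -> exp a <= exp b.
Proof. intros [H| ->]; [left; apply exp_increasing, H|lra]. Qed.

Lemma exp_le_1 a : a <= 0 -> exp a <= 1.
Proof. intros H; rewrite <- exp_0; apply exp_le, H. Qed.

Lemma pow_le_1 x k : 0 <= x <= 1 -> x ^ k <= 1.
Proof. intros H. rewrite <- (pow1 k). apply pow_incr, H. Qed.

Lemma inv_le_1 x : 1 <= x -> 0 < / x <= 1.
Proof.
  intros H. split; [apply Rinv_0_lt_compat; lra|].
  rewrite <- Rinv_1. apply Rinv_le_contravar; lra.
Qed.

Lemma inv_fact_le_1 k : 0 < / INR (fact k) <= 1.
Proof. apply inv_le_1. change 1 with (INR 1). apply le_INR, lt_O_fact. Qed.

Lemma Cmod_sqr (z : C) : Cmod z ^ 2 = Re z ^ 2 + Im z ^ 2.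
Proof. apply Cmod2_alt. Qed.

Lemma Cmod_minus_le (a b : C) : Cmod (a - b)%C <= Cmod a + Cmod b.
Proof.
  replace (a - b)%C with (a + - b)%C by ring.
  rewrite <- (Cmod_opp b). apply Cmod_triangle.
Qed.

Lemma Cmod_1_minus_ge q : 1 - Cmod q <= Cmod (1 - q)%C.
Proof.
  assert (Cmod (RtoC 1) <= Cmod (1 - q)%C + Cmod q).
  { replace (RtoC 1) with ((1 - q) + q)%C at 1 by ring. apply Cmod_triangle. }
  rewrite Cmod_1 in H. lra.
Qed.

Lemma im_le_Cmod (z : C) : Rabs (Im z) <= Cmod z.
Proof. eapply Rle_trans; [|apply Rmax_Cmod]. apply Rmax_r. Qed.

Lemma Cmod_le_Re_Im (z : C) : Cmod z <= Rabs (Re z) + Rabs (Im z).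
Proof.
  replace z with (RtoC (Re z) + Ci * RtoC (Im z))%C at 1.
  2:{ apply C_ext; simpl; ring. }
  eapply Rle_trans; [apply Cmod_triangle|].
  rewrite Cmod_mult, Cmod_Ci, !Cmod_R. lra.
Qed.

Lemma RtoC_neq0 (x : R) : x <> 0 -> RtoC x <> RtoC 0.
Proof. intros H E. apply H. now injection E. Qed.

Lemma Cneq0_Re (z : C) : Re z <> 0 -> z <> RtoC 0.
Proof. intros H E. apply H. rewrite E. reflexivity. Qed.

Lemma Cneq0_norm2 (z : C) : z <> RtoC 0 -> Re z ^ 2 + Im z ^ 2 <> 0.
Proof.
  intros H E. apply H. apply C_ext; simpl; nra.
Qed.

Lemma Cmult_minus_distr_l (a b c : C) : (a * (b - c) = a * b - a * c)%C.
Proof. ring. Qed.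

Lemma Cmult_reg_r (c a b : C) : c <> RtoC 0 -> (a * c = b * c)%C -> a = b.
Proof.
  intros N E. replace a with (a * c / c)%C by (field; exact N).
  rewrite E. field. exact N.
Qed.

Lemma Cderiv_ext (f g : R -> C) x l : (forall t, f t = g t) -> Cderiv f x l -> Cderiv g x l.
Proof.
  intros E [H1 H2]; split.
  - eapply is_derive_ext; [|exact H1]. intros t; simpl; now rewrite E.
  - eapply is_derive_ext; [|exact H2]. intros t; simpl; now rewrite E.
Qed.

Lemma Cderiv_eq (f : R -> C) x l l' : Cderiv f x l -> l = l' -> Cderiv f x l'.
Proof. intros H <-; exact H. Qed.

Lemma Cderiv_const (c : C) x : Cderiv (fun _ => c) x (RtoC 0).
Proof. split; apply @is_derive_const. Qed.

Lemma Cderiv_RtoC (f : R -> R) x l :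
  is_derive f x l -> Cderiv (fun t => RtoC (f t)) x (RtoC l).
Proof. intros H; split; simpl; [exact H|apply @is_derive_const]. Qed.

Lemma Cderiv_id x : Cderiv (fun t => RtoC t) x (RtoC 1).
Proof. apply Cderiv_RtoC. apply @is_derive_id. Qed.

Lemma Cderiv_plus f g x l m :
  Cderiv f x l -> Cderiv g x m -> Cderiv (fun t => f t + g t)%C x (l + m)%C.
Proof. intros [A B] [A' B']; split; simpl; apply @is_derive_plus; assumption. Qed.

Lemma Cderiv_opp f x l : Cderiv f x l -> Cderiv (fun t => - f t)%C x (- l)%C.
Proof. intros [A B]; split; simpl; apply @is_derive_opp; assumption. Qed.

Lemma Cderiv_minus f g x l m :
  Cderiv f x l -> Cderiv g x m -> Cderiv (fun t => f t - g t)%C x (l - m)%C.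
Proof. intros; apply Cderiv_plus; [|apply Cderiv_opp]; assumption. Qed.

Lemma is_derive_Rmult (f g : R -> R) x l m :
  is_derive f x l -> is_derive g x m ->
  is_derive (fun t => f t * g t) x (l * g x + f x * m).
Proof.
  intros A B. apply (is_derive_mult (K := R_AbsRing) f g x l m A B).
  intros; apply Rmult_comm.
Qed.

Lemma Cderiv_mult f g x l m :
  Cderiv f x l -> Cderiv g x m -> Cderiv (fun t => f t * g t)%C x (l * g x + f x * m)%C.
Proof.
  intros [A B] [A' B']; split.
  - eapply is_derive_ext; [intros t; symmetry; apply re_mult|].
    replace (Re _) with
      (minus (Re l * Re (g x) + Re (f x) * Re m) (Im l * Im (g x) + Im (f x) * Im m)).
    2:{ unfold minus, plus, opp, Re, Im; simpl; ring. }
    apply @is_derive_minus; apply is_derive_Rmult; assumption.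
  - eapply is_derive_ext; [intros t; symmetry; apply im_mult|].
    replace (Im _) with
      (plus (Re l * Im (g x) + Re (f x) * Im m) (Im l * Re (g x) + Im (f x) * Re m)).
    2:{ unfold plus, Re, Im; simpl; ring. }
    apply @is_derive_plus; apply is_derive_Rmult; assumption.
Qed.

Lemma Cderiv_scal (c : C) f x l : Cderiv f x l -> Cderiv (fun t => c * f t)%C x (c * l)%C.
Proof.
  intros H. eapply Cderiv_eq; [apply Cderiv_mult; [apply Cderiv_const|exact H]|]. cbv beta; ring.
Qed.

Lemma Cderiv_comp (f : R -> C) (g : R -> R) x l m :
  Cderiv f (g x) l -> is_derive g x m -> Cderiv (fun t => f (g t)) x (RtoC m * l)%C.
Proof.
  intros [A B] G; split.
  - replace (Re _) with (scal m (Re l)).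
    2:{ unfold scal; simpl; unfold mult, Re, Im; simpl; ring. }
    apply (is_derive_comp (fun t => Re (f t)) g); assumption.
  - replace (Im _) with (scal m (Im l)).
    2:{ unfold scal; simpl; unfold mult, Re, Im; simpl; ring. }
    apply (is_derive_comp (fun t => Im (f t)) g); assumption.
Qed.

Lemma is_derive_Rcomp (f g : R -> R) x l m :
  is_derive f (g x) l -> is_derive g x m -> is_derive (fun t => f (g t)) x (m * l).
Proof. intros. apply (is_derive_comp f g); assumption. Qed.

Lemma Cderiv_Cexp f x l : Cderiv f x l -> Cderiv (fun t => Cexp (f t)) x (l * Cexp (f x))%C.
Proof.
  intros [A B]; split.
  - apply (is_derive_ext (fun t => exp (Re (f t)) * cos (Im (f t)))); [reflexivity|].
    evar_last.
    + apply is_derive_Rmult.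
      * apply (is_derive_Rcomp exp); [apply is_derive_exp|exact A].
      * apply (is_derive_Rcomp cos); [apply is_derive_cos|exact B].
    + unfold Cexp, Re, Im; simpl; ring.
  - apply (is_derive_ext (fun t => exp (Re (f t)) * sin (Im (f t)))); [reflexivity|].
    evar_last.
    + apply is_derive_Rmult.
      * apply (is_derive_Rcomp exp); [apply is_derive_exp|exact A].
      * apply (is_derive_Rcomp sin); [apply is_derive_sin|exact B].
    + unfold Cexp, Re, Im; simpl; ring.
Qed.

Lemma Cderiv_inv f x l : f x <> RtoC 0 -> Cderiv f x l ->
  Cderiv (fun t => / f t)%C x (- l / (f x * f x))%C.
Proof.
  intros N [A B]. pose proof (Cneq0_norm2 _ N) as N2.
  assert (N3 : Re (f x) * Re (f x) + Im (f x) * Im (f x) <> 0) by (simpl in N2; lra).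
  assert (Q : is_derive (fun t => Re (f t) * Re (f t) + Im (f t) * Im (f t)) x
     (Re l * Re (f x) + Re (f x) * Re l + (Im l * Im (f x) + Im (f x) * Im l))).
  { apply @is_derive_plus; apply is_derive_Rmult; assumption. }
  assert (E : (- l / (f x * f x))%C =
    (let n := Re (f x) * Re (f x) + Im (f x) * Im (f x) in
     let d := Re l * Re (f x) + Re (f x) * Re l + (Im l * Im (f x) + Im (f x) * Im l) in
     ((Re l * n - Re (f x) * d) / n ^ 2, (- Im l * n - - Im (f x) * d) / n ^ 2))).
  { destruct (f x) as [u v], l as [p q]; simpl in *.
    assert (F : ((u, v) * (u, v) <> RtoC 0)%C) by (apply Cmult_neq_0; exact N).
    apply Cmult_reg_r with ((u, v) * (u, v))%C; [exact F|].
    unfold Cdiv. rewrite <- Cmult_assoc, Cinv_l, Cmult_1_r by exact F.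
    apply C_ext; simpl; field; auto. }
  rewrite E. split.
  - apply (is_derive_ext (fun t => Re (f t) / (Re (f t) * Re (f t) + Im (f t) * Im (f t)))).
    { intros t; unfold Re, Im; simpl. unfold Rdiv. f_equal. f_equal. ring. }
    apply (is_derive_div (fun t => Re (f t)) (fun t => Re (f t) * Re (f t) + Im (f t) * Im (f t))); assumption.
  - apply (is_derive_ext (fun t => - Im (f t) / (Re (f t) * Re (f t) + Im (f t) * Im (f t)))).
    { intros t; unfold Re, Im; simpl. unfold Rdiv. f_equal. f_equal. ring. }
    apply (is_derive_div (fun t => - Im (f t)) (fun t => Re (f t) * Re (f t) + Im (f t) * Im (f t))); [apply @is_derive_opp| |]; assumption.
Qed.

Lemma Cderiv_pow f x l n : Cderiv f x l ->
  Cderiv (fun t => f t ^ n)%C x (RtoC (INR n) * l * f x ^ (n - 1))%C.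
Proof.
  intros H. induction n as [|n IH].
  - simpl. eapply Cderiv_eq; [apply Cderiv_const|]. ring.
  - eapply Cderiv_eq.
    + apply (Cderiv_ext (fun t => f t * f t ^ n)%C); [reflexivity|].
      apply Cderiv_mult; [exact H|exact IH].
    + replace (S n - 1)%nat with n by lia. rewrite S_INR, RtoC_plus.
      destruct n as [|n]; [simpl; ring|].
      replace (S n - 1)%nat with n by lia. simpl. ring.
Qed.

Lemma Ccont_ext (f g : R -> C) x : (forall t, f t = g t) -> Ccont f x -> Ccont g x.
Proof.
  intros E [A B]; split.
  - eapply continuous_ext; [|exact A]; intros; simpl; now rewrite E.
  - eapply continuous_ext; [|exact B]; intros; simpl; now rewrite E.
Qed.

Lemma ex_derive_cont (f : R -> R) x : ex_derive f x -> continuous f x.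
Proof. apply (ex_derive_continuous f). Qed.

Lemma continuous_exp x : continuous exp x.
Proof. apply ex_derive_cont; auto_derive; exact I. Qed.
Lemma continuous_cos x : continuous cos x.
Proof. apply ex_derive_cont; auto_derive; exact I. Qed.
Lemma continuous_sin x : continuous sin x.
Proof. apply ex_derive_cont; auto_derive; exact I. Qed.

Lemma Cderiv_Ccont f x l : Cderiv f x l -> Ccont f x.
Proof.
  intros [A B]; split.
  - apply (ex_derive_continuous (fun t => Re (f t))); eexists; exact A.
  - apply (ex_derive_continuous (fun t => Im (f t))); eexists; exact B.
Qed.

Lemma Ccont_const c x : Ccont (fun _ => c) x.
Proof. eapply Cderiv_Ccont, Cderiv_const. Qed.

Lemma Ccont_RtoC (f : R -> R) x : continuous f x -> Ccont (fun t => RtoC (f t)) x.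
Proof. intros H; split; simpl; [exact H|apply continuous_const]. Qed.

Lemma Ccont_plus f g x : Ccont f x -> Ccont g x -> Ccont (fun t => f t + g t)%C x.
Proof. intros [A B] [A' B']; split; simpl; apply @continuous_plus; assumption. Qed.

Lemma Ccont_opp f x : Ccont f x -> Ccont (fun t => - f t)%C x.
Proof. intros [A B]; split; simpl; apply @continuous_opp; assumption. Qed.

Lemma Ccont_minus f g x : Ccont f x -> Ccont g x -> Ccont (fun t => f t - g t)%C x.
Proof. intros; apply Ccont_plus; [|apply Ccont_opp]; assumption. Qed.

Lemma Ccont_mult f g x : Ccont f x -> Ccont g x -> Ccont (fun t => f t * g t)%C x.
Proof.
  intros [A B] [A' B']; split; simpl.
  - apply @continuous_minus; apply @continuous_mult; assumption.
  - apply @continuous_plus; apply @continuous_mult; assumption.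
Qed.

Lemma Ccont_pow f x n : Ccont f x -> Ccont (fun t => f t ^ n)%C x.
Proof.
  intros H. induction n as [|n IH]; [apply Ccont_const|].
  simpl. apply Ccont_mult; assumption.
Qed.

Lemma Ccont_inv f x : f x <> RtoC 0 -> Ccont f x -> Ccont (fun t => / f t)%C x.
Proof.
  intros N [A B]. pose proof (Cneq0_norm2 _ N) as N2.
  assert (Q : continuous (fun t => / (Re (f t) ^ 2 + Im (f t) ^ 2)) x).
  { apply (continuous_comp (fun t => Re (f t) ^ 2 + Im (f t) ^ 2) Rinv).
    - apply (continuous_ext (fun t => Re (f t) * Re (f t) + Im (f t) * Im (f t))).
      { intros; simpl; ring. }
      apply @continuous_plus; apply @continuous_mult; assumption.
    - apply continuity_pt_filterlim, continuity_pt_inv; [|exact N2].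
      apply derivable_continuous_pt, derivable_pt_id. }
  split; simpl; apply @continuous_mult; try exact Q; try exact A.
  apply @continuous_opp; exact B.
Qed.

Lemma Ccont_Cexp f x : Ccont f x -> Ccont (fun t => Cexp (f t)) x.
Proof.
  intros [A B]; split.
  - apply (continuous_mult (fun t => exp (Re (f t))) (fun t => cos (Im (f t)))).
    + apply (continuous_comp (fun t => Re (f t)) exp); [exact A|apply continuous_exp].
    + apply (continuous_comp (fun t => Im (f t)) cos); [exact B|apply continuous_cos].
  - apply (continuous_mult (fun t => exp (Re (f t))) (fun t => sin (Im (f t)))).
    + apply (continuous_comp (fun t => Re (f t)) exp); [exact A|apply continuous_exp].
    + apply (continuous_comp (fun t => Im (f t)) sin); [exact B|apply continuous_sin].
Qed.

(** The real mean value theorem, applied to the scalar product of F with the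
    direction of the increment F b - F a. *)
Lemma mean_value_inequality (F F1 : R -> C) (G G1 : R -> R) a b : a <= b ->
  (forall x, a <= x <= b -> Cderiv F x (F1 x)) ->
  (forall x, a <= x <= b -> is_derive G x (G1 x)) ->
  (forall x, a <= x <= b -> Cmod (F1 x) <= G1 x) ->
  Cmod (F b - F a)%C <= G b - G a.
Proof.
  intros Hab HF HG Hle.
  (* The projection on any direction c obeys the real inequality; c = F b - F
     a is the useful one. *)
  assert (mono : forall c : C,
    Re (Cconj c * (F b - F a))%C <= Cmod c * (G b - G a)).
  { intros c.
    set (phi := fun t => (Re c * Re (F t) + Im c * Im (F t)) - Cmod c * G t).
    assert (D : forall x, a <= x <= b -> is_derive phi x
      ((Re c * Re (F1 x) + Im c * Im (F1 x)) - Cmod c * G1 x)).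
    { intros x Hx. destruct (HF x Hx) as [A B]. unfold phi.
      apply @is_derive_minus; [apply @is_derive_plus|];
        apply @is_derive_scal; auto. }
    destruct (MVT_gen phi a b (fun x => (Re c * Re (F1 x) + Im c * Im (F1 x)) - Cmod c * G1 x))
      as (x & Hx & E).
    - rewrite Rmin_left, Rmax_right by exact Hab. intros; apply D; lra.
    - rewrite Rmin_left, Rmax_right by exact Hab. intros x Hx.
      apply continuity_pt_filterlim. apply ex_derive_cont.
      eexists; apply D; exact Hx.
    - rewrite Rmin_left, Rmax_right in Hx by exact Hab.
      assert (K : Re c * Re (F1 x) + Im c * Im (F1 x) <= Cmod c * G1 x).
      { replace (Re c * Re (F1 x) + Im c * Im (F1 x)) with (Re (Cconj c * F1 x)%C)
          by (apply Re_conj_mult).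
        eapply Rle_trans; [apply Rle_abs|].
        eapply Rle_trans; [apply re_le_Cmod|].
        rewrite Cmod_mult, Cmod_conj. apply Rmult_le_compat_l; [apply Cmod_ge_0|auto]. }
      assert (phi b - phi a <= 0).
      { rewrite E. assert (0 <= b - a) by lra. nra. }
      unfold phi in H. rewrite Re_conj_mult, re_minus, im_minus. nra. }
  set (d := (F b - F a)%C) in *.
  destruct (Req_dec (Cmod d) 0) as [E|E].
  - rewrite E. generalize (mono (RtoC 1)). rewrite Cmod_1.
    apply Cmod_eq_0 in E. rewrite E. rewrite re_mult; simpl. lra.
  - assert (0 < Cmod d) by (generalize (Cmod_ge_0 d); lra).
    generalize (mono d). rewrite Re_conj_mult.
    replace (Re d * Re d + Im d * Im d) with (Cmod d ^ 2)
      by (rewrite Cmod_sqr; ring).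
    intros; nra.
Qed.

Lemma Cderiv_zero_const (F : R -> C) a b : a <= b ->
  (forall x, a <= x <= b -> Cderiv F x (RtoC 0)) -> F b = F a.
Proof.
  intros Hab H.
  assert (K : Cmod (F b - F a)%C <= 0 - 0).
  { apply (mean_value_inequality F (fun _ => RtoC 0) (fun _ => 0) (fun _ => 0)); auto.
    - intros. apply @is_derive_const.
    - intros. rewrite Cmod_0. lra. }
  assert (E : Cmod (F b - F a)%C = 0) by (generalize (Cmod_ge_0 (F b - F a)%C); lra).
  apply Cmod_eq_0 in E. replace (F b) with ((F b - F a) + F a)%C by ring.
  rewrite E. ring.
Qed.

Definition ex_Cint f a b := ex_RInt (fun t => Re (f t)) a b /\ ex_RInt (fun t => Im (f t)) a b.

Lemma ex_Cint_cont f a b : a <= b -> (forall x, a <= x <= b -> Ccont f x) -> ex_Cint f a b.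
Proof.
  intros Hab H; split; apply (ex_RInt_continuous (V := R_CompleteNormedModule));
  intros z Hz; rewrite Rmin_left, Rmax_right in Hz by exact Hab; apply H; exact Hz.
Qed.

Lemma Cint_ext f g a b : a <= b -> (forall x, a < x < b -> f x = g x) -> Cint f a b = Cint g a b.
Proof.
  intros Hab H. unfold Cint. f_equal; apply RInt_ext; intros x Hx;
  rewrite Rmin_left, Rmax_right in Hx by exact Hab; now rewrite H.
Qed.

Lemma RInt_Rplus f g a b : ex_RInt f a b -> ex_RInt g a b ->
  RInt (fun t => f t + g t) a b = RInt f a b + RInt g a b.
Proof. intros; apply (RInt_plus (V := R_CompleteNormedModule)); assumption. Qed.
Lemma RInt_Rminus f g a b : ex_RInt f a b -> ex_RInt g a b ->
  RInt (fun t => f t - g t) a b = RInt f a b - RInt g a b.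
Proof. intros; apply (RInt_minus (V := R_CompleteNormedModule)); assumption. Qed.
Lemma RInt_Rscal k f a b : ex_RInt f a b ->
  RInt (fun t => k * f t) a b = k * RInt f a b.
Proof. intros; apply (RInt_scal (V := R_CompleteNormedModule)); assumption. Qed.
Lemma ex_RInt_Rscal k f a b : ex_RInt f a b -> ex_RInt (fun t => k * f t) a b.
Proof. intros; apply (ex_RInt_scal (V := R_CompleteNormedModule)); assumption. Qed.
Lemma ex_RInt_Rplus f g a b : ex_RInt f a b -> ex_RInt g a b ->
  ex_RInt (fun t => f t + g t) a b.
Proof. intros; apply (ex_RInt_plus (V := R_CompleteNormedModule)); assumption. Qed.
Lemma ex_RInt_Rminus f g a b : ex_RInt f a b -> ex_RInt g a b ->
  ex_RInt (fun t => f t - g t) a b.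
Proof. intros; apply (ex_RInt_minus (V := R_CompleteNormedModule)); assumption. Qed.
Lemma ex_RInt_cont (f : R -> R) a b : a <= b ->
  (forall x, a <= x <= b -> continuous f x) -> ex_RInt f a b.
Proof.
  intros Hab H; apply (ex_RInt_continuous (V := R_CompleteNormedModule)).
  intros z Hz; rewrite Rmin_left, Rmax_right in Hz by exact Hab; apply H; exact Hz.
Qed.

Lemma Cint_plus f g a b : ex_Cint f a b -> ex_Cint g a b ->
  Cint (fun t => f t + g t)%C a b = (Cint f a b + Cint g a b)%C.
Proof.
  intros [A B] [A' B']. apply C_ext; simpl; apply RInt_Rplus; assumption.
Qed.

Lemma Cint_minus f g a b : ex_Cint f a b -> ex_Cint g a b ->
  Cint (fun t => f t - g t)%C a b = (Cint f a b - Cint g a b)%C.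
Proof.
  intros [A B] [A' B']. apply C_ext; simpl.
  - apply (RInt_Rminus (fun t => Re (f t)) (fun t => Re (g t))); assumption.
  - apply (RInt_Rminus (fun t => Im (f t)) (fun t => Im (g t))); assumption.
Qed.

Lemma ex_Cint_plus f g a b : ex_Cint f a b -> ex_Cint g a b ->
  ex_Cint (fun t => f t + g t)%C a b.
Proof. intros [A B] [A' B']; split; simpl; apply ex_RInt_Rplus; assumption. Qed.

Lemma ex_Cint_minus f g a b : ex_Cint f a b -> ex_Cint g a b ->
  ex_Cint (fun t => f t - g t)%C a b.
Proof.
  intros [A B] [A' B']; split; simpl.
  - apply (ex_RInt_Rminus (fun t => Re (f t)) (fun t => Re (g t))); assumption.
  - apply (ex_RInt_Rminus (fun t => Im (f t)) (fun t => Im (g t))); assumption.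
Qed.

Lemma ex_Cint_scal (c : C) f a b : ex_Cint f a b -> ex_Cint (fun t => c * f t)%C a b.
Proof.
  intros [A B]; split; simpl.
  - apply ex_RInt_Rminus; apply ex_RInt_Rscal; assumption.
  - apply ex_RInt_Rplus; apply ex_RInt_Rscal; assumption.
Qed.

Lemma Cint_scal (c : C) f a b : ex_Cint f a b ->
  Cint (fun t => c * f t)%C a b = (c * Cint f a b)%C.
Proof.
  intros [A B]. apply C_ext; simpl.
  - rewrite RInt_Rminus by (apply ex_RInt_Rscal; assumption).
    rewrite !RInt_Rscal by assumption. reflexivity.
  - rewrite RInt_Rplus by (apply ex_RInt_Rscal; assumption).
    rewrite !RInt_Rscal by assumption. reflexivity.
Qed.

Lemma Cint_Chasles f a b c : ex_Cint f a b -> ex_Cint f b c ->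
  (Cint f a b + Cint f b c)%C = Cint f a c.
Proof.
  intros [A B] [A' B']. apply C_ext; simpl;
  apply (RInt_Chasles (V := R_CompleteNormedModule)); assumption.
Qed.

Lemma Cint_derive F f a b : a <= b ->
  (forall x, a <= x <= b -> Cderiv F x (f x)) ->
  (forall x, a <= x <= b -> Ccont f x) ->
  Cint f a b = (F b - F a)%C.
Proof.
  intros Hab HD HC.
  apply C_ext; simpl; apply is_RInt_unique.
  - apply (is_RInt_derive (V := R_CompleteNormedModule) (fun t => Re (F t)));
    rewrite Rmin_left, Rmax_right by exact Hab; intros; [apply HD|apply HC]; assumption.
  - apply (is_RInt_derive (V := R_CompleteNormedModule) (fun t => Im (F t)));
    rewrite Rmin_left, Rmax_right by exact Hab; intros; [apply HD|apply HC]; assumption.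
Qed.

(** The integral d is paired with its own conjugate: |d|^2 is the real
    integral of Re (conj d * f). *)
Lemma Cint_bound f (g : R -> R) a b : a <= b -> ex_Cint f a b -> ex_RInt g a b ->
  (forall x, a < x < b -> Cmod (f x) <= g x) -> Cmod (Cint f a b) <= RInt g a b.
Proof.
  intros Hab Hf Hg Hle.
  set (d := Cint f a b).
  assert (K : Cmod d ^ 2 <= Cmod d * RInt g a b).
  { replace (Cmod d ^ 2) with (Re (Cconj d * d)%C)
      by (rewrite Cmod_sqr, Re_conj_mult; ring).
    unfold d at 2. rewrite <- Cint_scal by exact Hf.
    rewrite <- RInt_Rscal by exact Hg. simpl.
    apply RInt_le; [exact Hab| |apply ex_RInt_Rscal; exact Hg|].
    - apply (ex_Cint_scal (Cconj d)) in Hf. exact (proj1 Hf).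
    - intros x Hx. change (Re (Cconj d * f x)%C <= Cmod d * g x).
      eapply Rle_trans; [apply Rle_abs|].
      eapply Rle_trans; [apply re_le_Cmod|].
      rewrite Cmod_mult, Cmod_conj. apply Rmult_le_compat_l; [apply Cmod_ge_0|auto]. }
  destruct (Req_dec (Cmod d) 0) as [E|E].
  - rewrite E. rewrite <- (Rmult_0_r (b - a)).
    rewrite <- (RInt_const (V := R_CompleteNormedModule) a b (0 : R)) at 1.
    apply RInt_le; [exact Hab|apply ex_RInt_const|exact Hg|].
    intros x Hx. eapply Rle_trans; [apply Cmod_ge_0|auto].
  - assert (0 < Cmod d) by (generalize (Cmod_ge_0 d); lra). nra.
Qed.

Lemma RInt_Rconst (c a b : R) : RInt (fun _ => c) a b = c * (b - a).
Proof. rewrite RInt_const. unfold scal; simpl; unfold mult; simpl; ring. Qed.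

Lemma Cint_zero a b : Cint (fun _ => RtoC 0) a b = RtoC 0.
Proof. unfold Cint. apply C_ext; simpl; rewrite RInt_Rconst; ring. Qed.

Lemma Cint_bound_const f (K : R) a b : a <= b -> ex_Cint f a b ->
  (forall x, a < x < b -> Cmod (f x) <= K) -> Cmod (Cint f a b) <= K * (b - a).
Proof.
  intros Hab Hf Hle. rewrite <- RInt_Rconst.
  apply Cint_bound; auto. apply ex_RInt_const.
Qed.

Lemma Cexp_plus (a b : C) : Cexp (a + b)%C = (Cexp a * Cexp b)%C.
Proof.
  unfold Cexp. rewrite re_plus, im_plus, exp_plus, cos_plus, sin_plus.
  apply C_ext; unfold Re, Im; simpl; ring.
Qed.

Lemma Cexp_0 : Cexp (RtoC 0) = RtoC 1.
Proof. unfold Cexp; simpl. rewrite exp_0, cos_0, sin_0. apply C_ext; simpl; ring. Qed.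

Lemma Cmod_Cexp (z : C) : Cmod (Cexp z) = exp (Re z).
Proof.
  unfold Cmod, Cexp; simpl.
  replace (_ + _) with (exp (Re z) ^ 2 * (Rsqr (sin (Im z)) + Rsqr (cos (Im z))))
    by (unfold Rsqr; ring).
  rewrite sin2_cos2, Rmult_1_r. apply sqrt_pow2. left; apply exp_pos.
Qed.

Lemma Cexp_neq0 (z : C) : Cexp z <> RtoC 0.
Proof.
  apply Cmod_gt_0. rewrite Cmod_Cexp. apply exp_pos.
Qed.

Lemma Cexp_opp (z : C) : Cexp (- z)%C = (/ Cexp z)%C.
Proof.
  apply Cmult_reg_r with (Cexp z); [apply Cexp_neq0|].
  rewrite <- Cexp_plus, Cinv_l by apply Cexp_neq0.
  rewrite <- Cexp_0. f_equal. ring.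
Qed.

Lemma Cexp_RtoC (x : R) : Cexp (RtoC x) = RtoC (exp x).
Proof. unfold Cexp; simpl. rewrite cos_0, sin_0. apply C_ext; simpl; ring. Qed.

Lemma Cexp_INR_mult (n : nat) (z : C) : Cexp (RtoC (INR n) * z)%C = (Cexp z ^ n)%C.
Proof.
  induction n as [|n IH].
  - simpl. rewrite Cmult_0_l. apply Cexp_0.
  - rewrite S_INR, RtoC_plus, Cmult_plus_distr_r, Cexp_plus, IH, Cmult_1_l.
    simpl. ring.
Qed.

Lemma acos_div_cos (x r : R) : 0 < r -> Rabs x <= r -> r * cos (acos (x / r)) = x.
Proof.
  intros Hr Hx. rewrite cos_acos; [field; lra|].
  apply Rabs_le_between in Hx. split.
  - apply Rmult_le_reg_r with r; [exact Hr|]. unfold Rdiv. rewrite Rmult_assoc, Rinv_l; lra.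
  - apply Rmult_le_reg_r with r; [exact Hr|]. unfold Rdiv. rewrite Rmult_assoc, Rinv_l; lra.
Qed.

Lemma acos_div_sin (x y r : R) : 0 < r -> r ^ 2 = x ^ 2 + y ^ 2 ->
  r * sin (acos (x / r)) = Rabs y.
Proof.
  intros Hr E.
  assert (Hx : -1 <= x / r <= 1).
  { assert (Rabs x <= r).
    { rewrite <- (Rabs_right r) by lra. apply Rsqr_le_abs_0. unfold Rsqr. nra. }
    apply Rabs_le_between in H. split;
    (apply Rmult_le_reg_r with r; [exact Hr|]; unfold Rdiv; rewrite Rmult_assoc, Rinv_l; lra). }
  rewrite sin_acos by exact Hx.
  rewrite <- (sqrt_pow2 r) at 1 by lra.
  rewrite <- sqrt_mult_alt by apply pow2_ge_0.
  rewrite <- sqrt_Rsqr_abs. f_equal. unfold Rsqr.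
  replace (r ^ 2 * (1 - x / r * (x / r))) with (r ^ 2 - x ^ 2) by (field; lra).
  rewrite E. ring.
Qed.

Lemma Cexp_Clog (z : C) : z <> RtoC 0 -> Cexp (Clog z) = z.
Proof.
  intros N. apply Cmod_gt_0 in N.
  unfold Clog, Cexp, Carg; simpl. rewrite exp_ln by exact N.
  assert (Hs := acos_div_sin (Re z) (Im z) (Cmod z) N (Cmod_sqr z)).
  assert (Hc := acos_div_cos (Re z) (Cmod z) N (re_le_Cmod z)).
  destruct (Rle_dec 0 (Im z)) as [H|H].
  - rewrite Rabs_right in Hs by lra. now apply C_ext.
  - rewrite Rabs_left in Hs by lra. rewrite cos_neg, sin_neg.
    apply C_ext; simpl; lra.
Qed.

Ltac eq_in_R := match goal with |- @eq _ ?a ?b => change (@eq R a b) end.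

Lemma RInt_abs_bound (f g : R -> R) a b : a <= b -> ex_RInt f a b -> ex_RInt g a b ->
  (forall x, a < x < b -> Rabs (f x) <= g x) -> Rabs (RInt f a b) <= RInt g a b.
Proof.
  intros Hab Hf Hg H. apply Rabs_le. split.
  - assert (RInt (fun x => -1 * f x) a b <= RInt g a b).
    { apply RInt_le; [exact Hab|apply ex_RInt_Rscal, Hf|exact Hg|].
      intros x Hx. specialize (H x Hx). apply Rabs_le_between in H. lra. }
    rewrite RInt_Rscal in H0 by exact Hf. lra.
  - apply RInt_le; [exact Hab|exact Hf|exact Hg|].
    intros x Hx. specialize (H x Hx). apply Rabs_le_between in H. lra.
Qed.

(** * Cauchy's theorem for a rectangle *)

Definition Ccont2 (f : R -> R -> C) (x y : R) : Prop :=
  continuity_2d_pt (fun u v => Re (f u v)) x y /\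
  continuity_2d_pt (fun u v => Im (f u v)) x y.

Lemma Ccont2_const c x y : Ccont2 (fun _ _ => c) x y.
Proof. split; apply continuity_2d_pt_const. Qed.

Lemma Ccont2_RtoC (f : R -> R -> R) x y :
  continuity_2d_pt f x y -> Ccont2 (fun u v => RtoC (f u v)) x y.
Proof. intros H; split; simpl; [exact H|apply continuity_2d_pt_const]. Qed.

Lemma Ccont2_fst x y : Ccont2 (fun u _ => RtoC u) x y.
Proof. apply (Ccont2_RtoC (fun u _ => u)), continuity_2d_pt_id1. Qed.

Lemma Ccont2_plus f g x y : Ccont2 f x y -> Ccont2 g x y -> Ccont2 (fun u v => f u v + g u v)%C x y.
Proof. intros [A B] [A' B']; split; simpl; apply continuity_2d_pt_plus; assumption. Qed.

Lemma Ccont2_opp f x y : Ccont2 f x y -> Ccont2 (fun u v => - f u v)%C x y.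
Proof. intros [A B]; split; simpl; apply continuity_2d_pt_opp; assumption. Qed.

Lemma Ccont2_minus f g x y : Ccont2 f x y -> Ccont2 g x y -> Ccont2 (fun u v => f u v - g u v)%C x y.
Proof. intros; apply Ccont2_plus; [|apply Ccont2_opp]; assumption. Qed.

Lemma Ccont2_mult f g x y : Ccont2 f x y -> Ccont2 g x y -> Ccont2 (fun u v => f u v * g u v)%C x y.
Proof.
  intros [A B] [A' B']; split; simpl.
  - apply continuity_2d_pt_minus; apply continuity_2d_pt_mult; assumption.
  - apply continuity_2d_pt_plus; apply continuity_2d_pt_mult; assumption.
Qed.

Lemma Ccont2_inv f x y : f x y <> RtoC 0 -> Ccont2 f x y -> Ccont2 (fun u v => / f u v)%C x y.
Proof.
  intros N [A B]. pose proof (Cneq0_norm2 _ N) as N2.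
  assert (Q : continuity_2d_pt (fun u v => / (Re (f u v) ^ 2 + Im (f u v) ^ 2)) x y).
  { apply continuity_2d_pt_inv; [|exact N2].
    apply continuity_2d_pt_plus.
    - apply (continuity_2d_pt_ext (fun u v => Re (f u v) * Re (f u v))).
      { intros; simpl; ring. } apply continuity_2d_pt_mult; assumption.
    - apply (continuity_2d_pt_ext (fun u v => Im (f u v) * Im (f u v))).
      { intros; simpl; ring. } apply continuity_2d_pt_mult; assumption. }
  split; simpl; apply continuity_2d_pt_mult; try exact Q; try exact A.
  apply continuity_2d_pt_opp; exact B.
Qed.

Lemma Ccont2_Cexp f x y : Ccont2 f x y -> Ccont2 (fun u v => Cexp (f u v)) x y.
Proof.
  intros [A B]; split; simpl; apply continuity_2d_pt_mult.
  1, 3: apply (continuity_1d_2d_pt_comp exp (fun u v => Re (f u v))); [|exact A];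
    apply derivable_continuous_pt, derivable_pt_exp.
  - apply (continuity_1d_2d_pt_comp cos (fun u v => Im (f u v))); [|exact B].
    apply derivable_continuous_pt, derivable_pt_cos.
  - apply (continuity_1d_2d_pt_comp sin (fun u v => Im (f u v))); [|exact B].
    apply derivable_continuous_pt, derivable_pt_sin.
Qed.

Lemma cont2_snd (f : R -> R -> R) x y : continuity_2d_pt f x y -> continuous (f x) y.
Proof.
  intros H. apply continuity_pt_filterlim. intros e He.
  destruct (H (mkposreal e He)) as [d Hd].
  exists d; split; [apply cond_pos|]. intros z [_ Hz].
  simpl in Hz |- *. unfold R_dist in *.
  apply (Hd x z); [|exact Hz]. rewrite Rminus_diag, Rabs_R0. apply cond_pos.
Qed.

Lemma Ccont2_Ccont f x y : Ccont2 f x y -> Ccont (f x) y.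
Proof.
  intros [A B]; split.
  - apply (cont2_snd (fun u v => Re (f u v))); exact A.
  - apply (cont2_snd (fun u v => Im (f u v))); exact B.
Qed.

Lemma derive_param (f f1 : R -> R -> R) a b y d : a <= b -> 0 < d ->
  (forall z t, Rabs (z - y) < d -> a - d < t < b + d ->
     is_derive (fun z => f z t) z (f1 z t)) ->
  (forall t, a <= t <= b -> continuity_2d_pt f1 y t) ->
  (forall z t, Rabs (z - y) < d -> a <= t <= b -> continuous (f z) t) ->
  is_derive (fun z => RInt (f z) a b) y (RInt (f1 y) a b).
Proof.
  intros Hab Hd HD HC Hc.
  assert (Hloc : forall P : R -> Prop, (forall z, Rabs (z - y) < d -> P z) -> locally y P).
  { intros P HP. exists (mkposreal d Hd). intros z Hz. apply HP. exact Hz. }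
  replace (RInt (f1 y) a b) with (RInt (fun t => Derive (fun u => f u t) y) a b).
  2:{ apply RInt_ext. intros t Ht. rewrite Rmin_left, Rmax_right in Ht by exact Hab.
      apply is_derive_unique. apply HD; [|lra]. rewrite Rminus_diag, Rabs_R0. exact Hd. }
  apply is_derive_RInt_param.
  - apply Hloc. intros z Hz t Ht. rewrite Rmin_left, Rmax_right in Ht by exact Hab.
    eexists. apply HD; [exact Hz|lra].
  - intros t Ht. rewrite Rmin_left, Rmax_right in Ht by exact Hab.
    apply (continuity_2d_pt_ext_loc f1); [|apply HC; lra].
    exists (mkposreal d Hd). intros u v Hu Hv. symmetry.
    apply is_derive_unique. apply HD; [exact Hu|].
    apply Rabs_lt_between in Hv. simpl in Hv. lra.
  - apply Hloc. intros z Hz. apply ex_RInt_cont; [exact Hab|].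
    intros t Ht. apply Hc; assumption.
Qed.

Lemma Cderiv_Cint_param (f f1 : R -> R -> C) a b y d : a <= b -> 0 < d ->
  (forall z t, Rabs (z - y) < d -> a - d < t < b + d ->
     Cderiv (fun z => f z t) z (f1 z t)) ->
  (forall t, a <= t <= b -> Ccont2 f1 y t) ->
  (forall z t, Rabs (z - y) < d -> a <= t <= b -> Ccont (f z) t) ->
  Cderiv (fun z => Cint (f z) a b) y (Cint (f1 y) a b).
Proof.
  intros Hab Hd HD HC Hc; split; simpl.
  - apply (derive_param (fun z t => Re (f z t)) (fun z t => Re (f1 z t)) a b y d); auto.
    + intros; apply HD; assumption.
    + intros; apply HC; assumption.
    + intros; apply Hc; assumption.
  - apply (derive_param (fun z t => Im (f z t)) (fun z t => Im (f1 z t)) a b y d); auto.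
    + intros; apply HD; assumption.
    + intros; apply HC; assumption.
    + intros; apply Hc; assumption.
Qed.

Lemma is_derive_RInt_upper (f : R -> R) a x d : a <= x -> 0 < d ->
  (forall t, a - d < t < x + d -> continuous f t) ->
  is_derive (fun y => RInt f a y) x (f x).
Proof.
  intros Hax Hd Hc.
  apply (is_derive_RInt f (fun y => RInt f a y) a x).
  - exists (mkposreal d Hd). intros y Hy.
    apply Rabs_lt_between in Hy. simpl in Hy. unfold minus, plus, opp in Hy; simpl in Hy.
    apply (RInt_correct (V := R_CompleteNormedModule)).
    apply (ex_RInt_continuous (V := R_CompleteNormedModule)). intros z Hz.
    apply Hc. destruct (Rle_dec a y).
    + rewrite Rmin_left, Rmax_right in Hz; lra.
    + rewrite Rmin_right, Rmax_left in Hz; lra.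
  - apply Hc; lra.
Qed.

Lemma Cderiv_Cint_upper (f : R -> C) a x d : a <= x -> 0 < d ->
  (forall t, a - d < t < x + d -> Ccont f t) -> Cderiv (fun y => Cint f a y) x (f x).
Proof.
  intros Hax Hd Hc; split; simpl.
  - apply (is_derive_RInt_upper (fun t => Re (f t)) a x d); auto. intros; apply Hc; auto.
  - apply (is_derive_RInt_upper (fun t => Im (f t)) a x d); auto. intros; apply Hc; auto.
Qed.

Lemma Cint_point f a : Cint f a a = RtoC 0.
Proof. apply C_ext; simpl; rewrite RInt_point; reflexivity. Qed.

(** Cauchy's theorem for a rectangle. The integral over the upper side minus
    [Ci] times the difference of the vertical sides does not depend on the
    height: the derivative of the first part is the integral of the exact
    differential d/dx (Ci G), which the vertical sides cancel. *)
Lemma rectangle (G G1 : R -> R -> C) a b c d e : a <= b -> c <= d -> 0 < e ->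
  (forall x y, a - e < x < b + e -> c - e < y < d + e ->
     Cderiv (fun x => G x y) x (G1 x y)) ->
  (forall x y, a - e < x < b + e -> c - e < y < d + e ->
     Cderiv (fun y => G x y) y (Ci * G1 x y)%C) ->
  (forall x y, a - e < x < b + e -> c - e < y < d + e -> Ccont2 (fun y x => G1 x y) y x) ->
  Cint (fun x => G x d) a b =
  (Cint (fun x => G x c) a b + Ci * (Cint (fun y => G b y) c d - Cint (fun y => G a y) c d))%C.
Proof.
  intros Hab Hcd He HDx HDy HC.
  set (K := fun y => (Cint (fun x => G x y) a b -
     Ci * (Cint (fun s => G b s) c y - Cint (fun s => G a s) c y))%C).
  assert (HG1 : forall x y, a - e < x < b + e -> c - e < y < d + e ->
     Ccont (fun x => G1 x y) x).
  { intros x y Hx Hy. apply (Ccont2_Ccont (fun y x => G1 x y)). apply HC; assumption. }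
  assert (E : K d = K c).
  { apply Cderiv_zero_const; [exact Hcd|]. intros y Hy. unfold K.
    eapply Cderiv_eq.
    - apply Cderiv_minus.
      + apply (Cderiv_Cint_param (fun y x => G x y) (fun y x => (Ci * G1 x y)%C) a b y e);
          [exact Hab|exact He| | |].
        * intros z t Hz Ht. apply Rabs_lt_between in Hz. apply HDy; lra.
        * intros t Ht. apply Ccont2_mult; [apply Ccont2_const|]. apply HC; lra.
        * intros z t Hz Ht. apply Rabs_lt_between in Hz.
          eapply Cderiv_Ccont. apply HDx; lra.
      + apply Cderiv_scal. apply Cderiv_minus.
        * apply (Cderiv_Cint_upper (fun s => G b s) c y e); [lra|exact He|].
          intros t Ht. eapply Cderiv_Ccont. apply (HDy b t); lra.
        * apply (Cderiv_Cint_upper (fun s => G a s) c y e); [lra|exact He|].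
          intros t Ht. eapply Cderiv_Ccont. apply (HDy a t); lra.
    - rewrite Cint_scal.
      2:{ apply ex_Cint_cont; [exact Hab|]. intros x Hx. apply HG1; lra. }
      rewrite (Cint_derive (fun x => G x y)); [ring|exact Hab| |].
      + intros x Hx. apply HDx; lra.
      + intros x Hx. apply HG1; lra. }
  unfold K in E. rewrite !Cint_point in E.
  replace (Cint (fun x => G x d) a b) with
    ((Cint (fun x => G x d) a b -
     Ci * (Cint (fun s => G b s) c d - Cint (fun s => G a s) c d)) +
     Ci * (Cint (fun s => G b s) c d - Cint (fun s => G a s) c d))%C by ring.
  rewrite E. ring.
Qed.

(** * The Poisson kernel *)

Definition nome (z : C) : C := Cexp (RtoC (2 * PI) * Ci * z)%C.
(** In the upper half plane this is the sum of the positive powers of the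
    nome; it is meromorphic with poles at the integers. *)
Definition kern (z : C) : C := (nome z / (1 - nome z))%C.
Definition kern_deriv (z : C) : C :=
  (RtoC (2 * PI) * Ci * nome z / ((1 - nome z) * (1 - nome z)))%C.

Lemma Cmod_nome z : Cmod (nome z) = exp (- (2 * PI * Im z)).
Proof.
  unfold nome. rewrite Cmod_Cexp. f_equal. unfold Re, Im; simpl; ring.
Qed.

Lemma nome_plus a b : nome (a + b)%C = (nome a * nome b)%C.
Proof. unfold nome. rewrite <- Cexp_plus. f_equal. ring. Qed.

Lemma Cmod_nome_lt1 z : 0 < Im z -> Cmod (nome z) < 1.
Proof.
  intros H. rewrite Cmod_nome, <- exp_0. apply exp_increasing.
  generalize PI_RGT_0; intros. assert (0 < 2 * PI * Im z) by nra. lra.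
Qed.

Lemma Cneq_1_minus (q : C) : Cmod q < 1 -> (1 - q)%C <> RtoC 0.
Proof.
  intros H E. assert (q = RtoC 1).
  { replace q with (1 - (1 - q))%C by ring. rewrite E. ring. }
  rewrite H0, Cmod_1 in H. lra.
Qed.

Lemma nome_den z : 0 < Im z -> (1 - nome z)%C <> RtoC 0.
Proof. intros H; apply Cneq_1_minus, Cmod_nome_lt1, H. Qed.

Lemma Cderiv_nome f x l : Cderiv f x l ->
  Cderiv (fun t => nome (f t)) x (l * (RtoC (2 * PI) * Ci * nome (f x)))%C.
Proof.
  intros H. eapply Cderiv_eq.
  - apply Cderiv_Cexp. apply Cderiv_scal. exact H.
  - unfold nome. ring.
Qed.

Lemma Cderiv_kern f x l : (1 - nome (f x))%C <> RtoC 0 -> Cderiv f x l ->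
  Cderiv (fun t => kern (f t)) x (l * kern_deriv (f x))%C.
Proof.
  intros N H. unfold kern, Cdiv. eapply Cderiv_eq.
  - apply Cderiv_mult; [apply Cderiv_nome; exact H|].
    apply (Cderiv_inv (fun t => 1 - nome (f t))%C); [exact N|].
    apply Cderiv_minus; [apply Cderiv_const|apply Cderiv_nome; exact H].
  - unfold kern_deriv. field. exact N.
Qed.

Lemma Ccont_kern f x : (1 - nome (f x))%C <> RtoC 0 -> Ccont f x ->
  Ccont (fun t => kern (f t)) x.
Proof.
  intros N H. unfold kern, Cdiv.
  assert (Ccont (fun t => nome (f t)) x).
  { apply Ccont_Cexp, Ccont_mult; [apply Ccont_const|exact H]. }
  apply Ccont_mult; [assumption|].
  apply (Ccont_inv (fun t => 1 - nome (f t))%C); [exact N|].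
  apply Ccont_minus; [apply Ccont_const|assumption].
Qed.

Lemma Ccont2_nome f x y : Ccont2 f x y -> Ccont2 (fun u v => nome (f u v)) x y.
Proof. intros H. apply Ccont2_Cexp, Ccont2_mult; [apply Ccont2_const|exact H]. Qed.

Lemma Ccont2_kern f x y : (1 - nome (f x y))%C <> RtoC 0 -> Ccont2 f x y ->
  Ccont2 (fun u v => kern (f u v)) x y.
Proof.
  intros N H. unfold kern, Cdiv.
  apply Ccont2_mult; [apply Ccont2_nome, H|].
  apply (Ccont2_inv (fun u v => 1 - nome (f u v))%C); [exact N|].
  apply Ccont2_minus; [apply Ccont2_const|apply Ccont2_nome, H].
Qed.

Lemma Ccont2_kern_deriv f x y : (1 - nome (f x y))%C <> RtoC 0 -> Ccont2 f x y ->
  Ccont2 (fun u v => kern_deriv (f u v)) x y.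
Proof.
  intros N H. unfold kern_deriv, Cdiv.
  apply Ccont2_mult; [apply Ccont2_mult; [apply Ccont2_const|apply Ccont2_nome, H]|].
  apply (Ccont2_inv (fun u v => (1 - nome (f u v)) * (1 - nome (f u v)))%C).
  - apply Cmult_neq_0; exact N.
  - apply Ccont2_mult; (apply Ccont2_minus; [apply Ccont2_const|apply Ccont2_nome, H]).
Qed.

Lemma Cderiv_pair (f g : R -> R) x l m :
  is_derive f x l -> is_derive g x m -> Cderiv (fun t => (f t, g t)) x (l, m).
Proof. intros; split; assumption. Qed.

Lemma Ccont2_pair (f g : R -> R -> R) x y :
  continuity_2d_pt f x y -> continuity_2d_pt g x y -> Ccont2 (fun u v => (f u v, g u v)) x y.
Proof. intros; split; assumption. Qed.

(** The inequality 1 + x <= e^x turns the geometric bound |q| / (1 - |q|),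
    |q| = e^(-x), into 1 / x. *)
Lemma kern_bound z y : 0 < y <= Im z -> Cmod (kern z) <= / (2 * PI * y).
Proof.
  intros [Hy Hz]. generalize PI_RGT_0; intros HP.
  unfold kern. rewrite Cmod_div by (apply nome_den; lra).
  pose proof (Cmod_nome z) as E.
  pose proof (Cmod_1_minus_ge (nome z)) as H1.
  set (x := 2 * PI * Im z) in *. assert (Hx : 2 * PI * y <= x) by (unfold x; nra).
  assert (Hx0 : 0 < 2 * PI * y) by nra.
  assert (H2 : exp (- x) * (1 + x) <= 1).
  { rewrite <- (exp_0). replace 0 with (- x + x) at 2 by ring. rewrite exp_plus.
    rewrite exp_0. apply Rmult_le_compat_l; [left; apply exp_pos|].
    apply exp_ineq1_le. }
  rewrite E in *. generalize (exp_pos (- x)); intros Hp.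
  assert (0 < 1 - exp (-x)) by nra.
  apply Rle_trans with (exp (- x) / (1 - exp (- x))).
  - unfold Rdiv. apply Rmult_le_compat_l; [lra|]. apply Rinv_le_contravar; lra.
  - apply Rle_trans with (/ x); [|apply Rinv_le_contravar; lra].
    apply Rmult_le_reg_r with (1 - exp (- x)); [lra|].
    unfold Rdiv. rewrite Rmult_assoc, Rinv_l, Rmult_1_r by lra.
    apply Rmult_le_reg_l with x; [lra|]. rewrite <- Rmult_assoc, Rinv_r by lra. nra.
Qed.

Lemma nome_1 : nome (RtoC 1) = RtoC 1.
Proof.
  unfold nome, Cexp, Re, Im; simpl.
  replace (_ * 1 - _ * 0) with 0 by ring. rewrite exp_0.
  replace (_ + _) with (2 * PI) by ring.
  rewrite cos_2PI, sin_2PI. apply C_ext; simpl; ring.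
Qed.

Lemma kern_period z : kern (z + 1)%C = kern z.
Proof. unfold kern. rewrite nome_plus, nome_1, Cmult_1_r. reflexivity. Qed.

Lemma Ccont_kern_line y x : 0 < y -> Ccont (fun x => kern (x, y)) x.
Proof.
  intros Hy. apply (Ccont_kern (fun x => (x, y))); [apply nome_den; exact Hy|].
  eapply Cderiv_Ccont, Cderiv_pair; [apply @is_derive_id|apply @is_derive_const].
Qed.

(** By periodicity the vertical sides cancel in [rectangle], so the integral
    is independent of the height y, and by [kern_bound] it tends to 0 as y
    grows. *)
Lemma Cint_kern_period y a : 0 < y -> Cint (fun x => kern (x, y)) a (a + 1) = RtoC 0.
Proof.
  intros Hy.
  assert (E : forall Y, y <= Y ->
    Cint (fun x => kern (x, Y)) a (a + 1) = Cint (fun x => kern (x, y)) a (a + 1)).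
  { intros Y HY.
    rewrite (rectangle (fun x y => kern (x, y)) (fun x y => kern_deriv (x, y)) a (a + 1) y Y y);
      try lra.
    - replace (Cint (fun s => kern (a + 1, s)) y Y) with (Cint (fun s => kern (a, s)) y Y).
      2:{ apply Cint_ext; [exact HY|]. intros s _. rewrite <- kern_period. f_equal.
          apply C_ext; simpl; ring. }
      ring.
    - intros x s Hx Hs. eapply Cderiv_eq.
      + apply (Cderiv_kern (fun x => (x, s))); [apply nome_den; simpl; lra|].
        apply Cderiv_pair; [apply @is_derive_id|apply @is_derive_const].
      + change (RtoC 1 * kern_deriv (x, s) = kern_deriv (x, s))%C. ring.
    - intros x s Hx Hs. eapply Cderiv_eq.
      + apply (Cderiv_kern (fun s => (x, s))); [apply nome_den; simpl; lra|].
        apply Cderiv_pair; [apply @is_derive_const|apply @is_derive_id].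
      + reflexivity.
    - intros x s Hx Hs. apply (Ccont2_kern_deriv (fun s x => (x, s))); [apply nome_den; simpl; lra|].
      apply Ccont2_pair; [apply continuity_2d_pt_id2|apply continuity_2d_pt_id1]. }
  set (c := Cint (fun x => kern (x, y)) a (a + 1)) in *.
  assert (B : forall Y, y <= Y -> Cmod c <= / (2 * PI * Y)).
  { intros Y HY. rewrite <- (E Y HY).
    replace (/ (2 * PI * Y)) with (/ (2 * PI * Y) * (a + 1 - a)) by ring.
    apply Cint_bound_const; [lra| |].
    - apply ex_Cint_cont; [lra|]. intros x _. apply Ccont_kern_line. lra.
    - intros x _. apply kern_bound; simpl; lra. }
  apply Cmod_eq_0. destruct (Req_dec (Cmod c) 0) as [Z|Z]; [exact Z|exfalso].
  assert (Hc : 0 < Cmod c) by (generalize (Cmod_ge_0 c); lra).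
  generalize PI2_3_2; intros HP.
  set (Y := Rmax y (/ Cmod c)). specialize (B Y (Rmax_l _ _)).
  assert (HY : / Cmod c <= Y) by apply Rmax_r.
  assert (0 < / Cmod c) by (apply Rinv_0_lt_compat; exact Hc).
  assert (HY0 : 0 < 2 * PI * Y) by (apply Rmult_lt_0_compat; lra).
  assert (K : Cmod c * (2 * PI * Y) <= 1).
  { apply Rmult_le_compat_r with (r := 2 * PI * Y) in B; [|lra].
    rewrite Rinv_l in B; lra. }
  assert (Cmod c * / Cmod c = 1) by (apply Rinv_r; lra). nra.
Qed.

(** The Poisson kernel of the unit disc at radius e^(- 2 pi y), as a function
    of period 1. *)
Definition poisson (y x : R) : R := 1 + 2 * Re (kern (x, y)).

Lemma continuous_poisson y x : 0 < y -> continuous (poisson y) x.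
Proof.
  intros Hy. unfold poisson.
  apply @continuous_plus; [apply @continuous_const|].
  apply @continuous_mult; [apply @continuous_const|].
  apply (Ccont_kern_line y x Hy).
Qed.

Lemma RInt_poisson y a : 0 < y -> RInt (poisson y) a (a + 1) = 1.
Proof.
  intros Hy. unfold poisson.
  assert (X : ex_RInt (fun x => Re (kern (x, y))) a (a + 1)).
  { apply ex_RInt_cont; [lra|]. intros x _; apply (Ccont_kern_line y x Hy). }
  rewrite RInt_Rplus, RInt_Rscal, RInt_Rconst;
    [|exact X|apply ex_RInt_const|apply ex_RInt_Rscal, X].
  generalize (f_equal Re (Cint_kern_period y a Hy)). simpl. intros ->. ring.
Qed.

(** The closed form (1 - r^2) / |1 - q|^2 of the Poisson kernel, r = |q|; it
    makes the positivity visible. *)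
Lemma poisson_eq y x : 0 < y ->
  poisson y x * Cmod (1 - nome (x, y))%C ^ 2 = 1 - exp (- (2 * PI * y)) ^ 2.
Proof.
  intros Hy. pose proof (nome_den (x, y) Hy) as N.
  pose proof (Cmod_nome (x, y)) as E. simpl in E. rewrite <- E.
  unfold poisson, kern. set (q := nome (x, y)) in *.
  destruct q as [c s]. rewrite !Cmod_sqr.
  apply Cneq0_norm2 in N. unfold Re, Im in *; simpl in *. field. nra.
Qed.

Lemma poisson_ge0 y x : 0 < y -> 0 <= poisson y x.
Proof.
  intros Hy. pose proof (poisson_eq y x Hy) as E.
  pose proof (nome_den (x, y) Hy) as N. apply Cmod_gt_0 in N.
  pose proof (Cmod_nome_lt1 (x, y) Hy) as H. rewrite Cmod_nome in H. simpl in H.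
  generalize (exp_pos (- (2 * PI * y))); intros.
  assert (0 < Cmod (1 - nome (x, y))%C ^ 2) by nra.
  apply Rmult_le_reg_r with (Cmod (1 - nome (x, y))%C ^ 2); [assumption|]. nra.
Qed.

Lemma sin_lower x : 0 <= x <= PI / 2 -> x / 3 <= sin x.
Proof.
  intros [H0 H1]. generalize PI_4; intros H4.
  destruct (SIN_bound x) as [_ _].
  destruct (SIN x) as [L _]; [lra|lra|].
  eapply Rle_trans; [|exact L]. unfold sin_lb, sin_approx. simpl sum_f_R0.
  unfold sin_term; simpl.
  replace (_ + _ + _ + _) with (x - x ^ 3 / 6 + (x ^ 5 / 120 - x ^ 7 / 5040)) by field.
  assert (0 <= x ^ 5) by (apply pow_le; lra).
  assert (x * x <= 4) by nra.
  replace (x ^ 7) with (x ^ 5 * (x * x)) by ring.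
  replace (x ^ 3) with (x * (x * x)) by ring. nra.
Qed.

Lemma one_minus_cos t : Rabs t <= 1 / 2 -> 2 * t ^ 2 <= 1 - cos (2 * PI * t).
Proof.
  intros Ht. generalize PI_RGT_0 PI2_3_2; intros.
  replace (2 * PI * t) with (2 * (PI * t)) by ring.
  rewrite cos_2a_sin.
  assert (K : forall u, 0 <= u <= 1 / 2 -> u <= sin (PI * u)).
  { intros u Hu. eapply Rle_trans; [|apply sin_lower]; nra. }
  assert (t ^ 2 <= sin (PI * t) ^ 2).
  { destruct (Rle_dec 0 t) as [P|P].
    - rewrite Rabs_right in Ht by lra. specialize (K t). nra.
    - rewrite Rabs_left in Ht by lra. specialize (K (- t)).
      replace (PI * - t) with (- (PI * t)) in K by ring. rewrite sin_neg in K. nra. }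
  nra.
Qed.

(** Since |1 - q|^2 >= 2 r (1 - cos (2 pi x)) >= 4 r (x - j)^2, the square
    compensates the peak of the kernel at j; what remains is of the order of
    y. *)
Lemma poisson_sqr y x (j : nat) : 0 < y -> Rabs (x - INR j) <= 1 / 2 ->
  (x - INR j) ^ 2 * poisson y x <=
  (exp (2 * PI * y) - exp (- (2 * PI * y))) / 4.
Proof.
  intros Hy Hx.
  pose proof (poisson_eq y x Hy) as E. pose proof (poisson_ge0 y x Hy) as P.
  set (r := exp (- (2 * PI * y))) in *.
  assert (Er : exp (2 * PI * y) = / r).
  { unfold r. rewrite exp_Ropp, Rinv_inv. reflexivity. }
  rewrite Er. assert (Hr : 0 < r) by apply exp_pos.
  assert (L : 4 * r * (x - INR j) ^ 2 <= Cmod (1 - nome (x, y))%C ^ 2).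
  { pose proof (Cmod_nome (x, y)) as Eq. simpl in Eq. fold r in Eq.
    assert (E2 : Cmod (1 - nome (x, y))%C ^ 2 = (1 - r) ^ 2 + 2 * r * (1 - cos (2 * PI * x))).
    { assert (Enr : Re (nome (x, y)) = r * cos (2 * PI * x)).
      { unfold nome, Cexp, Re, Im; simpl. unfold r. f_equal; f_equal; ring. }
      rewrite Cmod_sqr, re_minus, im_minus, re_RtoC, im_RtoC.
      pose proof (Cmod_sqr (nome (x, y))) as Q. rewrite Eq, Enr in Q. rewrite Enr. nra. }
    rewrite E2.
    replace (cos (2 * PI * x)) with (cos (2 * PI * (x - INR j))).
    2:{ rewrite <- (cos_period (2 * PI * (x - INR j)) j). f_equal. ring. }
    pose proof (one_minus_cos _ Hx).
    assert (0 <= (1 - r) ^ 2) by apply pow2_ge_0. nra. }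
  replace ((/ r - r) / 4) with ((1 - r ^ 2) / (4 * r)) by (field; lra).
  rewrite <- E.
  apply Rmult_le_reg_r with (4 * r); [lra|].
  unfold Rdiv. rewrite !Rmult_assoc, Rinv_l, Rmult_1_r by lra. nra.
Qed.

(** A bound for the mean of |x - j| under the kernel: it comes from
    |u| <= eta + u^2 / eta, the unit mass and [poisson_sqr]. *)
Definition poisson_error (y eta : R) : R :=
  eta + (exp (2 * PI * y) - exp (- (2 * PI * y))) / (4 * eta).

Lemma Rabs_le_add_square u eta : 0 < eta -> Rabs u <= eta + u ^ 2 / eta.
Proof.
  intros He. apply Rmult_le_reg_r with eta; [exact He|].
  replace ((eta + u ^ 2 / eta) * eta) with (eta ^ 2 + u ^ 2) by (field; lra).
  rewrite <- (pow2_abs u). generalize (Rabs_pos u); intros. nra.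
Qed.

(** An approximate identity: the kernel is positive and has mass 1 on the
    period around j, so its action on a Lipschitz function differs from the
    value at j by at most K times the mean of |x - j|. *)
Lemma poisson_local (h : R -> R) (j : nat) K y eta : 0 < y -> 0 < eta -> 0 <= K ->
  (forall x, INR j - 1 / 2 <= x <= INR j + 1 / 2 -> continuous h x) ->
  (forall x, INR j - 1 / 2 <= x <= INR j + 1 / 2 ->
     Rabs (h x - h (INR j)) <= K * Rabs (x - INR j)) ->
  Rabs (RInt (fun x => h x * poisson y x) (INR j - 1 / 2) (INR j + 1 / 2) - h (INR j))
  <= K * poisson_error y eta.
Proof.
  intros Hy He HK Hc HL. set (a := INR j - 1 / 2) in *. set (b := INR j + 1 / 2) in *.
  assert (Hab : a <= b) by (unfold a, b; lra).
  assert (Pc : ex_RInt (poisson y) a b).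
  { apply ex_RInt_cont; [exact Hab|]. intros; apply continuous_poisson, Hy. }
  assert (Hc2 : forall x, a <= x <= b -> continuous (fun x => h x * poisson y x) x).
  { intros x Hx. apply (continuous_mult (K := R_AbsRing)); [apply Hc, Hx|apply continuous_poisson, Hy]. }
  assert (P1 : RInt (poisson y) a b = 1).
  { rewrite <- (RInt_poisson y a Hy). f_equal. unfold a, b; lra. }
  replace (RInt (fun x => h x * poisson y x) a b - h (INR j)) with
    (RInt (fun x => h x * poisson y x - h (INR j) * poisson y x) a b).
  2:{ rewrite RInt_Rminus, RInt_Rscal, P1; [rewrite Rmult_1_r; reflexivity|exact Pc| |apply ex_RInt_Rscal, Pc].
      apply ex_RInt_cont; [exact Hab|exact Hc2]. }
  assert (X : ex_RInt (fun x => h x * poisson y x - h (INR j) * poisson y x) a b).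
  { apply ex_RInt_Rminus; [|apply ex_RInt_Rscal, Pc]. apply ex_RInt_cont; [exact Hab|exact Hc2]. }
  set (S := (exp (2 * PI * y) - exp (- (2 * PI * y))) / 4).
  set (G := fun x => (K * eta) * poisson y x + K * S / eta).
  assert (XG : ex_RInt G a b).
  { unfold G. apply ex_RInt_Rplus; [apply ex_RInt_Rscal, Pc|apply ex_RInt_const]. }
  assert (EG : RInt G a b = K * poisson_error y eta).
  { unfold G. rewrite RInt_Rplus, RInt_Rscal, RInt_Rconst, P1;
      [|exact Pc|apply ex_RInt_Rscal, Pc|apply ex_RInt_const].
    unfold poisson_error, S, a, b. eq_in_R. field. lra. }
  rewrite <- EG.
  assert (B : forall x, a < x < b ->
     Rabs (h x * poisson y x - h (INR j) * poisson y x) <= G x).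
  { intros x Hx. rewrite <- Rmult_minus_distr_r, Rabs_mult.
    pose proof (poisson_ge0 y x Hy) as P0. rewrite (Rabs_right (poisson y x)) by lra.
    assert (Hx' : Rabs (x - INR j) <= 1 / 2) by (apply Rabs_le; unfold a, b in Hx; lra).
    pose proof (poisson_sqr y x j Hy Hx') as Q. fold S in Q.
    apply Rle_trans with (K * (eta + (x - INR j) ^ 2 / eta) * poisson y x).
    - apply Rmult_le_compat_r; [exact P0|].
      eapply Rle_trans; [apply HL; lra|].
      apply Rmult_le_compat_l; [exact HK|apply Rabs_le_add_square, He].
    - unfold G.
      replace (K * (eta + (x - INR j) ^ 2 / eta) * poisson y x) with
        (K * eta * poisson y x + (K / eta) * ((x - INR j) ^ 2 * poisson y x)) by (field; lra).
      apply Rplus_le_compat_l.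
      replace (K * S / eta) with (K / eta * S) by (field; lra).
      apply Rmult_le_compat_l; [|exact Q].
      apply Rmult_le_pos; [exact HK|left; apply Rinv_0_lt_compat, He]. }
  apply RInt_abs_bound; assumption.
Qed.

(** * Dirichlet sums as Poisson integrals *)

Definition dirichlet (xi x : R) : R := exp (- (1 + xi) * ln x).

Lemma is_derive_dirichlet xi x : 0 < x ->
  is_derive (dirichlet xi) x (- (1 + xi) * / x * dirichlet xi x).
Proof.
  intros Hx. unfold dirichlet. auto_derive; [exact Hx|]. field. lra.
Qed.

Lemma continuous_dirichlet xi x : 0 < x -> continuous (dirichlet xi) x.
Proof. intros; apply ex_derive_cont; eexists; apply is_derive_dirichlet; assumption. Qed.

(** The constants telescope in k, which keeps the sum of the errors of
    [poisson_local] bounded uniformly in N and xi. *)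
Lemma dirichlet_Lipschitz xi (k : nat) x : 0 < xi <= 1 ->
  INR (k + 2) - 1 / 2 <= x <= INR (k + 2) + 1 / 2 ->
  Rabs (dirichlet xi x - dirichlet xi (INR (k + 2))) <=
  2 * (/ (INR k + 1) - / (INR k + 2)) * Rabs (x - INR (k + 2)).
Proof.
  intros Hxi Hx. rewrite plus_INR in *. simpl (INR 2) in *.
  pose proof (pos_INR k) as Hk. set (j := INR k + (1 + 1)) in *.
  assert (Hj : 2 <= j) by (unfold j; lra).
  destruct (MVT_gen (dirichlet xi) j x (fun x => - (1 + xi) * / x * dirichlet xi x)) as (c & Hc & E).
  - intros z Hz. apply is_derive_dirichlet.
    destruct (Rle_dec j x); [rewrite Rmin_left in Hz|rewrite Rmin_right in Hz]; lra.
  - intros z Hz. apply continuity_pt_filterlim, continuous_dirichlet.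
    destruct (Rle_dec j x); [rewrite Rmin_left in Hz|rewrite Rmin_right in Hz]; lra.
  - assert (Hc' : j - 1 / 2 <= c).
    { destruct (Rle_dec j x); [rewrite Rmin_left in Hc|rewrite Rmin_right in Hc]; lra. }
    rewrite E, Rabs_mult. apply Rmult_le_compat_r; [apply Rabs_pos|].
    assert (Hd : 0 < dirichlet xi c <= / c).
    { split; [apply exp_pos|]. unfold dirichlet.
      rewrite <- (exp_ln (/ c)) by (apply Rinv_0_lt_compat; lra).
      rewrite ln_Rinv by lra.
      assert (0 <= ln c) by (rewrite <- ln_1; apply ln_le; lra).
      destruct (Req_dec ((1 + xi) * ln c) (ln c)) as [Z|Z].
      - replace (- (1 + xi) * ln c) with (- ln c) by lra. lra.
      - left. apply exp_increasing. nra. }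
    assert (Hc0 : 0 < / c) by (apply Rinv_0_lt_compat; lra).
    rewrite !Rabs_mult, Rabs_Ropp, (Rabs_right (1 + xi)), (Rabs_right (/ c)),
      (Rabs_right (dirichlet xi c)) by lra.
    apply Rle_trans with (2 * (/ c * / c)).
    { rewrite Rmult_assoc. apply Rmult_le_compat; try lra; nra. }
    apply Rmult_le_compat_l; [lra|].
    replace (/ (INR k + 1) - / (INR k + 2)) with (/ ((INR k + 1) * (INR k + 2))) by (field; lra).
    rewrite <- Rinv_mult. apply Rinv_le_contravar; [nra|]. unfold j in Hc'. nra.
Qed.

(** The integral starts at 3/2 because the moved path has to avoid the pole of
    kern at 1. The term 1 of the Dirichlet series is thereby left out. *)
Lemma poisson_sum xi y eta (N : nat) : 0 < xi <= 1 -> 0 < y -> 0 < eta ->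
  Rabs (RInt (fun x => dirichlet xi x * poisson y x) (3 / 2) (INR N + 3 / 2) -
        (sum_n (fun k => dirichlet xi (INR (S k))) N - 1)) <=
  2 * (1 - / (INR N + 1)) * poisson_error y eta.
Proof.
  intros Hxi Hy He.
  assert (Hint : forall a b, 0 < a -> a <= b -> ex_RInt (fun x => dirichlet xi x * poisson y x) a b).
  { intros a b Ha Hab. apply ex_RInt_cont; [exact Hab|]. intros x Hx.
    apply (continuous_mult (K := R_AbsRing)); [apply continuous_dirichlet; lra|apply continuous_poisson, Hy]. }
  induction N as [|N IH].
  - rewrite sum_O. simpl (INR 0). rewrite Rplus_0_l, RInt_point. unfold dirichlet.
    simpl (INR 1). rewrite ln_1, Rmult_0_r, exp_0.
    unfold zero; simpl. rewrite !Rminus_diag, Rabs_R0.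
    replace (/ (0 + 1)) with 1 by field. lra.
  - rewrite sum_Sn.
    pose proof (pos_INR N) as HN.
    rewrite <- (RInt_Chasles (V := R_CompleteNormedModule) _ (3 / 2) (INR N + 3 / 2));
      [|apply Hint; lra|apply Hint; rewrite ?S_INR; lra].
    pose proof (poisson_local (dirichlet xi) (N + 2) (2 * (/ (INR N + 1) - / (INR N + 2))) y eta Hy He) as L.
    replace (INR (N + 2) - 1 / 2) with (INR N + 3 / 2) in L by (rewrite plus_INR; simpl; lra).
    replace (INR (N + 2) + 1 / 2) with (INR (S N) + 3 / 2) in L
      by (rewrite plus_INR, S_INR; simpl; lra).
    assert (L' := L ltac:(apply Rmult_le_pos; [lra|]; replace (/ (INR N + 1) - / (INR N + 2)) with (/ ((INR N + 1) * (INR N + 2))) by (field; lra); left; apply Rinv_0_lt_compat; nra)).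
    clear L. specialize (L' ltac:(intros x Hx; apply continuous_dirichlet; lra)).
    assert (L := L' ltac:(intros x Hx; apply dirichlet_Lipschitz; [exact Hxi|];
      rewrite plus_INR; rewrite S_INR in Hx; simpl (INR 2); lra)). clear L'.
    unfold plus; simpl (AbelianMonoid.plus _ _).
    replace (S (S N)) with (N + 2)%nat by lia.
    rewrite (S_INR N) at 2.
    replace (INR N + 1 + 1) with (INR N + 2) by ring.
    set (A := RInt _ (3 / 2) _) in *. set (B := RInt _ _ (INR (S N) + 3 / 2)) in *.
    set (s := sum_n _ N) in *.
    match goal with |- Rabs ?X <= _ =>
      replace X with ((A - (s - 1)) + (B - dirichlet xi (INR (N + 2))));
      [|change (A - (s - 1) + (B - dirichlet xi (INR (N + 2))) = A + B - (s + dirichlet xi (INR (N + 2)) - 1)); ring] end.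
    eapply Rle_trans; [apply Rabs_triang|].
    eapply Rle_trans; [apply Rplus_le_compat; [exact IH|exact L]|]. right; ring.
Qed.

(** * Moving the path off the real axis *)

(** The ends of the integral of [poisson_sum] in the variable t = ln x. *)
Definition left_end : R := ln (3 / 2).
Definition right_end (N : nat) : R := ln (INR N + 3 / 2).

(** This path stays away from the poles of kern (e^t), which include all
    points t = ln k. *)
Definition path_integral (g : C -> C) (v : R) (N : nat) : C :=
  (Ci * Cint (fun s => g (left_end, s) * kern (Cexp (left_end, s))) 0 v +
   Cint (fun r => g (r, v) * kern (Cexp (r, v))) left_end (right_end N))%C.

Lemma left_end_bounds : 0 < left_end <= 1 / 2.
Proof.
  unfold left_end. split.
  - rewrite <- ln_1. apply ln_increasing; lra.
  - rewrite <- (ln_exp (1 / 2)). apply ln_le; [lra|].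
    generalize (exp_ineq1_le (1 / 2)). lra.
Qed.

Lemma exp_left_end : exp left_end = 3 / 2.
Proof. unfold left_end. apply exp_ln; lra. Qed.

Lemma exp_right_end N : exp (right_end N) = INR N + 3 / 2.
Proof. unfold right_end. apply exp_ln. generalize (pos_INR N); lra. Qed.

Lemma left_end_le_right_end N : left_end <= right_end N.
Proof. apply ln_le; [lra|]. generalize (pos_INR N); lra. Qed.

Lemma Im_Cexp_pair r s : Im (Cexp (r, s)) = exp r * sin s.
Proof. reflexivity. Qed.
Lemma Re_Cexp_pair r s : Re (Cexp (r, s)) = exp r * cos s.
Proof. reflexivity. Qed.

Lemma sin_ge_half v : 1 <= v < PI / 2 -> 1 / 2 <= sin v.
Proof.
  intros Hv. rewrite <- sin_PI6. generalize PI_4 PI_RGT_0; intros.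
  apply sin_incr_1; lra.
Qed.

(** Two reasons for which the nomes of z and of all z + i y, y >= 0, keep a
    distance 1/2 from 1: they are small, or their common direction points to
    the left half plane. *)
Definition safe (z : C) : Prop :=
  0 <= Im z /\ (1 / 4 <= Im z \/ cos (2 * PI * Re z) <= 0).

Lemma exp_m1_half : exp (- 1) <= 1 / 2.
Proof.
  replace (-1) with (Ropp 1) by lra. rewrite exp_Ropp. generalize (exp_ineq1_le 1); intros.
  apply Rle_trans with (/ 2); [apply Rinv_le_contravar|]; lra.
Qed.

Lemma Re_nome z : Re (nome z) = exp (- (2 * PI * Im z)) * cos (2 * PI * Re z).
Proof. unfold nome, Cexp, Re, Im; simpl; f_equal; f_equal; ring. Qed.

Lemma safe_den z y : safe z -> 0 <= y -> 1 / 2 <= Cmod (1 - nome (z + (0%R, y)))%C.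
Proof.
  intros [H0 H] Hy. generalize PI2_3_2; intros HP. destruct H as [H|H].
  - eapply Rle_trans; [|apply Cmod_1_minus_ge].
    rewrite Cmod_nome, im_plus. simpl.
    assert (exp (- (2 * PI * (Im z + y))) <= exp (- 1)).
    {
      assert (2 * PI * (1 / 4) <= 2 * PI * (Im z + y)) by (apply Rmult_le_compat_l; lra).
      left; apply exp_increasing. lra. }
    generalize exp_m1_half; lra.
  - apply Rle_trans with (Rabs (Re (1 - nome (z + (0%R, y)))%C)); [|apply re_le_Cmod].
    rewrite re_minus, re_RtoC, Re_nome, re_plus. simpl (Re (0, y)). rewrite Rplus_0_r.
    generalize (exp_pos (- (2 * PI * Im (z + (0%R, y))%C))); intros.
    rewrite Rabs_right; nra.
Qed.

Lemma safe_den0 z : safe z -> 1 / 2 <= Cmod (1 - nome z)%C.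
Proof.
  intros H. replace z with (z + (0%R, 0%R))%C by (apply C_ext; simpl; unfold Re, Im; ring).
  apply safe_den; [exact H|lra].
Qed.

Lemma nome_shift z y : nome (z + (0%R, y))%C = (nome z * RtoC (exp (- (2 * PI * y))))%C.
Proof.
  rewrite nome_plus. f_equal. unfold nome, Cexp, Re, Im; simpl.
  replace (_ - _) with (- (2 * PI * y)) by ring.
  replace (_ + _) with 0 by ring. rewrite cos_0, sin_0. apply C_ext; simpl; ring.
Qed.

(** The factor |nome z| matters on the horizontal line, where it makes the
    error integrable. *)
Lemma kern_shift z y : safe z -> 0 <= y ->
  Cmod (kern (z + (0%R, y)) - kern z)%C <= 8 * PI * y * Cmod (nome z).
Proof.
  intros Hs Hy.
  pose proof (safe_den z y Hs Hy) as D1. pose proof (safe_den0 z Hs) as D0.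
  rewrite nome_shift in D1. unfold kern. rewrite nome_shift.
  set (q := nome z) in *. set (e := exp (- (2 * PI * y))) in *.
  assert (N0 : (1 - q)%C <> RtoC 0) by (apply Cmod_gt_0; lra).
  assert (N1 : (1 - q * RtoC e)%C <> RtoC 0) by (apply Cmod_gt_0; lra).
  replace (q * RtoC e / (1 - q * RtoC e) - q / (1 - q))%C with
    (q * RtoC (e - 1) / ((1 - q * RtoC e) * (1 - q)))%C
    by (rewrite RtoC_minus; field; auto).
  assert (He : Rabs (e - 1) <= 2 * PI * y).
  { unfold e. generalize PI_RGT_0; intros. assert (0 <= 2 * PI * y) by nra.
    assert (exp (- (2 * PI * y)) <= 1) by (apply exp_le_1; lra).
    rewrite Rabs_left1 by lra.
    generalize (exp_ineq1_le (- (2 * PI * y))). lra. }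
  rewrite Cmod_div by (apply Cmult_neq_0; assumption).
  rewrite !Cmod_mult, Cmod_R.
  generalize (Cmod_ge_0 q); intros Q.
  apply Rmult_le_reg_r with (Cmod (1 - q * RtoC e)%C * Cmod (1 - q)%C); [nra|].
  unfold Rdiv. rewrite (Rmult_assoc (_ * _)), Rinv_l, Rmult_1_r by nra.
  assert (1 / 4 <= Cmod (1 - q * RtoC e)%C * Cmod (1 - q)%C) by nra.
  apply Rle_trans with (Cmod q * (2 * PI * y)); [apply Rmult_le_compat_l; lra|].
  assert (0 <= Cmod q * (2 * PI * y)).
  { generalize (Rabs_pos (e - 1)); intros; nra. }
  nra.
Qed.

(** The left side is an arc of radius 3/2. Where cos s >= 5/6 the real part
    lies in [5/4, 3/2], so the nome points to the left; elsewhere the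
    imaginary part exceeds 1/4. *)
Lemma safe_left s : 0 <= s <= PI / 2 -> safe (Cexp (left_end, s)).
Proof.
  intros Hs. generalize PI_RGT_0; intros HP.
  assert (S0 : 0 <= sin s) by (apply sin_ge_0; lra).
  assert (C0 : 0 <= cos s) by (apply cos_ge_0; lra).
  unfold safe. rewrite Im_Cexp_pair, Re_Cexp_pair, exp_left_end.
  split; [lra|].
  destruct (Rle_dec (5 / 6) (cos s)) as [H|H].
  - right. replace (2 * PI * (3 / 2 * cos s)) with (PI * (3 * cos s - 2) + 2 * INR 1 * PI)
      by (simpl; field).
    rewrite cos_period. pose proof (COS_bound s) as [_ B].
    apply cos_le_0; nra.
  - left. generalize (sin2_cos2 s); unfold Rsqr; intros.
    assert (sin s * sin s >= 1 / 4) by nra. nra.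
Qed.

Lemma safe_line r v : left_end <= r -> 1 <= v < PI / 2 -> safe (Cexp (r, v)).
Proof.
  intros Hr Hv. pose proof (sin_ge_half v Hv).
  assert (3 / 2 <= exp r).
  { rewrite <- exp_left_end. destruct Hr as [Hr| ->]; [left; apply exp_increasing; lra|lra]. }
  unfold safe. rewrite Im_Cexp_pair. split; [nra|left; nra].
Qed.

Lemma safe_neq z : safe z -> (1 - nome z)%C <> RtoC 0.
Proof.
  intros H. apply Cmod_gt_0. generalize (safe_den0 z H); lra.
Qed.

Lemma kern_safe_bound z : safe z -> Cmod (kern z) <= 2 * Cmod (nome z).
Proof.
  intros H. pose proof (safe_neq z H) as N.
  pose proof (safe_den0 z H) as D0.
  unfold kern. rewrite Cmod_div by exact N.
  apply Rmult_le_reg_r with (Cmod (1 - nome z)%C); [lra|].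
  unfold Rdiv. rewrite Rmult_assoc, Rinv_l by lra.
  generalize (Cmod_ge_0 (nome z)); nra.
Qed.

Lemma nome_line r v : left_end <= r -> 1 <= v < PI / 2 ->
  Cmod (nome (Cexp (r, v))) <= exp (- (2 * exp r)).
Proof.
  intros Hr Hv. pose proof (sin_ge_half v Hv). generalize (exp_pos r) PI2_3_2; intros.
  rewrite Cmod_nome, Im_Cexp_pair.
  left; apply exp_increasing. assert (PI * (exp r * sin v) > exp r); [|lra].
  assert (3 * (exp r * (1 / 2)) <= PI * (exp r * sin v)); [|nra].
  apply Rmult_le_compat; try lra; nra.
Qed.

Lemma nome_le1 z : 0 <= Im z -> Cmod (nome z) <= 1.
Proof.
  intros H. rewrite Cmod_nome. apply exp_le_1. generalize PI_RGT_0; intros. nra.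
Qed.

Lemma Ccont_pair (f g : R -> R) x : continuous f x -> continuous g x -> Ccont (fun t => (f t, g t)) x.
Proof. intros; split; assumption. Qed.

Lemma Ccont_hor (v x : R) : Ccont (fun r => (r, v)) x.
Proof. apply Ccont_pair; [apply continuous_id|apply continuous_const]. Qed.
Lemma Ccont_ver (u x : R) : Ccont (fun s => (u, s)) x.
Proof. apply Ccont_pair; [apply continuous_const|apply continuous_id]. Qed.

Lemma Ccont_kern_left s : 0 <= s <= PI / 2 -> Ccont (fun s => kern (Cexp (left_end, s))) s.
Proof.
  intros Hs. apply (Ccont_kern (fun s => Cexp (left_end, s))); [apply safe_neq, safe_left, Hs|].
  apply Ccont_Cexp, Ccont_ver.
Qed.

Lemma Ccont_kern_hor r v : left_end <= r -> 1 <= v < PI / 2 -> Ccont (fun r => kern (Cexp (r, v))) r.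
Proof.
  intros Hr Hv. apply (Ccont_kern (fun r => Cexp (r, v))); [apply safe_neq, safe_line; assumption|].
  apply Ccont_Cexp, Ccont_hor.
Qed.

(** The form x^(-1-xi) kern (x + i y) dx in the variable x = e^t, extended to
    complex t. *)
Definition shifted (xi y : R) (t : C) : C :=
  (Cexp (RtoC (- xi) * t) * kern (Cexp t + (0%R, y)))%C.
Definition shifted_deriv (xi y : R) (t : C) : C :=
  (RtoC (- xi) * Cexp (RtoC (- xi) * t) * kern (Cexp t + (0%R, y)) +
   Cexp (RtoC (- xi) * t) * (Cexp t * kern_deriv (Cexp t + (0%R, y))))%C.

Lemma Cderiv_shifted xi y f x l : (1 - nome (Cexp (f x) + (0%R, y)))%C <> RtoC 0 -> Cderiv f x l ->
  Cderiv (fun t => shifted xi y (f t)) x (l * shifted_deriv xi y (f x))%C.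
Proof.
  intros N H. unfold shifted. eapply Cderiv_eq.
  - apply Cderiv_mult; [apply Cderiv_Cexp, Cderiv_scal, H|].
    apply (Cderiv_kern (fun t => Cexp (f t) + (0%R, y))%C); [exact N|].
    apply Cderiv_plus; [apply Cderiv_Cexp, H|apply Cderiv_const].
  - unfold shifted_deriv. ring.
Qed.

Lemma Ccont2_shifted_deriv xi y f u v : (1 - nome (Cexp (f u v) + (0%R, y)))%C <> RtoC 0 ->
  Ccont2 f u v -> Ccont2 (fun u v => shifted_deriv xi y (f u v)) u v.
Proof.
  intros N H. unfold shifted_deriv.
  assert (A : Ccont2 (fun u v => Cexp (RtoC (- xi) * f u v)%C) u v)
    by (apply Ccont2_Cexp, Ccont2_mult; [apply Ccont2_const|exact H]).
  assert (B : Ccont2 (fun u v => Cexp (f u v) + (0%R, y))%C u v)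
    by (apply Ccont2_plus; [apply Ccont2_Cexp, H|apply Ccont2_const]).
  apply Ccont2_plus; apply Ccont2_mult.
  - apply Ccont2_mult; [apply Ccont2_const|exact A].
  - apply (Ccont2_kern (fun u v => Cexp (f u v) + (0%R, y))%C); assumption.
  - exact A.
  - apply Ccont2_mult; [apply Ccont2_Cexp, H|].
    apply (Ccont2_kern_deriv (fun u v => Cexp (f u v) + (0%R, y))%C); assumption.
Qed.

(** [rectangle] applies because Im (e^t) > - y also slightly below the real
    axis; the margin e is chosen for that. *)
Lemma shift_exact xi y v N : 0 < y -> 1 <= v < PI / 2 ->
  Cint (fun r => shifted xi y (r, v)) left_end (right_end N) =
  (Cint (fun r => shifted xi y (r, 0%R)) left_end (right_end N) +
   Ci * (Cint (fun s => shifted xi y (right_end N, s)) 0 v - Cint (fun s => shifted xi y (left_end, s)) 0 v))%C.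
Proof.
  intros Hy Hv. generalize PI_4 PI2_3_2; intros H4 H3.
  (* For Re t < R0 + 1 and Im t > - k the imaginary part of e^t exceeds - y. *)
  set (R0 := right_end N). set (k := y * exp (- (R0 + 1))).
  assert (Hk : 0 < k) by (apply Rmult_lt_0_compat; [exact Hy|apply exp_pos]).
  set (e := Rmin (1 / 2) k).
  assert (He : 0 < e) by (apply Rmin_pos; lra).
  assert (He1 : e <= 1 / 2) by apply Rmin_l.
  assert (He2 : e <= k) by apply Rmin_r.
  assert (Hpos : forall r s, left_end - e < r < R0 + e -> 0 - e < s < v + e ->
    (1 - nome (Cexp (r, s) + (0%R, y)))%C <> RtoC 0).
  { intros r s Hr Hs. apply nome_den. rewrite im_plus, Im_Cexp_pair. simpl.
    generalize (exp_pos r); intros Hep.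
    destruct (Rle_dec 0 s) as [P|P].
    - assert (0 <= sin s) by (apply sin_ge_0; lra). nra.
    - assert (Hsin : s <= sin s).
      { assert (sin (- s) < - s) by (apply sin_lt_x; lra). rewrite sin_neg in H. lra. }
      assert (exp r < exp (R0 + 1)) by (apply exp_increasing; lra).
      assert (- y < exp r * s); [|nra].
      assert (E1 : exp (R0 + 1) * k = y).
      { unfold k. rewrite (Rmult_comm y), <- Rmult_assoc, <- exp_plus.
        replace (R0 + 1 + - (R0 + 1)) with 0 by ring. rewrite exp_0; ring. }
      assert (exp r * (- s) < exp (R0 + 1) * k); [|lra].
      apply Rmult_le_0_lt_compat; lra. }
  apply (rectangle (fun r s => shifted xi y (r, s)) (fun r s => shifted_deriv xi y (r, s))
    left_end R0 0 v e); [apply left_end_le_right_end|lra|exact He| | |].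
  - intros r s Hr Hs. eapply Cderiv_eq.
    + apply (Cderiv_shifted xi y (fun r => (r, s))); [apply Hpos; assumption|].
      apply Cderiv_pair; [apply @is_derive_id|apply @is_derive_const].
    + change (RtoC 1 * shifted_deriv xi y (r, s) = shifted_deriv xi y (r, s))%C. ring.
  - intros r s Hr Hs. eapply Cderiv_eq.
    + apply (Cderiv_shifted xi y (fun s => (r, s))); [apply Hpos; assumption|].
      apply Cderiv_pair; [apply @is_derive_const|apply @is_derive_id].
    + reflexivity.
  - intros r s Hr Hs. apply (Ccont2_shifted_deriv xi y (fun s r => (r, s))); [apply Hpos; assumption|].
    apply Ccont2_pair; [apply continuity_2d_pt_id2|apply continuity_2d_pt_id1].
Qed.

Lemma Cmod_Cexp_xi xi r s : Cmod (Cexp (RtoC (- xi) * (r, s))%C) = exp (- xi * r).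
Proof. rewrite Cmod_Cexp. f_equal. unfold Re, RtoC; simpl. ring. Qed.

Lemma Ccont_xi xi f x : Ccont f x -> Ccont (fun t => Cexp (RtoC (- xi) * f t)%C) x.
Proof. intros; apply Ccont_Cexp, Ccont_mult; [apply Ccont_const|assumption]. Qed.

Lemma Ccont_shifted xi y f x : (1 - nome (Cexp (f x) + (0%R, y)))%C <> RtoC 0 -> Ccont f x ->
  Ccont (fun t => shifted xi y (f t)) x.
Proof.
  intros N H. unfold shifted. apply Ccont_mult; [apply Ccont_xi, H|].
  apply (Ccont_kern (fun t => Cexp (f t) + (0%R, y))%C); [exact N|].
  apply Ccont_plus; [apply Ccont_Cexp, H|apply Ccont_const].
Qed.

Lemma safe_shift_neq z y : safe z -> 0 <= y -> (1 - nome (z + (0%R, y)))%C <> RtoC 0.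
Proof.
  intros H Hy. pose proof (safe_den z y H Hy). apply Cmod_gt_0; lra.
Qed.

(** Away from the real axis the shift y can be dropped at a cost proportional
    to y. *)
Lemma left_close xi y v : 0 < xi -> 0 < y -> 1 <= v < PI / 2 ->
  Cmod (Cint (fun s => shifted xi y (left_end, s)) 0 v -
        Cint (fun s => Cexp (RtoC (- xi) * (left_end, s)) * kern (Cexp (left_end, s)))%C 0 v)%C
  <= 64 * y.
Proof.
  intros Hxi Hy Hv. generalize PI_4 PI2_3_2 (proj1 left_end_bounds); intros H4 H3 Hl.
  assert (A : ex_Cint (fun s => shifted xi y (left_end, s)) 0 v).
  { apply ex_Cint_cont; [lra|]. intros s Hs.
    apply (Ccont_shifted xi y (fun s => (left_end, s))); [|apply Ccont_ver].
    apply safe_shift_neq; [apply safe_left|]; lra. }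
  assert (B : ex_Cint (fun s => Cexp (RtoC (- xi) * (left_end, s)) * kern (Cexp (left_end, s)))%C 0 v).
  { apply ex_Cint_cont; [lra|]. intros s Hs.
    apply Ccont_mult; [apply Ccont_xi, Ccont_ver|apply Ccont_kern_left; lra]. }
  rewrite <- Cint_minus by assumption.
  apply Rle_trans with (32 * y * (v - 0)); [|nra].
  apply Cint_bound_const; [lra|apply ex_Cint_minus; assumption|].
  intros s Hs. unfold shifted. rewrite <- Cmult_minus_distr_l, Cmod_mult, Cmod_Cexp_xi.
  assert (S : safe (Cexp (left_end, s))) by (apply safe_left; lra).
  pose proof (kern_shift _ y S ltac:(lra)) as K.
  pose proof (nome_le1 _ (proj1 S)).
  assert (exp (- xi * left_end) <= 1) by (apply exp_le_1; nra).
  generalize (exp_pos (- xi * left_end)) (Cmod_ge_0 (kern (Cexp (left_end, s) + (0%R, y)) - kern (Cexp (left_end, s)))%C).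
  intros. assert (8 * PI * y * Cmod (nome (Cexp (left_end, s))) <= 32 * y).
  { apply Rle_trans with (8 * PI * y * 1); [apply Rmult_le_compat_l; nra|nra]. }
  nra.
Qed.

Lemma RInt_exp_neg xi a b : a <= b -> xi <> 0 ->
  RInt (fun t => exp (- xi * t)) a b = (exp (- xi * a) - exp (- xi * b)) / xi.
Proof.
  intros Hab Hxi. apply is_RInt_unique.
  replace ((exp (- xi * a) - exp (- xi * b)) / xi) with
    (minus (- exp (- xi * b) / xi) (- exp (- xi * a) / xi))
    by (unfold minus, plus, opp; simpl; field; exact Hxi).
  apply (is_RInt_derive (V := R_CompleteNormedModule) (fun t => - exp (- xi * t) / xi)).
  - intros x _. auto_derive; [exact I|]. field. exact Hxi.
  - intros x _. apply ex_derive_cont. auto_derive; exact I.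
Qed.

Lemma ex_RInt_exp_neg xi a b : a <= b -> ex_RInt (fun t => exp (- xi * t)) a b.
Proof.
  intros Hab; apply ex_RInt_cont; [exact Hab|]. intros; apply ex_derive_cont.
  auto_derive; exact I.
Qed.

Lemma line_close xi y v N : 0 < xi -> 0 < y -> 1 <= v < PI / 2 ->
  Cmod (Cint (fun r => shifted xi y (r, v)) left_end (right_end N) -
        Cint (fun r => Cexp (RtoC (- xi) * (r, v)) * kern (Cexp (r, v)))%C left_end (right_end N))%C
  <= 32 * y.
Proof.
  intros Hxi Hy Hv. generalize PI_4 PI2_3_2 (proj1 left_end_bounds) (left_end_le_right_end N); intros H4 H3 Hl HR.
  assert (A : ex_Cint (fun r => shifted xi y (r, v)) left_end (right_end N)).
  { apply ex_Cint_cont; [lra|]. intros s Hs.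
    apply (Ccont_shifted xi y (fun r => (r, v))); [|apply Ccont_hor].
    apply safe_shift_neq; [apply safe_line|]; lra. }
  assert (B : ex_Cint (fun r => Cexp (RtoC (- xi) * (r, v)) * kern (Cexp (r, v)))%C left_end (right_end N)).
  { apply ex_Cint_cont; [lra|]. intros s Hs.
    apply Ccont_mult; [apply Ccont_xi, Ccont_hor|apply Ccont_kern_hor; lra]. }
  rewrite <- Cint_minus by assumption.
  apply Rle_trans with (RInt (fun r => 32 * y * exp (- (1) * r)) left_end (right_end N)).
  - apply Cint_bound; [exact HR|apply ex_Cint_minus; assumption|apply ex_RInt_Rscal, ex_RInt_exp_neg, HR|].
    intros r Hr. unfold shifted. rewrite <- Cmult_minus_distr_l, Cmod_mult, Cmod_Cexp_xi.
    assert (S : safe (Cexp (r, v))) by (apply safe_line; lra).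
    pose proof (kern_shift _ y S ltac:(lra)) as K.
    pose proof (nome_line r v ltac:(lra) Hv) as Q.
    assert (Q2 : exp (- (2 * exp r)) <= exp (- (1) * r)).
    { apply exp_le. generalize (exp_ineq1_le r). lra. }
    assert (exp (- xi * r) <= 1) by (apply exp_le_1; nra).
    generalize (exp_pos (- xi * r)) (Cmod_ge_0 (nome (Cexp (r, v)))) (Cmod_ge_0 (kern (Cexp (r, v) + (0%R, y)) - kern (Cexp (r, v)))%C).
    intros.
    assert (8 * PI * y * Cmod (nome (Cexp (r, v))) <= 32 * y * exp (- (1) * r)).
    { apply Rmult_le_compat; try nra. }
    nra.
  - rewrite RInt_Rscal, RInt_exp_neg by (try apply ex_RInt_exp_neg; lra).
    assert (exp (- (1) * left_end) <= 1) by (apply exp_le_1; lra).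
    generalize (exp_pos (- (1) * right_end N)). intros.
    replace (32 * y) with (32 * y * 1) at 2 by ring.
    apply Rmult_le_compat_l; lra.
Qed.

(** For fixed y the decay of e^(- xi t) makes this side disappear as N grows. *)
Lemma right_small xi y v N : 0 < xi -> 0 < y -> 1 <= v < PI / 2 ->
  Cmod (Cint (fun s => shifted xi y (right_end N, s)) 0 v) <= exp (- xi * right_end N) / y.
Proof.
  intros Hxi Hy Hv. generalize PI_4 PI2_3_2; intros H4 H3.
  assert (Hpos : forall s, 0 <= s <= v -> 0 < y <= Im (Cexp (right_end N, s) + (0%R, y))%C).
  { intros s Hs. rewrite im_plus, Im_Cexp_pair. simpl.
    assert (0 <= sin s) by (apply sin_ge_0; lra).
    generalize (exp_pos (right_end N)); intros. split; [exact Hy|nra]. }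
  apply Rle_trans with (exp (- xi * right_end N) * / (2 * PI * y) * (v - 0)).
  - apply Cint_bound_const; [lra| |].
    + apply ex_Cint_cont; [lra|]. intros s Hs.
      apply (Ccont_shifted xi y (fun s => (right_end N, s))); [|apply Ccont_ver].
      apply nome_den. generalize (Hpos s Hs); lra.
    + intros s Hs. unfold shifted. rewrite Cmod_mult, Cmod_Cexp_xi.
      apply Rmult_le_compat_l; [left; apply exp_pos|]. apply kern_bound. apply Hpos; lra.
  - unfold Rdiv. rewrite Rmult_assoc. apply Rmult_le_compat_l; [left; apply exp_pos|].
    apply Rmult_le_reg_r with (2 * PI * y); [nra|].
    replace (/ y * (2 * PI * y)) with (2 * PI) by (field; lra).
    replace (/ (2 * PI * y) * (v - 0) * (2 * PI * y)) with v by (field; split; nra). lra.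
Qed.

(** Before the path is moved, the two parts of the kernel 1 + 2 Re kern give
    an elementary integral and the integral of [shifted] along the real axis. *)
Lemma real_side xi y N : 0 < xi -> 0 < y ->
  RInt (fun x => dirichlet xi x * poisson y x) (3 / 2) (INR N + 3 / 2) =
  (exp (- xi * left_end) - exp (- xi * right_end N)) / xi +
  2 * Re (Cint (fun r => shifted xi y (r, 0%R)) left_end (right_end N)).
Proof.
  intros Hxi Hy. pose proof (left_end_le_right_end N) as HR.
  rewrite <- exp_left_end at 1. rewrite <- exp_right_end.
  rewrite <- (RInt_comp (V := R_CompleteNormedModule) _ exp exp).
  2:{ intros x _. apply (continuous_mult (K := R_AbsRing)); [apply continuous_dirichlet, exp_pos|apply continuous_poisson, Hy]. }
  2:{ intros x _. split; [apply is_derive_exp|apply continuous_exp]. }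
  assert (X : ex_Cint (fun r => shifted xi y (r, 0%R)) left_end (right_end N)).
  { apply ex_Cint_cont; [exact HR|]. intros r Hr.
    apply (Ccont_shifted xi y (fun r => (r, 0%R))); [|apply Ccont_hor].
    apply nome_den. rewrite im_plus, Im_Cexp_pair, sin_0. simpl. lra. }
  destruct X as [X _].
  rewrite <- RInt_exp_neg by lra. simpl Re.
  rewrite <- RInt_Rscal by exact X.
  rewrite <- RInt_Rplus; [|apply ex_RInt_exp_neg, HR|apply ex_RInt_Rscal, X].
  apply RInt_ext. intros t _.
  change (exp t * (dirichlet xi (exp t) * poisson y (exp t)) =
    exp (- xi * t) + 2 * Re (shifted xi y (t, 0%R))).
  unfold dirichlet, poisson, shifted. rewrite ln_exp.
  replace (Cexp (t, 0%R) + (0%R, y))%C with ((exp t, y) : C).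
  2:{ unfold Cexp, Re, Im; simpl. rewrite cos_0, sin_0. apply C_ext; simpl; ring. }
  replace (RtoC (- xi) * (t, 0%R))%C with (RtoC (- xi * t)) by (apply C_ext; simpl; ring).
  rewrite Cexp_RtoC, re_mult, re_RtoC, im_RtoC.
  replace (- (1 + xi) * t) with (- t + - xi * t) by ring.
  rewrite exp_plus.
  replace (exp t * (exp (- t) * exp (- xi * t) * (1 + 2 * Re (kern (exp t, y))))) with
   ((exp t * exp (- t)) * (exp (- xi * t) * (1 + 2 * Re (kern (exp t, y))))) by ring.
  rewrite <- exp_plus, Rplus_opp_r, exp_0. eq_in_R. ring.
Qed.

Lemma poisson_error_small y eta : 0 < eta -> 0 < y <= 1 / 16 -> y <= eta ^ 2 / 6 -> poisson_error y eta <= 2 * eta.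
Proof.
  intros He Hy Hy2. unfold poisson_error. generalize PI_4 PI2_3_2; intros H4 H3.
  set (x := 2 * PI * y). assert (Hx : 0 < x <= 1 / 2) by (unfold x; split; nra).
  assert (Hx8 : x <= 8 * y) by (unfold x; nra).
  assert (A : 1 - x <= exp (- x)) by (generalize (exp_ineq1_le (- x)); lra).
  assert (B : exp x <= 1 + 2 * x).
  { assert (E : exp x * exp (- x) = 1) by (rewrite <- exp_plus, Rplus_opp_r; apply exp_0).
    generalize (exp_pos x); intros. nra. }
  assert (S : (exp x - exp (- x)) <= 24 * y) by lra.
  assert ((exp x - exp (- x)) / (4 * eta) <= eta); [|lra].
  apply Rmult_le_reg_r with (4 * eta); [lra|].
  unfold Rdiv at 1. rewrite Rmult_assoc, Rinv_l, Rmult_1_r by lra. nra.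
Qed.

Lemma exp_right_end_small xi d : 0 < xi -> 0 < d ->
  exists N0, forall N, (N0 <= N)%nat -> exp (- xi * right_end N) < d.
Proof.
  intros Hxi Hd.
  destruct (nfloor_ex (exp (- ln d / xi)) ltac:(left; apply exp_pos)) as [N0 HN0].
  exists (S N0). intros N HN. rewrite <- (exp_ln d) by exact Hd.
  apply exp_increasing.
  assert (- ln d / xi < right_end N).
  { rewrite <- (ln_exp (- ln d / xi)). unfold right_end. apply ln_increasing; [apply exp_pos|].
    apply le_INR in HN. rewrite S_INR in HN. lra. }
  apply Rmult_lt_compat_r with (r := xi) in H; [|exact Hxi].
  unfold Rdiv in H. rewrite Rmult_assoc, Rinv_l in H by lra. lra.
Qed.

(** What the elementary integral of x^(-1-xi) and the path integral leave of
    the partial sums of zeta (1 + xi). *)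
Definition zeta_defect (xi v : R) (N : nat) : R :=
  sum_n (fun k => dirichlet xi (INR (S k))) N - 1 -
  (exp (- xi * left_end) - exp (- xi * right_end N)) / xi -
  2 * Re (path_integral (fun t => Cexp (RtoC (- xi) * t)%C) v N).

(** The order of the choices is eta, then y, then N: [poisson_error] asks for
    y small compared with eta^2, and [right_small] for N large depending on y. *)
Lemma zeta_path_integral xi v : 0 < xi <= 1 -> 1 <= v < PI / 2 ->
  is_lim_seq (zeta_defect xi v) 0.
Proof.
  intros Hxi Hv. apply is_lim_seq_spec. intros [e He]. simpl.
  set (eta := e / 16). assert (Heta : 0 < eta) by (unfold eta; lra).
  set (y := Rmin (1 / 16) (Rmin (eta ^ 2 / 6) (eta / 192))).
  assert (Hy0 : 0 < y).
  { apply Rmin_pos; [lra|]. apply Rmin_pos; [|lra]. assert (0 < eta ^ 2) by (apply pow_lt; lra). lra. }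
  assert (Hy1 : y <= 1 / 16) by apply Rmin_l.
  assert (Hy2 : y <= eta ^ 2 / 6) by (eapply Rle_trans; [apply Rmin_r|apply Rmin_l]).
  assert (Hy3 : y <= eta / 192) by (eapply Rle_trans; [apply Rmin_r|apply Rmin_r]).
  destruct (exp_right_end_small xi (eta * y) ltac:(lra) ltac:(nra)) as [N0 HN0].
  exists N0. intros N HN. specialize (HN0 N HN). rewrite Rminus_0_r.
  pose proof (poisson_sum xi y eta N Hxi Hy0 Heta) as P.
  rewrite real_side in P by lra.
  pose proof (shift_exact xi y v N Hy0 Hv) as E.
  pose proof (left_close xi y v ltac:(lra) Hy0 Hv) as L.
  pose proof (line_close xi y v N ltac:(lra) Hy0 Hv) as H.
  pose proof (right_small xi y v N ltac:(lra) Hy0 Hv) as Q.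
  assert (Q2 : exp (- xi * right_end N) / y < eta).
  { apply Rmult_lt_reg_r with y; [exact Hy0|]. unfold Rdiv. rewrite Rmult_assoc, Rinv_l; lra. }
  unfold zeta_defect, path_integral.
  set (A0 := Cint (fun r => shifted xi y (r, 0%R)) left_end (right_end N)) in *.
  set (Av := Cint (fun r => shifted xi y (r, v)) left_end (right_end N)) in *.
  set (Br := Cint (fun s => shifted xi y (right_end N, s)) 0 v) in *.
  set (Bl := Cint (fun s => shifted xi y (left_end, s)) 0 v) in *.
  set (L0 := Cint (fun s => Cexp (RtoC (- xi) * (left_end, s)) * kern (Cexp (left_end, s)))%C 0 v) in *.
  set (H0 := Cint (fun r => Cexp (RtoC (- xi) * (r, v)) * kern (Cexp (r, v)))%C left_end (right_end N)) in *.
  set (sm := sum_n (fun k => dirichlet xi (INR (S k))) N) in *.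
  assert (W : poisson_error y eta <= 2 * eta) by (apply poisson_error_small; lra).
  assert (W0 : 0 <= poisson_error y eta).
  { unfold poisson_error. assert (exp (- (2 * PI * y)) <= exp (2 * PI * y)).
    { apply exp_le. generalize PI_RGT_0; intros; nra. }
    assert (0 <= (exp (2 * PI * y) - exp (- (2 * PI * y))) / (4 * eta)).
    { apply Rmult_le_pos; [lra|]. left; apply Rinv_0_lt_compat; lra. } lra. }
  assert (P2 : Rabs ((exp (- xi * left_end) - exp (- xi * right_end N)) / xi + 2 * Re A0 - (sm - 1)) <= 4 * eta).
  { eapply Rle_trans; [exact P|]. generalize (pos_INR N); intros.
    assert (0 < / (INR N + 1)) by (apply Rinv_0_lt_compat; lra).
    assert (/ (INR N + 1) <= 1) by (apply inv_le_1; lra).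
    nra. }
  assert (D : Rabs (Re A0 - Re (Ci * L0 + H0)%C) <= 96 * y + exp (- xi * right_end N) / y).
  { rewrite <- re_minus. eapply Rle_trans; [apply re_le_Cmod|].
    replace (A0 - (Ci * L0 + H0))%C with ((Av - H0) + Ci * (Bl - L0) - Ci * Br)%C
      by (rewrite E; ring).
    eapply Rle_trans; [apply Cmod_minus_le|].
    eapply Rle_trans; [apply Rplus_le_compat_r, Cmod_triangle|].
    rewrite !Cmod_mult, Cmod_Ci. lra. }
  apply Rabs_le_between in P2. apply Rabs_le_between in D.
  apply Rabs_lt_between. unfold eta in *. lra.
Qed.

(** * Finite sums and the Taylor polynomials of the exponential *)

Fixpoint Csum (f : nat -> C) (n : nat) : C :=
  match n with O => RtoC 0 | S m => (Csum f m + f m)%C end.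

Lemma Csum_ext f g n : (forall k, (k < n)%nat -> f k = g k) -> Csum f n = Csum g n.
Proof.
  induction n as [|n IH]; intros H; [reflexivity|]. simpl.
  rewrite IH, H by (intros; try apply H; lia). reflexivity.
Qed.

Lemma Csum_plus f g n : Csum (fun k => f k + g k)%C n = (Csum f n + Csum g n)%C.
Proof. induction n as [|n IH]; simpl; [ring|]. rewrite IH. ring. Qed.

Lemma Csum_minus f g n : Csum (fun k => f k - g k)%C n = (Csum f n - Csum g n)%C.
Proof. induction n as [|n IH]; simpl; [ring|]. rewrite IH. ring. Qed.

Lemma Csum_scal c f n : Csum (fun k => c * f k)%C n = (c * Csum f n)%C.
Proof. induction n as [|n IH]; simpl; [ring|]. rewrite IH. ring. Qed.

Lemma Csum_shift f n : Csum f (S n) = (f 0%nat + Csum (fun k => f (S k)) n)%C.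
Proof.
  induction n as [|n IH]; [simpl; ring|].
  change (Csum f (S (S n))) with (Csum f (S n) + f (S n))%C. rewrite IH. simpl. ring.
Qed.

Lemma Csum_split f n m : Csum f (n + m) = (Csum f n + Csum (fun k => f (n + k)%nat) m)%C.
Proof.
  induction m as [|m IH]; [rewrite Nat.add_0_r; simpl; ring|].
  rewrite Nat.add_succ_r. simpl. rewrite IH. ring.
Qed.

Lemma Csum_zero f n : (forall k, (k < n)%nat -> f k = RtoC 0) -> Csum f n = RtoC 0.
Proof.
  induction n as [|n IH]; intros H; [reflexivity|].
  simpl. rewrite IH, H by (intros; try apply H; lia). ring.
Qed.

Lemma Csum_bound f n K : (forall k, (k < n)%nat -> Cmod (f k) <= K) ->
  Cmod (Csum f n) <= INR n * K.
Proof.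
  induction n as [|n IH]; intros H; simpl Csum.
  - rewrite Cmod_0. simpl. lra.
  - eapply Rle_trans; [apply Cmod_triangle|].
    rewrite S_INR. specialize (IH ltac:(intros; apply H; lia)).
    specialize (H n ltac:(lia)). lra.
Qed.

Lemma sum_n_Csum (a : nat -> C) N : sum_n (G := C_AbelianGroup) a N = Csum a (S N).
Proof.
  induction N as [|N IH].
  - rewrite sum_O. simpl. ring.
  - rewrite sum_Sn, IH. reflexivity.
Qed.

(** The terms of the series of e^(-X). *)
Definition expterm (X : C) (k : nat) : C := ((- X) ^ k / RtoC (INR (fact k)))%C.

Lemma fact_neq0_C k : RtoC (INR (fact k)) <> RtoC 0.
Proof. apply RtoC_neq0, INR_fact_neq_0. Qed.

Lemma is_derive_lin c x : is_derive (fun s : R => c * s) x c.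
Proof. auto_derive; [exact I|ring]. Qed.

(** Induction on the order: along the segment from 0 to X the remainder of
    order M + 1 has derivative - X times the remainder of order M. *)
Lemma exp_taylor_aux (X : C) M m : 1 <= m -> exp (- Re X) <= m ->
  forall s, 0 <= s <= 1 ->
  Cmod (Cexp (- (RtoC s * X)) - Csum (expterm (RtoC s * X)) M)%C <= Cmod X ^ M * m.
Proof.
  intros Hm HX. induction M as [|M IH]; intros s Hs.
  - simpl. replace (_ - 0)%C with (Cexp (- (RtoC s * X)))%C by ring.
    rewrite Cmod_Cexp.
    replace (Re (- (RtoC s * X))%C) with (s * - Re X) by (unfold Re; simpl; ring).
    rewrite Rmult_1_l. destruct (Rle_dec 0 (- Re X)).
    + eapply Rle_trans; [|exact HX]. apply exp_le. nra.
    + apply Rle_trans with 1; [|exact Hm]. apply exp_le_1. nra.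
  - set (F := fun s => (Cexp (- (RtoC s * X)) - Csum (expterm (RtoC s * X)) (S M))%C).
    assert (D : forall x, Cderiv (fun s => Csum (expterm (RtoC s * X)) (S M)) x
        (- X * Csum (expterm (RtoC x * X)) M)%C).
    { clear. intros x. induction M as [|M IH].
      - simpl. apply (Cderiv_ext (fun _ => RtoC 0 + RtoC 1 / RtoC 1)%C);
          [intros t; unfold expterm; simpl; reflexivity|].
        eapply Cderiv_eq; [apply Cderiv_const|]. ring.
      - apply (Cderiv_ext (fun s => Csum (expterm (RtoC s * X)) (S M) +
           RtoC (/ INR (fact (S M))) * (- X * RtoC s) ^ (S M))%C).
        { intros t. change (Csum (expterm (RtoC t * X)) (S (S M))) with
            (Csum (expterm (RtoC t * X)) (S M) + expterm (RtoC t * X) (S M))%C.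
          f_equal. unfold expterm, Cdiv.
          rewrite RtoC_inv by apply INR_fact_neq_0.
          replace (- (RtoC t * X))%C with (- X * RtoC t)%C by ring.
          apply Cmult_comm. }
        eapply Cderiv_eq.
        + apply Cderiv_plus; [exact IH|]. apply Cderiv_scal. apply Cderiv_pow. apply Cderiv_scal, Cderiv_id.
        + change (Csum (expterm (RtoC x * X)) (S M)) with
            (Csum (expterm (RtoC x * X)) M + expterm (RtoC x * X) M)%C.
          replace (S M - 1)%nat with M by lia.
          unfold expterm. rewrite fact_simpl, mult_INR.
          rewrite RtoC_inv, RtoC_mult by (apply Rmult_integral_contrapositive_currified; [apply not_0_INR; lia|apply INR_fact_neq_0]).
          assert (RtoC (INR (S M)) <> RtoC 0) by (apply RtoC_neq0, not_0_INR; lia).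
          replace (- X * RtoC x)%C with (- (RtoC x * X))%C by ring.
          field. split; [apply fact_neq0_C|assumption]. }
    assert (F0 : F 0 = RtoC 0).
    { unfold F. rewrite Csum_shift.
      replace (- (RtoC 0 * X))%C with (RtoC 0) by ring. rewrite Cexp_0.
      rewrite Csum_zero.
      - unfold expterm; simpl. field.
      - intros k _. unfold expterm. simpl.
        replace (- (RtoC 0 * X))%C with (RtoC 0) by ring. unfold Cdiv; ring. }
    replace (Cexp (- (RtoC s * X)) - Csum (expterm (RtoC s * X)) (S M))%C with (F s - F 0)%C
      by (rewrite F0; unfold F; ring).
    apply Rle_trans with (Cmod X ^ S M * m * s - Cmod X ^ S M * m * 0).
    + apply (mean_value_inequality F (fun s => - X * (Cexp (- (RtoC s * X)) - Csum (expterm (RtoC s * X)) M))%C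
         (fun s => Cmod X ^ S M * m * s) (fun _ => Cmod X ^ S M * m)); [lra| | |].
      * intros x Hx. unfold F. eapply Cderiv_eq.
        -- apply Cderiv_minus; [|apply D].
           apply (Cderiv_Cexp (fun s => - (RtoC s * X))%C). apply Cderiv_opp.
           apply Cderiv_mult; [apply Cderiv_id|apply Cderiv_const].
        -- cbv beta. ring.
      * intros x Hx. apply is_derive_lin.
      * intros x Hx. rewrite Cmod_mult, Cmod_opp. simpl. rewrite Rmult_assoc.
        apply Rmult_le_compat_l; [apply Cmod_ge_0|]. apply IH. lra.
    + assert (0 <= Cmod X ^ S M * m) by (apply Rmult_le_pos; [apply pow_le, Cmod_ge_0|lra]).
      nra.
Qed.

Lemma exp_taylor (X : C) M m : 1 <= m -> exp (- Re X) <= m ->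
  Cmod (Cexp (- X) - Csum (expterm X) M)%C <= Cmod X ^ M * m.
Proof.
  intros H1 H2. pose proof (exp_taylor_aux X M m H1 H2 1 ltac:(lra)) as K.
  replace (RtoC 1 * X)%C with X in K by ring. exact K.
Qed.

(** * Uniqueness of asymptotic expansions *)

Lemma finite_bound (f : nat -> R) n : exists B, 0 <= B /\ forall k, (k < n)%nat -> f k <= B.
Proof.
  induction n as [|n (B & HB & H)].
  - exists 0. split; [lra|]. intros; lia.
  - exists (Rmax B (f n)). split; [eapply Rle_trans; [exact HB|apply Rmax_l]|].
    intros k Hk. destruct (Nat.eq_dec k n) as [->|]; [apply Rmax_r|].
    eapply Rle_trans; [apply H; lia|apply Rmax_l].
Qed.

Lemma is_series_Csum (a : nat -> C) (l : C) :
  is_series (K := C_AbsRing) (V := C_NormedModule) a l ->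
  forall e, 0 < e -> exists N0, forall N, (N0 <= N)%nat -> Cmod (Csum a N - l)%C < e.
Proof.
  intros H e He.
  unfold is_series in H.
  destruct (proj1 (filterlim_locally_ball_norm (K := C_AbsRing) (U := C_NormedModule) _ l) H
     (mkposreal e He)) as [N0 HN0].
  exists (S N0). intros N HN. specialize (HN0 (pred N) ltac:(lia)).
  rewrite (sum_n_Csum a) in HN0. replace (S (pred N)) with N in HN0 by lia.
  exact HN0.
Qed.

Lemma geom_tail (f : nat -> C) B q P : 0 <= q <= 1 / 2 ->
  (forall k, Cmod (f k) <= B * q ^ k) -> Cmod (Csum f P) <= 2 * B.
Proof.
  intros Hq H.
  assert (HB : 0 <= B) by (generalize (H 0%nat) (Cmod_ge_0 (f 0%nat)); simpl; lra).
  assert (K : Cmod (Csum f P) <= 2 * B * (1 - q ^ P)).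
  { induction P as [|P IH]; [simpl; rewrite Cmod_0; lra|].
    change (Csum f (S P)) with (Csum f P + f P)%C.
    eapply Rle_trans; [apply Cmod_triangle|].
    specialize (H P). simpl. assert (0 <= q ^ P) by (apply pow_le; lra).
    assert (0 <= B * q ^ P) by (apply Rmult_le_pos; assumption).
    assert (B * q ^ P * (2 * q) <= B * q ^ P * 1) by (apply Rmult_le_compat_l; lra). lra. }
  assert (0 <= q ^ P) by (apply pow_le; lra). nra.
Qed.

(** The terms are bounded at x0, so at x <= x0 / 2 they decrease
    geometrically. *)
Lemma series_tail (a : nat -> C) (s : R -> C) x0 M : 0 < x0 ->
  (forall x, 0 < x <= x0 ->
     is_series (K := C_AbsRing) (V := C_NormedModule) (fun k => a k * RtoC x ^ k)%C (s x)) ->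
  exists K, forall x, 0 < x <= x0 / 2 ->
    Cmod (s x - Csum (fun k => a k * RtoC x ^ k) M)%C <= K * x ^ M.
Proof.
  intros Hx0 H.
  assert (HB : exists B, 0 <= B /\ forall k, Cmod (a k) * x0 ^ k <= B).
  { destruct (is_series_Csum _ _ (H x0 ltac:(lra)) 1 ltac:(lra)) as [N0 HN0].
    destruct (finite_bound (fun k => Cmod (a k) * x0 ^ k) N0) as (B & HB & HBk).
    exists (B + 2). split; [lra|]. intros k.
    destruct (Compare_dec.le_lt_dec N0 k) as [L|L].
    - pose proof (HN0 k L) as A1. pose proof (HN0 (S k) ltac:(lia)) as A2.
      assert (E : (Cmod (a k) * x0 ^ k) = Cmod ((Csum (fun k => a k * RtoC x0 ^ k)%C (S k) - s x0) -
        (Csum (fun k => a k * RtoC x0 ^ k)%C k - s x0))%C).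
      { simpl Csum. rewrite <- (Rabs_right (x0 ^ k)) by (apply Rle_ge, pow_le; lra).
        rewrite <- Cmod_R, RtoC_pow, <- Cmod_mult. f_equal. ring. }
      rewrite E. eapply Rle_trans; [apply Cmod_minus_le|]. lra.
    - specialize (HBk k L). lra. }
  destruct HB as (B & HB & HBk).
  assert (Hp : 0 < x0 ^ M) by (apply pow_lt; lra).
  exists (2 * (B / x0 ^ M)). intros x Hx.
  set (q := x / x0).
  assert (Hq : 0 <= q <= 1 / 2).
  { unfold q, Rdiv. split; [apply Rmult_le_pos; [lra|left; apply Rinv_0_lt_compat; lra]|].
    apply Rmult_le_reg_r with x0; [exact Hx0|]. rewrite Rmult_assoc, Rinv_l; lra. }
  apply Rle_plus_epsilon. intros e He.
  destruct (is_series_Csum _ _ (H x ltac:(lra)) e He) as [N0 HN0].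
  specialize (HN0 (M + N0)%nat ltac:(lia)). rewrite Csum_split in HN0.
  set (S1 := Csum (fun k => a k * RtoC x ^ k)%C M) in *.
  set (S2 := Csum _ N0) in HN0.
  replace (s x - S1)%C with (S2 - (S1 + S2 - s x))%C by ring.
  eapply Rle_trans; [apply Cmod_minus_le|]. apply Rplus_le_compat; [|lra].
  replace (2 * (B / x0 ^ M) * x ^ M) with (2 * (B * q ^ M)).
  2:{ unfold q, Rdiv. rewrite Rpow_mult_distr, pow_inv. ring. }
  apply (geom_tail _ _ q); [exact Hq|]. intros k.
  rewrite Cmod_mult, Cmod_pow, Cmod_R, Rabs_right by lra.
  replace x with (q * x0) by (unfold q; field; lra).
  rewrite Rpow_mult_distr, pow_add.
  specialize (HBk (M + k)%nat).
  assert (0 <= q ^ M * q ^ k) by (apply Rmult_le_pos; apply pow_le; lra).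
  rewrite pow_add in HBk |- *.
  replace (Cmod (a (M + k)%nat) * (q ^ M * q ^ k * (x0 ^ M * x0 ^ k))) with
    ((Cmod (a (M + k)%nat) * (x0 ^ M * x0 ^ k)) * (q ^ M * q ^ k)) by ring.
  replace (B * q ^ M * q ^ k) with (B * (q ^ M * q ^ k)) by ring.
  apply Rmult_le_compat_r; assumption.
Qed.

(** Letting x tend to 0 isolates the coefficient of order 0; the others follow
    after division by x. *)
Lemma asym_unique M : forall (d : nat -> C) K x0, 0 < x0 ->
  (forall x, 0 < x <= x0 -> Cmod (Csum (fun k => d k * RtoC x ^ k)%C M) <= K * x ^ M) ->
  forall k, (k < M)%nat -> d k = RtoC 0.
Proof.
  induction M as [|M IH]; intros d K x0 Hx0 H k Hk; [lia|].
  assert (E : forall x, Csum (fun k => d k * RtoC x ^ k)%C (S M) =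
     (d 0%nat + RtoC x * Csum (fun k => d (S k) * RtoC x ^ k) M)%C).
  { intros x. rewrite Csum_shift, <- Csum_scal. f_equal; [simpl; ring|].
    apply Csum_ext. intros j _. simpl. ring. }
  assert (D0 : d 0%nat = RtoC 0).
  { destruct (finite_bound (fun k => Cmod (d (S k))) M) as (Q & HQ & HQk).
    apply Cmod_eq_0.
    destruct (Req_dec (Cmod (d 0%nat)) 0) as [Z|Z]; [exact Z|exfalso].
    assert (Hd : 0 < Cmod (d 0%nat)) by (generalize (Cmod_ge_0 (d 0%nat)); lra).
    (* All admissible x would satisfy |d 0| <= x L; this x violates it. *)
    set (L := Rabs K + INR M * Q + 1).
    assert (HL : 0 < L).
    { unfold L. generalize (Rabs_pos K) (pos_INR M); intros; nra. }
    set (x := Rmin (Rmin 1 x0) (Cmod (d 0%nat) / (2 * L))).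
    assert (Hx1 : 0 < x).
    { apply Rmin_pos; [apply Rmin_pos; lra|]. apply Rmult_lt_0_compat; [exact Hd|].
      apply Rinv_0_lt_compat; lra. }
    assert (Hx2 : x <= 1) by (eapply Rle_trans; [apply Rmin_l|apply Rmin_l]).
    assert (Hx3 : x <= x0) by (eapply Rle_trans; [apply Rmin_l|apply Rmin_r]).
    assert (Hx4 : x <= Cmod (d 0%nat) / (2 * L)) by apply Rmin_r.
    specialize (H x ltac:(lra)). rewrite E in H.
    assert (B : Cmod (Csum (fun k => d (S k) * RtoC x ^ k)%C M) <= INR M * Q).
    { apply Csum_bound. intros j Hj. rewrite Cmod_mult, Cmod_pow, Cmod_R, Rabs_right by lra.
      assert (x ^ j <= 1) by (apply pow_le_1; lra).
      assert (0 <= x ^ j) by (apply pow_le; lra).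
      specialize (HQk j Hj). generalize (Cmod_ge_0 (d (S j))); intros; nra. }
    assert (A : Cmod (d 0%nat) <= x * L).
    { set (T := Csum (fun k => d (S k) * RtoC x ^ k)%C M) in *.
      replace (d 0%nat) with ((d 0%nat + RtoC x * T) - RtoC x * T)%C by ring.
      eapply Rle_trans; [apply Cmod_minus_le|].
      rewrite (Cmod_mult (RtoC x) T), Cmod_R, Rabs_right by lra.
      assert (x ^ S M <= x).
      { simpl. assert (x ^ M <= 1) by (apply pow_le_1; lra). nra. }
      assert (0 <= x ^ S M) by (apply pow_le; lra).
      assert (K * x ^ S M <= Rabs K * x).
      { generalize (Rle_abs K) (Rabs_pos K); intros. nra. }
      unfold L. nra. }
    assert (x * L <= Cmod (d 0%nat) / 2).
    { replace (Cmod (d 0%nat) / 2) with (Cmod (d 0%nat) / (2 * L) * L) by (field; lra).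
      apply Rmult_le_compat_r; lra. }
    lra. }
  destruct k as [|k]; [exact D0|].
  apply (IH (fun k => d (S k)) K x0 Hx0); [|lia].
  intros x Hx. specialize (H x Hx). rewrite E, D0, Cplus_0_l, Cmod_mult, Cmod_R, Rabs_right in H by lra.
  simpl in H. apply Rmult_le_reg_l with x; [lra|]. lra.
Qed.

(** Coefficients known from Taylor estimates on a real interval are hereby
    identified with those of a given convergent expansion, by [series_tail]
    and [asym_unique]. *)
Lemma series_coeff_unique (a b : nat -> C) (s : R -> C) x0 M K : 0 < x0 ->
  (forall x, 0 < x <= x0 ->
     is_series (K := C_AbsRing) (V := C_NormedModule) (fun k => a k * RtoC x ^ k)%C (s x)) ->
  (forall x, 0 < x <= x0 ->
     Cmod (s x - Csum (fun k => b k * RtoC x ^ k) M)%C <= K * x ^ M) ->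
  forall k, (k < M)%nat -> a k = b k.
Proof.
  intros Hx0 Ha Hb k Hk.
  destruct (series_tail a s x0 M Hx0 Ha) as [K2 HK2].
  assert (D : (a k - b k)%C = RtoC 0).
  { apply (asym_unique M (fun k => a k - b k)%C (K + K2) (x0 / 2)); [lra| |exact Hk].
    intros x Hx.
    replace (Csum (fun k => (a k - b k) * RtoC x ^ k)%C M) with ((s x - Csum (fun k => b k * RtoC x ^ k) M) -
       (s x - Csum (fun k => a k * RtoC x ^ k) M))%C.
    - eapply Rle_trans; [apply Cmod_minus_le|].
      specialize (HK2 x Hx). specialize (Hb x ltac:(lra)). lra.
    - rewrite (Csum_ext (fun k => (a k - b k) * RtoC x ^ k)%C (fun k => a k * RtoC x ^ k - b k * RtoC x ^ k)%C).
      + rewrite Csum_minus. ring.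
      + intros j _. ring. }
  replace (a k) with ((a k - b k) + b k)%C by ring. rewrite D. ring.
Qed.

(** * The Stieltjes constants as path integrals *)

(** Continuity of g : C -> C in the form in which it is used along paths. *)
Definition preserves_Ccont (g : C -> C) : Prop := forall f x, Ccont f x -> Ccont (fun t => g (f t)) x.

Lemma preserves_Ccont_pow k : preserves_Ccont (fun t => t ^ k)%C.
Proof. intros f x H. apply Ccont_pow, H. Qed.
Lemma preserves_Ccont_xi xi : preserves_Ccont (fun t => Cexp (RtoC (- xi) * t))%C.
Proof. intros f x H. apply Ccont_xi, H. Qed.
Lemma preserves_Ccont_scal c g : preserves_Ccont g -> preserves_Ccont (fun t => c * g t)%C.
Proof. intros Hg f x H. apply Ccont_mult; [apply Ccont_const|apply Hg, H]. Qed.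
Lemma preserves_Ccont_minus g h : preserves_Ccont g -> preserves_Ccont h -> preserves_Ccont (fun t => g t - h t)%C.
Proof. intros Hg Hh f x H. apply Ccont_minus; [apply Hg, H|apply Hh, H]. Qed.
Lemma preserves_Ccont_Csum (g : nat -> C -> C) n : (forall k, preserves_Ccont (g k)) -> preserves_Ccont (fun t => Csum (fun k => g k t) n).
Proof.
  intros Hg f x H. induction n as [|n IH]; simpl; [apply Ccont_const|].
  apply Ccont_plus; [exact IH|apply Hg, H].
Qed.

Lemma ex_Cint_left g v : preserves_Ccont g -> 1 <= v < PI / 2 ->
  ex_Cint (fun s => g (left_end, s) * kern (Cexp (left_end, s)))%C 0 v.
Proof.
  intros Hg Hv. apply ex_Cint_cont; [lra|]. intros s Hs.
  apply Ccont_mult; [apply Hg, Ccont_ver|apply Ccont_kern_left; lra].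
Qed.

Lemma ex_Cint_line g v a b : preserves_Ccont g -> 1 <= v < PI / 2 -> left_end <= a <= b ->
  ex_Cint (fun r => g (r, v) * kern (Cexp (r, v)))%C a b.
Proof.
  intros Hg Hv Hab. apply ex_Cint_cont; [lra|]. intros s Hs.
  apply Ccont_mult; [apply Hg, Ccont_hor|apply Ccont_kern_hor; lra].
Qed.

Lemma path_integral_minus g h v N : preserves_Ccont g -> preserves_Ccont h -> 1 <= v < PI / 2 ->
  path_integral (fun t => g t - h t)%C v N = (path_integral g v N - path_integral h v N)%C.
Proof.
  intros Hg Hh Hv. unfold path_integral. pose proof (left_end_le_right_end N) as HR.
  rewrite (Cint_ext _ (fun s => g (left_end, s) * kern (Cexp (left_end, s)) - h (left_end, s) * kern (Cexp (left_end, s)))%C 0 v);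
    [|lra|intros; ring].
  rewrite Cint_minus by (apply ex_Cint_left; assumption).
  rewrite (Cint_ext _ (fun r => g (r, v) * kern (Cexp (r, v)) - h (r, v) * kern (Cexp (r, v)))%C left_end);
    [|lra|intros; ring].
  rewrite Cint_minus by (apply ex_Cint_line; auto; lra). ring.
Qed.

Lemma path_integral_plus g h v N : preserves_Ccont g -> preserves_Ccont h -> 1 <= v < PI / 2 ->
  path_integral (fun t => g t + h t)%C v N = (path_integral g v N + path_integral h v N)%C.
Proof.
  intros Hg Hh Hv. unfold path_integral. pose proof (left_end_le_right_end N) as HR.
  rewrite (Cint_ext _ (fun s => g (left_end, s) * kern (Cexp (left_end, s)) + h (left_end, s) * kern (Cexp (left_end, s)))%C 0 v);
    [|lra|intros; ring].
  rewrite Cint_plus by (apply ex_Cint_left; assumption).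
  rewrite (Cint_ext _ (fun r => g (r, v) * kern (Cexp (r, v)) + h (r, v) * kern (Cexp (r, v)))%C left_end);
    [|lra|intros; ring].
  rewrite Cint_plus by (apply ex_Cint_line; auto; lra). ring.
Qed.

Lemma path_integral_scal c g v N : preserves_Ccont g -> 1 <= v < PI / 2 ->
  path_integral (fun t => c * g t)%C v N = (c * path_integral g v N)%C.
Proof.
  intros Hg Hv. unfold path_integral. pose proof (left_end_le_right_end N) as HR.
  rewrite (Cint_ext _ (fun s => c * (g (left_end, s) * kern (Cexp (left_end, s))))%C 0 v);
    [|lra|intros; ring].
  rewrite Cint_scal by (apply ex_Cint_left; assumption).
  rewrite (Cint_ext _ (fun r => c * (g (r, v) * kern (Cexp (r, v))))%C left_end);
    [|lra|intros; ring].
  rewrite Cint_scal by (apply ex_Cint_line; auto; lra). ring.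
Qed.

Lemma path_integral_ext g h v N : 0 <= v -> (forall t, g t = h t) -> path_integral g v N = path_integral h v N.
Proof.
  intros Hv E. unfold path_integral. f_equal; [f_equal|]; apply Cint_ext; auto using left_end_le_right_end;
  intros; rewrite E; reflexivity.
Qed.

Lemma path_integral_Csum (g : nat -> C -> C) v N M : (forall k, preserves_Ccont (g k)) -> 1 <= v < PI / 2 ->
  path_integral (fun t => Csum (fun k => g k t) M) v N = Csum (fun k => path_integral (g k) v N) M.
Proof.
  intros Hg Hv. induction M as [|M IH].
  - simpl. rewrite (path_integral_ext _ (fun _ => RtoC 0 * RtoC 0)%C) by (try lra; intros; ring).
    rewrite (path_integral_scal (RtoC 0) (fun _ => RtoC 0)); [ring|intros f x _; apply Ccont_const|exact Hv].
  - simpl Csum. rewrite (path_integral_plus (fun t => Csum (fun k => g k t) M) (g M) v N), IH; auto.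
    apply preserves_Ccont_Csum, Hg.
Qed.

Definition left_bounded (g : C -> C) K := forall s, 0 <= s <= PI / 2 -> Cmod (g (left_end, s)) <= K.
(** The growth e^r is harmless, since kern (e^t) decreases faster than any
    power of e^(-r) along the line. *)
Definition line_bounded (g : C -> C) v K := forall r, left_end <= r -> Cmod (g (r, v)) <= K * exp r.

Lemma line_kern_bound r v : left_end <= r -> 1 <= v < PI / 2 ->
  Cmod (kern (Cexp (r, v))) * exp r <= 2 * exp (- (1) * r).
Proof.
  intros Hr Hv.
  pose proof (kern_safe_bound _ (safe_line r v Hr Hv)) as A.
  pose proof (nome_line r v Hr Hv) as B.
  assert (C' : exp (- (2 * exp r)) * exp r <= exp (- (1) * r)).
  { rewrite <- exp_plus. apply exp_le. generalize (exp_ineq1_le r). lra. }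
  generalize (exp_pos r); intros. nra.
Qed.

Lemma line_integral_bound g v K a b : preserves_Ccont g -> 1 <= v < PI / 2 -> left_end <= a <= b -> 0 <= K ->
  line_bounded g v K ->
  Cmod (Cint (fun r => g (r, v) * kern (Cexp (r, v)))%C a b) <= 2 * K * exp (- (1) * a).
Proof.
  intros Hg Hv Hab HK HB.
  apply Rle_trans with (RInt (fun r => 2 * K * exp (- (1) * r)) a b).
  - apply Cint_bound; [lra|apply ex_Cint_line; auto|apply ex_RInt_Rscal, ex_RInt_exp_neg; lra|].
    intros r Hr. rewrite Cmod_mult.
    pose proof (line_kern_bound r v ltac:(lra) Hv) as A.
    specialize (HB r ltac:(lra)). generalize (Cmod_ge_0 (kern (Cexp (r, v)))) (exp_pos r); intros.
    apply Rle_trans with (K * exp r * Cmod (kern (Cexp (r, v)))); [apply Rmult_le_compat_r; assumption|].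
    nra.
  - rewrite RInt_Rscal, RInt_exp_neg by (try apply ex_RInt_exp_neg; lra).
    generalize (exp_pos (- (1) * b)). intros. apply Rmult_le_compat_l; lra.
Qed.

Lemma left_integral_bound g v K : preserves_Ccont g -> 1 <= v < PI / 2 -> left_bounded g K ->
  Cmod (Cint (fun s => g (left_end, s) * kern (Cexp (left_end, s)))%C 0 v) <= 4 * K.
Proof.
  intros Hg Hv HB. generalize PI_4; intros.
  assert (HK : 0 <= K) by (eapply Rle_trans; [apply Cmod_ge_0|apply (HB 0); lra]).
  apply Rle_trans with (2 * K * (v - 0)); [|nra].
  apply Cint_bound_const; [lra|apply ex_Cint_left; assumption|].
  intros s Hs. rewrite Cmod_mult.
  assert (S : safe (Cexp (left_end, s))) by (apply safe_left; lra).
  pose proof (kern_safe_bound _ S). pose proof (nome_le1 _ (proj1 S)).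
  specialize (HB s ltac:(lra)).
  rewrite (Rmult_comm 2 K). apply Rmult_le_compat; try apply Cmod_ge_0; lra.
Qed.

Lemma path_integral_bound g v K1 K2 N : preserves_Ccont g -> 1 <= v < PI / 2 -> 0 <= K2 ->
  left_bounded g K1 -> line_bounded g v K2 -> Cmod (path_integral g v N) <= 4 * K1 + 2 * K2.
Proof.
  intros Hg Hv HK H1 H2. unfold path_integral.
  eapply Rle_trans; [apply Cmod_triangle|]. rewrite Cmod_mult, Cmod_Ci, Rmult_1_l.
  apply Rplus_le_compat; [apply left_integral_bound; assumption|].
  eapply Rle_trans; [apply line_integral_bound; eauto; split; [lra|apply left_end_le_right_end]|].
  assert (exp (- (1) * left_end) <= 1) by (apply exp_le_1; generalize left_end_bounds; lra). nra.
Qed.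

Lemma right_end_le N M : (N <= M)%nat -> right_end N <= right_end M.
Proof.
  intros H. apply ln_le; [generalize (pos_INR N); lra|]. apply le_INR in H. lra.
Qed.

Lemma path_integral_cauchy g v K : preserves_Ccont g -> 1 <= v < PI / 2 -> 0 <= K -> line_bounded g v K ->
  forall e, 0 < e -> exists N0, forall N M, (N0 <= N)%nat -> (N0 <= M)%nat ->
  Cmod (path_integral g v N - path_integral g v M)%C <= e.
Proof.
  intros Hg Hv HK HB e He.
  assert (Hd : 0 < e / (2 * K + 1) / 2).
  { apply Rmult_lt_0_compat; [|lra]. apply Rmult_lt_0_compat; [lra|]. apply Rinv_0_lt_compat; lra. }
  destruct (exp_right_end_small 1 (e / (2 * K + 1) / 2) ltac:(lra) Hd) as [N0 HN0].
  exists N0.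
  assert (A : forall N, (N0 <= N)%nat -> Cmod (path_integral g v N - path_integral g v N0)%C <= e / 2).
  { intros N HN. specialize (HN0 N0 (le_n _)). unfold path_integral.
    rewrite <- (Cint_Chasles _ left_end (right_end N0) (right_end N)).
    2, 3: apply ex_Cint_line; auto; split; auto using left_end_le_right_end, right_end_le; lra.
    match goal with |- Cmod ?X <= _ => replace X with
      (Cint (fun r => g (r, v) * kern (Cexp (r, v)))%C (right_end N0) (right_end N)) by ring end.
    eapply Rle_trans; [apply line_integral_bound; eauto; split; auto using left_end_le_right_end, right_end_le|].
    apply Rle_trans with (2 * K * (e / (2 * K + 1) / 2)); [apply Rmult_le_compat_l; lra|].
    apply Rmult_le_reg_r with (2 * (2 * K + 1)); [lra|].
    replace (2 * K * (e / (2 * K + 1) / 2) * (2 * (2 * K + 1))) with (2 * K * e) by (field; lra).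
    nra. }
  intros N M HN HM.
  replace (path_integral g v N - path_integral g v M)%C with
    ((path_integral g v N - path_integral g v N0) - (path_integral g v M - path_integral g v N0))%C by ring.
  eapply Rle_trans; [apply Cmod_minus_le|].
  generalize (A N HN) (A M HM). lra.
Qed.

Lemma pow_fact_le x k : 0 <= x -> x ^ k <= INR (fact k) * exp x.
Proof.
  intros Hx. pose proof (exp_ge_taylor x k Hx) as H.
  assert (B : x ^ k / INR (fact k) <= sum_f_R0 (fun k => x ^ k / INR (fact k)) k).
  { destruct k as [|k]; [simpl; lra|]. rewrite tech5.
    assert (0 <= sum_f_R0 (fun k => x ^ k / INR (fact k)) k).
    { apply cond_pos_sum. intros n. apply Rmult_le_pos; [apply pow_le, Hx|].
      left; apply Rinv_0_lt_compat, INR_fact_lt_0. } lra. }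
  pose proof (INR_fact_lt_0 k) as F.
  apply Rmult_le_reg_r with (/ INR (fact k)); [apply Rinv_0_lt_compat, F|].
  replace (INR (fact k) * exp x * / INR (fact k)) with (exp x) by (field; lra).
  unfold Rdiv in *; lra.
Qed.

Lemma Cmod_pair_le r s : 0 <= r -> 0 <= s <= PI / 2 -> Cmod (r, s) <= r + 2.
Proof.
  intros Hr Hs. eapply Rle_trans; [apply Cmod_le_Re_Im|]. simpl.
  rewrite !Rabs_right by lra. generalize PI_4; lra.
Qed.

Lemma left_pow k : left_bounded (fun t => t ^ k)%C (3 ^ k).
Proof.
  intros s Hs. rewrite Cmod_pow. apply pow_incr. split; [apply Cmod_ge_0|].
  eapply Rle_trans; [apply Cmod_pair_le; [generalize left_end_bounds; lra|exact Hs]|].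
  generalize left_end_bounds; lra.
Qed.

Lemma line_pow k v : 1 <= v < PI / 2 ->
  line_bounded (fun t => t ^ k)%C v (INR (fact k) * exp 2).
Proof.
  intros Hv r Hr. rewrite Cmod_pow. generalize left_end_bounds; intros.
  apply Rle_trans with ((r + 2) ^ k).
  - apply pow_incr. split; [apply Cmod_ge_0|]. apply Cmod_pair_le; lra.
  - rewrite Rmult_assoc, <- exp_plus, (Rplus_comm 2 r). apply pow_fact_le; lra.
Qed.

Definition path_moment (v : R) (k : nat) : R :=
  real (Lim_seq (fun N => 2 * Re (path_integral (fun t => t ^ k)%C v N))).

Lemma path_moment_lim v k : 1 <= v < PI / 2 ->
  is_lim_seq (fun N => 2 * Re (path_integral (fun t => t ^ k)%C v N)) (path_moment v k).
Proof.
  intros Hv. unfold path_moment. apply Lim_seq_correct'.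
  apply ex_lim_seq_cauchy_corr. intros [e He].
  destruct (path_integral_cauchy (fun t => t ^ k)%C v (INR (fact k) * exp 2) (preserves_Ccont_pow k) Hv) with (e := e / 4)
    as [N0 HN0].
  - apply Rmult_le_pos; [left; apply INR_fact_lt_0|left; apply exp_pos].
  - apply line_pow, Hv.
  - lra.
  - exists N0. intros n m Hn Hm. cbv beta. simpl pos. rewrite <- Rmult_minus_distr_l, Rabs_mult, (Rabs_right 2) by lra.
    rewrite <- re_minus.
    pose proof (Rle_trans _ _ _ (re_le_Cmod _) (HN0 n m Hn Hm)). lra.
Qed.

Fixpoint Rsum (f : nat -> R) (n : nat) : R :=
  match n with O => 0 | S m => Rsum f m + f m end.

Lemma Rsum_ext f g n : (forall k, (k < n)%nat -> f k = g k) -> Rsum f n = Rsum g n.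
Proof.
  induction n as [|n IH]; intros H; [reflexivity|]. simpl.
  rewrite IH, H by (intros; try apply H; lia). reflexivity.
Qed.

Lemma Rsum_plus f g n : Rsum (fun k => f k + g k) n = Rsum f n + Rsum g n.
Proof. induction n as [|n IH]; simpl; [ring|]. rewrite IH. ring. Qed.
Lemma Rsum_scal c f n : Rsum (fun k => c * f k) n = c * Rsum f n.
Proof. induction n as [|n IH]; simpl; [ring|]. rewrite IH. ring. Qed.

Lemma Rsum_shift f n : Rsum f (S n) = f 0%nat + Rsum (fun k => f (S k)) n.
Proof.
  induction n as [|n IH]; [simpl; ring|].
  change (Rsum f (S (S n))) with (Rsum f (S n) + f (S n)). rewrite IH. simpl. ring.
Qed.

Lemma Csum_Rsum f n : Csum (fun k => RtoC (f k)) n = RtoC (Rsum f n).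
Proof. induction n as [|n IH]; [reflexivity|]. simpl. rewrite IH, RtoC_plus. reflexivity. Qed.

Lemma Re_Csum_R f n : Re (Csum f n) = Rsum (fun k => Re (f k)) n.
Proof. induction n as [|n IH]; [reflexivity|]. simpl Csum. rewrite re_plus, IH. reflexivity. Qed.

Lemma Rsum_lim (u : nat -> nat -> R) (l c : nat -> R) M :
  (forall k, is_lim_seq (u k) (l k)) ->
  is_lim_seq (fun N => Rsum (fun k => c k * u k N) M) (Rsum (fun k => c k * l k) M).
Proof.
  intros H. induction M as [|M IH]; [apply is_lim_seq_const|]. simpl.
  apply is_lim_seq_plus'; [exact IH|].
  apply (is_lim_seq_scal_l (u M) (c M) (l M)), H.
Qed.

(** The Taylor remainder of e^(- xi t) is at most |xi t|^M on the path, and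
    t^M is integrable against kern (e^t) with a bound independent of N. *)
Lemma path_integral_exp_expand xi v M N : 0 < xi <= 1 -> 1 <= v < PI / 2 ->
  Rabs (2 * Re (path_integral (fun t => Cexp (RtoC (- xi) * t)%C) v N) -
    Rsum (fun k => ((- xi) ^ k / INR (fact k)) * (2 * Re (path_integral (fun t => t ^ k)%C v N))) M)
  <= 2 * (4 * 3 ^ M + 2 * (INR (fact M) * exp 2)) * xi ^ M.
Proof.
  intros Hxi Hv.
  set (c := fun k => RtoC ((- xi) ^ k / INR (fact k))).
  assert (E : Rsum (fun k => ((- xi) ^ k / INR (fact k)) * (2 * Re (path_integral (fun t => t ^ k)%C v N))) M =
    2 * Re (path_integral (fun t => Csum (fun k => c k * t ^ k) M)%C v N)).
  { rewrite (path_integral_Csum (fun k t => c k * t ^ k)%C);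
      [|intros; apply preserves_Ccont_scal, preserves_Ccont_pow|exact Hv].
    rewrite Re_Csum_R, <- Rsum_scal. apply Rsum_ext. intros k _.
    rewrite path_integral_scal by (auto using preserves_Ccont_pow). unfold c.
    rewrite re_mult, re_RtoC, im_RtoC. ring. }
  rewrite E, <- Rmult_minus_distr_l, Rabs_mult, (Rabs_right 2), Rmult_assoc by lra.
  apply Rmult_le_compat_l; [lra|]. rewrite <- re_minus.
  eapply Rle_trans; [apply re_le_Cmod|].
  rewrite <- path_integral_minus; [|apply preserves_Ccont_xi|apply preserves_Ccont_Csum; intros; apply preserves_Ccont_scal, preserves_Ccont_pow|exact Hv].
  assert (T : forall t : C, 0 <= Re t ->
    Cmod (Cexp (RtoC (- xi) * t) - Csum (fun k => c k * t ^ k) M)%C <= xi ^ M * Cmod (t ^ M)%C).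
  { intros t Ht.
    pose proof (exp_taylor (RtoC xi * t)%C M 1 (Rle_refl 1)) as X.
    assert (Y : exp (- Re (RtoC xi * t)%C) <= 1).
    { apply exp_le_1. rewrite re_mult, re_RtoC, im_RtoC. nra. }
    specialize (X Y). rewrite Cmod_mult, Cmod_R, Rabs_right, Rpow_mult_distr, Rmult_1_r in X by lra.
    rewrite Cmod_pow.
    replace (RtoC (- xi) * t)%C with (- (RtoC xi * t))%C by (rewrite RtoC_opp; ring).
    rewrite (Csum_ext (fun k => c k * t ^ k)%C (expterm (RtoC xi * t)%C)); [exact X|].
    intros k _. unfold c, expterm.
    rewrite RtoC_div, RtoC_pow by apply INR_fact_neq_0.
    replace (- (RtoC xi * t))%C with (RtoC (- xi) * t)%C by (rewrite RtoC_opp; ring).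
    rewrite Cpow_mult_l. unfold Cdiv. ring. }
  assert (P : 0 <= xi ^ M) by (apply pow_le; lra).
  replace ((4 * 3 ^ M + 2 * (INR (fact M) * exp 2)) * xi ^ M) with
    (4 * (xi ^ M * 3 ^ M) + 2 * (xi ^ M * (INR (fact M) * exp 2))) by ring.
  apply path_integral_bound.
  - apply preserves_Ccont_minus; [apply preserves_Ccont_xi|apply preserves_Ccont_Csum; intros; apply preserves_Ccont_scal, preserves_Ccont_pow].
  - exact Hv.
  - apply Rmult_le_pos; [exact P|]. apply Rmult_le_pos; [left; apply INR_fact_lt_0|left; apply exp_pos].
  - intros s Hs. eapply Rle_trans; [apply T; simpl; generalize left_end_bounds; lra|].
    apply Rmult_le_compat_l; [exact P|]. apply left_pow, Hs.
  - intros r Hr. eapply Rle_trans; [apply T; simpl; generalize left_end_bounds; lra|].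
    rewrite Rmult_assoc. apply Rmult_le_compat_l; [exact P|]. apply line_pow; assumption.
Qed.

(** The coefficient of xi^k in zeta (1 + xi) - 1 / xi. The 1 at k = 0 is the
    first term of the Dirichlet series; the power of [left_end] comes from the
    expansion of e^(- xi left_end) / xi. *)
Definition laurent_coef (v : R) (k : nat) : R :=
  (match k with O => 1 | S _ => 0 end) +
  (-1) ^ k / INR (fact k) * (path_moment v k - left_end ^ (S k) / INR (S k)).

Lemma exp_left_end_expand xi M : 0 < xi <= 1 ->
  Rabs ((exp (- xi * left_end) - 1) / xi -
    Rsum (fun k => (-1) ^ k / INR (fact k) * (- (left_end ^ (S k) / INR (S k))) * xi ^ k) M) <= xi ^ M.
Proof.
  intros Hxi. pose proof left_end_bounds as Hl.
  pose proof (exp_taylor (RtoC (xi * left_end)) (S M) 1 (Rle_refl 1)) as T.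
  rewrite re_RtoC in T. specialize (T ltac:(apply exp_le_1; nra)).
  rewrite Cmod_R, Rabs_right, Rmult_1_r in T by nra.
  assert (E : Csum (expterm (RtoC (xi * left_end))) (S M) =
     RtoC (Rsum (fun k => (- (xi * left_end)) ^ k / INR (fact k)) (S M))).
  { rewrite <- Csum_Rsum. apply Csum_ext. intros k _. unfold expterm.
    rewrite RtoC_div, RtoC_pow, RtoC_opp by apply INR_fact_neq_0. reflexivity. }
  rewrite E, <- RtoC_opp, Cexp_RtoC, <- RtoC_minus, Cmod_R, Rsum_shift in T.
  simpl (_ ^ 0) in T. simpl (fact 0) in T. simpl (INR 1) in T.
  set (X := (exp (- xi * left_end) - 1) / xi - _).
  assert (EX : X = (exp (- (xi * left_end)) - (1 / 1 + Rsum (fun k => (- (xi * left_end)) ^ S k / INR (fact (S k))) M)) / xi).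
  { unfold X.
    rewrite (Rsum_ext (fun k => (- (xi * left_end)) ^ S k / INR (fact (S k)))
      (fun k => xi * ((-1) ^ k / INR (fact k) * (- (left_end ^ (S k) / INR (S k))) * xi ^ k))).
    - rewrite Rsum_scal. replace (- xi * left_end) with (- (xi * left_end)) by ring. field. lra.
    - intros k _. rewrite fact_simpl, mult_INR.
      replace (- (xi * left_end)) with (-1 * (xi * left_end)) by ring. rewrite !Rpow_mult_distr.
      simpl pow. field. split; [apply not_0_INR; lia|apply INR_fact_neq_0]. }
  rewrite EX. unfold Rdiv. rewrite Rabs_mult, (Rabs_right (/ xi)) by (left; apply Rinv_0_lt_compat; lra).
  apply Rmult_le_reg_r with xi; [lra|]. rewrite Rmult_assoc, Rinv_l, Rmult_1_r by lra.
  eapply Rle_trans; [exact T|].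
  rewrite Rpow_mult_distr.
  assert (left_end ^ S M <= 1) by (apply pow_le_1; lra).
  assert (0 <= xi ^ S M) by (apply pow_le; lra).
  replace (xi ^ M * xi) with (xi ^ S M) by (simpl; ring). nra.
Qed.

Lemma zeta_expand v M xi (l : R) : 0 < xi <= 1 -> 1 <= v < PI / 2 ->
  is_lim_seq (sum_n (fun k => dirichlet xi (INR (S k)))) l ->
  Rabs (l - / xi - Rsum (fun k => laurent_coef v k * xi ^ k) (S M)) <=
  (2 * (4 * 3 ^ (S M) + 2 * (INR (fact (S M)) * exp 2)) + 1) * xi ^ (S M).
Proof.
  intros Hxi Hv Hl.
  set (c := fun k => (- xi) ^ k / INR (fact k)).
  set (L := fun k N => 2 * Re (path_integral (fun t => t ^ k)%C v N)).
  set (B := 2 * (4 * 3 ^ (S M) + 2 * (INR (fact (S M)) * exp 2)) * xi ^ (S M)).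
  set (u := fun N => sum_n (fun k => dirichlet xi (INR (S k))) N - 1 -
     (exp (- xi * left_end) - exp (- xi * right_end N)) / xi - Rsum (fun k => c k * L k N) (S M)).
  assert (HR : is_lim_seq (fun N => exp (- xi * right_end N)) 0).
  { apply is_lim_seq_spec. intros [e He]. simpl.
    destruct (exp_right_end_small xi e ltac:(lra) He) as [N0 HN0]. exists N0. intros N HN.
    rewrite Rminus_0_r, Rabs_right by (left; apply exp_pos). auto. }
  assert (Hu : is_lim_seq u (l - 1 - (exp (- xi * left_end) - 0) / xi - Rsum (fun k => c k * path_moment v k) (S M))).
  { unfold u. apply is_lim_seq_minus'; [apply is_lim_seq_minus'; [apply is_lim_seq_minus'|]|].
    - exact Hl.
    - apply is_lim_seq_const.
    - apply (is_lim_seq_scal_r (fun N => exp (- xi * left_end) - exp (- xi * right_end N)) (/ xi) (exp (- xi * left_end) - 0)).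
      apply is_lim_seq_minus'; [apply is_lim_seq_const|exact HR].
    - apply Rsum_lim. intros k. apply path_moment_lim, Hv. }
  assert (Hb : Rabs (l - 1 - (exp (- xi * left_end) - 0) / xi - Rsum (fun k => c k * path_moment v k) (S M)) <= 0 + B).
  { pose proof (zeta_path_integral xi v Hxi Hv) as Z.
    assert (Z2 : is_lim_seq (fun N => Rabs (zeta_defect xi v N) + B) (0 + B)).
    { apply is_lim_seq_plus'; [|apply is_lim_seq_const].
      rewrite <- Rabs_R0. apply (is_lim_seq_abs _ 0), Z. }
    match goal with |- Rabs ?a <= ?b => change (Rbar_le (Finite (Rabs a)) (Finite b)) end.
    apply (is_lim_seq_le (fun N => Rabs (u N)) _ _ _) with (3 := Z2).
    2:{ apply (is_lim_seq_abs _ (Finite _) Hu). }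
    intros N. pose proof (path_integral_exp_expand xi v (S M) N Hxi Hv) as E. fold B in E.
    unfold u, zeta_defect.
    set (s := sum_n _ N). set (x := 2 * Re _) in *.
    match goal with |- Rabs ?X <= Rabs ?Y + B => replace X with (Y + (x - Rsum (fun k => c k * L k N) (S M))) by ring end.
    eapply Rle_trans; [apply Rabs_triang|]. apply Rplus_le_compat_l. exact E. }
  pose proof (exp_left_end_expand xi (S M) Hxi) as E2.
  assert (ES : Rsum (fun k => laurent_coef v k * xi ^ k) (S M) =
    1 + Rsum (fun k => c k * path_moment v k) (S M) +
    Rsum (fun k => (-1) ^ k / INR (fact k) * (- (left_end ^ (S k) / INR (S k))) * xi ^ k) (S M)).
  { assert (E1 : forall M, Rsum (fun k => match k with O => 1 | S _ => 0 end * xi ^ k) (S M) = 1).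
    { clear. induction M as [|M IH]; [simpl; ring|].
      change (Rsum ?f (S (S M))) with (Rsum f (S M) + f (S M)). rewrite IH. ring. }
    rewrite <- (E1 M), <- !Rsum_plus. apply Rsum_ext. intros k _. unfold laurent_coef, c.
    replace (- xi) with (-1 * xi) by ring. rewrite Rpow_mult_distr. unfold Rdiv. ring. }
  rewrite ES.
  set (T1 := Rsum (fun k => c k * path_moment v k) (S M)) in *.
  set (T2 := Rsum _ (S M)) in E2 |- *.
  replace (l - / xi - (1 + T1 + T2)) with
    ((l - 1 - (exp (- xi * left_end) - 0) / xi - T1) + ((exp (- xi * left_end) - 1) / xi - T2)) by (field; lra).
  eapply Rle_trans; [apply Rabs_triang|].
  rewrite Rmult_plus_distr_r. fold B. lra.
Qed.

Lemma Clog_pos x : 0 < x -> Clog (RtoC x) = RtoC (ln x).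
Proof.
  intros Hx. unfold Clog, Carg. rewrite Cmod_R, Rabs_right by lra.
  simpl. destruct (Rle_dec 0 0) as [_|N]; [|lra].
  replace (x / x) with 1 by (field; lra). rewrite acos_1. reflexivity.
Qed.

Lemma dirichlet_real xi k : Cpower (RtoC (INR (S k))) (- (1 + RtoC xi))%C = RtoC (dirichlet xi (INR (S k))).
Proof.
  unfold Cpower, dirichlet. rewrite Clog_pos by (apply lt_0_INR; lia).
  rewrite <- Cexp_RtoC. f_equal. rewrite RtoC_mult, RtoC_opp, RtoC_plus. reflexivity.
Qed.

Lemma sum_n_RtoC (a : nat -> R) N :
  sum_n (G := C_AbelianGroup) (fun k => RtoC (a k)) N = RtoC (sum_n a N).
Proof.
  induction N as [|N IH]; [rewrite !sum_O; reflexivity|].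
  rewrite !sum_Sn, IH. unfold plus; simpl. rewrite RtoC_plus. reflexivity.
Qed.

(** By [zeta_expand] and by the Laurent series, zeta (1 + xi) - 1 / xi has two
    expansions as xi -> 0+, and [series_coeff_unique] equates them. The height
    v remains free: it will be the imaginary part of the saddle. *)
Lemma stieltjes_path_integral (zeta : C -> C) (gamma : nat -> C) v n :
  is_Riemann_zeta zeta -> is_Stieltjes zeta gamma -> 1 <= v < PI / 2 -> (1 <= n)%nat ->
  gamma n = RtoC (path_moment v n - left_end ^ (S n) / INR (S n)).
Proof.
  intros [Hz _] [e He] Hv Hn.
  set (x0 := Rmin 1 (e / 2)).
  assert (Hx0 : 0 < x0) by (apply Rmin_pos; [lra|generalize (cond_pos e); lra]).
  assert (Hx1 : x0 <= 1) by apply Rmin_l.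
  assert (Hx2 : x0 <= e / 2) by apply Rmin_r.
  assert (U : (RtoC ((-1) ^ n / INR (fact n)) * gamma n)%C = RtoC (laurent_coef v n)).
  { apply (series_coeff_unique (fun k => RtoC ((-1) ^ k / INR (fact k)) * gamma k)%C
      (fun k => RtoC (laurent_coef v k)) (fun x => zeta (1 + RtoC x) - 1 / RtoC x)%C x0 (S n)
      (2 * (4 * 3 ^ (S n) + 2 * (INR (fact (S n)) * exp 2)) + 1)); [exact Hx0| | |lia].
    - intros x Hx. specialize (He (1 + RtoC x)%C).
      replace (1 + RtoC x - 1)%C with (RtoC x) in He by ring.
      apply He.
      + split; simpl; unfold ball; simpl; unfold AbsRing_ball, abs, minus, plus, opp; simpl.
        * replace (1 + x + - (1)) with x by ring. rewrite Rabs_right; lra.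
        * replace (0 + 0 + - 0) with 0 by ring. rewrite Rabs_R0. apply cond_pos.
      + intros E. apply (f_equal Re) in E. rewrite re_plus, !re_RtoC in E. lra.
    - intros x Hx.
      assert (S1 := Hz (1 + RtoC x)%C ltac:(rewrite re_plus, !re_RtoC; lra)).
      assert (S2 : is_series (K := C_AbsRing) (V := C_NormedModule)
        (fun k => RtoC (dirichlet x (INR (S k)))) (zeta (1 + RtoC x)%C)).
      { eapply is_series_ext; [|exact S1]. intros k. apply dirichlet_real. }
      set (z := zeta (1 + RtoC x)%C) in *.
      assert (L : forall d, 0 < d -> exists N0, forall N, (N0 <= N)%nat ->
         Cmod (RtoC (sum_n (fun k => dirichlet x (INR (S k))) N) - z)%C < d).
      { intros d Hd. destruct (is_series_Csum _ _ S2 d Hd) as [N0 HN0].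
        exists N0. intros N HN. rewrite <- sum_n_RtoC, sum_n_Csum. apply HN0. lia. }
      assert (Lr : is_lim_seq (sum_n (fun k => dirichlet x (INR (S k)))) (Re z)).
      { apply is_lim_seq_spec. intros [d Hd]. destruct (L d Hd) as [N0 HN0]. exists N0.
        intros N HN. simpl pos. eapply Rle_lt_trans; [|apply (HN0 N HN)].
        eapply Rle_trans; [|apply re_le_Cmod]. rewrite re_minus, re_RtoC. lra. }
      assert (Li : Im z = 0).
      { destruct (Req_dec (Im z) 0) as [|N]; [assumption|exfalso].
        destruct (L (Rabs (Im z)) ltac:(apply Rabs_pos_lt; exact N)) as [N0 HN0].
        specialize (HN0 N0 (le_n _)).
        pose proof (im_le_Cmod (RtoC (sum_n (fun k => dirichlet x (INR (S k))) N0) - z)%C) as Q.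
        rewrite im_minus, im_RtoC, Rminus_0_l, Rabs_Ropp in Q. lra. }
      assert (Ez : z = RtoC (Re z)) by (apply C_ext; [reflexivity|exact Li]).
      rewrite Ez.
      rewrite (Csum_ext _ (fun k => RtoC (laurent_coef v k * x ^ k))).
      2:{ intros k _. rewrite RtoC_mult, RtoC_pow. reflexivity. }
      rewrite Csum_Rsum, <- RtoC_div, <- !RtoC_minus, Cmod_R by lra.
      replace (1 / x) with (/ x) by (field; lra).
      apply zeta_expand; auto; lra. }
  destruct n as [|n]; [lia|].
  unfold laurent_coef in U. rewrite Rplus_0_l, RtoC_mult in U.
  set (c := (-1) ^ S n / INR (fact (S n))) in *.
  assert (Hc : RtoC c <> RtoC 0).
  { apply RtoC_neq0. unfold c, Rdiv. apply Rmult_integral_contrapositive_currified.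
    - apply pow_nonzero. lra.
    - apply Rinv_neq_0_compat, INR_fact_neq_0. }
  apply Cmult_reg_r with (RtoC c); [exact Hc|].
  rewrite Cmult_comm, U. ring.
Qed.

(** * The saddle point *)

Definition saddle (n : nat) (t0 : C) : Prop :=
  (1 <= n)%nat /\ 0 < Re t0 /\ 0 < Im t0 < PI / 2 /\
  (t0 * Cexp t0)%C = (RtoC (INR n) * Ci / RtoC (2 * PI))%C.

Lemma Re_target n : Re (RtoC (INR n) * Ci / RtoC (2 * PI))%C = 0.
Proof.
  generalize PI_RGT_0; intros.
  unfold Cdiv. rewrite <- RtoC_inv by lra. unfold Re, Ci, RtoC; simpl. ring.
Qed.
Lemma Im_target n : Im (RtoC (INR n) * Ci / RtoC (2 * PI))%C = INR n / (2 * PI).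
Proof.
  generalize PI_RGT_0; intros.
  unfold Cdiv. rewrite <- RtoC_inv by lra. unfold Im, Ci, RtoC; simpl. unfold Rdiv; ring.
Qed.

(** The equation says u cos v = v sin v and u sin v + v cos v > 0. These
    exclude v = 0; together with the description of the principal branch they
    exclude v < 0 and v >= pi/2. *)
Lemma lambert_saddle n t0 : (1 <= n)%nat ->
  is_LambertW0 (RtoC (INR n) * Ci / RtoC (2 * PI))%C t0 -> saddle n t0.
Proof.
  intros Hn (E & Hpi & Hbr).
  assert (Hn0 : 0 < INR n) by (apply lt_0_INR; lia).
  generalize PI_RGT_0; intros HP.
  set (u := Re t0) in *. set (v := Im t0) in *.
  assert (ER := f_equal Re E). assert (EI := f_equal Im E).
  rewrite Re_target in ER. rewrite Im_target in EI.
  rewrite re_mult in ER. rewrite im_mult in EI. fold u v in ER, EI.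
  unfold Cexp in ER, EI. fold u v in ER, EI. simpl in ER, EI.
  generalize (exp_pos u); intros He.
  assert (A : u * cos v = v * sin v).
  { apply Rmult_eq_reg_l with (exp u); [|lra]. lra. }
  assert (B : 0 < u * sin v + v * cos v).
  { apply Rmult_lt_reg_l with (exp u); [exact He|].
    assert (0 < INR n / (2 * PI)) by (apply Rmult_lt_0_compat; [exact Hn0|apply Rinv_0_lt_compat; lra]).
    lra. }
  clear ER EI.
  assert (Main : 0 < u /\ 0 < v < PI / 2); [|destruct Main; repeat split; try tauto; assumption].
  destruct Hbr as [[Hv Hu]|[[Hv Hu]|[Hv Hu]]].
  - assert (Sv : 0 < sin v) by (apply sin_gt_0; lra).
    assert (Cv : 0 < cos v).
    { destruct (Rlt_dec 0 (cos v)) as [|N]; [assumption|exfalso].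
      destruct (Req_dec (cos v) 0) as [Z|Z]; [rewrite Z in A; nra|].
      assert (cos v < 0) by lra. assert (u < 0) by nra. nra. }
    assert (Hu0 : 0 < u) by nra.
    split; [exact Hu0|]. split; [exact Hv|].
    destruct (Rlt_dec v (PI / 2)) as [|N]; [assumption|exfalso].
    assert (cos v <= 0) by (apply cos_le_0; lra). lra.
  - exfalso. rewrite Hv, sin_0, cos_0 in *. lra.
  - exfalso.
    assert (Sv : sin v < 0).
    { assert (0 < sin (- v)) by (apply sin_gt_0; lra). rewrite sin_neg in H. lra. }
    destruct (Rlt_dec 0 (cos v)) as [Cv|Cv].
    + assert (0 < u) by nra. nra.
    + destruct (Req_dec (cos v) 0) as [Z|Z]; [rewrite Z in A; nra|].
      assert (cos v < 0) by lra. assert (u < 0) by nra.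
      assert (0 < cos v / sin v).
      { replace (cos v / sin v) with (- cos v * / - sin v) by (field; lra).
        apply Rmult_lt_0_compat; [lra|apply Rinv_0_lt_compat; lra]. }
      nra.
Qed.

Lemma saddle_neq0 n t0 : saddle n t0 -> t0 <> RtoC 0.
Proof. intros (_ & Hu & _). apply Cneq0_Re. lra. Qed.

Lemma saddle_size n t0 : saddle n t0 -> Cmod t0 * exp (Re t0) = INR n / (2 * PI).
Proof.
  intros (Hn & Hu & Hv & E). generalize PI_RGT_0; intros HP.
  apply (f_equal Cmod) in E. rewrite Cmod_mult, Cmod_Cexp in E. rewrite E.
  rewrite Cmod_div by (apply RtoC_neq0; lra).
  rewrite Cmod_mult, Cmod_Ci, !Cmod_R, !Rabs_right; [unfold Rdiv; ring|lra|].
  apply Rle_ge, pos_INR.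
Qed.

Lemma saddle_cot n t0 : saddle n t0 -> Re t0 * cos (Im t0) = Im t0 * sin (Im t0).
Proof.
  intros (Hn & Hu & Hv & E). apply (f_equal Re) in E. rewrite Re_target, re_mult in E.
  unfold Cexp in E. simpl in E. generalize (exp_pos (Re t0)); intros He.
  apply Rmult_eq_reg_l with (exp (Re t0)); [|lra]. unfold Re, Im in *. lra.
Qed.

Lemma Cmod_ge_Re t : Re t <= Cmod t.
Proof. eapply Rle_trans; [apply Rle_abs|apply re_le_Cmod]. Qed.

Lemma saddle_Cmod_le n t0 : saddle n t0 -> Cmod t0 <= Re t0 + 2.
Proof.
  intros (Hn & Hu & Hv & E). eapply Rle_trans; [apply Cmod_le_Re_Im|].
  rewrite !Rabs_right by lra. generalize PI_4; lra.
Qed.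

Lemma saddle_Im_ge1 n t0 : saddle n t0 -> 2 <= Re t0 -> 1 <= Im t0.
Proof.
  intros S Hu. pose proof (saddle_cot _ _ S) as A. destruct S as (_ & _ & Hv & _).
  destruct (Rle_dec 1 (Im t0)) as [|N]; [assumption|exfalso].
  generalize PI2_3_2; intros HP.
  assert (C : 1 / 2 < cos (Im t0)).
  { rewrite <- cos_PI3. apply cos_decreasing_1; lra. }
  pose proof (SIN_bound (Im t0)) as B.
  assert (0 < sin (Im t0)) by (apply sin_gt_0; lra). nra.
Qed.

(** |t0| e^u = n / (2 pi) and |t0| <= u + 2, so u tends to infinity with n. *)
Lemma saddle_far (t0 : nat -> C) : (forall n, (1 <= n)%nat -> saddle n (t0 n)) ->
  forall U, exists n0, forall n, (n0 <= n)%nat -> (1 <= n)%nat -> U <= Re (t0 n).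
Proof.
  intros Sd U.
  set (V := Rmax U 0). assert (HV : 0 <= V) by apply Rmax_r. assert (HU : U <= V) by apply Rmax_l.
  destruct (nfloor_ex (2 * PI * ((V + 2) * exp V))) as [n0 Hn0].
  { generalize PI_RGT_0 (exp_pos V); intros. apply Rmult_le_pos; [lra|]. apply Rmult_le_pos; lra. }
  exists (S n0)%nat. intros n Hn Hn1. specialize (Sd n Hn1).
  destruct (Rle_dec U (Re (t0 n))) as [|N]; [assumption|exfalso].
  pose proof (saddle_size _ _ Sd) as E. pose proof (saddle_Cmod_le _ _ Sd) as B.
  assert (exp (Re (t0 n)) <= exp V) by (apply exp_le; lra).
  apply le_INR in Hn. rewrite S_INR in Hn.
  generalize PI_RGT_0; intros HP.
  assert (INR n = 2 * PI * (Cmod (t0 n) * exp (Re (t0 n)))) by (rewrite E; field; lra).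
  assert (Cmod (t0 n) * exp (Re (t0 n)) <= (V + 2) * exp V).
  { apply Rmult_le_compat; [apply Cmod_ge_0|left; apply exp_pos|lra|assumption]. }
  assert (2 * PI * (Cmod (t0 n) * exp (Re (t0 n))) <= 2 * PI * ((V + 2) * exp V)) by (apply Rmult_le_compat_l; lra).
  lra.
Qed.

Definition psi_incr (n : nat) (t0 : C) (x : R) : C := (psi n (t0 + RtoC x) - psi n t0)%C.

(** The leading part of the integrand t^n kern (e^t); it is e^(- n psi t) by
    [main_term_psi]. *)
Definition main_term (n : nat) (t : C) : C := (t ^ n * nome (Cexp t))%C.

Lemma main_term_psi n t : (1 <= n)%nat -> t <> RtoC 0 ->
  main_term n t = Cexp (- (RtoC (INR n) * psi n t))%C.
Proof.
  intros Hn Ht. unfold main_term, psi, nome.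
  assert (N : RtoC (INR n) <> RtoC 0) by (apply RtoC_neq0, not_0_INR; lia).
  replace (- (RtoC (INR n) * (- (RtoC (2 * PI) * Ci / RtoC (INR n)) * Cexp t - Clog t)))%C
    with (RtoC (INR n) * Clog t + RtoC (2 * PI) * Ci * Cexp t)%C by (field; exact N).
  rewrite Cexp_plus, Cexp_INR_mult, Cexp_Clog by exact Ht. reflexivity.
Qed.

Lemma main_term_psi_incr n t0 x : (1 <= n)%nat -> t0 <> RtoC 0 -> (t0 + RtoC x)%C <> RtoC 0 ->
  main_term n (t0 + RtoC x)%C = (main_term n t0 * Cexp (- (RtoC (INR n) * psi_incr n t0 x)))%C.
Proof.
  intros Hn H0 Hx. rewrite !main_term_psi by assumption. rewrite <- Cexp_plus. f_equal.
  unfold psi_incr. ring.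
Qed.

(** The equation psi' (t0) = 0. *)
Lemma saddle_exp n t0 : saddle n t0 ->
  (RtoC (2 * PI) * Ci / RtoC (INR n) * Cexp t0)%C = (- / t0)%C.
Proof.
  intros S. pose proof (saddle_neq0 _ _ S) as H0. destruct S as (Hn & _ & _ & E).
  assert (N : RtoC (INR n) <> RtoC 0) by (apply RtoC_neq0, not_0_INR; lia).
  assert (P : RtoC (2 * PI) <> RtoC 0) by (apply RtoC_neq0; generalize PI_RGT_0; lra).
  apply Cmult_reg_r with t0; [exact H0|].
  replace (RtoC (2 * PI) * Ci / RtoC (INR n) * Cexp t0 * t0)%C with
    (RtoC (2 * PI) * Ci / RtoC (INR n) * (t0 * Cexp t0))%C by (field; exact N).
  rewrite E.
  replace (RtoC (2 * PI) * Ci / RtoC (INR n) * (RtoC (INR n) * Ci / RtoC (2 * PI)))%C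
    with (Ci * Ci)%C by (field; auto).
  replace (- / t0 * t0)%C with (- (1))%C by (field; exact H0).
  apply C_ext; simpl; ring.
Qed.

(** The saddle equation removes n: the increment depends on t0 alone. All
    later bounds are uniform in n for this reason. *)
Lemma psi_incr_eq n t0 x : saddle n t0 ->
  psi_incr n t0 x = (/ t0 * (RtoC (exp x) - 1) - (Clog (t0 + RtoC x) - Clog t0))%C.
Proof.
  intros S. unfold psi_incr, psi. rewrite Cexp_plus, Cexp_RtoC.
  pose proof (saddle_exp _ _ S) as E.
  replace (- (RtoC (2 * PI) * Ci / RtoC (INR n)) * (Cexp t0 * RtoC (exp x)))%C with
    (- (RtoC (2 * PI) * Ci / RtoC (INR n) * Cexp t0) * RtoC (exp x))%C by ring.
  replace (- (RtoC (2 * PI) * Ci / RtoC (INR n)) * Cexp t0)%C with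
    (- (RtoC (2 * PI) * Ci / RtoC (INR n) * Cexp t0))%C by ring.
  rewrite E. ring.
Qed.

(** By [saddle_far] this holds for all large n; the value 20 leaves room in
    the numerical estimates. *)
Definition far (n : nat) (t0 : C) : Prop := saddle n t0 /\ 20 <= Re t0.

Lemma far_inv n t0 : far n t0 ->
  Cmod (/ t0)%C = / Cmod t0 /\ 0 < Cmod (/ t0)%C <= 1 / 20 /\
  Cmod (/ t0)%C / 2 <= Re (/ t0)%C <= Cmod (/ t0)%C /\
  Rabs (Im (/ t0)%C) <= Re (/ t0)%C / 10.
Proof.
  intros [S Hu]. pose proof (saddle_neq0 _ _ S) as N.
  pose proof (Cmod_ge_Re t0) as L. pose proof (saddle_Cmod_le _ _ S) as Hle.
  assert (E : Cmod (/ t0)%C = / Cmod t0) by (apply Cmod_inv, N).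
  assert (Hm : 0 < Cmod t0) by lra.
  assert (Hi : 0 < / Cmod t0) by (apply Rinv_0_lt_compat, Hm).
  assert (H20 : / Cmod t0 <= 1 / 20).
  { replace (1 / 20) with (/ 20) by field. apply Rinv_le_contravar; lra. }
  split; [exact E|]. rewrite E. split; [lra|].
  destruct S as (Hn & Hu0 & Hv & _).
  assert (Sq := Cmod_sqr t0).
  assert (HR : Re (/ t0)%C = Re t0 / Cmod t0 ^ 2) by (rewrite Sq; reflexivity).
  assert (HI : Im (/ t0)%C = - Im t0 / Cmod t0 ^ 2) by (rewrite Sq; reflexivity).
  generalize PI_4; intros H4.
  assert (P2 : 0 < / (Cmod t0 ^ 2)) by (apply Rinv_0_lt_compat; nra).
  assert (E1 : / Cmod t0 = Cmod t0 * / (Cmod t0 ^ 2)) by (field; lra).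
  rewrite HR, HI. unfold Rdiv. rewrite E1. split; [split|].
  - nra.
  - apply Rmult_le_compat_r; lra.
  - rewrite Rabs_mult, Rabs_Ropp, (Rabs_right (Im t0)), (Rabs_right (/ _)) by lra. nra.
Qed.

Lemma Re_Clog z : Re (Clog z) = ln (Cmod z).
Proof. reflexivity. Qed.

Lemma shift_neq0 n t0 x : saddle n t0 -> (t0 + RtoC x)%C <> RtoC 0.
Proof.
  intros (_ & _ & Hv & _) E. apply (f_equal Im) in E. rewrite im_plus, !im_RtoC in E. lra.
Qed.

Lemma Cmod_shift_sqr t0 x : t0 <> RtoC 0 ->
  Cmod (t0 + RtoC x)%C ^ 2 = Cmod t0 ^ 2 * (1 + 2 * Re (/ t0)%C * x + Cmod (/ t0)%C ^ 2 * x ^ 2).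
Proof.
  intros N. pose proof (proj1 (Cmod_gt_0 t0) N) as Hm. rewrite Cmod_inv by exact N.
  assert (Sq := Cmod_sqr t0).
  assert (HR : Re (/ t0)%C = Re t0 / Cmod t0 ^ 2) by (rewrite Sq; reflexivity).
  rewrite HR.
  replace (Cmod t0 ^ 2 * (1 + 2 * (Re t0 / Cmod t0 ^ 2) * x + (/ Cmod t0) ^ 2 * x ^ 2)) with
   (Cmod t0 ^ 2 + 2 * Re t0 * x + x ^ 2) by (field; lra).
  rewrite Sq, Cmod_sqr, re_plus, im_plus, re_RtoC, im_RtoC. ring.
Qed.

(** This is ln (1 + X) <= X for |1 + x / t0|^2 = 1 + X. *)
Lemma ln_ratio n t0 x : saddle n t0 ->
  ln (Cmod (t0 + RtoC x)%C) - ln (Cmod t0) <= Re (/ t0)%C * x + Cmod (/ t0)%C ^ 2 * x ^ 2 / 2.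
Proof.
  intros S. pose proof (saddle_neq0 _ _ S) as N. pose proof (shift_neq0 _ _ x S) as Nx.
  apply Cmod_gt_0 in Nx. pose proof (Cmod_shift_sqr t0 x N) as E. apply Cmod_gt_0 in N.
  set (X := 2 * Re (/ t0)%C * x + Cmod (/ t0)%C ^ 2 * x ^ 2) in *.
  assert (HX : 0 < 1 + X).
  { apply Rmult_lt_reg_l with (Cmod t0 ^ 2); [apply pow_lt, N|].
    rewrite Rmult_0_r. replace (1 + X) with (1 + 2 * Re (/ t0)%C * x + Cmod (/ t0)%C ^ 2 * x ^ 2) by (unfold X; ring).
    rewrite <- E. apply pow_lt, Nx. }
  assert (L : ln (1 + X) <= X).
  { rewrite <- (ln_exp X) at 2. apply ln_le; [exact HX|].
    apply exp_ineq1_le. }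
  assert (2 * ln (Cmod (t0 + RtoC x)%C) = 2 * ln (Cmod t0) + ln (1 + X)).
  { replace (2 * ln (Cmod (t0 + RtoC x)%C)) with (ln (Cmod (t0 + RtoC x)%C ^ 2))
      by (rewrite ln_pow by exact Nx; simpl; ring).
    replace (2 * ln (Cmod t0)) with (ln (Cmod t0 ^ 2)) by (rewrite ln_pow by exact N; simpl; ring).
    rewrite <- ln_mult by (try apply pow_lt; assumption). f_equal. rewrite E. unfold X. ring. }
  unfold X in *. lra.
Qed.

Lemma Re_psi_incr n t0 x : saddle n t0 ->
  Re (psi_incr n t0 x) = Re (/ t0)%C * (exp x - 1) - (ln (Cmod (t0 + RtoC x)%C) - ln (Cmod t0)).
Proof.
  intros S. rewrite (psi_incr_eq _ _ _ S), !re_minus, re_mult, !Re_Clog.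
  rewrite re_minus, im_minus, !re_RtoC, !im_RtoC. ring.
Qed.

Lemma exp_quad x : -2 <= x -> x ^ 2 / 4 <= exp x - 1 - x.
Proof.
  intros Hx. replace (exp x) with (exp (x / 2) * exp (x / 2)) by (rewrite <- exp_plus; f_equal; field).
  pose proof (exp_ineq1_le (x / 2)).
  nra.
Qed.

(** The linear terms of the exponential and of the logarithm cancel, and
    e^x - 1 - x >= x^2 / 4 dominates the quadratic term |w|^2 x^2 / 2 of
    [ln_ratio], since |w| <= 1/20. *)
Lemma gap_near n t0 x : far n t0 -> -2 <= x ->
  Cmod (/ t0)%C * x ^ 2 / 16 <= Re (psi_incr n t0 x).
Proof.
  intros F Hx. destruct (far_inv _ _ F) as (_ & [W0 W1] & [R0 R1] & _). destruct F as [S Hu].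
  rewrite (Re_psi_incr _ _ _ S). pose proof (ln_ratio _ _ x S) as L.
  pose proof (exp_quad x Hx) as Q. set (w := Cmod (/ t0)%C) in *. set (r := Re (/ t0)%C) in *.
  assert (0 <= x ^ 2) by apply pow2_ge_0.
  assert (r * (x ^ 2 / 4) <= r * (exp x - 1 - x)) by (apply Rmult_le_compat_l; lra).
  assert (w / 2 * (x ^ 2 / 4) <= r * (x ^ 2 / 4)) by (apply Rmult_le_compat_r; lra).
  assert (w * w * x ^ 2 <= w * (1 / 20) * x ^ 2) by (apply Rmult_le_compat_r; [lra|apply Rmult_le_compat_l; lra]).
  nra.
Qed.

(** Here |t0 + x| is smaller than |t0 - 2|, so the logarithm is at most its
    value at x = -2, and there [ln_ratio] suffices. *)
Lemma gap_far n t0 x : far n t0 -> - Re t0 <= x <= -2 ->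
  Cmod (/ t0)%C / 8 <= Re (psi_incr n t0 x).
Proof.
  intros F Hx. destruct (far_inv _ _ F) as (_ & [W0 W1] & [R0 R1] & _). destruct F as [S Hu].
  rewrite (Re_psi_incr _ _ _ S). pose proof (ln_ratio _ _ (-2) S) as L.
  assert (M : ln (Cmod (t0 + RtoC x)%C) <= ln (Cmod (t0 + RtoC (-2))%C)).
  { apply ln_le; [apply Cmod_gt_0, (shift_neq0 _ _ _ S)|].
    unfold Cmod. apply sqrt_le_1_alt.
    change (fst (t0 + RtoC x)%C) with (Re t0 + x). change (fst (t0 + RtoC (-2))%C) with (Re t0 + -2).
    change (snd (t0 + RtoC x)%C) with (Im t0 + 0). change (snd (t0 + RtoC (-2))%C) with (Im t0 + 0).
    apply Rplus_le_compat_r. apply pow_incr. lra. }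
  set (w := Cmod (/ t0)%C) in *. set (r := Re (/ t0)%C) in *.
  assert (0 < exp x) by apply exp_pos. nra.
Qed.

Lemma Carg_atan z : 0 < Re z -> 0 < Im z -> Carg z = atan (Im z / Re z).
Proof.
  intros HR HI. unfold Carg. destruct (Rle_dec 0 (Im z)) as [_|N]; [|lra].
  assert (Hm : 0 < Cmod z) by (generalize (Cmod_ge_Re z); lra).
  assert (Hd : 0 < Im z / Re z) by (apply Rmult_lt_0_compat; [exact HI|apply Rinv_0_lt_compat, HR]).
  rewrite <- (acos_cos (atan (Im z / Re z))).
  - f_equal. rewrite cos_atan.
    assert (E : 1 + (Im z / Re z)² = (Cmod z / Re z) ^ 2).
    { unfold Rsqr. replace ((Cmod z / Re z) ^ 2) with (Cmod z ^ 2 / Re z ^ 2) by (field; lra).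
      rewrite Cmod_sqr. field. lra. }
    rewrite E, sqrt_pow2 by (apply Rmult_le_pos; [lra|left; apply Rinv_0_lt_compat, HR]).
    field. lra.
  - pose proof (atan_bound (Im z / Re z)) as B. generalize PI_RGT_0; intros.
    assert (0 < atan (Im z / Re z)) by (rewrite <- atan_0; apply atan_increasing, Hd). lra.
Qed.

Lemma Cderiv_Clog t0 x : 0 < Im t0 -> 0 < Re t0 + x ->
  Cderiv (fun x => Clog (t0 + RtoC x)) x (/ (t0 + RtoC x))%C.
Proof.
  intros Hv Hu.
  set (u := Re t0) in *. set (v := Im t0) in *.
  assert (D : 0 < (u + x) ^ 2 + v ^ 2) by nra.
  split.
  - apply (is_derive_ext (fun x => ln ((u + x) ^ 2 + v ^ 2) / 2)).
    { intros t. rewrite Re_Clog.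
      assert (E : (u + t) ^ 2 + v ^ 2 = Cmod (t0 + RtoC t)%C ^ 2).
      { rewrite Cmod_sqr, re_plus, im_plus, re_RtoC, im_RtoC. fold u v. ring. }
      rewrite E.
      assert (0 < Cmod (t0 + RtoC t)%C).
      { apply Cmod_gt_0. intros Z. apply (f_equal Im) in Z. rewrite im_plus, !im_RtoC in Z. fold v in Z. lra. }
      rewrite ln_pow by assumption. simpl. field. }
    evar_last.
    + auto_derive; [simpl in D; lra|reflexivity].
    + change (Re (/ (t0 + RtoC x))%C) with ((u + x) / ((u + x) ^ 2 + (v + 0) ^ 2)).
      rewrite Rplus_0_r. field. simpl in D |- *. lra.
  - apply (is_derive_ext_loc (fun x => atan (v / (u + x)))).
    { exists (mkposreal (u + x) Hu). intros t Ht. apply Rabs_lt_between in Ht. simpl in Ht.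
      unfold minus, plus, opp in Ht; simpl in Ht.
      change (atan (v / (u + t)) = Carg (t0 + RtoC t)%C).
      rewrite Carg_atan, re_plus, im_plus, re_RtoC, im_RtoC, Rplus_0_r; [reflexivity| |].
      - rewrite re_plus, re_RtoC. fold u. lra.
      - rewrite im_plus, im_RtoC. fold v. lra. }
    evar_last.
    + auto_derive; [lra|reflexivity].
    + change (Im (/ (t0 + RtoC x))%C) with (- (v + 0) / ((u + x) ^ 2 + (v + 0) ^ 2)).
      rewrite Rplus_0_r. field. split; [|lra]. simpl in D. nra.
Qed.

(** * Taylor truncations with uniform constants *)

Definition tpoly (a : nat -> C) (M : nat) (x : R) : C := Csum (fun k => a k * RtoC x ^ k)%C M.

Definition conv (a b : nat -> C) (k : nat) : C := Csum (fun i => a i * b (k - i)%nat)%C (S k).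

(** The coefficients of the j-th power of a series; without constant term they
    are the partial ordinary Bell polynomials ([bell_cpow]). *)
Fixpoint cpow (a : nat -> C) (j : nat) : nat -> C :=
  match j with
  | O => fun k => match k with O => RtoC 1 | S _ => RtoC 0 end
  | S i => conv a (cpow a i)
  end.

Lemma Csum_triangle (F : nat -> nat -> C) M :
  Csum (fun k => Csum (fun i => F i (k - i)%nat) (S k)) M = Csum (fun i => Csum (F i) (M - i)) M.
Proof.
  induction M as [|M IH]; [reflexivity|].
  change (Csum (fun k => Csum (fun i => F i (k - i)%nat) (S k)) (S M)) with
    (Csum (fun k => Csum (fun i => F i (k - i)%nat) (S k)) M + Csum (fun i => F i (M - i)%nat) (S M))%C.
  rewrite IH.
  change (Csum (fun i => Csum (F i) (S M - i)) (S M)) with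
    (Csum (fun i => Csum (F i) (S M - i)) M + Csum (F M) (S M - M))%C.
  change (Csum (fun i => F i (M - i)%nat) (S M)) with
    (Csum (fun i => F i (M - i)%nat) M + F M (M - M)%nat)%C.
  rewrite (Csum_ext (fun i => Csum (F i) (S M - i)) (fun i => Csum (F i) (M - i) + F i (M - i)%nat)%C).
  - rewrite Csum_plus. replace (S M - M)%nat with 1%nat by lia.
    replace (M - M)%nat with 0%nat by lia. simpl. ring.
  - intros i Hi. replace (S M - i)%nat with (S (M - i)) by lia. reflexivity.
Qed.

Lemma poly_conv a b M x :
  tpoly (conv a b) M x = Csum (fun i => a i * RtoC x ^ i * tpoly b (M - i) x)%C M.
Proof.
  unfold tpoly.
  rewrite (Csum_ext (fun k => conv a b k * RtoC x ^ k)%C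
    (fun k => Csum (fun i => (fun i j => (a i * RtoC x ^ i) * (b j * RtoC x ^ j))%C i (k - i)%nat) (S k))).
  - rewrite (Csum_triangle (fun i j => (a i * RtoC x ^ i) * (b j * RtoC x ^ j))%C). apply Csum_ext. intros i _. rewrite <- Csum_scal. reflexivity.
  - intros k _. unfold conv. rewrite Cmult_comm, <- Csum_scal. apply Csum_ext. intros i Hi.
    cbv beta. replace (RtoC x ^ k)%C with (RtoC x ^ i * RtoC x ^ (k - i))%C.
    + ring.
    + rewrite <- Cpow_add_r. f_equal. lia.
Qed.

Lemma Rabs_pow_le_1 x k : Rabs x <= 1 -> Rabs x ^ k <= 1.
Proof. intros H. apply pow_le_1. split; [apply Rabs_pos|exact H]. Qed.

Lemma pow_le_pow x k m : Rabs x <= 1 -> (m <= k)%nat -> Rabs x ^ k <= Rabs x ^ m.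
Proof.
  intros H L. replace k with (m + (k - m))%nat by lia. rewrite pow_add.
  pose proof (Rabs_pow_le_1 x (k - m) H). assert (0 <= Rabs x ^ m) by (apply pow_le, Rabs_pos). nra.
Qed.

Lemma Cmod_Rpow x k : Cmod (RtoC x ^ k)%C = Rabs x ^ k.
Proof. rewrite Cmod_pow, Cmod_R. reflexivity. Qed.

(** The same constant K bounds the truncation error on [-1, 1] and the
    coefficients, so that products and powers stay in the class with explicit
    constants. These constants carry the uniformity in n. *)
Definition approx (g : R -> C) (a : nat -> C) (M : nat) (K : R) : Prop :=
  0 <= K /\
  (forall x, Rabs x <= 1 -> Cmod (g x - tpoly a M x)%C <= K * Rabs x ^ M) /\
  (forall k, (k < M)%nat -> Cmod (a k) <= K).

Lemma poly_bound a M K x : Rabs x <= 1 -> (forall k, (k < M)%nat -> Cmod (a k) <= K) ->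
  Cmod (tpoly a M x) <= INR M * K.
Proof.
  intros Hx H. apply Csum_bound. intros k Hk. rewrite Cmod_mult, Cmod_Rpow.
  pose proof (Rabs_pow_le_1 x k Hx). assert (0 <= Rabs x ^ k) by (apply pow_le, Rabs_pos).
  specialize (H k Hk). generalize (Cmod_ge_0 (a k)); intros; nra.
Qed.

Lemma approx_bound g a M K x : approx g a M K -> Rabs x <= 1 -> Cmod (g x) <= (1 + INR M) * K.
Proof.
  intros (HK & H1 & H2) Hx. replace (g x) with ((g x - tpoly a M x) + tpoly a M x)%C by ring.
  eapply Rle_trans; [apply Cmod_triangle|].
  pose proof (poly_bound a M K x Hx H2). specialize (H1 x Hx).
  pose proof (Rabs_pow_le_1 x M Hx). assert (0 <= Rabs x ^ M) by (apply pow_le, Rabs_pos). nra.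
Qed.

Lemma approx_bound_lin g a M K x : (1 <= M)%nat -> a 0%nat = RtoC 0 -> approx g a M K -> Rabs x <= 1 ->
  Cmod (g x) <= (1 + INR M) * K * Rabs x.
Proof.
  intros HM H0 (HK & H1 & H2) Hx. destruct M as [|M]; [lia|].
  replace (g x) with ((g x - tpoly a (S M) x) + tpoly a (S M) x)%C by ring.
  eapply Rle_trans; [apply Cmod_triangle|].
  assert (P : Cmod (tpoly a (S M) x) <= INR (S M) * (K * Rabs x)).
  { apply Csum_bound. intros k Hk. rewrite Cmod_mult, Cmod_Rpow.
    destruct k as [|k]; [rewrite H0, Cmod_0, Rmult_0_l; apply Rmult_le_pos; [exact HK|apply Rabs_pos]|].
    pose proof (pow_le_pow x (S k) 1 Hx ltac:(lia)). rewrite pow_1 in H.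
    apply Rmult_le_compat; auto using Cmod_ge_0. apply pow_le, Rabs_pos. }
  specialize (H1 x Hx). pose proof (pow_le_pow x (S M) 1 Hx ltac:(lia)). rewrite pow_1 in H.
  assert (K * Rabs x ^ S M <= K * Rabs x) by (apply Rmult_le_compat_l; assumption).
  generalize (pos_INR (S M)); intros. nra.
Qed.

(** The terms in which the product of two truncations exceeds the truncation
    of the product have degree at least M. *)
Lemma approx_mult g h a b M K1 K2 : approx g a M K1 -> approx h b M K2 ->
  approx (fun x => g x * h x)%C (conv a b) M ((1 + INR M) ^ 2 * (K1 * K2)).
Proof.
  intros G H. pose proof G as (HK1 & G1 & G2). pose proof H as (HK2 & H1 & H2).
  pose proof (pos_INR M) as HM. assert (HK : 0 <= K1 * K2) by (apply Rmult_le_pos; assumption).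
  split; [nra|split].
  - intros x Hx.
    assert (D : Cmod (tpoly a M x * tpoly b M x - tpoly (conv a b) M x)%C <=
       INR M * (INR M * (K1 * K2 * Rabs x ^ M))).
    { rewrite poly_conv.
      replace (tpoly a M x * tpoly b M x)%C with (Csum (fun i => a i * RtoC x ^ i * tpoly b M x)%C M).
      2:{ rewrite (Csum_ext _ (fun i => tpoly b M x * (a i * RtoC x ^ i))%C) by (intros; ring).
          rewrite Csum_scal. unfold tpoly at 2. ring. }
      rewrite <- Csum_minus. apply Csum_bound. intros i Hi.
      replace (a i * RtoC x ^ i * tpoly b M x - a i * RtoC x ^ i * tpoly b (M - i) x)%C with
        (a i * RtoC x ^ i * Csum (fun k => b (M - i + k)%nat * RtoC x ^ (M - i + k)) i)%C.
      2:{ unfold tpoly. replace (Csum (fun k => b k * RtoC x ^ k)%C M) with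
            (Csum (fun k => b k * RtoC x ^ k)%C (M - i + i)) by (f_equal; lia).
          rewrite Csum_split. ring. }
      rewrite <- Csum_scal.
      apply Rle_trans with (INR i * (K1 * K2 * Rabs x ^ M)).
      - apply Csum_bound. intros k Hk. rewrite !Cmod_mult, !Cmod_Rpow.
        replace (Cmod (a i) * Rabs x ^ i * (Cmod (b (M - i + k)%nat) * Rabs x ^ (M - i + k))) with
          (Cmod (a i) * Cmod (b (M - i + k)%nat) * (Rabs x ^ (i + (M - i + k)))) by (rewrite (pow_add _ i); ring).
        apply Rmult_le_compat.
        + apply Rmult_le_pos; apply Cmod_ge_0.
        + apply pow_le, Rabs_pos.
        + apply Rmult_le_compat; try apply Cmod_ge_0; [apply G2|apply H2]; lia.
        + apply pow_le_pow; [exact Hx|lia].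
      - apply Rmult_le_compat_r; [apply Rmult_le_pos; [exact HK|apply pow_le, Rabs_pos]|].
        apply le_INR; lia. }
    replace (g x * h x - tpoly (conv a b) M x)%C with
      ((g x - tpoly a M x) * h x + tpoly a M x * (h x - tpoly b M x) +
       (tpoly a M x * tpoly b M x - tpoly (conv a b) M x))%C by ring.
    eapply Rle_trans; [apply Cmod_triangle|].
    eapply Rle_trans; [apply Rplus_le_compat; [apply Cmod_triangle|exact D]|].
    rewrite !Cmod_mult.
    pose proof (approx_bound h b M K2 x H Hx) as Bh. pose proof (poly_bound a M K1 x Hx G2) as Ba.
    specialize (G1 x Hx). specialize (H1 x Hx).
    set (p := Rabs x ^ M) in *. assert (Hp : 0 <= p) by (apply pow_le, Rabs_pos).
    assert (E1 : Cmod (g x - tpoly a M x)%C * Cmod (h x) <= (K1 * p) * ((1 + INR M) * K2))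
      by (apply Rmult_le_compat; auto using Cmod_ge_0).
    assert (E2 : Cmod (tpoly a M x) * Cmod (h x - tpoly b M x)%C <= (INR M * K1) * (K2 * p))
      by (apply Rmult_le_compat; auto using Cmod_ge_0).
    assert (0 <= K1 * K2 * p) by (apply Rmult_le_pos; assumption).
    replace ((1 + INR M) ^ 2 * (K1 * K2) * p) with
      (K1 * p * ((1 + INR M) * K2) + INR M * K1 * (K2 * p) + INR M * (INR M * (K1 * K2 * p))) by ring.
    lra.
  - intros k Hk. unfold conv.
    apply Rle_trans with (INR (S k) * (K1 * K2)).
    + apply Csum_bound. intros i Hi. rewrite Cmod_mult.
      apply Rmult_le_compat; try apply Cmod_ge_0; [apply G2|apply H2]; lia.
    + apply Rmult_le_compat_r; [exact HK|]. apply Rle_trans with (INR M); [apply le_INR; lia|nra].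
Qed.

Lemma approx_weaken g a M K K' : K <= K' -> approx g a M K -> approx g a M K'.
Proof.
  intros L (HK & H1 & H2). split; [lra|split].
  - intros x Hx. eapply Rle_trans; [apply H1, Hx|].
    apply Rmult_le_compat_r; [apply pow_le, Rabs_pos|exact L].
  - intros k Hk. specialize (H2 k Hk). lra.
Qed.

Fixpoint pow_const (M : nat) (K : R) (j : nat) : R :=
  match j with O => 1 | S i => (1 + INR M) ^ 2 * (K * pow_const M K i) end.

Lemma approx_pow g a M K j : approx g a M K -> approx (fun x => g x ^ j)%C (cpow a j) M (pow_const M K j).
Proof.
  intros G. induction j as [|j IH].
  - simpl. split; [lra|split].
    + intros x Hx. rewrite Rmult_1_l. destruct M as [|M].
      * unfold tpoly; simpl. replace (RtoC 1 - RtoC 0)%C with (RtoC 1) by ring. rewrite Cmod_1; lra.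
      * unfold tpoly. rewrite Csum_shift.
        rewrite Csum_zero by (intros; ring). simpl.
        replace (_ - _)%C with (RtoC 0) by ring. rewrite Cmod_0.
        apply Rmult_le_pos; [apply Rabs_pos|apply pow_le, Rabs_pos].
    + intros [|k] _; simpl; [rewrite Cmod_1|rewrite Cmod_0]; lra.
  - simpl. apply approx_mult; assumption.
Qed.

Lemma cpow_zero a j k : a 0%nat = RtoC 0 -> (k < j)%nat -> cpow a j k = RtoC 0.
Proof.
  intros H0. revert k. induction j as [|j IH]; intros k Hk; [lia|].
  simpl. apply Csum_zero. intros i Hi. destruct i as [|i]; [rewrite H0; ring|].
  rewrite IH by lia. ring.
Qed.

(** * The expansions of the phase and of the amplitude *)

(** [mean_value_inequality] on both sides of 0. *)
Lemma flat_bound (F F1 : R -> C) K M : 0 <= K -> F 0 = RtoC 0 ->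
  (forall x, Rabs x <= 1 -> Cderiv F x (F1 x)) ->
  (forall x, Rabs x <= 1 -> Cmod (F1 x) <= K * Rabs x ^ M) ->
  forall x, Rabs x <= 1 -> Cmod (F x) <= K * Rabs x ^ S M.
Proof.
  intros HK F0 HD HB x Hx.
  assert (pos : forall (F F1 : R -> C) x, 0 <= x <= 1 -> F 0 = RtoC 0 ->
    (forall x, 0 <= x <= 1 -> Cderiv F x (F1 x)) ->
    (forall x, 0 <= x <= 1 -> Cmod (F1 x) <= K * x ^ M) -> Cmod (F x) <= K * x ^ S M).
  { clear. intros F F1 x Hx F0 HD HB.
    replace (F x) with (F x - F 0)%C by (rewrite F0; ring).
    assert (Q : 0 <= K * x ^ M).
    { eapply Rle_trans; [apply Cmod_ge_0|apply (HB x); lra]. }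
    apply Rle_trans with (K * x ^ M * x - K * x ^ M * 0); [|simpl; right; ring].
    apply (mean_value_inequality F F1 (fun s => K * x ^ M * s) (fun _ => K * x ^ M)); [lra| | |].
    - intros y Hy. apply HD; lra.
    - intros y Hy. apply is_derive_lin.
    - intros y Hy.
      assert (Q1 : 0 <= K * 1 ^ M) by (eapply Rle_trans; [apply Cmod_ge_0|apply (HB 1); lra]).
      rewrite pow1 in Q1.
      eapply Rle_trans; [apply HB; lra|]. apply Rmult_le_compat_l; [lra|]. apply pow_incr; lra. }
  destruct (Rle_dec 0 x) as [P|P].
  - rewrite (Rabs_right x) in Hx |- * by lra. apply (pos F F1); auto.
    + intros y Hy. apply HD. rewrite Rabs_right; lra.
    + intros y Hy. specialize (HB y). rewrite Rabs_right in HB by lra. apply HB; lra.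
  - rewrite (Rabs_left x) in Hx |- * by lra.
    replace (F x) with (F (- (- x))) by (f_equal; ring).
    apply (pos (fun t => F (- t)) (fun t => - F1 (- t)%R)%C); [lra|rewrite Ropp_0; exact F0| |].
    + intros y Hy. eapply Cderiv_eq.
      * apply (Cderiv_comp F (fun t => - t) y (F1 (- y)) (-1)).
        -- apply HD. rewrite Rabs_Ropp, Rabs_right; lra.
        -- auto_derive; [exact I|ring].
      * apply C_ext; simpl; unfold Re, Im; ring.
    + intros y Hy. rewrite Cmod_opp. specialize (HB (- y)).
      rewrite Rabs_Ropp, Rabs_right in HB by lra. apply HB; lra.
Qed.

Lemma approx_exp M : approx (fun x => RtoC (exp x)) (fun k => RtoC (/ INR (fact k))) M 3.
Proof.
  split; [lra|split].
  - intros x Hx.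
    pose proof (exp_taylor (- RtoC x)%C M 3) as T.
    assert (E3 : exp (- Re (- RtoC x)%C) <= 3).
    { rewrite re_opp, re_RtoC, Ropp_involutive. eapply Rle_trans; [apply exp_le|apply exp_le_3].
      generalize (Rle_abs x); lra. }
    specialize (T ltac:(lra) E3). rewrite Cmod_opp, Cmod_R in T.
    replace (- - RtoC x)%C with (RtoC x) in T by ring.
    rewrite Cexp_RtoC in T. rewrite Rmult_comm.
    replace (tpoly (fun k => RtoC (/ INR (fact k))) M x) with (Csum (expterm (- RtoC x)%C) M); [exact T|].
    unfold tpoly. apply Csum_ext. intros k _. unfold expterm.
    replace (- - RtoC x)%C with (RtoC x) by ring. rewrite RtoC_inv by apply INR_fact_neq_0.
    unfold Cdiv; ring.
  - intros k _. pose proof (inv_fact_le_1 k). rewrite Cmod_R, Rabs_right; lra.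
Qed.

Lemma geom_identity (w : C) (x : R) M : (1 + w * RtoC x)%C <> RtoC 0 ->
  (/ (1 + w * RtoC x) - Csum (fun k => (- w) ^ k * RtoC x ^ k) M)%C =
  ((- w) ^ M * RtoC x ^ M / (1 + w * RtoC x))%C.
Proof.
  intros N. induction M as [|M IH].
  - simpl. field. exact N.
  - simpl Csum. replace (_ - (_ + _))%C with
      (/ (1 + w * RtoC x) - Csum (fun k => (- w) ^ k * RtoC x ^ k) M - (- w) ^ M * RtoC x ^ M)%C by ring.
    rewrite IH. simpl. field. exact N.
Qed.

Lemma small_den (w : C) x : Cmod w <= 1 / 20 -> Rabs x <= 1 -> 1 / 2 <= Cmod (1 + w * RtoC x)%C.
Proof.
  intros Hw Hx. pose proof (Cmod_1_minus_ge (- (w * RtoC x))%C) as H.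
  replace (1 - - (w * RtoC x))%C with (1 + w * RtoC x)%C in H by ring.
  rewrite Cmod_opp, Cmod_mult, Cmod_R in H. generalize (Cmod_ge_0 w) (Rabs_pos x); intros. nra.
Qed.

Lemma approx_geom (w : C) M : Cmod w <= 1 / 20 ->
  approx (fun x => / (1 + w * RtoC x))%C (fun k => (- w) ^ k)%C M 2.
Proof.
  intros Hw. assert (P : forall k, Cmod ((- w) ^ k)%C <= 1).
  { intros k. rewrite Cmod_pow, Cmod_opp. apply pow_le_1. generalize (Cmod_ge_0 w); lra. }
  split; [lra|split].
  - intros x Hx. pose proof (small_den w x Hw Hx) as D.
    assert (N : (1 + w * RtoC x)%C <> RtoC 0) by (apply Cmod_gt_0; lra).
    unfold tpoly. rewrite geom_identity by exact N.
    rewrite Cmod_div, Cmod_mult, Cmod_Rpow by exact N.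
    assert (0 <= Rabs x ^ M) by (apply pow_le, Rabs_pos).
    apply Rmult_le_reg_r with (Cmod (1 + w * RtoC x)%C); [lra|].
    unfold Rdiv. rewrite Rmult_assoc, Rinv_l by lra.
    specialize (P M). generalize (Cmod_ge_0 ((- w) ^ M)%C); intros. nra.
  - intros k _. specialize (P k). lra.
Qed.

(** The Taylor coefficients of log (1 + w x). *)
Definition logterm (w : C) (m : nat) : C :=
  match m with O => RtoC 0 | S r => (w * (- w) ^ r / RtoC (INR (S r)))%C end.

Lemma Cderiv_poly_primitive (c : nat -> C) M x :
  Cderiv (fun x => Csum (fun r => c r / RtoC (INR (S r)) * RtoC x ^ S r)%C M) x
    (Csum (fun r => c r * RtoC x ^ r)%C M).
Proof.
  induction M as [|M IH]; simpl Csum; [apply Cderiv_const|].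
  apply (Cderiv_plus (fun x => Csum (fun r => c r / RtoC (INR (S r)) * RtoC x ^ S r)%C M)
    (fun x => c M / RtoC (INR (S M)) * RtoC x ^ S M)%C); [exact IH|].
  eapply Cderiv_eq.
  - apply Cderiv_scal. apply (Cderiv_pow (fun x => RtoC x)). apply Cderiv_id.
  - replace (S M - 1)%nat with M by lia. field. apply RtoC_neq0, not_0_INR; lia.
Qed.

(** The derivative w / (1 + w x) is a geometric series with explicit
    remainder, which [flat_bound] integrates. *)
Lemma log_taylor n t0 M : far n t0 -> forall x, Rabs x <= 1 ->
  Cmod (Clog (t0 + RtoC x) - Clog t0 - tpoly (logterm (/ t0)) (S M) x)%C <=
  2 * Cmod (/ t0)%C ^ S M * Rabs x ^ S M.
Proof.
  intros F. destruct (far_inv _ _ F) as (_ & [W0 W1] & _ & _).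
  destruct F as [Sd Hu]. pose proof (saddle_neq0 _ _ Sd) as N0. set (w := (/ t0)%C) in *.
  apply (flat_bound (fun x => Clog (t0 + RtoC x) - Clog t0 - tpoly (logterm w) (S M) x)%C
    (fun x => / (t0 + RtoC x) - w * tpoly (fun k => (- w) ^ k) M x)%C).
  - assert (0 <= Cmod w ^ S M) by (apply pow_le; lra). lra.
  - unfold tpoly. rewrite Csum_shift. simpl logterm at 1.
    rewrite Csum_zero by (intros k _; simpl; ring). replace (t0 + RtoC 0)%C with t0 by ring. ring.
  - intros x Hx. eapply Cderiv_eq.
    + apply Cderiv_minus; [apply Cderiv_minus; [apply Cderiv_Clog|apply Cderiv_const]|].
      * destruct Sd as (_ & _ & Hv & _). lra.
      * apply Rabs_le_between in Hx. lra.
      * apply (Cderiv_ext (fun x => logterm w 0 * RtoC 1 +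
           Csum (fun r => (w * (- w) ^ r) / RtoC (INR (S r)) * RtoC x ^ S r) M)%C).
        { intros t. unfold tpoly. rewrite Csum_shift. f_equal. }
        apply Cderiv_plus; [apply Cderiv_const|]. apply (Cderiv_poly_primitive (fun r => w * (- w) ^ r)%C).
    + unfold tpoly. rewrite <- Csum_scal.
      rewrite (Csum_ext (fun k => w * ((- w) ^ k * RtoC x ^ k))%C (fun r => w * (- w) ^ r * RtoC x ^ r)%C)
        by (intros; ring). ring.
  - intros x Hx. pose proof (small_den w x W1 Hx) as D.
    assert (N : (1 + w * RtoC x)%C <> RtoC 0) by (apply Cmod_gt_0; lra).
    assert (Nx : (t0 + RtoC x)%C <> RtoC 0) by (apply (shift_neq0 _ _ _ Sd)).
    assert (E : (/ (t0 + RtoC x))%C = (w * / (1 + w * RtoC x))%C).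
    { unfold w. field. repeat split; auto. }
    rewrite E, <- Cmult_minus_distr_l.
    unfold tpoly. rewrite geom_identity by exact N.
    rewrite Cmod_mult, Cmod_div, Cmod_mult, Cmod_Rpow, Cmod_pow, Cmod_opp by exact N.
    assert (0 <= Rabs x ^ M) by (apply pow_le, Rabs_pos).
    assert (0 <= Cmod w ^ M) by (apply pow_le; lra).
    simpl. replace (2 * (Cmod w * Cmod w ^ M) * Rabs x ^ M) with
      (Cmod w * (Cmod w ^ M * Rabs x ^ M * 2)) by ring.
    apply Rmult_le_compat_l; [lra|].
    apply Rmult_le_compat_l; [nra|].
    replace 2 with (/ (1 / 2)) by field. apply Rinv_le_contravar; lra.
Qed.

(** The coefficient of x^r in (psi (t0 + x) - psi t0) / (w x^2), w = 1 / t0. *)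
Definition phase_coef (w : C) (r : nat) : C :=
  (RtoC (/ INR (fact (S (S r)))) - (- w) ^ S r / RtoC (INR (S (S r))))%C.

Definition phase_tail_coef (w : C) (r : nat) : C := match r with O => RtoC 0 | S _ => phase_coef w r end.

Lemma poly_shift a M x : tpoly a (S M) x = (a 0%nat + RtoC x * tpoly (fun k => a (S k)) M x)%C.
Proof.
  unfold tpoly. rewrite Csum_shift, <- Csum_scal. f_equal; [simpl; ring|].
  apply Csum_ext. intros k _. simpl. ring.
Qed.

Lemma inv_INR_le1 k : 0 < / INR (S k) <= 1.
Proof.
  apply inv_le_1. rewrite S_INR. generalize (pos_INR k); lra.
Qed.

Lemma phase_coef_bound w r : Cmod w <= 1 / 20 -> Cmod (phase_coef w r) <= 2.
Proof.
  intros Hw. unfold phase_coef. eapply Rle_trans; [apply Cmod_minus_le|].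
  assert (A : Cmod (RtoC (/ INR (fact (S (S r))))) <= 1).
  { pose proof (inv_fact_le_1 (S (S r))). rewrite Cmod_R, Rabs_right; lra. }
  assert (B : Cmod ((- w) ^ S r / RtoC (INR (S (S r))))%C <= 1).
  { rewrite Cmod_div by (apply RtoC_neq0, not_0_INR; lia).
    rewrite Cmod_R, Rabs_right by (apply Rle_ge, pos_INR).
    pose proof (inv_INR_le1 (S r)).
    assert (Cmod ((- w) ^ S r)%C <= 1).
    { rewrite Cmod_pow, Cmod_opp. apply pow_le_1. generalize (Cmod_ge_0 w); lra. }
    generalize (Cmod_ge_0 ((- w) ^ S r)%C); intros. unfold Rdiv. nra. }
  lra.
Qed.

Lemma psi_incr_taylor n t0 M x : far n t0 -> Rabs x <= 1 ->
  Cmod (psi_incr n t0 x - / t0 * RtoC x ^ 2 * tpoly (phase_coef (/ t0)) M x)%C <=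
  5 * Cmod (/ t0)%C * Rabs x ^ (S (S M)).
Proof.
  intros F Hx. destruct (far_inv _ _ F) as (_ & [W0 W1] & _ & _).
  pose proof (log_taylor n t0 (S M) F x Hx) as L.
  pose proof (proj1 (proj2 (approx_exp (S (S M)))) x Hx) as E.
  rewrite (psi_incr_eq n t0 x (proj1 F)). set (w := (/ t0)%C) in *.
  set (dL := (Clog (t0 + RtoC x) - Clog t0)%C) in *.
  set (pe := tpoly (fun k => RtoC (/ INR (fact k))) (S (S M)) x) in *.
  assert (I : (w * (pe - 1) - tpoly (logterm w) (S (S M)) x)%C = (w * RtoC x ^ 2 * tpoly (phase_coef w) M x)%C).
  { unfold pe. rewrite !poly_shift. simpl (fact 0). simpl (fact 1). simpl (INR 1). simpl (logterm w 0).
    simpl (logterm w 1).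
    rewrite Rinv_1.
    replace (tpoly (phase_coef w) M x) with (tpoly (fun k => RtoC (/ INR (fact (S (S k))))) M x -
      tpoly (fun k => (- w) ^ S k / RtoC (INR (S (S k))))%C M x)%C.
    2:{ unfold tpoly. rewrite <- Csum_minus. apply Csum_ext. intros k _. unfold phase_coef. ring. }
    replace (tpoly (fun k => logterm w (S (S k))) M x) with
      (w * tpoly (fun k => (- w) ^ S k / RtoC (INR (S (S k))))%C M x)%C.
    2:{ unfold tpoly. rewrite <- Csum_scal. apply Csum_ext. intros k _. unfold logterm, Cdiv. ring. }
    field. }
  rewrite <- I.
  replace (w * (RtoC (exp x) - 1) - dL - (w * (pe - 1) - tpoly (logterm w) (S (S M)) x))%C with
    (w * (RtoC (exp x) - pe) - (dL - tpoly (logterm w) (S (S M)) x))%C by ring.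
  eapply Rle_trans; [apply Cmod_minus_le|]. rewrite Cmod_mult.
  assert (P : 0 <= Rabs x ^ S (S M)) by (apply pow_le, Rabs_pos).
  assert (Q : Cmod w ^ S (S M) <= Cmod w).
  { simpl. assert (Cmod w * Cmod w ^ M <= 1); [|nra].
    change (Cmod w ^ S M <= 1). apply pow_le_1; lra. }
  assert (Cmod w * Cmod (RtoC (exp x) - pe)%C <= Cmod w * (3 * Rabs x ^ S (S M)))
    by (apply Rmult_le_compat_l; lra).
  assert (2 * Cmod w ^ S (S M) * Rabs x ^ S (S M) <= 2 * Cmod w * Rabs x ^ S (S M))
    by (apply Rmult_le_compat_r; lra).
  lra.
Qed.

(** The non-constant part of (psi (t0 + x) - psi t0) / (w x^2), with its limit
    at x = 0. *)
Definition phase_tail (n : nat) (t0 : C) (x : R) : C :=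
  if Req_EM_T x 0 then RtoC 0 else (psi_incr n t0 x / (/ t0 * RtoC x ^ 2) - phase_coef (/ t0) 0)%C.

Lemma psi_incr_0 n t0 : psi_incr n t0 0 = RtoC 0.
Proof. unfold psi_incr. replace (t0 + RtoC 0)%C with t0 by ring. ring. Qed.

Lemma Cinv_neq0 (z : C) : z <> RtoC 0 -> (/ z)%C <> RtoC 0.
Proof.
  intros N. apply Cmod_gt_0. rewrite Cmod_inv by exact N. apply Rinv_0_lt_compat.
  apply Cmod_gt_0, N.
Qed.

Lemma psi_incr_phase_tail n t0 x : t0 <> RtoC 0 ->
  psi_incr n t0 x = (/ t0 * RtoC x ^ 2 * (phase_coef (/ t0) 0 + phase_tail n t0 x))%C.
Proof.
  intros N. unfold phase_tail. destruct (Req_EM_T x 0) as [->|Hx].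
  - rewrite psi_incr_0. ring.
  - assert (RtoC x <> RtoC 0) by (apply RtoC_neq0, Hx).
    replace (phase_coef (/ t0) 0 + (psi_incr n t0 x / (/ t0 * RtoC x ^ 2) - phase_coef (/ t0) 0))%C with
      (psi_incr n t0 x / (/ t0 * RtoC x ^ 2))%C by ring.
    field. split; [exact N|exact H].
Qed.

Lemma approx_phase_tail n t0 M : far n t0 -> approx (phase_tail n t0) (phase_tail_coef (/ t0)) M 5.
Proof.
  intros F. destruct (far_inv _ _ F) as (_ & [W0 W1] & _ & _).
  pose proof (saddle_neq0 _ _ (proj1 F)) as N. pose proof (Cinv_neq0 _ N) as Nw.
  split; [lra|split].
  - intros x Hx. unfold phase_tail. destruct (Req_EM_T x 0) as [->|Hx0].
    + destruct M as [|M].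
      * unfold tpoly; simpl. replace (_ - _)%C with (RtoC 0) by ring. rewrite Cmod_0. lra.
      * rewrite poly_shift. simpl (phase_tail_coef _ 0). replace (_ - _)%C with (RtoC 0) by ring.
        rewrite Cmod_0. apply Rmult_le_pos; [lra|apply pow_le, Rabs_pos].
    + destruct M as [|M].
      * pose proof (psi_incr_taylor n t0 1 x F Hx) as T. rewrite poly_shift in T.
        set (w := (/ t0)%C) in *.
        assert (Nx : RtoC x <> RtoC 0) by (apply RtoC_neq0, Hx0).
        unfold tpoly at 1 in T. simpl Csum in T. unfold tpoly. simpl Csum.
        apply Rmult_le_reg_r with (Cmod (w * RtoC x ^ 2)%C).
        { rewrite Cmod_mult, Cmod_Rpow. apply Rmult_lt_0_compat; [exact W0|]. apply pow_lt, Rabs_pos_lt, Hx0. }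
        rewrite <- Cmod_mult.
        replace ((psi_incr n t0 x / (w * RtoC x ^ 2) - phase_coef w 0 - 0) * (w * RtoC x ^ 2))%C with
          (psi_incr n t0 x - w * RtoC x ^ 2 * (phase_coef w 0 + RtoC x * 0))%C by (field; auto).
        eapply Rle_trans; [exact T|]. rewrite Cmod_mult, Cmod_Rpow. simpl.
        assert (0 <= Rabs x * Rabs x) by (apply Rmult_le_pos; apply Rabs_pos).
        generalize (Rabs_pos x); intros.
        replace (5 * Cmod w * (Rabs x * (Rabs x * (Rabs x * 1)))) with (5 * Cmod w * (Rabs x * Rabs x) * Rabs x) by ring.
        replace (5 * 1 * (Cmod w * (Rabs x * (Rabs x * 1)))) with (5 * Cmod w * (Rabs x * Rabs x) * 1) by ring.
        apply Rmult_le_compat_l; [|lra]. apply Rmult_le_pos; lra.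
      * pose proof (psi_incr_taylor n t0 (S M) x F Hx) as T.
        set (w := (/ t0)%C) in *.
        assert (Nx : RtoC x <> RtoC 0) by (apply RtoC_neq0, Hx0).
        apply Rmult_le_reg_r with (Cmod (w * RtoC x ^ 2)%C).
        { rewrite Cmod_mult, Cmod_Rpow. apply Rmult_lt_0_compat; [exact W0|]. apply pow_lt, Rabs_pos_lt, Hx0. }
        rewrite <- Cmod_mult.
        replace ((psi_incr n t0 x / (w * RtoC x ^ 2) - phase_coef w 0 - tpoly (phase_tail_coef w) (S M) x) * (w * RtoC x ^ 2))%C with
          (psi_incr n t0 x - w * RtoC x ^ 2 * tpoly (phase_coef w) (S M) x)%C.
        2:{ rewrite !poly_shift. simpl (phase_tail_coef w 0).
            change (fun k => phase_tail_coef w (S k)) with (fun k => phase_coef w (S k)). field; auto. }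
        eapply Rle_trans; [exact T|]. rewrite Cmod_mult, Cmod_Rpow. right. simpl. ring.
  - intros [|k] _; simpl phase_tail_coef; [rewrite Cmod_0; lra|].
    pose proof (phase_coef_bound (/ t0) (S k) W1). lra.
Qed.

Lemma real_series (P : C -> Prop) (t0 : C) :
  locally (T := C_UniformSpace) t0 P -> exists x0, 0 < x0 <= 1 /\ forall x, Rabs x <= x0 -> P (t0 + RtoC x)%C.
Proof.
  intros [e He]. exists (Rmin 1 (e / 2)). generalize (cond_pos e); intros Hp.
  assert (A : Rmin 1 (e / 2) <= e / 2) by apply Rmin_r.
  split; [split; [apply Rmin_pos; lra|apply Rmin_l]|].
  intros x Hx. apply He. split; simpl; unfold ball; simpl; unfold AbsRing_ball, abs, minus, plus, opp; simpl.
  - replace (fst t0 + x + - fst t0) with x by ring. lra.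
  - replace (snd t0 + 0 + - snd t0) with 0 by ring. rewrite Rabs_R0. exact Hp.
Qed.

(** The given expansion and [psi_incr_taylor] are compared along real
    increments by [series_coeff_unique]. *)
Lemma alpha_explicit n t0 alpha : far n t0 -> is_psi_expansion n t0 alpha ->
  forall r, alpha r = (/ t0 * phase_coef (/ t0) r)%C.
Proof.
  intros F H r. destruct (real_series _ _ H) as (x0 & Hx0 & Hs).
  apply (series_coeff_unique alpha (fun r => / t0 * phase_coef (/ t0) r)%C
    (fun x => psi_incr n t0 x / RtoC x ^ 2)%C x0 (S r) (5 * Cmod (/ t0)%C)); [lra| | |lia].
  - intros x Hx. specialize (Hs x ltac:(rewrite Rabs_right; lra)).
    assert (Nx : RtoC x <> RtoC 0) by (apply RtoC_neq0; lra).
    apply (is_series_scal (K := C_AbsRing) (V := C_NormedModule) (/ RtoC x ^ 2)%C) in Hs.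
    unfold scal in Hs; simpl in Hs; unfold mult in Hs; simpl in Hs.
    replace (psi_incr n t0 x / RtoC x ^ 2)%C with (/ (RtoC x * (RtoC x * 1)) * (psi n (t0 + RtoC x) - psi n t0))%C.
    2:{ unfold psi_incr. field. exact Nx. }
    eapply is_series_ext; [|exact Hs]. intros k. cbv beta.
    replace (t0 + RtoC x - t0)%C with (RtoC x) by ring. rewrite Cpow_add_r.
    simpl. field. exact Nx.
  - intros x Hx. assert (Nx : RtoC x <> RtoC 0) by (apply RtoC_neq0; lra).
    assert (Ax : Rabs x = x) by (apply Rabs_right; lra).
    pose proof (psi_incr_taylor n t0 (S r) x F ltac:(rewrite Ax; lra)) as T. rewrite Ax in T.
    apply Rmult_le_reg_r with (Cmod (RtoC x ^ 2)%C).
    { rewrite Cmod_Rpow, Ax. apply pow_lt; lra. }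
    rewrite <- Cmod_mult.
    replace ((psi_incr n t0 x / RtoC x ^ 2 - Csum (fun k => / t0 * phase_coef (/ t0) k * RtoC x ^ k) (S r)) * RtoC x ^ 2)%C
      with (psi_incr n t0 x - / t0 * RtoC x ^ 2 * tpoly (phase_coef (/ t0)) (S r) x)%C.
    + eapply Rle_trans; [exact T|]. rewrite Cmod_Rpow, Ax. right; simpl; ring.
    + replace (Csum (fun k => / t0 * phase_coef (/ t0) k * RtoC x ^ k)%C (S r)) with
        (/ t0 * tpoly (phase_coef (/ t0)) (S r) x)%C.
      * field. split; [apply (saddle_neq0 _ _ (proj1 F))|exact Nx].
      * unfold tpoly. rewrite <- Csum_scal. apply Csum_ext. intros; ring.
Qed.

Definition ampl_slope (n : nat) (t0 : C) : C := (/ (RtoC (INR n) - t0))%C.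

(** The quotient f (t0 + x) / f t0, in which 1 - x / (n - t0) is the quotient
    of the last factors. *)
Definition ampl_ratio (n : nat) (t0 : C) (x : R) : C :=
  (RtoC (exp (- x)) * / (1 + / t0 * RtoC x) * (1 - ampl_slope n t0 * RtoC x))%C.

Definition ampl_coef (n : nat) (t0 : C) : nat -> C :=
  conv (conv (fun k => (- (1)) ^ k * RtoC (/ INR (fact k)))%C (fun k => (- / t0) ^ k)%C)
    (fun k => match k with O => RtoC 1 | S O => (- ampl_slope n t0)%C | _ => RtoC 0 end).

Definition ampl_const (M : nat) : R := (1 + INR M) ^ 2 * ((1 + INR M) ^ 2 * (3 * 2) * 2).

Lemma n_minus_t0 n t0 : saddle n t0 -> (RtoC (INR n) - t0)%C <> RtoC 0.
Proof.
  intros (_ & _ & Hv & _) E. apply (f_equal Im) in E.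
  rewrite im_minus, !im_RtoC in E. lra.
Qed.

Lemma far_n n t0 : far n t0 -> 20 * Cmod t0 <= INR n.
Proof.
  intros [Sd Hu]. pose proof (saddle_size _ _ Sd) as E. generalize PI2_3_2; intros HP.
  assert (INR n = 2 * PI * (Cmod t0 * exp (Re t0))) by (rewrite E; field; lra).
  rewrite H. assert (20 <= exp (Re t0)) by (generalize (exp_ineq1_le (Re t0)); lra).
  generalize (Cmod_ge_0 t0); intros.
  assert (Cmod t0 * 20 <= Cmod t0 * exp (Re t0)) by (apply Rmult_le_compat_l; lra). nra.
Qed.

Lemma ampl_slope_bound n t0 : far n t0 -> Cmod (ampl_slope n t0) <= 1.
Proof.
  intros F. pose proof (far_n _ _ F) as B. destruct F as [Sd Hu].
  pose proof (Cmod_ge_Re t0) as R0. unfold ampl_slope. rewrite Cmod_inv by (apply n_minus_t0, Sd).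
  assert (1 <= Cmod (RtoC (INR n) - t0)%C).
  { assert (Cmod (RtoC (INR n)) <= Cmod (RtoC (INR n) - t0)%C + Cmod t0).
    { replace (RtoC (INR n)) with ((RtoC (INR n) - t0) + t0)%C at 1 by ring. apply Cmod_triangle. }
    rewrite Cmod_R, Rabs_right in H by (apply Rle_ge, pos_INR). lra. }
  apply inv_le_1. lra.
Qed.

Lemma approx_exp_opp M : approx (fun x => RtoC (exp (- x))) (fun k => (- (1)) ^ k * RtoC (/ INR (fact k)))%C M 3.
Proof.
  destruct (approx_exp M) as (H0 & H1 & H2). split; [lra|split].
  - intros x Hx. specialize (H1 (- x)). rewrite Rabs_Ropp in H1. specialize (H1 Hx).
    replace (tpoly (fun k => (- (1)) ^ k * RtoC (/ INR (fact k)))%C M x) with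
      (tpoly (fun k => RtoC (/ INR (fact k))) M (- x)); [exact H1|].
    apply Csum_ext. intros k _. rewrite RtoC_opp.
    replace (- RtoC x)%C with (- (1) * RtoC x)%C by ring. rewrite Cpow_mult_l. ring.
  - intros k Hk. rewrite Cmod_mult, Cmod_pow, Cmod_opp, Cmod_1, pow1, Rmult_1_l. apply H2, Hk.
Qed.

Lemma approx_lin (c : C) M : Cmod c <= 1 -> approx (fun x => 1 - c * RtoC x)%C
  (fun k => match k with O => RtoC 1 | S O => (- c)%C | _ => RtoC 0 end) M 2.
Proof.
  intros Hc. split; [lra|split].
  - intros x Hx. destruct M as [|[|M]].
    + unfold tpoly; simpl. replace (_ - _ - _)%C with (1 - c * RtoC x)%C by ring.
      eapply Rle_trans; [apply Cmod_minus_le|]. rewrite Cmod_1, Cmod_mult, Cmod_R.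
      generalize (Cmod_ge_0 c) (Rabs_pos x); intros. nra.
    + unfold tpoly; simpl. replace (_ - _ - _)%C with (- (c * RtoC x))%C by ring.
      rewrite Cmod_opp, Cmod_mult, Cmod_R. generalize (Cmod_ge_0 c) (Rabs_pos x); intros. nra.
    + rewrite !poly_shift.
      replace (tpoly _ M x) with (RtoC 0).
      2:{ symmetry. apply Csum_zero. intros; ring. }
      replace (_ - _)%C with (RtoC 0) by ring. rewrite Cmod_0.
      apply Rmult_le_pos; [lra|apply pow_le, Rabs_pos].
  - intros [|[|k]] _; [rewrite Cmod_1; lra|rewrite Cmod_opp; lra|rewrite Cmod_0; lra].
Qed.

Lemma approx_ampl_ratio n t0 M : far n t0 -> approx (ampl_ratio n t0) (ampl_coef n t0) M (ampl_const M).
Proof.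
  intros F. destruct (far_inv _ _ F) as (_ & [W0 W1] & _ & _).
  unfold ampl_ratio, ampl_coef, ampl_const. apply approx_mult; [apply approx_mult|].
  - apply approx_exp_opp.
  - apply approx_geom, W1.
  - apply approx_lin, ampl_slope_bound, F.
Qed.

Lemma ampl_coef_0 n t0 : ampl_coef n t0 0 = RtoC 1.
Proof. unfold ampl_coef, conv; simpl. rewrite Rinv_1. ring. Qed.

Lemma f_eq_ampl_ratio n t0 x : far n t0 -> Rabs x <= 1 -> Defs.f n (t0 + RtoC x)%C = (Defs.f n t0 * ampl_ratio n t0 x)%C.
Proof.
  intros F Hx. destruct (far_inv _ _ F) as (_ & [W0 W1] & _ & _). destruct F as [Sd Hu].
  pose proof (saddle_neq0 _ _ Sd) as N0. pose proof (shift_neq0 _ _ x Sd) as Nx.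
  pose proof (n_minus_t0 _ _ Sd) as Nn.
  assert (Hn : RtoC (INR n) <> RtoC 0) by (apply RtoC_neq0, not_0_INR; destruct Sd; lia).
  unfold Defs.f, ampl_ratio, ampl_slope. replace (- (t0 + RtoC x))%C with (- t0 + RtoC (- x))%C by (rewrite RtoC_opp; ring).
  rewrite Cexp_plus, Cexp_RtoC. field.
  repeat split; auto.
Qed.

Lemma f_t0_neq0 n t0 : saddle n t0 -> Defs.f n t0 <> RtoC 0.
Proof.
  intros Sd. pose proof (saddle_neq0 _ _ Sd) as N0. pose proof (n_minus_t0 _ _ Sd) as Nn.
  assert (Hn : RtoC (INR n) <> RtoC 0) by (apply RtoC_neq0, not_0_INR; destruct Sd; lia).
  unfold Defs.f, Cdiv. repeat apply Cmult_neq_0; auto using Cexp_neq0, Cinv_neq0.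
  intros E. apply Nn. replace (RtoC (INR n) - t0)%C with ((1 - t0 * / RtoC (INR n)) * RtoC (INR n))%C by (field; exact Hn).
  rewrite E. ring.
Qed.

Lemma beta_explicit n t0 beta : far n t0 -> is_f_expansion n t0 beta ->
  forall r, beta r = (Defs.f n t0 * ampl_coef n t0 r)%C.
Proof.
  intros F H r. destruct (real_series _ _ H) as (x0 & Hx0 & Hs).
  apply (series_coeff_unique beta (fun r => Defs.f n t0 * ampl_coef n t0 r)%C
    (fun x => Defs.f n (t0 + RtoC x))%C x0 (S r) (Cmod (Defs.f n t0) * ampl_const (S r))); [lra| | |lia].
  - intros x Hx. specialize (Hs x ltac:(rewrite Rabs_right; lra)).
    eapply is_series_ext; [|exact Hs]. intros k. cbv beta.
    replace (t0 + RtoC x - t0)%C with (RtoC x) by ring. reflexivity.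
  - intros x Hx. assert (Ax : Rabs x = x) by (apply Rabs_right; lra).
    rewrite f_eq_ampl_ratio by (auto; rewrite Ax; lra).
    replace (Csum (fun k => Defs.f n t0 * ampl_coef n t0 k * RtoC x ^ k)%C (S r)) with
        (Defs.f n t0 * tpoly (ampl_coef n t0) (S r) x)%C.
    2:{ unfold tpoly. rewrite <- Csum_scal. apply Csum_ext. intros; ring. }
    rewrite <- Cmult_minus_distr_l, Cmod_mult, Rmult_assoc.
    apply Rmult_le_compat_l; [apply Cmod_ge_0|].
    pose proof (proj1 (proj2 (approx_ampl_ratio n t0 (S r) F)) x ltac:(rewrite Ax; lra)) as T.
    rewrite Ax in T. exact T.
Qed.

(** * Gaussian integrals with a complex parameter *)

Definition gauss (z : C) (x : R) : C := Cexp (- (z * RtoC x ^ 2))%C.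

Lemma Cderiv_gauss z x : Cderiv (gauss z) x (- (RtoC 2 * z * RtoC x) * gauss z x)%C.
Proof.
  unfold gauss. eapply Cderiv_eq.
  - apply (Cderiv_Cexp (fun x => - (z * RtoC x ^ 2))%C). apply Cderiv_opp, Cderiv_scal.
    apply (Cderiv_pow (fun x => RtoC x)). apply Cderiv_id.
  - replace (INR 2) with 2 by (simpl; ring). change (2 - 1)%nat with 1%nat. ring.
Qed.

Lemma Ccont_gauss z x : Ccont (gauss z) x.
Proof. eapply Cderiv_Ccont, Cderiv_gauss. Qed.

Lemma Cmod_gauss z x : Cmod (gauss z x) = exp (- (Re z * x ^ 2)).
Proof.
  unfold gauss. rewrite Cmod_Cexp, re_opp, <- RtoC_pow, re_mult, re_RtoC, im_RtoC. f_equal. ring.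
Qed.

(** The classical evaluation of the Gaussian integral. If the upper limit 1 is
    replaced by T, and z by z T^2 in the second integral, the sum has
    derivative 0 in T, and its value at T = 0 is an arctangent. *)
Lemma gauss_square z :
  (z * (Cint (gauss z) 0 1 * Cint (gauss z) 0 1) +
   Cint (fun x => Cexp (- (z * RtoC (1 + x ^ 2))) * RtoC (/ (1 + x ^ 2)))%C 0 1)%C = RtoC (PI / 4).
Proof.
  set (A := fun T => Cint (gauss z) 0 T).
  set (j := fun T x => (Cexp (- (z * RtoC (T ^ 2 * (1 + x ^ 2)))) * RtoC (/ (1 + x ^ 2)))%C).
  set (j1 := fun T x => (- (RtoC 2 * z * RtoC T) * Cexp (- (z * RtoC (T ^ 2 * (1 + x ^ 2)))))%C).
  assert (DA : forall T, 0 <= T -> Cderiv A T (gauss z T)).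
  { intros T HT. apply (Cderiv_Cint_upper (gauss z) 0 T 1); [exact HT|lra|]. intros; apply Ccont_gauss. }
  assert (P1 : forall x, 0 < 1 + x ^ 2) by (intros x; generalize (pow2_ge_0 x); lra).
  assert (CE : forall T x, Cderiv (fun T => Cexp (- (z * RtoC (T ^ 2 * (1 + x ^ 2)))))%C T
     (- (z * RtoC (2 * T * (1 + x ^ 2))) * Cexp (- (z * RtoC (T ^ 2 * (1 + x ^ 2)))))%C).
  { intros T x. apply (Cderiv_Cexp (fun T => - (z * RtoC (T ^ 2 * (1 + x ^ 2))))%C).
    apply Cderiv_opp, Cderiv_scal. apply Cderiv_RtoC. auto_derive; [exact I|ring]. }
  assert (C2E : forall T x, Ccont2 (fun T x => Cexp (- (z * RtoC (T ^ 2 * (1 + x ^ 2)))))%C T x).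
  { intros T x. apply Ccont2_Cexp, Ccont2_opp, Ccont2_mult; [apply Ccont2_const|]. apply Ccont2_RtoC.
    apply (continuity_2d_pt_ext (fun u v => (u * u) * (1 + v * v))).
    { intros; simpl; ring. }
    apply continuity_2d_pt_mult.
    - apply continuity_2d_pt_mult; apply continuity_2d_pt_id1.
    - apply continuity_2d_pt_plus; [apply continuity_2d_pt_const|].
      apply continuity_2d_pt_mult; apply continuity_2d_pt_id2. }
  assert (C1inv : forall x, continuous (fun x => / (1 + x ^ 2)) x).
  { intros x. apply ex_derive_cont. auto_derive. generalize (P1 x). simpl. lra. }
  assert (DJ : forall T, Cderiv (fun T => Cint (j T) 0 1) T (Cint (j1 T) 0 1)).
  { intros T. apply (Cderiv_Cint_param j j1 0 1 T 1); [lra|lra| | |].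
    - intros T' x _ _. unfold j, j1. eapply Cderiv_eq.
      + apply Cderiv_mult; [apply CE|apply Cderiv_const].
      + cbv beta. rewrite !RtoC_mult, RtoC_inv by (generalize (P1 x); lra).
        field. apply RtoC_neq0. generalize (P1 x); lra.
    - intros x _. unfold j1. apply Ccont2_mult; [|apply C2E].
      apply Ccont2_opp, Ccont2_mult; [apply Ccont2_const|apply Ccont2_fst].
    - intros T' x _ _. unfold j. apply Ccont_mult.
      + apply (Ccont2_Ccont (fun T x => Cexp (- (z * RtoC (T ^ 2 * (1 + x ^ 2)))))%C), C2E.
      + apply Ccont_RtoC, C1inv. }
  assert (EJ : forall T, 0 <= T -> Cint (j1 T) 0 1 = (- (RtoC 2 * z * gauss z T) * A T)%C).
  { intros T HT.
    assert (E : Cint (fun x => RtoC T * gauss z (T * x))%C 0 1 = A T).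
    { rewrite (Cint_derive (fun x => A (T * x)) (fun x => RtoC T * gauss z (T * x))%C 0 1); [|lra| |].
      - rewrite Rmult_1_r, Rmult_0_r. unfold A at 2. rewrite Cint_point. ring.
      - intros x Hx. apply (Cderiv_comp A (fun x => T * x)); [apply DA; nra|apply is_derive_lin].
      - intros x Hx. apply Ccont_mult; [apply Ccont_const|].
        eapply Cderiv_Ccont. apply (Cderiv_comp (gauss z) (fun x => T * x)); [apply Cderiv_gauss|apply is_derive_lin]. }
    rewrite <- E, <- Cint_scal.
    - apply Cint_ext; [lra|]. intros x _. unfold j1, gauss.
      replace (- (z * RtoC (T ^ 2 * (1 + x ^ 2))))%C with
        (- (z * RtoC T ^ 2) + - (z * RtoC (T * x) ^ 2))%C.
      + rewrite Cexp_plus. ring.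
      + rewrite <- !RtoC_pow. rewrite <- Copp_plus_distr, <- Cmult_plus_distr_l, <- RtoC_plus. do 3 f_equal. ring.
    - apply ex_Cint_cont; [lra|]. intros x Hx. apply Ccont_mult; [apply Ccont_const|].
      eapply Cderiv_Ccont. apply (Cderiv_comp (gauss z) (fun x => T * x)); [apply Cderiv_gauss|apply is_derive_lin]. }
  set (Phi := fun T => (z * (A T * A T) + Cint (j T) 0 1)%C).
  assert (E01 : Phi 1 = Phi 0).
  { apply Cderiv_zero_const; [lra|]. intros T HT. unfold Phi. eapply Cderiv_eq.
    - apply Cderiv_plus; [apply Cderiv_scal, Cderiv_mult; apply DA; lra|apply DJ].
    - rewrite EJ by lra. ring. }
  assert (E0 : Phi 0 = RtoC (PI / 4)).
  { unfold Phi. assert (A0 : A 0 = RtoC 0) by (unfold A; apply Cint_point). rewrite A0.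
    rewrite (Cint_derive (fun x => RtoC (atan x)) (j 0) 0 1); [|lra| |].
    - rewrite atan_1, atan_0. ring.
    - intros x _. eapply Cderiv_eq; [apply Cderiv_RtoC, is_derive_Reals, derivable_pt_lim_atan|].
      unfold j. replace (- (z * RtoC (0 ^ 2 * (1 + x ^ 2))))%C with (RtoC 0).
      + rewrite Cexp_0, Cmult_1_l. replace (x ^ 2) with (Rsqr x) by (unfold Rsqr; ring). reflexivity.
      + rewrite pow_i, Rmult_0_l by lia. ring.
    - intros x _. unfold j. apply Ccont_mult; [|apply Ccont_RtoC, C1inv].
      apply (Ccont2_Ccont (fun T x => Cexp (- (z * RtoC (T ^ 2 * (1 + x ^ 2)))))%C), C2E. }
  rewrite <- E0, <- E01. unfold Phi, A, j. f_equal. apply Cint_ext; [lra|]. intros x _.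
  rewrite pow1, Rmult_1_l. reflexivity.
Qed.

Lemma gauss_square_close z : 0 <= Re z ->
  Cmod (z * (Cint (gauss z) 0 1 * Cint (gauss z) 0 1) - RtoC (PI / 4))%C <= exp (- Re z).
Proof.
  intros Hz. rewrite <- (gauss_square z).
  match goal with |- Cmod ?X <= _ => match X with (_ - (_ + ?Y))%C => replace X with (- Y)%C by ring end end.
  rewrite Cmod_opp.
  assert (P1 : forall x, 0 < 1 + x ^ 2) by (intros x; generalize (pow2_ge_0 x); lra).
  replace (exp (- Re z)) with (exp (- Re z) * (1 - 0)) by ring.
  apply Cint_bound_const; [lra| |].
  - apply ex_Cint_cont; [lra|]. intros x _. apply Ccont_mult.
    + apply Ccont_Cexp, Ccont_opp, Ccont_mult; [apply Ccont_const|]. apply Ccont_RtoC, ex_derive_cont.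
      auto_derive. exact I.
    + apply Ccont_RtoC, ex_derive_cont. auto_derive. generalize (P1 x). simpl; lra.
  - intros x _. rewrite Cmod_mult, Cmod_Cexp, Cmod_R, re_opp, re_mult, re_RtoC, im_RtoC.
    pose proof (pow2_ge_0 x) as Q.
    rewrite (Rabs_right (/ _)) by (left; apply Rinv_0_lt_compat; lra).
    assert (/ (1 + x ^ 2) <= 1) by (apply inv_le_1; lra).
    assert (0 < / (1 + x ^ 2)) by (apply Rinv_0_lt_compat; lra).
    assert (exp (- (Re z * (1 + x ^ 2) - Im z * 0)) <= exp (- Re z)) by (apply exp_le; nra).
    generalize (exp_pos (- (Re z * (1 + x ^ 2) - Im z * 0))). intros. nra.
Qed.

(** Since |e^(- i b x^2) - 1| <= |b| x^2 and the second moment is at most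
    G0 / (2 a), the integral differs from the positive number G0 by at most G0
    / 4. This decides the sign of the square root in [gauss_half]. *)
Lemma gauss_sector z : 0 < Re z -> Rabs (Im z) <= Re z / 2 ->
  Rabs (Im (Cint (gauss z) 0 1)) <= Re (Cint (gauss z) 0 1).
Proof.
  intros Ha Hb. set (a := Re z) in *. set (b := Im z) in *.
  set (G0 := RInt (fun x => exp (- (a * x ^ 2))) 0 1).
  assert (X0 : ex_RInt (fun x => exp (- (a * x ^ 2))) 0 1).
  { apply ex_RInt_cont; [lra|]. intros; apply ex_derive_cont; auto_derive; exact I. }
  assert (X2 : ex_RInt (fun x => x ^ 2 * exp (- (a * x ^ 2))) 0 1).
  { apply ex_RInt_cont; [lra|]. intros; apply ex_derive_cont; auto_derive; exact I. }
  (* By parts, with x times the derivative of the Gaussian. *)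
  assert (E2 : 2 * a * RInt (fun x => x ^ 2 * exp (- (a * x ^ 2))) 0 1 <= G0).
  { assert (E : RInt (fun x => exp (- (a * x ^ 2)) - 2 * a * (x ^ 2 * exp (- (a * x ^ 2)))) 0 1 = exp (- a)).
    { apply is_RInt_unique.
      replace (exp (- a)) with (minus (1 * exp (- (a * 1 ^ 2))) (0 * exp (- (a * 0 ^ 2)))).
      2:{ unfold minus, plus, opp; simpl. rewrite !Rmult_1_r. ring. }
      apply (is_RInt_derive (V := R_CompleteNormedModule) (fun x => x * exp (- (a * x ^ 2)))).
      - intros x _. auto_derive; [exact I|]. simpl. ring.
      - intros x _. apply ex_derive_cont. auto_derive. exact I. }
    rewrite RInt_Rminus, RInt_Rscal in E; [|exact X2|exact X0|apply ex_RInt_Rscal, X2].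
    fold G0 in E. generalize (exp_pos (- a)). lra. }
  assert (G0p : 0 <= G0).
  { apply RInt_ge_0; [lra|exact X0|]. intros; left; apply exp_pos. }
  assert (D : Cmod (Cint (gauss z) 0 1 - RtoC G0)%C <= G0 / 4).
  { replace (RtoC G0) with (Cint (fun x => RtoC (exp (- (a * x ^ 2)))) 0 1).
    2:{ apply C_ext; simpl; [reflexivity|]. rewrite RInt_Rconst. ring. }
    assert (Y : ex_Cint (fun x => RtoC (exp (- (a * x ^ 2)))) 0 1).
    { split; simpl; [exact X0|apply ex_RInt_const]. }
    assert (Y2 : ex_Cint (gauss z) 0 1) by (apply ex_Cint_cont; [lra|intros; apply Ccont_gauss]).
    rewrite <- Cint_minus by assumption.
    apply Rle_trans with (RInt (fun x => Rabs b * (x ^ 2 * exp (- (a * x ^ 2)))) 0 1).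
    - apply Cint_bound; [lra|apply ex_Cint_minus; assumption|apply ex_RInt_Rscal, X2|].
      intros x Hx. unfold gauss.
      replace (- (z * RtoC x ^ 2))%C with (RtoC (- (a * x ^ 2)) + - (RtoC (b * x ^ 2) * Ci))%C.
      2:{ rewrite <- RtoC_pow. apply C_ext; [rewrite re_plus, !re_opp, !re_mult|rewrite im_plus, !im_opp, !im_mult];
          rewrite ?re_RtoC, ?im_RtoC; simpl; fold a b; ring. }
      rewrite Cexp_plus, Cexp_RtoC.
      replace (RtoC (exp (- (a * x ^ 2))) * Cexp (- (RtoC (b * x ^ 2) * Ci)) - RtoC (exp (- (a * x ^ 2))))%C
        with (RtoC (exp (- (a * x ^ 2))) * (Cexp (- (RtoC (b * x ^ 2) * Ci)) - 1))%C by ring.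
      rewrite Cmod_mult, Cmod_R, Rabs_right by (left; apply exp_pos).
      pose proof (exp_taylor (RtoC (b * x ^ 2) * Ci)%C 1 1 (Rle_refl 1)) as T.
      assert (HT : exp (- Re (RtoC (b * x ^ 2) * Ci)%C) <= 1).
      { apply exp_le_1. simpl. lra. }
      specialize (T HT). rewrite Cmod_mult, Cmod_Ci, Cmod_R, pow_1, !Rmult_1_r, Rabs_mult in T.
      rewrite (Rabs_right (x ^ 2)) in T by (apply Rle_ge, pow2_ge_0).
      replace (Csum (expterm (RtoC (b * x ^ 2) * Ci)) 1) with (RtoC 1) in T
        by (simpl; unfold expterm; simpl; field).
      replace (Rabs b * (x ^ 2 * exp (- (a * x ^ 2)))) with (exp (- (a * x ^ 2)) * (Rabs b * x ^ 2)) by ring.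
      apply Rmult_le_compat_l; [left; apply exp_pos|exact T].
    - rewrite RInt_Rscal by exact X2.
      assert (0 <= RInt (fun x => x ^ 2 * exp (- (a * x ^ 2))) 0 1).
      { apply RInt_ge_0; [lra|exact X2|].
        intros; apply Rmult_le_pos; [apply pow2_ge_0|left; apply exp_pos]. }
      generalize (Rabs_pos b); intros. nra. }
  pose proof (Rle_trans _ _ _ (re_le_Cmod _) D) as D1.
  pose proof (Rle_trans _ _ _ (im_le_Cmod _) D) as D2.
  rewrite re_minus, re_RtoC in D1. rewrite im_minus, im_RtoC, Rminus_0_r in D2.
  apply Rabs_le_between in D1. lra.
Qed.

Lemma sqrt_PI_ge : 1 <= sqrt PI.
Proof. rewrite <- sqrt_1. apply sqrt_le_1_alt. generalize PI2_3_2; lra. Qed.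

(** With s = 1 / r and h = sqrt pi / 2, [gauss_square_close] says that
    (s G - h) (s G + h) is small. Both s and G lie in the sector |Im| <= Re,
    so Re (s G) >= 0 and the second factor is not small. *)
Lemma gauss_half z r : 0 < Re z -> Rabs (Im z) <= Re z / 2 -> 0 < Re r -> (r * r * z)%C = RtoC 1 ->
  Cmod (Cint (gauss z) 0 1 - r * RtoC (sqrt PI / 2))%C <= 2 * Cmod r * exp (- Re z).
Proof.
  intros Hz Hb Hr E.
  pose proof (gauss_sector z Hz Hb) as S. pose proof (gauss_square_close z (Rlt_le _ _ Hz)) as Q.
  set (G := Cint (gauss z) 0 1) in *.
  assert (Nr : r <> RtoC 0) by (apply Cneq0_Re; lra).
  set (s := (/ r)%C).
  assert (Es : (s * s)%C = z).
  { apply Cmult_reg_r with (r * r)%C; [apply Cmult_neq_0; exact Nr|].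
    rewrite (Cmult_comm z), E. unfold s. field. exact Nr. }
  assert (Hs : 0 < Re s).
  { unfold s. change (Re (/ r)%C) with (Re r / (Re r ^ 2 + Im r ^ 2)).
    apply Rmult_lt_0_compat; [exact Hr|]. apply Rinv_0_lt_compat. nra. }
  assert (His : Rabs (Im s) <= Re s).
  { apply (f_equal Re) in Es. rewrite re_mult in Es. apply Rabs_le. split; nra. }
  assert (Hg : 0 <= Re (s * G)%C).
  { rewrite re_mult.
    assert (Im s * Im G <= Rabs (Im s) * Rabs (Im G)) by (rewrite <- Rabs_mult; apply Rle_abs).
    assert (Rabs (Im s) * Rabs (Im G) <= Re s * Re G)
      by (apply Rmult_le_compat; auto using Rabs_pos). lra. }
  set (h := sqrt PI / 2). assert (Hh : 1 / 2 <= h) by (unfold h; generalize sqrt_PI_ge; lra).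
  assert (Hhh : h * h = PI / 4).
  { unfold h. generalize (sqrt_sqrt PI (Rlt_le _ _ PI_RGT_0)); intros. nra. }
  assert (F : Cmod (s * G - RtoC h)%C * Cmod (s * G + RtoC h)%C <= exp (- Re z)).
  { rewrite <- Cmod_mult.
    replace ((s * G - RtoC h) * (s * G + RtoC h))%C with (z * (G * G) - RtoC (PI / 4))%C; [exact Q|].
    rewrite <- Hhh, RtoC_mult, <- Es. ring. }
  assert (L : 1 / 2 <= Cmod (s * G + RtoC h)%C).
  { eapply Rle_trans; [|apply Cmod_ge_Re]. rewrite re_plus, re_RtoC. lra. }
  assert (B : Cmod (s * G - RtoC h)%C <= 2 * exp (- Re z)).
  { generalize (Cmod_ge_0 (s * G - RtoC h)%C); intros. nra. }
  replace (G - r * RtoC h)%C with (r * (s * G - RtoC h))%C.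
  - rewrite Cmod_mult. generalize (Cmod_ge_0 r); intros. nra.
  - unfold s. field. exact Nr.
Qed.

Definition half_moment (z : C) (k : nat) : C := Cint (fun x => RtoC x ^ k * gauss z x)%C 0 1.

Lemma Ccont_Rpow k x : Ccont (fun x => RtoC x ^ k)%C x.
Proof. apply Ccont_pow. eapply Cderiv_Ccont, Cderiv_id. Qed.

Lemma ex_Cint_moment z k a b : a <= b -> ex_Cint (fun x => RtoC x ^ k * gauss z x)%C a b.
Proof.
  intros Hab. apply ex_Cint_cont; [exact Hab|]. intros. apply Ccont_mult; [apply Ccont_Rpow|apply Ccont_gauss].
Qed.

Lemma half_moment_rec z k : (RtoC 2 * z * half_moment z (k + 2))%C =
  (RtoC (INR (k + 1)) * half_moment z k - Cexp (- z))%C.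
Proof.
  assert (E : Cint (fun x => RtoC (INR (k + 1)) * (RtoC x ^ k * gauss z x) -
      RtoC 2 * z * (RtoC x ^ (k + 2) * gauss z x))%C 0 1 = Cexp (- z)%C).
  { rewrite (Cint_derive (fun x => RtoC x ^ (k + 1) * gauss z x)%C); [|lra| |].
    - rewrite !Cpow_add_r. unfold gauss.
      replace (- (z * RtoC 1 ^ 2))%C with (- z)%C by ring.
      rewrite Cpow_1_l. simpl. ring.
    - intros x _. eapply Cderiv_eq.
      + apply Cderiv_mult; [apply (Cderiv_pow (fun x => RtoC x)), Cderiv_id|apply Cderiv_gauss].
      + replace (k + 1 - 1)%nat with k by lia. rewrite !Cpow_add_r. simpl. ring.
    - intros x _. apply Ccont_minus; (apply Ccont_mult; [apply Ccont_const|]);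
        (apply Ccont_mult; [apply Ccont_Rpow|apply Ccont_gauss]). }
  assert (X : forall m, ex_Cint (fun x => RtoC x ^ m * gauss z x)%C 0 1) by (intros; apply ex_Cint_moment; lra).
  rewrite Cint_minus in E; [|apply (ex_Cint_scal _ _ _ _ (X k))|apply (ex_Cint_scal _ _ _ _ (X (k + 2)%nat))].
  rewrite (Cint_scal _ _ _ _ (X k)), (Cint_scal _ _ _ _ (X (k + 2)%nat)) in E.
  fold (half_moment z k) (half_moment z (k + 2)) in E. rewrite <- E. ring.
Qed.

(** The Pochhammer symbol (1/2)_k as a product ([pochhammer_half0]). *)
Fixpoint half_rising (k : nat) : R := match k with O => 1 | S j => half_rising j * (INR j + 1 / 2) end.

Lemma half_rising_pos k : 0 < half_rising k.
Proof.
  induction k as [|k IH]; simpl; [lra|]. apply Rmult_lt_0_compat; [exact IH|].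
  generalize (pos_INR k); lra.
Qed.

Fixpoint moment_error (k : nat) : R := match k with O => 2 | S j => (2 * INR j + 1) * moment_error j + 1 end.

Lemma moment_error_pos k : 0 < moment_error k.
Proof.
  induction k as [|k IH]; simpl; [lra|]. generalize (pos_INR k); intros. nra.
Qed.

(** Integration by parts raises the index by 2 with an error e^(-z). *)
Lemma half_moment_close z r k : 0 < Re z -> Rabs (Im z) <= Re z / 2 -> 0 < Re r ->
  (r * r * z)%C = RtoC 1 -> Cmod r <= 1 ->
  Cmod (half_moment z (2 * k) - RtoC (half_rising k * (sqrt PI / 2)) * r ^ (2 * k + 1))%C <= moment_error k * exp (- Re z).
Proof.
  intros Hz Hb Hr E Hr1.
  assert (Nz : z <> RtoC 0) by (apply Cneq0_Re; lra).
  assert (Ei : (/ z)%C = (r * r)%C).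
  { apply Cmult_reg_r with z; [exact Nz|]. rewrite E. field. exact Nz. }
  generalize (exp_pos (- Re z)); intros He.
  induction k as [|k IH].
  - assert (E0 : half_moment z (2 * 0) = Cint (gauss z) 0 1).
    { unfold half_moment. apply Cint_ext; [lra|]. intros; simpl; ring. }
    rewrite E0. pose proof (gauss_half z r Hz Hb Hr E) as G.
    simpl half_rising. simpl moment_error. rewrite Rmult_1_l. simpl (2 * 0 + 1)%nat.
    replace (RtoC (sqrt PI / 2) * r ^ 1)%C with (r * RtoC (sqrt PI / 2))%C by (simpl; ring).
    eapply Rle_trans; [exact G|]. apply Rmult_le_compat_r; lra.
  - pose proof (half_moment_rec z (2 * k)) as R0.
    replace (2 * k + 2)%nat with (2 * S k)%nat in R0 by lia.
    assert (R1 : half_moment z (2 * S k) = (r * r * ((RtoC (INR (2 * k + 1)) * half_moment z (2 * k) - Cexp (- z)) / RtoC 2))%C).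
    { rewrite <- R0, <- Ei. field. exact Nz. }
    set (e := (half_moment z (2 * k) - RtoC (half_rising k * (sqrt PI / 2)) * r ^ (2 * k + 1))%C) in *.
    assert (E2 : (half_moment z (2 * S k) - RtoC (half_rising (S k) * (sqrt PI / 2)) * r ^ (2 * S k + 1))%C =
      (r * r * ((RtoC (INR (2 * k + 1)) * e - Cexp (- z)) / RtoC 2))%C).
    { rewrite R1. replace (2 * S k + 1)%nat with (2 + (2 * k + 1))%nat by lia.
      rewrite Cpow_add_r. unfold e. simpl half_rising.
      replace (INR k + 1 / 2) with (INR (2 * k + 1) / 2)
        by (rewrite plus_INR, mult_INR; simpl; field).
      rewrite !RtoC_mult, !RtoC_div by lra. simpl (r ^ 2)%C. field. }
    rewrite E2.
    assert (F : Cmod (RtoC (INR (2 * k + 1)) * e - Cexp (- z))%C <= (2 * INR k + 1) * (moment_error k * exp (- Re z)) + exp (- Re z)).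
    { eapply Rle_trans; [apply Cmod_minus_le|]. rewrite Cmod_mult, Cmod_R, Cmod_Cexp, re_opp.
      rewrite Rabs_right by (apply Rle_ge, pos_INR).
      replace (INR (2 * k + 1)) with (2 * INR k + 1) by (rewrite plus_INR, mult_INR; simpl; ring).
      apply Rplus_le_compat_r, Rmult_le_compat_l; [generalize (pos_INR k); lra|exact IH]. }
    rewrite !Cmod_mult, Cmod_div, Cmod_R, Rabs_right by (try apply RtoC_neq0; lra).
    set (X := Cmod (_ - _)%C) in *. assert (HX : 0 <= X) by apply Cmod_ge_0.
    generalize (Cmod_ge_0 r); intros.
    assert (Cmod r * Cmod r <= 1) by nra.
    simpl moment_error. apply Rle_trans with X; [|lra].
    assert (Cmod r * Cmod r * (X / 2) <= 1 * (X / 2)) by (apply Rmult_le_compat_r; lra). lra.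
Qed.

Lemma RInt_reflect (f : R -> R) : ex_RInt f (-1) 0 ->
  RInt f (-1) 0 = RInt (fun x => f (- x)) 0 1 /\ ex_RInt (fun x => f (- x)) 0 1.
Proof.
  intros [l H].
  assert (X : is_RInt (fun x => f (- x)) 0 1 l).
  { pose proof (is_RInt_comp_opp (V := R_NormedModule) f 1 0 l) as E.
    rewrite Ropp_0 in E. specialize (E H).
    apply (is_RInt_swap (V := R_NormedModule)), (is_RInt_opp (V := R_NormedModule)) in E.
    rewrite opp_opp in E.
    eapply is_RInt_ext; [|exact E]. intros x _. apply opp_opp. }
  split; [|exists l; exact X].
  rewrite (is_RInt_unique _ _ _ _ H), (is_RInt_unique _ _ _ _ X). reflexivity.
Qed.

Lemma Cint_reflect g : (forall x, -1 <= x <= 1 -> Ccont g x) ->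
  Cint g (-1) 1 = Cint (fun x => g x + g (- x)%R)%C 0 1.
Proof.
  intros H.
  assert (A : ex_Cint g (-1) 0) by (apply ex_Cint_cont; [lra|intros; apply H; lra]).
  assert (B : ex_Cint g 0 1) by (apply ex_Cint_cont; [lra|intros; apply H; lra]).
  rewrite <- (Cint_Chasles g (-1) 0 1 A B).
  destruct A as [A1 A2].
  destruct (RInt_reflect _ A1) as [E1 X1]. destruct (RInt_reflect _ A2) as [E2 X2].
  rewrite Cint_plus; [|exact B|split; assumption].
  rewrite Cplus_comm. f_equal. unfold Cint. rewrite E1, E2. reflexivity.
Qed.

Definition moment (z : C) (k : nat) : C := Cint (fun x => RtoC x ^ k * gauss z x)%C (-1) 1.

Lemma gauss_even z x : gauss z (- x) = gauss z x.
Proof. unfold gauss. rewrite RtoC_opp. f_equal. ring. Qed.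

Lemma Copp_pow_even (x : C) k : ((- x) ^ (2 * k) = x ^ (2 * k))%C.
Proof. rewrite !Cpow_mult_r. f_equal. ring. Qed.

Lemma moment_even z k : moment z (2 * k) = (RtoC 2 * half_moment z (2 * k))%C.
Proof.
  unfold moment. rewrite Cint_reflect.
  - unfold half_moment. rewrite <- Cint_scal by (apply ex_Cint_moment; lra).
    apply Cint_ext; [lra|]. intros x _. rewrite gauss_even, RtoC_opp, Copp_pow_even. ring.
  - intros; apply Ccont_mult; [apply Ccont_Rpow|apply Ccont_gauss].
Qed.

Lemma moment_odd z k : moment z (2 * k + 1) = RtoC 0.
Proof.
  unfold moment. rewrite Cint_reflect.
  - rewrite (Cint_ext _ (fun _ => RtoC 0)); [|lra|].
    + apply Cint_zero.
    + intros x _. rewrite gauss_even, RtoC_opp, !Cpow_add_r, Copp_pow_even. ring.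
  - intros; apply Ccont_mult; [apply Ccont_Rpow|apply Ccont_gauss].
Qed.

(** * The Gamma function at half-integers *)

Definition Gamma_partial (k : nat) (T : R) : R := RInt (fun s => s ^ (2 * k) * exp (- s ^ 2)) 0 T.

(** By scaling, the truncated Gamma integral at k + 1/2, in the variable s
    with s^2 = t, is a half moment with the real parameter T^2. So the
    Gaussian estimates also evaluate Gamma. *)
Lemma Gamma_partial_half_moment k T : 0 < T -> RtoC (Gamma_partial k T) = (RtoC (T ^ (2 * k + 1)) * half_moment (RtoC (T ^ 2)) (2 * k))%C.
Proof.
  intros HT. unfold Gamma_partial, half_moment.
  assert (E : RInt (fun s => s ^ (2 * k) * exp (- s ^ 2)) 0 T =
    RInt (fun x => T ^ (2 * k + 1) * (x ^ (2 * k) * exp (- (T ^ 2 * x ^ 2)))) 0 1).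
  { replace T with (T * 1) at 1 by ring. replace 0 with (T * 0) at 1 by ring.
    rewrite <- (RInt_comp (V := R_CompleteNormedModule) _ (fun x => T * x) (fun _ => T)).
    - apply RInt_ext. intros x _.
      change (T * ((T * x) ^ (2 * k) * exp (- (T * x) ^ 2)) = T ^ (2 * k + 1) * (x ^ (2 * k) * exp (- (T ^ 2 * x ^ 2)))).
      rewrite !Rpow_mult_distr, pow_add, pow_1. ring.
    - intros x _. apply ex_derive_cont. auto_derive. exact I.
    - intros x _. split; [apply is_derive_lin|apply continuous_const]. }
  rewrite E.
  assert (X : ex_RInt (fun x => x ^ (2 * k) * exp (- (T ^ 2 * x ^ 2))) 0 1).
  { apply ex_RInt_cont; [lra|]. intros; apply ex_derive_cont. auto_derive. exact I. }
  rewrite RInt_Rscal, RtoC_mult by exact X. f_equal.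
  assert (P : forall x, (RtoC x ^ (2 * k) * gauss (RtoC (T ^ 2)) x)%C = RtoC (x ^ (2 * k) * exp (- (T ^ 2 * x ^ 2)))).
  { intros x. unfold gauss. rewrite <- !RtoC_pow, <- RtoC_mult, <- RtoC_opp, Cexp_RtoC, <- RtoC_mult.
    reflexivity. }
  rewrite (Cint_ext _ (fun x => RtoC (x ^ (2 * k) * exp (- (T ^ 2 * x ^ 2))))); [|lra|intros; apply P].
  apply C_ext; unfold Cint; [reflexivity|].
  change (0 = RInt (fun _ => 0) 0 1). rewrite RInt_Rconst. eq_in_R. ring.
Qed.

Lemma Gamma_partial_close k T : 1 <= T ->
  Rabs (Gamma_partial k T - half_rising k * (sqrt PI / 2)) <= T ^ (2 * k + 1) * (moment_error k * exp (- T ^ 2)).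
Proof.
  intros HT. assert (HT2 : 0 < T ^ 2) by (apply pow_lt; lra).
  pose proof (half_moment_close (RtoC (T ^ 2)) (RtoC (/ T)) k) as G.
  rewrite re_RtoC, im_RtoC, Rabs_R0 in G.
  assert (Hi : 0 < / T <= 1).
  { apply inv_le_1, HT. }
  assert (E : (RtoC (/ T) * RtoC (/ T) * RtoC (T ^ 2))%C = RtoC 1).
  { rewrite <- !RtoC_mult. f_equal. field. lra. }
  specialize (G HT2 ltac:(lra) ltac:(simpl; lra) E).
  rewrite Cmod_R, Rabs_right in G by lra. specialize (G ltac:(lra)).
  rewrite <- Cmod_R, RtoC_minus, Gamma_partial_half_moment by lra.
  replace (RtoC (half_rising k * (sqrt PI / 2))) with
    (RtoC (T ^ (2 * k + 1)) * (RtoC (half_rising k * (sqrt PI / 2)) * RtoC (/ T) ^ (2 * k + 1)))%C.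
  - rewrite <- Cmult_minus_distr_l, Cmod_mult, Cmod_R, Rabs_right by (apply Rle_ge, pow_le; lra).
    apply Rmult_le_compat_l; [apply pow_le; lra|exact G].
  - rewrite <- RtoC_pow, <- !RtoC_mult. f_equal.
    rewrite pow_inv. field. apply pow_nonzero. lra.
Qed.

Lemma Gamma_partial_lim k e : 0 < e -> exists T0, 1 <= T0 /\ forall T, T0 <= T ->
  Rabs (Gamma_partial k T - half_rising k * (sqrt PI / 2)) < e.
Proof.
  intros He. set (F := INR (fact (k + 2))). assert (HF : 0 < F) by apply INR_fact_lt_0.
  pose proof (moment_error_pos k) as HK.
  assert (HFK : 0 < F * moment_error k) by (apply Rmult_lt_0_compat; assumption).
  exists (F * moment_error k / e + 1). split.
  { assert (0 < F * moment_error k / e) by (apply Rmult_lt_0_compat; [assumption|apply Rinv_0_lt_compat, He]). lra. }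
  intros T HT.
  assert (H0 : 0 < F * moment_error k / e) by (apply Rmult_lt_0_compat; [assumption|apply Rinv_0_lt_compat, He]).
  assert (HT1 : 1 <= T) by lra.
  eapply Rle_lt_trans; [apply Gamma_partial_close, HT1|].
  assert (P : T ^ (2 * k + 4) * exp (- T ^ 2) <= F).
  { pose proof (pow_fact_le (T ^ 2) (k + 2) (pow2_ge_0 T)) as Q. fold F in Q.
    rewrite <- pow_mult in Q. replace (2 * (k + 2))%nat with (2 * k + 4)%nat in Q by lia.
    apply Rmult_le_reg_r with (exp (T ^ 2)); [apply exp_pos|].
    rewrite Rmult_assoc, <- exp_plus. replace (- T ^ 2 + T ^ 2) with 0 by ring. rewrite exp_0. lra. }
  assert (P2 : T ^ (2 * k + 1) * exp (- T ^ 2) * T <= F).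
  { eapply Rle_trans; [|exact P].
    replace (2 * k + 4)%nat with (2 * k + 1 + 1 + 2)%nat by lia. rewrite (pow_add _ (2 * k + 1 + 1)), (pow_add _ (2 * k + 1)), pow_1.
    assert (1 <= T ^ 2) by nra.
    assert (0 <= T ^ (2 * k + 1) * exp (- T ^ 2) * T).
    { apply Rmult_le_pos; [|lra]. apply Rmult_le_pos; [apply pow_le; lra|left; apply exp_pos]. }
    nra. }
  apply Rmult_lt_reg_r with T; [lra|].
  replace (T ^ (2 * k + 1) * (moment_error k * exp (- T ^ 2)) * T) with (moment_error k * (T ^ (2 * k + 1) * exp (- T ^ 2) * T)) by ring.
  apply Rle_lt_trans with (F * moment_error k); [nra|].
  assert (F * moment_error k / e * e = F * moment_error k) by (field; lra). nra.
Qed.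

Lemma Gamma_partial_small k T : 0 <= T <= 1 -> Rabs (Gamma_partial k T) <= T.
Proof.
  intros HT. unfold Gamma_partial. replace T with (1 * (T - 0)) at 2 by ring. rewrite <- RInt_Rconst.
  apply RInt_abs_bound; [lra| |apply ex_RInt_const|].
  - apply ex_RInt_cont; [lra|]. intros; apply ex_derive_cont. auto_derive. exact I.
  - intros x Hx. rewrite Rabs_right.
    + assert (x ^ (2 * k) <= 1) by (apply pow_le_1; lra).
      assert (0 <= x ^ (2 * k)) by (apply pow_le; lra).
      assert (exp (- x ^ 2) <= 1) by (apply exp_le_1; nra).
      generalize (exp_pos (- x ^ 2)); intros. nra.
    + apply Rle_ge, Rmult_le_pos; [apply pow_le; lra|left; apply exp_pos].
Qed.

Lemma Gamma_integral k a b : 0 < a <= b ->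
  is_RInt (fun t => Rpower t (INR k + 1 / 2 - 1) * exp (- t)) a b
    (2 * Gamma_partial k (sqrt b) - 2 * Gamma_partial k (sqrt a)).
Proof.
  intros Hab.
  apply (is_RInt_derive (V := R_CompleteNormedModule) (fun t => 2 * Gamma_partial k (sqrt t))).
  - rewrite Rmin_left, Rmax_right by lra. intros x Hx.
    assert (Hs : 0 < sqrt x) by (apply sqrt_lt_R0; lra).
    assert (Ss : sqrt x * sqrt x = x) by (apply sqrt_sqrt; lra).
    replace (Rpower x (INR k + 1 / 2 - 1) * exp (- x)) with
      (2 * (/ (2 * sqrt x) * (sqrt x ^ (2 * k) * exp (- sqrt x ^ 2)))).
    + apply is_derive_scal. apply (is_derive_Rcomp (Gamma_partial k) sqrt).
      * apply (is_derive_RInt_upper (fun s => s ^ (2 * k) * exp (- s ^ 2)) 0 (sqrt x) 1); [lra|lra|].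
        intros; apply ex_derive_cont. auto_derive. exact I.
      * apply is_derive_Reals. apply derivable_pt_lim_sqrt. lra.
    + replace (- sqrt x ^ 2) with (- x) by (simpl; rewrite Rmult_1_r, Ss; reflexivity).
      rewrite pow_mult. replace (sqrt x ^ 2) with x by (simpl; rewrite Rmult_1_r, Ss; reflexivity).
      replace (INR k + 1 / 2 - 1) with (INR k + - (/ 2)) by field.
      rewrite Rpower_plus, Rpower_Ropp, Rpower_pow, Rpower_sqrt by lra. field. lra.
  - rewrite Rmin_left, Rmax_right by lra. intros x Hx. apply ex_derive_cont.
    unfold Rpower. auto_derive. lra.
Qed.

Lemma Gamma_half k : Gamma (INR k + 1 / 2) = half_rising k * sqrt PI.
Proof.
  unfold Gamma. apply is_RInt_gen_unique.
  intros P [e He]. set (d := e / 4). assert (Hd : 0 < d) by (unfold d; generalize (cond_pos e); lra).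
  destruct (Gamma_partial_lim k d Hd) as (T0 & HT0 & HL).
  set (dl := Rmin 1 (d ^ 2)). assert (Hdl : 0 < dl) by (apply Rmin_pos; [lra|apply pow_lt, Hd]).
  apply (Filter_prod _ _ _ (fun a => 0 < a < dl) (fun b => T0 ^ 2 < b)).
  - exists (mkposreal dl Hdl). intros y Hy Hy0. apply Rabs_lt_between in Hy.
    simpl in Hy. unfold minus, plus, opp in Hy; simpl in Hy. lra.
  - exists (T0 ^ 2). intros; assumption.
  - intros a b Ha Hb. simpl.
    assert (dl <= 1) by apply Rmin_l. assert (dl <= d ^ 2) by apply Rmin_r.
    exists (2 * Gamma_partial k (sqrt b) - 2 * Gamma_partial k (sqrt a)). split.
    + apply Gamma_integral. nra.
    + apply He.
      assert (Hsb : T0 <= sqrt b).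
      { rewrite <- (sqrt_pow2 T0) by lra. apply sqrt_le_1_alt. lra. }
      assert (Hsa : sqrt a <= d).
      { rewrite <- (sqrt_pow2 d) by lra. apply sqrt_le_1_alt. lra. }
      assert (Hsa1 : sqrt a <= 1) by (rewrite <- sqrt_1; apply sqrt_le_1_alt; lra).
      specialize (HL _ Hsb). pose proof (Gamma_partial_small k (sqrt a) ltac:(split; [apply sqrt_pos|exact Hsa1])) as S.
      unfold ball; simpl. unfold AbsRing_ball, abs, minus, plus, opp; simpl.
      apply Rabs_lt_between in HL. apply Rabs_le_between in S.
      apply Rabs_lt_between. unfold d in *. lra.
Qed.

Lemma pochhammer_half s j : pochhammer (INR s + 1 / 2) j = half_rising (s + j) / half_rising s.
Proof.
  unfold pochhammer. replace (INR s + 1 / 2 + INR j) with (INR (s + j) + 1 / 2)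
    by (rewrite plus_INR; ring).
  rewrite !Gamma_half. field. split.
  - generalize (half_rising_pos s); lra.
  - generalize sqrt_PI_ge; lra.
Qed.

Lemma pochhammer_half0 s : pochhammer (1 / 2) s = half_rising s.
Proof.
  replace (1 / 2) with (INR 0 + 1 / 2) by (simpl; ring). rewrite pochhammer_half. simpl. field.
Qed.

(** * Laplace's method *)

Lemma ex_Cint_Csum (F : nat -> R -> C) a b n : (forall k, (k < n)%nat -> ex_Cint (F k) a b) ->
  ex_Cint (fun x => Csum (fun k => F k x) n) a b.
Proof.
  induction n as [|n IH]; intros H; simpl Csum.
  - split; apply ex_RInt_const.
  - apply (ex_Cint_plus (fun x => Csum (fun k => F k x) n) (F n)); [apply IH; intros; apply H; lia|apply H; lia].
Qed.

Lemma Cint_Csum (F : nat -> R -> C) a b n : (forall k, (k < n)%nat -> ex_Cint (F k) a b) ->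
  Cint (fun x => Csum (fun k => F k x) n) a b = Csum (fun k => Cint (F k) a b) n.
Proof.
  induction n as [|n IH]; intros H; simpl Csum; [apply Cint_zero|].
  rewrite (Cint_plus (fun x => Csum (fun k => F k x) n) (F n)).
  - rewrite IH by (intros; apply H; lia). reflexivity.
  - apply ex_Cint_Csum. intros; apply H; lia.
  - apply H; lia.
Qed.

Definition decay_const (k : nat) : R := 16 ^ (k + 1) * (INR (fact (k + 1)) * exp 1).

Lemma decay_const_pos k : 0 < decay_const k.
Proof.
  unfold decay_const. apply Rmult_lt_0_compat; [apply pow_lt; lra|].
  apply Rmult_lt_0_compat; [apply INR_fact_lt_0|apply exp_pos].
Qed.

(** The integrable majorant 1 / (1 + y^2) is used with y = sqrt H |x|, for
    which its integral supplies a factor H^(-1/2) ([lorentz_integral]). *)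
Lemma gauss_decay k y : 0 <= y -> y ^ k * exp (- (y ^ 2 / 16)) <= decay_const k / (1 + y ^ 2).
Proof.
  intros Hy. assert (P : 0 < 1 + y ^ 2) by (generalize (pow2_ge_0 y); lra).
  apply Rmult_le_reg_r with (1 + y ^ 2); [exact P|].
  unfold Rdiv. rewrite (Rmult_assoc (decay_const k)), Rinv_l, Rmult_1_r by lra.
  assert (A : y ^ k * (1 + y ^ 2) <= (1 + y ^ 2) ^ (k + 1)).
  { rewrite pow_add, pow_1. apply Rmult_le_compat_r; [lra|]. apply pow_incr. split; [exact Hy|].
    assert (0 <= (1 - y) ^ 2) by apply pow2_ge_0. nra. }
  pose proof (pow_fact_le ((1 + y ^ 2) / 16) (k + 1) ltac:(lra)) as B.
  unfold Rdiv in B. rewrite Rpow_mult_distr, pow_inv in B.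
  assert (C16 : 0 < 16 ^ (k + 1)) by (apply pow_lt; lra).
  assert (B2 : (1 + y ^ 2) ^ (k + 1) <= 16 ^ (k + 1) * (INR (fact (k + 1)) * exp ((1 + y ^ 2) * / 16))).
  { apply Rmult_le_reg_r with (/ 16 ^ (k + 1)); [apply Rinv_0_lt_compat, C16|].
    eapply Rle_trans; [exact B|]. right. field. lra. }
  assert (E : exp ((1 + y ^ 2) * / 16) * exp (- (y ^ 2 * / 16)) <= exp 1).
  { rewrite <- exp_plus. apply exp_le. lra. }
  generalize (exp_pos (- (y ^ 2 * / 16))); intros Hp.
  apply Rle_trans with (16 ^ (k + 1) * (INR (fact (k + 1)) * exp ((1 + y ^ 2) * / 16)) * exp (- (y ^ 2 * / 16))).
  - replace (y ^ k * exp (- (y ^ 2 * / 16)) * (1 + y ^ 2)) with (y ^ k * (1 + y ^ 2) * exp (- (y ^ 2 * / 16))) by ring.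
    apply Rmult_le_compat_r; [lra|]. eapply Rle_trans; [exact A|exact B2].
  - unfold decay_const.
    replace (16 ^ (k + 1) * (INR (fact (k + 1)) * exp ((1 + y ^ 2) * / 16)) * exp (- (y ^ 2 * / 16))) with
     (16 ^ (k + 1) * (INR (fact (k + 1)) * (exp ((1 + y ^ 2) * / 16) * exp (- (y ^ 2 * / 16))))) by ring.
    apply Rmult_le_compat_l; [lra|]. apply Rmult_le_compat_l; [left; apply INR_fact_lt_0|exact E].
Qed.

Lemma lorentz_continuous H x : 0 <= H -> continuous (fun x => / (1 + H * x ^ 2)) x.
Proof.
  intros HH. apply ex_derive_cont. auto_derive.
  assert (0 <= H * (x * (x * 1))) by (apply Rmult_le_pos; nra). lra.
Qed.

Lemma lorentz_integral s : 0 < s -> RInt (fun x => / (1 + s ^ 2 * x ^ 2)) (-1) 1 <= 4 / s.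
Proof.
  intros Hs.
  assert (E : RInt (fun x => / (1 + s ^ 2 * x ^ 2)) (-1) 1 = atan (s * 1) / s - atan (s * -1) / s).
  { apply is_RInt_unique.
    apply (is_RInt_derive (V := R_CompleteNormedModule) (fun x => atan (s * x) / s)).
    - intros x _. evar_last; [auto_derive; [exact I|reflexivity]|].
      assert (0 < 1 + s ^ 2 * x ^ 2) by (generalize (pow2_ge_0 (s * x)); rewrite Rpow_mult_distr; lra).
      field. simpl in *. repeat split; try lra; nra.
    - intros x _. apply lorentz_continuous, pow2_ge_0. }
  rewrite E. pose proof (atan_bound (s * 1)). pose proof (atan_bound (s * -1)). generalize PI_4; intros.
  unfold Rdiv. rewrite <- Rmult_minus_distr_r. apply Rmult_le_compat_r; [left; apply Rinv_0_lt_compat, Hs|]. lra.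
Qed.

Definition exp_coef (nu : C) (j : nat) : C := ((- nu) ^ j / RtoC (INR (fact j)))%C.

Lemma Cmod_exp_coef nu j : Cmod (exp_coef nu j) <= Cmod nu ^ j.
Proof.
  unfold exp_coef. rewrite Cmod_div, Cmod_pow, Cmod_opp, Cmod_R by apply fact_neq0_C.
  rewrite Rabs_right by (left; apply INR_fact_lt_0).
  pose proof (inv_fact_le_1 j). pose proof (pow_le _ j (Cmod_ge_0 nu)). unfold Rdiv. nra.
Qed.

(** Obtained by expanding exp (- nu x^2 gm) to order M in powers of nu x^2 gm,
    replacing gm^j b by its Taylor polynomial, and integrating over [-1, 1]
    term by term. *)
Definition laplace_sum (nu z : C) (ga ba : nat -> C) (M : nat) : C :=
  Csum (fun j => Csum (fun m => exp_coef nu j * conv (cpow ga j) ba m * moment z (2 * j + m))%C M) M.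

Definition laplace_const (N : nat) (K : R) : R :=
  let M := (2 * N + 1)%nat in
  4 * (((1 + INR M) * K) ^ (M + 1) * decay_const (3 * M) +
       Rsum (fun j => (1 + INR M) ^ 2 * (pow_const M K j * K) * decay_const (2 * j + M)) M).

Lemma Csum_Rbound (f : nat -> C) (g : nat -> R) n : (forall k, (k < n)%nat -> Cmod (f k) <= g k) ->
  Cmod (Csum f n) <= Rsum g n.
Proof.
  induction n as [|n IH]; intros H; simpl.
  - rewrite Cmod_0; lra.
  - eapply Rle_trans; [apply Cmod_triangle|]. apply Rplus_le_compat; [apply IH; intros; apply H; lia|apply H; lia].
Qed.

Lemma Rsum_Rdiv f c n : Rsum (fun k => f k * c) n = Rsum f n * c.
Proof. induction n as [|n IH]; simpl; [ring|]. rewrite IH. ring. Qed.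

Lemma pow_const_ge0 M K j : 0 <= K -> 0 <= pow_const M K j.
Proof.
  intros HK. induction j as [|j IH]; simpl; [lra|].
  apply Rmult_le_pos; [apply (pow2_ge_0 (1 + INR M))|apply Rmult_le_pos; assumption].
Qed.

(** Write H = |nu|, y = sqrt H |x| and X = nu x^2 gm = O (H |x|^3). The
    remainder of order M of e^(-X) is O (y^(3M) H^(-M/2)), and replacing gm^j
    b by its Taylor polynomial costs H^j |x|^(2j+M) = y^(2j+M) H^(-M/2). The
    Gaussian turns the powers of y into the majorant of [gauss_decay], whose
    integral gives another H^(-1/2); for M = 2 N + 1 the total is H^(-N-1). *)
Lemma laplace N K (nu z a0 : C) (gm b : R -> C) (ga ba : nat -> C) :
  0 <= K -> 1 <= Cmod nu -> z = (nu * a0)%C -> Cmod nu / 8 <= Re z ->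
  (forall x, Rabs x <= 1 -> Cmod nu * x ^ 2 / 16 <= Re (nu * RtoC x ^ 2 * (a0 + gm x))%C) ->
  ga 0%nat = RtoC 0 -> approx gm ga (2 * N + 1) K -> approx b ba (2 * N + 1) K ->
  ex_Cint (fun x => Cexp (- (nu * RtoC x ^ 2 * (a0 + gm x))) * b x)%C (-1) 1 ->
  Cmod (Cint (fun x => Cexp (- (nu * RtoC x ^ 2 * (a0 + gm x))) * b x)%C (-1) 1 -
        laplace_sum nu z ga ba (2 * N + 1))%C <= laplace_const N K / Cmod nu ^ (N + 1).
Proof.
  intros HK HH Ez Hz Hgap Hg0 Hgm Hb Hex.
  set (M := (2 * N + 1)%nat) in *. set (H := Cmod nu) in *.
  set (main := fun j x => (exp_coef nu j * RtoC x ^ (2 * j) * gauss z x * tpoly (conv (cpow ga j) ba) M x)%C).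
  assert (Xmono : forall k c, ex_Cint (fun x => c * (RtoC x ^ k * gauss z x))%C (-1) 1).
  { intros k c. apply ex_Cint_scal, ex_Cint_moment. lra. }
  assert (Emain : forall j x, main j x = Csum (fun m => exp_coef nu j * conv (cpow ga j) ba m * (RtoC x ^ (2 * j + m) * gauss z x))%C M).
  { intros j x. unfold main, tpoly. rewrite <- Csum_scal. apply Csum_ext. intros m _.
    rewrite Cpow_add_r. ring. }
  assert (Xmain : forall j, ex_Cint (main j) (-1) 1).
  { intros j.
    destruct (ex_Cint_Csum (fun m x => exp_coef nu j * conv (cpow ga j) ba m * (RtoC x ^ (2 * j + m) * gauss z x))%C (-1) 1 M) as [A B].
    - intros m _. apply Xmono.
    - split; [eapply ex_RInt_ext; [|exact A]|eapply ex_RInt_ext; [|exact B]]; intros x _; cbv beta; rewrite Emain; reflexivity. }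
  assert (Imain : Cint (fun x => Csum (fun j => main j x) M) (-1) 1 = laplace_sum nu z ga ba M).
  { rewrite Cint_Csum by (intros; apply Xmain). unfold laplace_sum. apply Csum_ext. intros j _.
    rewrite (Cint_ext _ (fun x => Csum (fun m => exp_coef nu j * conv (cpow ga j) ba m * (RtoC x ^ (2 * j + m) * gauss z x))%C M)); [|lra|intros; apply Emain].
    rewrite (Cint_Csum (fun m x => exp_coef nu j * conv (cpow ga j) ba m * (RtoC x ^ (2 * j + m) * gauss z x))%C) by (intros; apply Xmono).
    apply Csum_ext. intros m _. apply Cint_scal. apply ex_Cint_moment. lra. }
  rewrite <- Imain.
  rewrite <- Cint_minus; [|exact Hex|apply ex_Cint_Csum; intros; apply Xmain].
  set (s := sqrt H). assert (Hs : 1 <= s) by (unfold s; rewrite <- sqrt_1; apply sqrt_le_1_alt; exact HH).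
  assert (Hs2 : s ^ 2 = H) by (unfold s; simpl; rewrite Rmult_1_r; apply sqrt_sqrt; lra).
  set (C1 := (1 + INR M) * K). assert (HC1 : 0 <= C1) by (unfold C1; generalize (pos_INR M); intros; nra).
  set (Ct := C1 ^ (M + 1) * decay_const (3 * M) + Rsum (fun j => (1 + INR M) ^ 2 * (pow_const M K j * K) * decay_const (2 * j + M)) M).
  assert (Hs0 : 0 < s ^ M) by (apply pow_lt; lra).
  apply Rle_trans with (RInt (fun x => Ct / s ^ M * / (1 + s ^ 2 * x ^ 2)) (-1) 1).
  - apply Cint_bound; [lra|apply ex_Cint_minus; [exact Hex|apply ex_Cint_Csum; intros; apply Xmain]| |].
    { apply ex_RInt_Rscal, ex_RInt_cont; [lra|]. intros; apply lorentz_continuous, pow2_ge_0. }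
    intros x Hx0. assert (Hx : Rabs x <= 1) by (apply Rabs_le; lra). clear Hx0.
    (* The part of the exponent beyond the quadratic term. *)
    set (X := (nu * RtoC x ^ 2 * gm x)%C).
    set (y := s * Rabs x). assert (Hy : 0 <= y) by (unfold y; generalize (Rabs_pos x); intros; nra).
    assert (Hy2 : y ^ 2 = H * x ^ 2) by (unfold y; rewrite Rpow_mult_distr, Hs2, pow2_abs; reflexivity).
    replace (s ^ 2 * x ^ 2) with (y ^ 2) by (rewrite Hs2; exact Hy2).
    assert (EE : Cexp (- (nu * RtoC x ^ 2 * (a0 + gm x)))%C = (gauss z x * Cexp (- X))%C).
    { unfold gauss. rewrite <- Cexp_plus. f_equal. unfold X. rewrite Ez. ring. }
    rewrite EE.
    assert (ES : (gauss z x * Cexp (- X) * b x - Csum (fun j => main j x) M)%C =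
      (gauss z x * (Cexp (- X) - Csum (expterm X) M) * b x +
       Csum (fun j => gauss z x * (exp_coef nu j * RtoC x ^ (2 * j)) * (gm x ^ j * b x - tpoly (conv (cpow ga j) ba) M x)) M)%C).
    { rewrite (Csum_ext (fun j => gauss z x * (exp_coef nu j * RtoC x ^ (2 * j)) * (gm x ^ j * b x - tpoly (conv (cpow ga j) ba) M x))%C
        (fun j => gauss z x * b x * expterm X j - main j x)%C).
      - rewrite Csum_minus, Csum_scal. ring.
      - intros j _. unfold main, expterm, exp_coef, X.
        replace (- (nu * RtoC x ^ 2 * gm x))%C with (- nu * (RtoC x ^ 2 * gm x))%C by ring.
        rewrite !Cpow_mult_l, Cpow_mult_r. unfold Cdiv. ring. }
    rewrite ES. clear ES EE.
    assert (G1 : Cmod (gauss z x) <= exp (- (y ^ 2 / 16))).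
    { rewrite Cmod_gauss. apply exp_le. rewrite Hy2. assert (0 <= x ^ 2) by apply pow2_ge_0. nra. }
    (* The Taylor remainder of e^(-X) involves max (1, e^(- Re X)). Multiplied
       by the Gaussian, both cases stay Gaussian: the second one is the full
       exponential, controlled by the gap hypothesis. *)
    assert (G2 : Cmod (gauss z x) * Rmax 1 (exp (- Re X)) <= exp (- (y ^ 2 / 16))).
    { unfold Rmax. destruct (Rle_dec 1 (exp (- Re X))); [|rewrite Rmult_1_r; exact G1].
      rewrite Cmod_gauss, <- exp_plus. apply exp_le. rewrite Hy2.
      specialize (Hgap x Hx).
      replace (nu * RtoC x ^ 2 * (a0 + gm x))%C with (z * RtoC (x ^ 2) + X)%C in Hgap.
      - rewrite re_plus, re_mult, re_RtoC, im_RtoC in Hgap. lra.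
      - unfold X. rewrite Ez, RtoC_pow. ring. }
    assert (Bgm : Cmod (gm x) <= C1 * Rabs x) by (apply (approx_bound_lin gm ga M K x); auto; unfold M; lia).
    assert (Bb : Cmod (b x) <= C1) by (apply (approx_bound b ba M K x); auto).
    assert (BX : Cmod X <= C1 * (H * Rabs x ^ 3)).
    { unfold X. rewrite !Cmod_mult, Cmod_Rpow. fold H.
      replace (C1 * (H * Rabs x ^ 3)) with (H * Rabs x ^ 2 * (C1 * Rabs x)) by ring.
      apply Rmult_le_compat_l; [|exact Bgm]. apply Rmult_le_pos; [lra|apply pow_le, Rabs_pos]. }
    assert (Hax : 0 <= Rabs x) by apply Rabs_pos.
    assert (T1 : Cmod (gauss z x * (Cexp (- X) - Csum (expterm X) M) * b x)%C <=
      C1 ^ (M + 1) * decay_const (3 * M) * (/ s ^ M * / (1 + y ^ 2))).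
    { rewrite !Cmod_mult.
      pose proof (exp_taylor X M (Rmax 1 (exp (- Re X))) (Rmax_l _ _) (Rmax_r _ _)) as T.
      apply Rle_trans with ((C1 * (H * Rabs x ^ 3)) ^ M * exp (- (y ^ 2 / 16)) * C1).
      - apply Rmult_le_compat; [apply Rmult_le_pos; apply Cmod_ge_0|apply Cmod_ge_0| |exact Bb].
        apply Rle_trans with (Cmod X ^ M * (Cmod (gauss z x) * Rmax 1 (exp (- Re X)))).
        + replace (Cmod X ^ M * (Cmod (gauss z x) * Rmax 1 (exp (- Re X)))) with
            (Cmod (gauss z x) * (Cmod X ^ M * Rmax 1 (exp (- Re X)))) by ring.
          apply Rmult_le_compat_l; [apply Cmod_ge_0|exact T].
        + apply Rmult_le_compat; [apply pow_le, Cmod_ge_0| |apply pow_incr; split; [apply Cmod_ge_0|exact BX]|exact G2].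
          apply Rmult_le_pos; [apply Cmod_ge_0|]. apply Rle_trans with 1; [lra|apply Rmax_l].
      - pose proof (gauss_decay (3 * M) y Hy) as D.
        assert (E : (C1 * (H * Rabs x ^ 3)) ^ M = C1 ^ M * (y ^ (3 * M) * / s ^ M)).
        { rewrite Rpow_mult_distr. f_equal. rewrite <- Hs2. unfold y.
          rewrite !Rpow_mult_distr, <- !pow_mult.
          replace (3 * M)%nat with (2 * M + M)%nat at 2 by lia. rewrite (pow_add s). field. lra. }
        rewrite E, pow_add, pow_1.
        replace (C1 ^ M * (y ^ (3 * M) * / s ^ M) * exp (- (y ^ 2 / 16)) * C1) with
          (C1 ^ M * C1 * / s ^ M * (y ^ (3 * M) * exp (- (y ^ 2 / 16)))) by ring.
        replace (C1 ^ M * C1 * decay_const (3 * M) * (/ s ^ M * / (1 + y ^ 2))) with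
          (C1 ^ M * C1 * / s ^ M * (decay_const (3 * M) / (1 + y ^ 2))) by (unfold Rdiv; ring).
        apply Rmult_le_compat_l; [|exact D].
        apply Rmult_le_pos; [apply Rmult_le_pos; [apply pow_le|]; exact HC1|left; apply Rinv_0_lt_compat, Hs0]. }
    assert (T2 : Cmod (Csum (fun j => gauss z x * (exp_coef nu j * RtoC x ^ (2 * j)) * (gm x ^ j * b x - tpoly (conv (cpow ga j) ba) M x))%C M) <=
      Rsum (fun j => (1 + INR M) ^ 2 * (pow_const M K j * K) * decay_const (2 * j + M)) M * (/ s ^ M * / (1 + y ^ 2))).
    { rewrite <- Rsum_Rdiv. apply Csum_Rbound. intros j _.
      pose proof (approx_mult _ _ _ _ _ _ _ (approx_pow gm ga M K j Hgm) Hb) as (_ & A & _).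
      specialize (A x Hx). cbv beta in A.
      set (Kj := (1 + INR M) ^ 2 * (pow_const M K j * K)) in *.
      assert (HKj : 0 <= Kj).
      { unfold Kj. apply Rmult_le_pos; [apply pow2_ge_0|]. apply Rmult_le_pos; [apply pow_const_ge0|]; exact HK. }
      rewrite !Cmod_mult, Cmod_Rpow.
      pose proof (Cmod_exp_coef nu j) as Ec. fold H in Ec.
      apply Rle_trans with (exp (- (y ^ 2 / 16)) * (H ^ j * Rabs x ^ (2 * j)) * (Kj * Rabs x ^ M)).
      - apply Rmult_le_compat; [|apply Cmod_ge_0| |exact A].
        + repeat apply Rmult_le_pos; try apply Cmod_ge_0. apply pow_le, Hax.
        + apply Rmult_le_compat; [apply Cmod_ge_0| |exact G1|].
          * apply Rmult_le_pos; [apply Cmod_ge_0|apply pow_le, Hax].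
          * apply Rmult_le_compat_r; [apply pow_le, Hax|exact Ec].
      - pose proof (gauss_decay (2 * j + M) y Hy) as D.
        assert (E : H ^ j * Rabs x ^ (2 * j) * Rabs x ^ M = y ^ (2 * j + M) * / s ^ M).
        { rewrite <- Hs2. unfold y. rewrite !Rpow_mult_distr, <- !pow_mult, !pow_add. field. lra. }
        replace (exp (- (y ^ 2 / 16)) * (H ^ j * Rabs x ^ (2 * j)) * (Kj * Rabs x ^ M)) with
          (Kj * exp (- (y ^ 2 / 16)) * (H ^ j * Rabs x ^ (2 * j) * Rabs x ^ M)) by ring.
        rewrite E.
        replace (Kj * exp (- (y ^ 2 / 16)) * (y ^ (2 * j + M) * / s ^ M)) with
          (Kj * / s ^ M * (y ^ (2 * j + M) * exp (- (y ^ 2 / 16)))) by ring.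
        replace (Kj * decay_const (2 * j + M) * (/ s ^ M * / (1 + y ^ 2))) with
          (Kj * / s ^ M * (decay_const (2 * j + M) / (1 + y ^ 2))) by (unfold Rdiv; ring).
        apply Rmult_le_compat_l; [|exact D].
        apply Rmult_le_pos; [exact HKj|left; apply Rinv_0_lt_compat, Hs0]. }
    eapply Rle_trans; [apply Cmod_triangle|].
    eapply Rle_trans; [apply Rplus_le_compat; [exact T1|exact T2]|].
    right. unfold Ct, Rdiv. ring.
  - rewrite RInt_Rscal by (apply ex_RInt_cont; [lra|]; intros; apply lorentz_continuous, pow2_ge_0).
    pose proof (lorentz_integral s ltac:(lra)) as L.
    assert (HCt : 0 <= Ct).
    { unfold Ct. apply Rplus_le_le_0_compat.
      - apply Rmult_le_pos; [apply pow_le, HC1|left; apply decay_const_pos].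
      - clear - HK. generalize M at 4. intros n. induction n as [|n IH]; simpl; [lra|].
        apply Rplus_le_le_0_compat; [exact IH|]. apply Rmult_le_pos; [|left; apply decay_const_pos].
        apply Rmult_le_pos; [apply (pow2_ge_0 (1 + INR M))|]. apply Rmult_le_pos; [apply pow_const_ge0|]; exact HK. }
    apply Rle_trans with (Ct / s ^ M * (4 / s)).
    + apply Rmult_le_compat_l; [|exact L].
      apply Rmult_le_pos; [exact HCt|left; apply Rinv_0_lt_compat, Hs0].
    + right. unfold laplace_const. fold M. fold C1. fold Ct.
      rewrite <- Hs2, <- pow_mult. replace (2 * (N + 1))%nat with (M + 1)%nat by (unfold M; lia).
      rewrite pow_add, pow_1. field. split; lra.
Qed.

(** * The coefficients of the expansion *)

Lemma sum_n_m_Csum (a : nat -> C) N : sum_n_m (G := C_AbelianGroup) a 0 N = Csum a (S N).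
Proof. apply sum_n_Csum. Qed.

Lemma sum_n_m_Csum1 (a : nat -> C) N : sum_n_m (G := C_AbelianGroup) a 1 N = Csum (fun k => a (S k)) N.
Proof.
  destruct N as [|N].
  - rewrite sum_n_m_zero by lia. reflexivity.
  - rewrite <- sum_n_m_Csum. symmetry. apply (sum_n_m_S a 0 N).
Qed.

Lemma Csum_tail_zero f n m : (forall k, (n <= k < n + m)%nat -> f k = RtoC 0) -> Csum f (n + m) = Csum f n.
Proof.
  intros H. rewrite Csum_split, (Csum_zero _ m) by (intros; apply H; lia). ring.
Qed.

(** The recursion of the Bell polynomials is the multiplication by a series
    without constant term, and each factor alpha_r contributes one w. *)
Lemma bell_cpow (w : C) (alpha : nat -> C) : (forall r, alpha r = (w * phase_coef w r)%C) ->
  forall j k, (j <= k)%nat -> bell alpha j k = (w ^ j * cpow (phase_tail_coef w) j k)%C.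
Proof.
  intros Ha. induction j as [|j IH]; intros k Hk.
  - simpl. destruct k; ring.
  - simpl bell. rewrite sum_n_m_Csum1. simpl cpow. unfold conv.
    rewrite (Csum_shift (fun i => phase_tail_coef w i * cpow (phase_tail_coef w) j (k - i))%C k). simpl (phase_tail_coef w 0).
    rewrite Cmult_0_l, Cplus_0_l, <- Csum_scal.
    replace (k - S j + 1)%nat with (k - j)%nat by lia.
    symmetry.
    match goal with |- Csum ?F k = _ => transitivity (Csum F ((k - j) + j)); [f_equal; lia|] end.
    rewrite Csum_tail_zero.
    + apply Csum_ext. intros i Hi. rewrite IH by lia. rewrite Ha. simpl. ring.
    + intros i Hi. rewrite cpow_zero by (auto; lia). ring.
Qed.

Lemma Csum_swap (F : nat -> nat -> C) n m :
  Csum (fun i => Csum (fun j => F i j) m) n = Csum (fun j => Csum (fun i => F i j) n) m.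
Proof.
  induction n as [|n IH]; simpl.
  - symmetry. apply Csum_zero. reflexivity.
  - rewrite IH, <- Csum_plus. reflexivity.
Qed.

(** All sums over j get the same range M, because [cpow] vanishes below the
    diagonal; the double sum can then be exchanged. *)
Lemma chat_formula (w f0 : C) (alpha beta ba : nat -> C) s M :
  w <> RtoC 0 -> f0 <> RtoC 0 -> phase_coef w 0 <> RtoC 0 -> ba 0%nat = RtoC 1 ->
  (forall r, alpha r = (w * phase_coef w r)%C) -> (forall r, beta r = (f0 * ba r)%C) ->
  (2 * s < M)%nat ->
  chat alpha beta s = (/ (alpha 0%nat ^ s) *
    Csum (fun j => RtoC ((-1) ^ j * (half_rising (s + j) / half_rising s) / INR (fact j)) * / phase_coef w 0 ^ j *
       conv (cpow (phase_tail_coef w) j) ba (2 * s)) M)%C.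
Proof.
  intros Hw Hf Ha0 Hb Ha Hbe HM. unfold chat. f_equal. rewrite sum_n_m_Csum.
  set (d := fun j => (RtoC ((-1) ^ j * (half_rising (s + j) / half_rising s) / INR (fact j)) * / phase_coef w 0 ^ j)%C).
  rewrite (Csum_ext _ (fun k => Csum (fun j => d j * (cpow (phase_tail_coef w) j k * ba (2 * s - k)%nat)) M)%C).
  - rewrite Csum_swap. apply Csum_ext. intros j _. unfold conv. rewrite <- Csum_scal.
    reflexivity.
  - intros k Hk. rewrite sum_n_m_Csum.
    replace (Csum (fun j => d j * (cpow (phase_tail_coef w) j k * ba (2 * s - k)%nat))%C M) with
      (Csum (fun j => d j * (cpow (phase_tail_coef w) j k * ba (2 * s - k)%nat))%C (S k + (M - S k))) by (f_equal; lia).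
    rewrite Csum_tail_zero.
    + rewrite <- Csum_scal. apply Csum_ext. intros j Hj.
      rewrite (bell_cpow w alpha Ha) by lia. rewrite !Hbe, Hb, Ha, pochhammer_half.
      rewrite Cpow_mult_l. unfold d. rewrite RtoC_div by apply INR_fact_neq_0.
      pose proof (fact_neq0_C j) as Nf.
      assert (Nw : (w ^ j)%C <> RtoC 0) by (apply Cpow_nz, Hw).
      assert (Na : (phase_coef w 0 ^ j)%C <> RtoC 0) by (apply Cpow_nz, Ha0).
      field. repeat split; assumption.
    + intros j Hj. rewrite cpow_zero by (auto; lia). ring.
Qed.

Lemma Csum_even F N : (forall k, F (2 * k + 1)%nat = RtoC 0) ->
  Csum F (2 * N + 1) = Csum (fun s => F (2 * s)%nat) (N + 1).
Proof.
  intros H. induction N as [|N IH]; [reflexivity|].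
  replace (2 * S N + 1)%nat with (S (S (2 * N + 1))) by lia.
  replace (S N + 1)%nat with (S (N + 1)) by lia. simpl Csum. simpl in IH. rewrite IH.
  replace (N + (N + 0) + 1)%nat with (2 * N + 1)%nat by lia. rewrite H.
  replace (S (2 * N + 1)) with (N + 1 + (N + 1 + 0))%nat by lia. ring.
Qed.

Definition moment_const (N : nat) (K : R) : R :=
  let M := (2 * N + 1)%nat in
  Rsum (fun j => Rsum (fun s => (1 + INR M) ^ 2 * (pow_const M K j * K) * (2 * moment_error (j + s))) (N + 1)) M.

(** The odd moments vanish, and [half_moment_close] evaluates the even ones up
    to e^(- Re z). *)
Lemma laplace_sum_moments N K (nu z r : C) (gm b : R -> C) (ga ba : nat -> C) :
  0 <= K -> 1 <= Cmod nu -> approx gm ga (2 * N + 1) K -> approx b ba (2 * N + 1) K ->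
  0 < Re z -> Rabs (Im z) <= Re z / 2 -> 0 < Re r -> (r * r * z)%C = RtoC 1 -> Cmod r <= 1 ->
  Cmod (laplace_sum nu z ga ba (2 * N + 1) -
    Csum (fun j => Csum (fun s => exp_coef nu j * conv (cpow ga j) ba (2 * s) *
      (RtoC (half_rising (j + s) * sqrt PI) * r ^ (2 * (j + s) + 1))) (N + 1)) (2 * N + 1))%C
  <= moment_const N K * (Cmod nu ^ (2 * N) * exp (- Re z)).
Proof.
  intros HK HH Hg Hb Hz Hiz Hr E Hr1. set (M := (2 * N + 1)%nat) in *. set (H := Cmod nu) in *.
  unfold laplace_sum.
  rewrite (Csum_ext _ (fun j => Csum (fun s => exp_coef nu j * conv (cpow ga j) ba (2 * s) * (RtoC 2 * half_moment z (2 * (j + s)))) (N + 1))%C).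
  2:{ intros j _. unfold M. rewrite (Csum_even (fun m => exp_coef nu j * conv (cpow ga j) ba m * moment z (2 * j + m))%C).
      - apply Csum_ext. intros s _. replace (2 * j + 2 * s)%nat with (2 * (j + s))%nat by lia.
        rewrite moment_even. reflexivity.
      - intros k. replace (2 * j + (2 * k + 1))%nat with (2 * (j + k) + 1)%nat by lia.
        rewrite moment_odd. ring. }
  rewrite <- Csum_minus.
  unfold moment_const. fold M. rewrite <- Rsum_Rdiv. apply Csum_Rbound. intros j Hj.
  rewrite <- Csum_minus, <- Rsum_Rdiv. apply Csum_Rbound. intros s Hs.
  rewrite <- Cmult_minus_distr_l, !Cmod_mult.
  pose proof (proj2 (proj2 (approx_mult _ _ _ _ _ _ _ (approx_pow gm ga M K j Hg) Hb)) (2 * s)%nat ltac:(unfold M; lia)) as A.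
  pose proof (half_moment_close z r (j + s) Hz Hiz Hr E Hr1) as G.
  assert (Hp : forall k, 0 <= H ^ k) by (intros; apply pow_le; lra).
  assert (Ec : Cmod (exp_coef nu j) <= H ^ (2 * N)).
  { eapply Rle_trans; [apply Cmod_exp_coef|]. apply Rle_pow; [exact HH|unfold M in Hj; lia]. }
  set (Kj := (1 + INR M) ^ 2 * (pow_const M K j * K)) in *.
  replace (RtoC 2 * half_moment z (2 * (j + s)) - RtoC (half_rising (j + s) * sqrt PI) * r ^ (2 * (j + s) + 1))%C with
    (RtoC 2 * (half_moment z (2 * (j + s)) - RtoC (half_rising (j + s) * (sqrt PI / 2)) * r ^ (2 * (j + s) + 1)))%C.
  2:{ replace (half_rising (j + s) * sqrt PI) with (2 * (half_rising (j + s) * (sqrt PI / 2))) by field.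
      rewrite (RtoC_mult 2). ring. }
  rewrite Cmod_mult, Cmod_R, (Rabs_right 2) by lra.
  apply Rle_trans with (H ^ (2 * N) * Kj * (2 * (moment_error (j + s) * exp (- Re z)))).
  - apply Rmult_le_compat; [apply Rmult_le_pos; apply Cmod_ge_0| | |].
    + apply Rmult_le_pos; [lra|apply Cmod_ge_0].
    + apply Rmult_le_compat; auto using Cmod_ge_0.
    + apply Rmult_le_compat_l; [lra|exact G].
  - right. ring.
Qed.

(** Here r^2 = 1 / z = 1 / (n alpha_0). In the term (j, s) the power r^(2j+2s)
    cancels nu^j up to the j-th power of 1 / phase_coef w 0 and leaves n^(-s)
    alpha_0^(-s), so that the sum over j is that of [chat_formula]. *)
Lemma main_sum_chat N (w z r f0 : C) (n : R) (alpha beta ba : nat -> C) :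
  n <> 0 -> w <> RtoC 0 -> f0 <> RtoC 0 -> phase_coef w 0 <> RtoC 0 -> ba 0%nat = RtoC 1 ->
  (forall r, alpha r = (w * phase_coef w r)%C) -> (forall r, beta r = (f0 * ba r)%C) ->
  z = (RtoC n * w * phase_coef w 0)%C -> (r * r * z)%C = RtoC 1 ->
  Csum (fun j => Csum (fun s => exp_coef (RtoC n * w) j * conv (cpow (phase_tail_coef w) j) ba (2 * s) *
      (RtoC (half_rising (j + s) * sqrt PI) * r ^ (2 * (j + s) + 1))) (N + 1))%C (2 * N + 1) =
  (r * RtoC (sqrt PI) * Csum (fun s => RtoC (half_rising s / n ^ s) * chat alpha beta s) (N + 1))%C.
Proof.
  intros Hn Hw Hf Ha0 Hb Ha Hbe Ez Er.
  assert (NC : RtoC n <> RtoC 0) by (apply RtoC_neq0, Hn).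
  assert (Er2 : (r * r)%C = (/ (RtoC n * w * phase_coef w 0))%C).
  { rewrite <- Ez. apply Cmult_reg_r with z.
    - rewrite Ez. repeat apply Cmult_neq_0; assumption.
    - rewrite Er. field. rewrite Ez. repeat apply Cmult_neq_0; assumption. }
  rewrite Csum_swap, <- Csum_scal. apply Csum_ext. intros s Hs.
  rewrite (chat_formula w f0 alpha beta ba s (2 * N + 1)) by (auto; lia).
  rewrite Ha, <- !Csum_scal. apply Csum_ext. intros j _.
  assert (Nnj : forall k, (RtoC n ^ k)%C <> RtoC 0) by (intros; apply Cpow_nz, NC).
  assert (Nwj : forall k, (w ^ k)%C <> RtoC 0) by (intros; apply Cpow_nz, Hw).
  assert (Naj : forall k, (phase_coef w 0 ^ k)%C <> RtoC 0) by (intros; apply Cpow_nz, Ha0).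
  assert (Epow : (r ^ (2 * (j + s) + 1))%C = (r * / (RtoC n ^ j * w ^ j * phase_coef w 0 ^ j) * / (RtoC n ^ s * w ^ s * phase_coef w 0 ^ s))%C).
  { rewrite Cpow_add_r, Cpow_mult_r. replace (r ^ 2)%C with (r * r)%C by (simpl; ring).
    rewrite Er2, Cpow_inv by (repeat apply Cmult_neq_0; assumption).
    rewrite Cpow_add_r, !Cpow_mult_l. simpl (r ^ 1)%C. field. repeat split; auto. }
  rewrite Epow. unfold exp_coef.
  replace (- (RtoC n * w))%C with (RtoC (-1) * (RtoC n * w))%C by (apply C_ext; unfold Re, Im; simpl; ring).
  rewrite !Cpow_mult_l, <- RtoC_pow.
  replace (j + s)%nat with (s + j)%nat by lia.
  pose proof (half_rising_pos s) as Hps. pose proof (fact_neq0_C j) as Nf.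
  assert (Nh : RtoC (half_rising s) <> RtoC 0) by (apply RtoC_neq0; lra).
  rewrite (RtoC_div (half_rising s)) by (apply pow_nonzero, Hn).
  rewrite RtoC_div, RtoC_mult, RtoC_mult, RtoC_div, (RtoC_pow n) by (try apply INR_fact_neq_0; lra).
  field. repeat split; auto.
Qed.

(** * The contribution of the saddle *)

(** The large parameter of the Laplace expansion; its modulus is 2 pi e^u
    ([nu_exp]). *)
Definition nu (n : nat) (t0 : C) : C := (RtoC (INR n) * / t0)%C.
(** This is n alpha_0, the coefficient of the quadratic term of n psi at t0. *)
Definition gauss_param (n : nat) (t0 : C) : C := (nu n t0 * phase_coef (/ t0) 0)%C.

Lemma Cmod_nu n t0 : Cmod (nu n t0) = INR n * Cmod (/ t0)%C.
Proof.
  unfold nu. rewrite Cmod_mult, Cmod_R, Rabs_right by (apply Rle_ge, pos_INR). reflexivity.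
Qed.

Lemma nu_exp n t0 : far n t0 -> Cmod (nu n t0) = 2 * PI * exp (Re t0).
Proof.
  intros F. destruct (far_inv _ _ F) as (E & _). destruct F as [Sd Hu].
  rewrite Cmod_nu, E. pose proof (saddle_size _ _ Sd) as Z. pose proof (Cmod_ge_Re t0).
  generalize PI_RGT_0; intros.
  assert (INR n = 2 * PI * (Cmod t0 * exp (Re t0))) by (rewrite Z; field; lra).
  rewrite H1. field. lra.
Qed.

Lemma nu_large n t0 : far n t0 -> 120 <= Cmod (nu n t0) /\ 6 * Re t0 <= Cmod (nu n t0).
Proof.
  intros F. rewrite (nu_exp _ _ F). destruct F as [_ Hu]. generalize PI2_3_2; intros.
  assert (Re t0 <= exp (Re t0)) by (generalize (exp_ineq1_le (Re t0)); lra). split; nra.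
Qed.

Lemma phase_coef_0 w : phase_coef w 0 = ((1 + w) / RtoC 2)%C.
Proof.
  unfold phase_coef. simpl fact. replace (INR 2) with 2 by (simpl; ring).
  rewrite RtoC_inv by lra. simpl. field.
Qed.

Lemma phase_coef_0_bounds n t0 : far n t0 -> 1 / 4 <= Cmod (phase_coef (/ t0) 0) <= 1.
Proof.
  intros F. destruct (far_inv _ _ F) as (_ & [W0 W1] & _).
  rewrite phase_coef_0, Cmod_div, (Cmod_R 2), (Rabs_right 2) by (try apply RtoC_neq0; lra).
  pose proof (Cmod_1_minus_ge (- / t0)%C) as A. rewrite Cmod_opp in A.
  replace (1 - - / t0)%C with (1 + / t0)%C in A by ring.
  pose proof (Cmod_triangle (RtoC 1) (/ t0)%C) as B. rewrite Cmod_1 in B. lra.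
Qed.

Lemma gauss_param_bounds n t0 : far n t0 ->
  Cmod (nu n t0) / 8 <= Re (gauss_param n t0) /\ Rabs (Im (gauss_param n t0)) <= Re (gauss_param n t0) / 2.
Proof.
  intros F. destruct (far_inv _ _ F) as (_ & [W0 W1] & [R0 R1] & I0).
  rewrite Cmod_nu. unfold gauss_param, nu. rewrite phase_coef_0. set (w := (/ t0)%C) in *.
  replace (RtoC (INR n) * w * ((1 + w) / RtoC 2))%C with (RtoC (INR n / 2) * (w + w * w))%C
    by (rewrite RtoC_div by lra; field).
  rewrite !re_mult, !im_mult, re_RtoC, im_RtoC, re_plus, im_plus, re_mult, im_mult.
  set (p := Re w) in *. set (q := Im w) in *. set (h := Cmod w) in *.
  pose proof (pos_INR n) as Hn.
  apply Rabs_le_between in I0.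
  assert (Q2 : q * q <= p * p / 100) by nra.
  assert (P1 : p * p <= p / 20) by nra.
  split.
  - assert (h / 4 <= p + (p * p - q * q)) by nra. nra.
  - replace (INR n / 2 * (q + (p * q + q * p)) + 0 * (p + (p * p - q * q))) with
      (INR n / 2 * (q * (1 + 2 * p))) by ring.
    replace (INR n / 2 * (p + (p * p - q * q)) - 0 * (q + (p * q + q * p))) with
      (INR n / 2 * (p + (p * p - q * q))) by ring.
    rewrite Rabs_mult, (Rabs_right (INR n / 2)) by lra.
    assert (Rabs (q * (1 + 2 * p)) <= p / 4).
    { apply Rabs_le. split; nra. }
    assert (p / 2 <= p + (p * p - q * q)) by nra.
    assert (INR n / 2 * Rabs (q * (1 + 2 * p)) <= INR n / 2 * (p / 4)) by (apply Rmult_le_compat_l; lra).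
    assert (INR n / 2 * (p / 2) <= INR n / 2 * (p + (p * p - q * q))) by (apply Rmult_le_compat_l; lra).
    lra.
Qed.

(** This is e^(- n (psi (t0 + x) - psi t0)) ([nu_psi_incr]), in the form to
    which [laplace] applies. *)
Definition peak (n : nat) (t0 : C) (x : R) : C :=
  Cexp (- (nu n t0 * RtoC x ^ 2 * (phase_coef (/ t0) 0 + phase_tail n t0 x)))%C.

Lemma nu_psi_incr n t0 x : saddle n t0 ->
  (nu n t0 * RtoC x ^ 2 * (phase_coef (/ t0) 0 + phase_tail n t0 x))%C = (RtoC (INR n) * psi_incr n t0 x)%C.
Proof. intros Sd. rewrite psi_incr_phase_tail by (apply (saddle_neq0 _ _ Sd)). unfold nu. ring. Qed.

Lemma main_term_peak n t0 x : saddle n t0 -> main_term n (t0 + RtoC x)%C = (main_term n t0 * peak n t0 x)%C.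
Proof.
  intros Sd. unfold peak. rewrite nu_psi_incr by exact Sd.
  apply main_term_psi_incr; [apply Sd|apply (saddle_neq0 _ _ Sd)|apply (shift_neq0 _ _ _ Sd)].
Qed.

Lemma Cmod_peak n t0 x : saddle n t0 -> Cmod (peak n t0 x) = exp (- (INR n * Re (psi_incr n t0 x))).
Proof.
  intros Sd. unfold peak. rewrite nu_psi_incr, Cmod_Cexp, re_opp, re_mult, re_RtoC, im_RtoC by exact Sd.
  f_equal. ring.
Qed.

Lemma peak_near n t0 x : far n t0 -> -2 <= x ->
  Cmod (peak n t0 x) <= exp (- (Cmod (nu n t0) * x ^ 2 / 16)).
Proof.
  intros F Hx. rewrite Cmod_peak by apply F. apply exp_le. rewrite Cmod_nu.
  pose proof (gap_near n t0 x F Hx) as G. pose proof (pos_INR n). nra.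
Qed.

Lemma peak_far n t0 x : far n t0 -> - Re t0 <= x <= -2 ->
  Cmod (peak n t0 x) <= exp (- (Cmod (nu n t0) / 8)).
Proof.
  intros F Hx. rewrite Cmod_peak by apply F. apply exp_le. rewrite Cmod_nu.
  pose proof (gap_far n t0 x F Hx) as G. pose proof (pos_INR n). nra.
Qed.

Lemma main_term_neq0 n t : (1 <= n)%nat -> t <> RtoC 0 -> main_term n t <> RtoC 0.
Proof. intros Hn Ht. rewrite main_term_psi by assumption. apply Cexp_neq0. Qed.

Lemma Cderiv_shift t0 x : Cderiv (fun x => t0 + RtoC x)%C x (RtoC 1).
Proof.
  eapply Cderiv_eq; [apply Cderiv_plus; [apply Cderiv_const|apply Cderiv_id]|]. ring.
Qed.

Lemma Ccont_shift t0 x : Ccont (fun x => t0 + RtoC x)%C x.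
Proof. eapply Cderiv_Ccont, Cderiv_shift. Qed.

Lemma Ccont_main_term n t0 x : Ccont (fun x => main_term n (t0 + RtoC x)%C) x.
Proof.
  unfold main_term. apply Ccont_mult; [apply Ccont_pow, Ccont_shift|].
  apply Ccont_Cexp, Ccont_mult; [apply Ccont_const|]. apply Ccont_Cexp, Ccont_shift.
Qed.

Lemma Ccont_peak n t0 x : saddle n t0 -> Ccont (peak n t0) x.
Proof.
  intros Sd. apply (Ccont_ext (fun x => / main_term n t0 * main_term n (t0 + RtoC x))%C).
  - intros t. rewrite (main_term_peak n t0 t Sd). field. apply main_term_neq0; [apply Sd|apply (saddle_neq0 _ _ Sd)].
  - apply Ccont_mult; [apply Ccont_const|apply Ccont_main_term].
Qed.

Lemma Ccont_f n t0 x : saddle n t0 -> Ccont (fun x => Defs.f n (t0 + RtoC x)%C) x.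
Proof.
  intros Sd. unfold Defs.f, Cdiv. apply Ccont_mult; [apply Ccont_mult|].
  - apply Ccont_Cexp, Ccont_opp, Ccont_shift.
  - apply (Ccont_inv (fun x => t0 + RtoC x)%C); [apply (shift_neq0 _ _ _ Sd)|apply Ccont_shift].
  - apply Ccont_minus; [apply Ccont_const|]. apply Ccont_mult; [apply Ccont_shift|apply Ccont_const].
Qed.

(** The factor t^n q (e^t) contributes n / t + 2 pi i e^t and the factor
    e^(-t) contributes -1 to the logarithmic derivative; n f t collects
    n e^(-t) / t - e^(-t). *)
Lemma by_parts n t0 x : saddle n t0 ->
  Cderiv (fun x => Cexp (- (t0 + RtoC x)) * main_term n (t0 + RtoC x))%C x
    (RtoC (INR n) * (Defs.f n (t0 + RtoC x) * main_term n (t0 + RtoC x)) +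
     RtoC (2 * PI) * Ci * main_term n (t0 + RtoC x))%C.
Proof.
  intros Sd. pose proof (shift_neq0 _ _ x Sd) as Nx.
  assert (Hn : (1 <= n)%nat) by apply Sd.
  assert (NC : RtoC (INR n) <> RtoC 0) by (apply RtoC_neq0, not_0_INR; lia).
  unfold main_term. eapply Cderiv_eq.
  - apply Cderiv_mult; [apply (Cderiv_Cexp (fun x => - (t0 + RtoC x))%C), Cderiv_opp, Cderiv_shift|].
    apply Cderiv_mult; [apply (Cderiv_pow (fun x => t0 + RtoC x)%C), Cderiv_shift|].
    apply (Cderiv_nome (fun x => Cexp (t0 + RtoC x))), (Cderiv_Cexp (fun x => t0 + RtoC x)%C), Cderiv_shift.
  - unfold Defs.f. set (t := (t0 + RtoC x)%C) in *.
    destruct n as [|m]; [lia|]. replace (S m - 1)%nat with m by lia.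
    set (k := RtoC (INR (S m))) in *.
    rewrite !Cexp_opp. pose proof (Cexp_neq0 t) as Ne.
    change (t ^ S m)%C with (t * t ^ m)%C. field. auto.
Qed.

Lemma exp_m_t0 n t0 : saddle n t0 -> Cexp (- t0)%C = (- (RtoC (2 * PI) * Ci / RtoC (INR n)) * t0)%C.
Proof.
  intros Sd. pose proof (saddle_exp _ _ Sd) as E. pose proof (saddle_neq0 _ _ Sd) as N0.
  rewrite Cexp_opp. pose proof (Cexp_neq0 t0) as Ne.
  apply Cmult_reg_r with (Cexp t0); [exact Ne|].
  replace (- (RtoC (2 * PI) * Ci / RtoC (INR n)) * t0 * Cexp t0)%C with
    (- t0 * (RtoC (2 * PI) * Ci / RtoC (INR n) * Cexp t0))%C by ring.
  rewrite E. field. auto.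
Qed.

(** This value of n f is the origin of the factor 1 - t0 / n. *)
Lemma nf_t0 n t0 : saddle n t0 ->
  (RtoC (INR n) * Defs.f n t0)%C = (- (RtoC (2 * PI) * Ci) * (1 - t0 / RtoC (INR n)))%C.
Proof.
  intros Sd. pose proof (saddle_neq0 _ _ Sd) as N0.
  assert (NC : RtoC (INR n) <> RtoC 0) by (apply RtoC_neq0, not_0_INR; destruct Sd; lia).
  unfold Defs.f. rewrite (exp_m_t0 _ _ Sd). field. auto.
Qed.

Lemma exp_small k H : 1 <= H -> exp (- (H / 32)) <= INR (fact k) * 32 ^ k / H ^ k.
Proof.
  intros HH. pose proof (pow_fact_le (H / 32) k ltac:(lra)) as P.
  assert (Hk : 0 < H ^ k) by (apply pow_lt; lra). assert (P32 : 0 < 32 ^ k) by (apply pow_lt; lra).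
  unfold Rdiv in P. rewrite Rpow_mult_distr, pow_inv in P.
  apply Rmult_le_reg_r with (H ^ k * exp (H * / 32)).
  { apply Rmult_lt_0_compat; [exact Hk|apply exp_pos]. }
  replace (exp (- (H / 32)) * (H ^ k * exp (H * / 32))) with (H ^ k * (exp (- (H / 32)) * exp (H * / 32))) by ring.
  rewrite <- exp_plus. replace (- (H / 32) + H * / 32) with 0 by (unfold Rdiv; ring). rewrite exp_0, Rmult_1_r.
  replace (INR (fact k) * 32 ^ k / H ^ k * (H ^ k * exp (H * / 32))) with (32 ^ k * (INR (fact k) * exp (H * / 32)))
    by (field; lra).
  apply Rmult_le_reg_r with (/ 32 ^ k); [apply Rinv_0_lt_compat, P32|].
  replace (32 ^ k * (INR (fact k) * exp (H * / 32)) * / 32 ^ k) with (INR (fact k) * exp (H * / 32)) by (field; lra).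
  exact P.
Qed.

Definition taylor_const (N : nat) : R := Rmax 5 (ampl_const (2 * N + 1)).

Lemma taylor_const_ge0 N : 0 <= taylor_const N.
Proof. unfold taylor_const. eapply Rle_trans; [|apply Rmax_l]. lra. Qed.

Lemma phase_tail_taylor n t0 N : far n t0 ->
  approx (phase_tail n t0) (phase_tail_coef (/ t0)) (2 * N + 1) (taylor_const N).
Proof. intros F. apply (approx_weaken _ _ _ 5); [apply Rmax_l|apply approx_phase_tail, F]. Qed.

Lemma ampl_ratio_taylor n t0 N : far n t0 ->
  approx (ampl_ratio n t0) (ampl_coef n t0) (2 * N + 1) (taylor_const N).
Proof.
  intros F. apply (approx_weaken _ _ _ (ampl_const (2 * N + 1))); [apply Rmax_r|apply approx_ampl_ratio, F].
Qed.

(** C0 depends on N only, because [laplace] and [laplace_sum_moments] see n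
    and t0 through |nu| alone. The exponentially small error of the moments is
    absorbed by [exp_small]. *)
Lemma chat_sum_local N : exists C0, 0 <= C0 /\ forall n t0 alpha beta r,
  far n t0 -> is_psi_expansion n t0 alpha -> is_f_expansion n t0 beta ->
  0 < Re r -> (r * r * gauss_param n t0)%C = RtoC 1 ->
  Cmod (Cint (fun x => peak n t0 x * ampl_ratio n t0 x)%C (-1) 1 -
    r * RtoC (sqrt PI) * Csum (fun s => RtoC (half_rising s / INR n ^ s) * chat alpha beta s) (N + 1))%C
  <= C0 / Cmod (nu n t0) ^ (N + 1).
Proof.
  set (K := taylor_const N).
  assert (HK : 0 <= K) by apply taylor_const_ge0.
  exists (Rabs (laplace_const N K) + Rabs (moment_const N K) * (INR (fact (3 * N + 1)) * 32 ^ (3 * N + 1))).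
  split.
  { apply Rplus_le_le_0_compat; [apply Rabs_pos|]. apply Rmult_le_pos; [apply Rabs_pos|].
    apply Rmult_le_pos; [left; apply INR_fact_lt_0|apply pow_le; lra]. }
  intros n t0 alpha beta r F Hal Hbe Hr Er.
  destruct (far_inv _ _ F) as (_ & [W0 W1] & _ & _).
  assert (Sd : saddle n t0) by apply F.
  pose proof (saddle_neq0 _ _ Sd) as N0. pose proof (Cinv_neq0 _ N0) as Nw.
  destruct (nu_large _ _ F) as [HH _]. destruct (gauss_param_bounds _ _ F) as [Z1 Z2].
  destruct (phase_coef_0_bounds _ _ F) as [A1 A2].
  set (H := Cmod (nu n t0)) in *.
  pose proof (phase_tail_taylor n t0 N F) as Hgm. pose proof (ampl_ratio_taylor n t0 N F) as Hb.
  fold K in Hgm, Hb.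
  assert (Hex : ex_Cint (fun x => peak n t0 x * ampl_ratio n t0 x)%C (-1) 1).
  { apply ex_Cint_cont; [lra|]. intros x Hx. apply Ccont_mult; [apply Ccont_peak, Sd|].
    unfold ampl_ratio. apply Ccont_mult; [apply Ccont_mult|].
    - apply Ccont_RtoC, ex_derive_cont. auto_derive. exact I.
    - apply (Ccont_inv (fun x => 1 + / t0 * RtoC x)%C).
      + apply Cmod_gt_0. pose proof (small_den (/ t0)%C x W1 ltac:(apply Rabs_le; lra)). lra.
      + apply Ccont_plus; [apply Ccont_const|]. apply Ccont_mult; [apply Ccont_const|]. eapply Cderiv_Ccont, Cderiv_id.
    - apply Ccont_minus; [apply Ccont_const|]. apply Ccont_mult; [apply Ccont_const|]. eapply Cderiv_Ccont, Cderiv_id. }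
  assert (Hr1 : Cmod r <= 1).
  { apply (f_equal Cmod) in Er. rewrite !Cmod_mult, Cmod_1 in Er.
    pose proof (Cmod_ge_Re (gauss_param n t0)). pose proof (Cmod_ge_0 r).
    destruct (Rle_dec (Cmod r) 1); [assumption|exfalso].
    assert (1 < Cmod r * Cmod r) by nra. nra. }
  assert (L := laplace N K (nu n t0) (gauss_param n t0) (phase_coef (/ t0) 0) (phase_tail n t0) (ampl_ratio n t0)
    (phase_tail_coef (/ t0)) (ampl_coef n t0) HK ltac:(fold H; lra) eq_refl Z1).
  specialize (L ltac:(intros x Hx; rewrite nu_psi_incr by exact Sd;
    rewrite re_mult, re_RtoC, im_RtoC; fold H; unfold H; rewrite Cmod_nu;
    pose proof (gap_near n t0 x F ltac:(apply Rabs_le_between in Hx; lra)) as G;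
    pose proof (pos_INR n); nra)).
  specialize (L eq_refl Hgm Hb Hex).
  pose proof (laplace_sum_moments N K (nu n t0) (gauss_param n t0) r (phase_tail n t0) (ampl_ratio n t0) (phase_tail_coef (/ t0)) (ampl_coef n t0)
    HK ltac:(fold H; lra) Hgm Hb ltac:(lra) Z2 Hr Er Hr1) as Q.
  unfold nu at 2 in Q.
  rewrite (main_sum_chat N (/ t0) (gauss_param n t0) r (Defs.f n t0) (INR n) alpha beta (ampl_coef n t0)) in Q.
  - change (fun x => peak n t0 x * ampl_ratio n t0 x)%C with
      (fun x => Cexp (- (nu n t0 * RtoC x ^ 2 * (phase_coef (/ t0) 0 + phase_tail n t0 x))) * ampl_ratio n t0 x)%C.
    set (I1 := Cint _ (-1) 1) in *. set (V := (r * RtoC (sqrt PI) * _)%C) in *.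
    set (LS := laplace_sum _ _ _ _ _) in *.
    replace (I1 - V)%C with ((I1 - LS) + (LS - V))%C by ring.
    eapply Rle_trans; [apply Cmod_triangle|].
    fold H in L, Q.
    assert (HHk : 0 < H ^ (N + 1)) by (apply pow_lt; lra).
    unfold Rdiv. rewrite Rmult_plus_distr_r. apply Rplus_le_compat.
    + eapply Rle_trans; [exact L|]. apply Rmult_le_compat_r; [left; apply Rinv_0_lt_compat, HHk|apply Rle_abs].
    + eapply Rle_trans; [exact Q|].
      assert (HN : 0 < H ^ (2 * N)) by (apply pow_lt; lra).
      apply Rle_trans with (Rabs (moment_const N K) * (H ^ (2 * N) * exp (- Re (gauss_param n t0)))).
      { apply Rmult_le_compat_r; [|apply Rle_abs]. apply Rmult_le_pos; [lra|left; apply exp_pos]. }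
      rewrite Rmult_assoc. apply Rmult_le_compat_l; [apply Rabs_pos|].
      apply Rle_trans with (H ^ (2 * N) * (INR (fact (3 * N + 1)) * 32 ^ (3 * N + 1) / H ^ (3 * N + 1))).
      * apply Rmult_le_compat_l; [lra|]. eapply Rle_trans; [|apply exp_small; lra]. apply exp_le. lra.
      * right. replace (3 * N + 1)%nat with (2 * N + (N + 1))%nat at 3 by lia. rewrite (pow_add H). field. lra.
  - apply not_0_INR. destruct Sd; lia.
  - exact Nw.
  - apply f_t0_neq0, Sd.
  - apply Cmod_gt_0. lra.
  - apply ampl_coef_0.
  - apply (alpha_explicit n t0 alpha); assumption.
  - apply (beta_explicit n t0 beta); assumption.
  - reflexivity.
  - exact Er.
Qed.

(** By [by_parts] the integrals with the amplitudes 1 and f are proportional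
    up to boundary terms at x = -1 and x = 1, where the peak has decayed. *)
Lemma line_to_amplitude n t0 : far n t0 ->
  Cmod (Cint (peak n t0) (-1) 1 - (1 - t0 / RtoC (INR n)) * Cint (fun x => peak n t0 x * ampl_ratio n t0 x)%C (-1) 1)%C
  <= exp (- (Cmod (nu n t0) / 32)).
Proof.
  intros F. assert (Sd : saddle n t0) by apply F. destruct (nu_large _ _ F) as [HH _].
  pose proof (saddle_neq0 _ _ Sd) as N0.
  assert (Na : main_term n t0 <> RtoC 0) by (apply main_term_neq0; [apply Sd|exact N0]).
  assert (Hn : 0 < INR n) by (apply lt_0_INR; destruct Sd; lia).
  assert (NC : RtoC (INR n) <> RtoC 0) by (apply RtoC_neq0; lra).
  generalize PI_RGT_0; intros HP.
  assert (NP : (RtoC (2 * PI) * Ci)%C <> RtoC 0).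
  { apply Cmult_neq_0; [apply RtoC_neq0; lra|]. intros E. apply (f_equal Im) in E. simpl in E. lra. }
  set (e := fun x => (Cexp (- (t0 + RtoC x)) * main_term n (t0 + RtoC x))%C).
  assert (Xf : ex_Cint (fun x => Defs.f n (t0 + RtoC x) * main_term n (t0 + RtoC x))%C (-1) 1).
  { apply ex_Cint_cont; [lra|]. intros; apply Ccont_mult; [apply Ccont_f, Sd|apply Ccont_main_term]. }
  assert (Xa : ex_Cint (fun x => main_term n (t0 + RtoC x)%C) (-1) 1).
  { apply ex_Cint_cont; [lra|]. intros; apply Ccont_main_term. }
  assert (XE : ex_Cint (peak n t0) (-1) 1) by (apply ex_Cint_cont; [lra|]; intros; apply Ccont_peak, Sd).
  assert (P : (e 1 - e (-1))%C = (RtoC (INR n) * Cint (fun x => Defs.f n (t0 + RtoC x) * main_term n (t0 + RtoC x)) (-1) 1 +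
     RtoC (2 * PI) * Ci * Cint (fun x => main_term n (t0 + RtoC x)) (-1) 1)%C).
  { rewrite <- !Cint_scal by assumption. rewrite <- Cint_plus by (apply ex_Cint_scal; assumption).
    symmetry. apply Cint_derive; [lra| |].
    - intros x _. apply by_parts, Sd.
    - intros x _. apply Ccont_plus; (apply Ccont_mult; [apply Ccont_const|]); [apply Ccont_mult; [apply Ccont_f, Sd|]|]; apply Ccont_main_term. }
  assert (Ea : Cint (fun x => main_term n (t0 + RtoC x)%C) (-1) 1 = (main_term n t0 * Cint (peak n t0) (-1) 1)%C).
  { rewrite <- Cint_scal by exact XE. apply Cint_ext; [lra|]. intros; apply main_term_peak, Sd. }
  assert (Ef : Cint (fun x => Defs.f n (t0 + RtoC x) * main_term n (t0 + RtoC x))%C (-1) 1 =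
     (Defs.f n t0 * main_term n t0 * Cint (fun x => peak n t0 x * ampl_ratio n t0 x) (-1) 1)%C).
  { assert (Nf : (Defs.f n t0 * main_term n t0)%C <> RtoC 0) by (apply Cmult_neq_0; [apply f_t0_neq0, Sd|exact Na]).
    apply Cmult_reg_r with (/ (Defs.f n t0 * main_term n t0))%C; [apply Cinv_neq0, Nf|].
    rewrite Cmult_comm, <- Cint_scal by exact Xf.
    rewrite (Cint_ext _ (fun x => peak n t0 x * ampl_ratio n t0 x)%C); [field; split|lra|].
    - exact Na.
    - apply f_t0_neq0, Sd.
    - intros x Hx. rewrite f_eq_ampl_ratio, main_term_peak; [field; split; [exact Na|apply f_t0_neq0, Sd]|exact Sd|exact F|apply Rabs_le; lra]. }
  rewrite Ea, Ef in P.
  set (I0 := Cint (peak n t0) (-1) 1) in *. set (I1 := Cint (fun x => peak n t0 x * ampl_ratio n t0 x)%C (-1) 1) in *.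
  assert (D : (I0 - (1 - t0 / RtoC (INR n)) * I1)%C = ((e 1 - e (-1)) / (RtoC (2 * PI) * Ci * main_term n t0))%C).
  { rewrite P.
    replace (RtoC (INR n) * (Defs.f n t0 * main_term n t0 * I1))%C with ((RtoC (INR n) * Defs.f n t0) * main_term n t0 * I1)%C by ring.
    rewrite nf_t0 by exact Sd. field. repeat split; auto.
    - intros E. apply (f_equal Im) in E. simpl in E. lra.
    - apply RtoC_neq0. lra. }
  rewrite D.
  assert (Be : forall x, Rabs x = 1 -> Cmod (e x) <= 2 * PI * Cmod t0 / INR n * 3 * exp (- (Cmod (nu n t0) / 16)) * Cmod (main_term n t0)).
  { intros x Hx. unfold e. rewrite main_term_peak by exact Sd.
    replace (- (t0 + RtoC x))%C with (- t0 + RtoC (- x))%C by (rewrite RtoC_opp; ring).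
    rewrite Cexp_plus, Cexp_RtoC, (exp_m_t0 _ _ Sd).
    rewrite !Cmod_mult, Cmod_opp, Cmod_div, Cmod_mult, Cmod_Ci, !Cmod_R by exact NC.
    rewrite (Rabs_right (2 * PI)), (Rabs_right (INR n)), (Rabs_right (exp (- x))) by (try (left; apply exp_pos); lra).
    pose proof (peak_near n t0 x F ltac:(apply Rle_trans with (-1); [lra|]; generalize (Rle_abs (- x)); rewrite Rabs_Ropp, Hx; lra)) as K.
    replace (x ^ 2) with 1 in K by (rewrite <- pow2_abs, Hx; ring). rewrite Rmult_1_r in K.
    assert (E3 : exp (- x) <= 3).
    { eapply Rle_trans; [apply exp_le|apply exp_le_3]. generalize (Rle_abs (- x)). rewrite Rabs_Ropp. lra. }
    assert (H0 : 0 <= 2 * PI * Cmod t0 / INR n).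
    { apply Rmult_le_pos; [apply Rmult_le_pos; [lra|apply Cmod_ge_0]|left; apply Rinv_0_lt_compat, Hn]. }
    replace (2 * PI * 1 / INR n * Cmod t0 * exp (- x) * (Cmod (main_term n t0) * Cmod (peak n t0 x))) with
      ((2 * PI * Cmod t0 / INR n * exp (- x)) * Cmod (peak n t0 x) * Cmod (main_term n t0)) by (field; lra).
    apply Rmult_le_compat_r; [apply Cmod_ge_0|]. apply Rmult_le_compat; [|apply Cmod_ge_0| |exact K].
    - apply Rmult_le_pos; [exact H0|left; apply exp_pos].
    - apply Rmult_le_compat_l; assumption. }
  assert (Pa : 0 < Cmod (main_term n t0)) by (apply Cmod_gt_0, Na).
  rewrite Cmod_div by (apply Cmult_neq_0; assumption).
  rewrite !Cmod_mult, Cmod_Ci, Cmod_R, (Rabs_right (2 * PI)) by lra.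
  set (g := exp (- (Cmod (nu n t0) / 16))) in *. assert (Hg : 0 < g) by apply exp_pos.
  apply Rle_trans with g; [|apply exp_le; lra].
  apply Rmult_le_reg_r with (2 * PI * 1 * Cmod (main_term n t0)); [nra|].
  unfold Rdiv. rewrite Rmult_assoc, Rinv_l, Rmult_1_r by nra.
  eapply Rle_trans; [apply Cmod_minus_le|].
  pose proof (Be 1 ltac:(apply Rabs_R1)) as B1.
  pose proof (Be (-1) ltac:(rewrite Rabs_left; lra)) as B2.
  assert (Hq : Cmod t0 / INR n <= 1 / 20).
  { pose proof (far_n _ _ F). apply Rmult_le_reg_r with (INR n); [exact Hn|].
    unfold Rdiv. rewrite Rmult_assoc, Rinv_l; lra. }
  assert (B3 : 2 * PI * Cmod t0 / INR n * 3 * g * Cmod (main_term n t0) <= 2 * PI * Cmod (main_term n t0) * g * (3 / 20)).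
  { replace (2 * PI * Cmod t0 / INR n * 3 * g * Cmod (main_term n t0)) with
      (2 * PI * Cmod (main_term n t0) * g * (3 * (Cmod t0 / INR n))) by (field; lra).
    apply Rmult_le_compat_l; [|lra]. apply Rmult_le_pos; [nra|lra]. }
  assert (0 <= 2 * PI * Cmod (main_term n t0) * g) by (apply Rmult_le_pos; nra).
  lra.
Qed.

(** * From the path integral to the saddle *)

Lemma Cint_translate f u a b : a <= b -> (forall x, a <= x <= b -> Ccont f (u + x)) ->
  Cint f (u + a) (u + b) = Cint (fun x => f (u + x)) a b.
Proof.
  intros Hab H.
  assert (R : forall g : R -> R, (forall x, a <= x <= b -> continuous g (u + x)) ->
    RInt g (u + a) (u + b) = RInt (fun x => g (u + x)) a b).
  { intros g Hg. rewrite <- (RInt_comp (V := R_CompleteNormedModule) g (fun x => u + x) (fun _ => 1)).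
    - apply RInt_ext. intros x _. change (1 * g (u + x) = g (u + x)). ring.
    - rewrite Rmin_left, Rmax_right by exact Hab. exact Hg.
    - intros x _. split; [|apply continuous_const]. auto_derive; [exact I|ring]. }
  unfold Cint. f_equal.
  - apply (R (fun t => Re (f t))). intros x Hx. apply H, Hx.
  - apply (R (fun t => Im (f t))). intros x Hx. apply H, Hx.
Qed.

Lemma pair_shift t0 r : ((r, Im t0) : C) = (t0 + RtoC (r - Re t0))%C.
Proof. apply C_ext; rewrite ?re_plus, ?im_plus, ?re_RtoC, ?im_RtoC; simpl; ring. Qed.

Lemma Cmod_nome_shift n t0 x : saddle n t0 ->
  Cmod (nome (Cexp (t0 + RtoC x))) = exp (- (INR n * Re (/ t0)%C * exp x)).
Proof.
  intros Sd. pose proof (saddle_exp _ _ Sd) as E.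
  assert (NC : RtoC (INR n) <> RtoC 0) by (apply RtoC_neq0, not_0_INR; destruct Sd; lia).
  assert (E2 : (RtoC (2 * PI) * Ci * Cexp t0)%C = (- (RtoC (INR n) * / t0))%C).
  { replace (- (RtoC (INR n) * / t0))%C with (RtoC (INR n) * - / t0)%C by ring. rewrite <- E. field. exact NC. }
  unfold nome. rewrite Cexp_plus, Cexp_RtoC, Cmod_Cexp. f_equal.
  replace (RtoC (2 * PI) * Ci * (Cexp t0 * RtoC (exp x)))%C with
    (RtoC (2 * PI) * Ci * Cexp t0 * RtoC (exp x))%C by ring.
  rewrite E2, re_mult, re_opp, re_mult, !re_RtoC, !im_RtoC. ring.
Qed.

Lemma far_Im n t0 : far n t0 -> 1 <= Im t0 < PI / 2.
Proof.
  intros [Sd Hu]. split; [apply (saddle_Im_ge1 n); [exact Sd|lra]|]. apply Sd.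
Qed.

Lemma integrand_bound n t0 r : far n t0 -> left_end <= r ->
  Cmod ((r, Im t0) ^ n * kern (Cexp (r, Im t0)))%C <=
  2 * (Cmod (main_term n t0) * Cmod (peak n t0 (r - Re t0))).
Proof.
  intros F Hr. assert (Sd : saddle n t0) by apply F.
  pose proof (kern_safe_bound _ (safe_line r (Im t0) Hr (far_Im _ _ F))) as K.
  rewrite <- Cmod_mult, <- main_term_peak, <- pair_shift by exact Sd. unfold main_term.
  rewrite !Cmod_mult. pose proof (Cmod_ge_0 ((r, Im t0) ^ n)%C).
  replace (2 * (Cmod ((r, Im t0) ^ n) * Cmod (nome (Cexp (r, Im t0))))) with
    (Cmod ((r, Im t0) ^ n) * (2 * Cmod (nome (Cexp (r, Im t0))))) by ring.
  apply Rmult_le_compat_l; assumption.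
Qed.

(** The line is cut at u - 2, u - 1 and u + 1. Off the middle piece the peak
    is exponentially small ([peak_far], [peak_near]); on the middle piece
    kern - nome = kern nome is smaller than the nome by such a factor. *)
Lemma line_split n t0 N : far n t0 -> Re t0 + 1 <= right_end N ->
  Cmod (Cint (fun r => (r, Im t0) ^ n * kern (Cexp (r, Im t0)))%C left_end (right_end N) -
        main_term n t0 * Cint (peak n t0) (-1) 1)%C <=
  Cmod (main_term n t0) * ((2 * Re t0 + 8) * exp (- (Cmod (nu n t0) / 32))).
Proof.
  intros F HR. assert (Sd : saddle n t0) by apply F. pose proof (far_Im _ _ F) as Hv.
  assert (Hu : 20 <= Re t0) by apply F. pose proof left_end_bounds as Hl.
  destruct (nu_large _ _ F) as [HH _]. destruct (far_inv _ _ F) as (_ & [W0 W1] & [R0 R1] & _).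
  set (u := Re t0) in *. set (v := Im t0) in *. set (H := Cmod (nu n t0)) in *.
  set (G := fun r => ((r, v) ^ n * kern (Cexp (r, v)))%C).
  set (A := Cmod (main_term n t0)). assert (HA : 0 <= A) by apply Cmod_ge_0.
  set (g := exp (- (H / 32))). assert (Hg : 0 < g) by apply exp_pos.
  assert (X : forall a b, left_end <= a <= b -> ex_Cint G a b).
  { intros a b Hab. apply (ex_Cint_line (fun t => t ^ n)%C v a b (preserves_Ccont_pow n) Hv Hab). }
  assert (B1 : Cmod (Cint G left_end (u - 2)) <= A * (2 * u * g)).
  { apply Rle_trans with (2 * (A * g) * (u - 2 - left_end)).
    - apply Cint_bound_const; [lra|apply X; lra|]. intros r Hr.
      eapply Rle_trans; [apply integrand_bound; [exact F|lra]|].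
      apply Rmult_le_compat_l; [lra|]. apply Rmult_le_compat_l; [exact HA|].
      eapply Rle_trans; [apply peak_far; [exact F|fold u; lra]|]. fold H. apply exp_le. lra.
    - assert (0 <= A * g) by (apply Rmult_le_pos; lra). nra. }
  assert (B2 : Cmod (Cint G (u - 2) (u - 1)) <= A * (2 * g)).
  { apply Rle_trans with (2 * (A * g) * (u - 1 - (u - 2))); [|right; ring].
    apply Cint_bound_const; [lra|apply X; lra|]. intros r Hr.
    eapply Rle_trans; [apply integrand_bound; [exact F|lra]|].
    apply Rmult_le_compat_l; [lra|]. apply Rmult_le_compat_l; [exact HA|].
    eapply Rle_trans; [apply peak_near; [exact F|fold u; lra]|]. fold u H. apply exp_le.
    assert (1 <= (r - u) ^ 2) by nra. nra. }
  assert (B3 : Cmod (Cint G (u + 1) (right_end N)) <= A * (2 * g)).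
  { apply Rle_trans with (RInt (fun r => 2 * (A * g) * exp u * exp (- (1) * r)) (u + 1) (right_end N)).
    - apply Cint_bound; [lra|apply X; lra|apply ex_RInt_Rscal, ex_RInt_exp_neg; lra|]. intros r Hr.
      eapply Rle_trans; [apply integrand_bound; [exact F|lra]|].
      replace (2 * (A * g) * exp u * exp (- (1) * r)) with (2 * (A * (g * (exp u * exp (- (1) * r))))) by ring.
      apply Rmult_le_compat_l; [lra|]. apply Rmult_le_compat_l; [exact HA|].
      eapply Rle_trans; [apply peak_near; [exact F|fold u; lra]|]. fold u H.
      unfold g. rewrite <- !exp_plus. apply exp_le.
      assert (1 <= r - u) by lra. assert (r - u <= (r - u) ^ 2) by nra. nra.
    - rewrite RInt_Rscal, RInt_exp_neg by (try apply ex_RInt_exp_neg; lra).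
      assert (exp u * exp (- (1) * (u + 1)) <= 1) by (rewrite <- exp_plus; apply exp_le_1; lra).
      generalize (exp_pos (- (1) * right_end N)) (exp_pos u); intros.
      assert (0 <= A * g) by (apply Rmult_le_pos; lra).
      replace (2 * (A * g) * exp u * ((exp (- (1) * (u + 1)) - exp (- (1) * right_end N)) / 1)) with
        (2 * (A * g) * (exp u * exp (- (1) * (u + 1)) - exp u * exp (- (1) * right_end N))) by field.
      replace (A * (2 * g)) with (2 * (A * g) * 1) by ring.
      apply Rmult_le_compat_l; [lra|]. nra. }
  assert (B4 : Cmod (Cint G (u - 1) (u + 1) - main_term n t0 * Cint (peak n t0) (-1) 1)%C <= A * (4 * g)).
  { replace (u - 1) with (u + -1) by ring. rewrite Cint_translate; [|lra|].
    2:{ intros x Hx. unfold G. apply Ccont_mult; [apply Ccont_pow, Ccont_hor|apply Ccont_kern_hor; lra]. }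
    assert (XE : ex_Cint (peak n t0) (-1) 1) by (apply ex_Cint_cont; [lra|]; intros; apply Ccont_peak, Sd).
    assert (Pr : forall x, ((u + x, v) : C) = (t0 + RtoC x)%C).
    { intros x. unfold v. rewrite pair_shift. fold u. do 2 f_equal. ring. }
    assert (XG : ex_Cint (fun x => G (u + x)) (-1) 1).
    { apply ex_Cint_cont; [lra|]. intros x Hx. unfold G.
      apply Ccont_mult.
      - apply (Ccont_ext (fun x => (t0 + RtoC x) ^ n)%C); [intros t; rewrite <- Pr; reflexivity|]. apply Ccont_pow, Ccont_shift.
      - apply (Ccont_ext (fun x => kern (Cexp (t0 + RtoC x)))); [intros t; rewrite <- Pr; reflexivity|].
        apply (Ccont_kern (fun x => Cexp (t0 + RtoC x))).
        + rewrite <- Pr. apply safe_neq, safe_line; lra.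
        + apply Ccont_Cexp, Ccont_shift. }
    rewrite <- Cint_scal by exact XE. rewrite <- Cint_minus; [|exact XG|apply ex_Cint_scal, XE].
    apply Rle_trans with (A * (2 * g) * (1 - -1)); [|right; ring].
    apply Cint_bound_const; [lra|apply ex_Cint_minus; [exact XG|apply ex_Cint_scal, XE]|].
    intros x Hx. rewrite <- main_term_peak by exact Sd. unfold G. rewrite Pr. unfold main_term.
    assert (Sf : safe (Cexp (t0 + RtoC x))) by (rewrite <- Pr; apply safe_line; lra).
    pose proof (safe_neq _ Sf) as Nq. pose proof (safe_den0 _ Sf) as D.
    pose proof (Cmod_nome_shift n t0 x Sd) as Eq.
    set (q := nome (Cexp (t0 + RtoC x))) in *.
    replace ((t0 + RtoC x) ^ n * kern (Cexp (t0 + RtoC x)) - (t0 + RtoC x) ^ n * q)%C with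
      (((t0 + RtoC x) ^ n * q) * (q / (1 - q)))%C by (unfold kern; fold q; field; exact Nq).
    change ((t0 + RtoC x) ^ n * q)%C with (main_term n (t0 + RtoC x)).
    rewrite (main_term_peak n t0 x Sd), !Cmod_mult. fold A.
    assert (K1 : Cmod (peak n t0 x) <= 1).
    { eapply Rle_trans; [apply peak_near; [exact F|lra]|]. apply exp_le_1. fold H. assert (0 <= x ^ 2) by apply pow2_ge_0. nra. }
    assert (Bq : Cmod q <= g).
    { rewrite Eq. apply exp_le.
      assert (E13 : 1 / 3 <= exp x).
      { apply Rle_trans with (exp (-1)); [|apply exp_le; lra].
        replace (-1) with (Ropp 1) by lra. rewrite exp_Ropp. replace (1 / 3) with (/ 3) by field.
        apply Rinv_le_contravar; [apply exp_pos|apply exp_le_3]. }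
      assert (H / 2 <= INR n * Re (/ t0)%C).
      { unfold H. rewrite Cmod_nu. pose proof (pos_INR n). nra. }
      nra. }
    rewrite Cmod_div by exact Nq.
    assert (Bq2 : Cmod q / Cmod (1 - q)%C <= 2 * g).
    { apply Rmult_le_reg_r with (Cmod (1 - q)%C); [lra|]. unfold Rdiv. rewrite Rmult_assoc, Rinv_l by lra. nra. }
    pose proof (Cmod_ge_0 (peak n t0 x)).
    assert (Hq0 : 0 <= Cmod q / Cmod (1 - q)%C).
    { apply Rmult_le_pos; [apply Cmod_ge_0|left; apply Rinv_0_lt_compat; lra]. }
    apply Rmult_le_compat; [apply Rmult_le_pos; assumption|exact Hq0| |exact Bq2]. nra. }
  rewrite <- (Cint_Chasles G left_end (u - 2) (right_end N)), <- (Cint_Chasles G (u - 2) (u - 1) (right_end N)),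
    <- (Cint_Chasles G (u - 1) (u + 1) (right_end N)) by (apply X; lra).
  set (I0 := (main_term n t0 * Cint (peak n t0) (-1) 1)%C) in *.
  match goal with |- Cmod ?Y <= _ => replace Y with
    (Cint G left_end (u - 2) + Cint G (u - 2) (u - 1) + Cint G (u + 1) (right_end N) + (Cint G (u - 1) (u + 1) - I0))%C by ring end.
  eapply Rle_trans; [apply Cmod_triangle|].
  eapply Rle_trans; [apply Rplus_le_compat_r, Cmod_triangle|].
  eapply Rle_trans; [apply Rplus_le_compat_r, Rplus_le_compat_r, Cmod_triangle|].
  lra.
Qed.

Lemma exp_INR_le n : exp (INR n) <= 3 ^ n.
Proof.
  induction n as [|n IH]; [simpl; rewrite exp_0; lra|].
  rewrite S_INR, exp_plus. simpl. generalize (exp_pos (INR n)) (exp_pos 1) exp_le_3; intros. nra.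
Qed.

(** Since |t0| is large, contributions of the order 3^n, from the vertical
    side and from the power of [left_end], are negligible against the main
    term. *)
Lemma main_term_lower n t0 : far n t0 -> 3 ^ n <= Cmod (main_term n t0) * exp (- (Cmod (nu n t0) / 32)).
Proof.
  intros F. assert (Sd : saddle n t0) by apply F. destruct (far_inv _ _ F) as (_ & [W0 W1] & [R0 R1] & _).
  assert (Hu : 20 <= Re t0) by apply F. pose proof (Cmod_ge_Re t0).
  unfold main_term. rewrite Cmod_mult, Cmod_pow.
  pose proof (Cmod_nome_shift n t0 0 Sd) as E. replace (t0 + RtoC 0)%C with t0 in E by ring.
  rewrite E, exp_0, Rmult_1_r, Cmod_nu, Rmult_assoc, <- exp_plus.
  set (X := - (INR n * Re (/ t0)%C) + - (INR n * Cmod (/ t0)%C / 32)).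
  assert (HX : - INR n <= X) by (unfold X; pose proof (pos_INR n); nra).
  assert (E1 : (/ 3) ^ n <= exp X).
  { apply Rle_trans with (exp (- INR n)); [|apply exp_le, HX].
    rewrite exp_Ropp, pow_inv. apply Rinv_le_contravar; [apply exp_pos|].
    apply exp_INR_le. }
  apply Rle_trans with (9 ^ n * (/ 3) ^ n).
  - rewrite <- Rpow_mult_distr. replace (9 * / 3) with 3 by field. lra.
  - apply Rmult_le_compat; [apply pow_le; lra|apply pow_le; lra| |exact E1]. apply pow_incr. lra.
Qed.

Lemma stieltjes_saddle (zeta : C -> C) (gamma : nat -> C) n t0 :
  is_Riemann_zeta zeta -> is_Stieltjes zeta gamma -> far n t0 ->
  Rabs (Re (gamma n) - 2 * Re (main_term n t0 * Cint (peak n t0) (-1) 1)%C) <=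
  Cmod (main_term n t0) * ((4 * Re t0 + 25) * exp (- (Cmod (nu n t0) / 32))).
Proof.
  intros Hz Hg F. assert (Sd : saddle n t0) by apply F. pose proof (far_Im _ _ F) as Hv.
  rewrite (stieltjes_path_integral zeta gamma (Im t0) n Hz Hg Hv) by apply Sd.
  rewrite re_RtoC.
  set (I0 := (main_term n t0 * Cint (peak n t0) (-1) 1)%C).
  pose proof (main_term_lower n t0 F) as L.
  set (A := Cmod (main_term n t0)) in *. set (g := exp (- (Cmod (nu n t0) / 32))) in *.
  assert (Q : Rabs (path_moment (Im t0) n - 2 * Re I0) <= 2 * (4 * 3 ^ n + A * ((2 * Re t0 + 8) * g))).
  { pose proof (path_moment_lim (Im t0) n Hv) as G.
    set (sq := fun N => 2 * Re (path_integral (fun t => t ^ n)%C (Im t0) N)) in *.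
    assert (G2 : is_lim_seq (fun N => Rabs (sq N - 2 * Re I0)) (Rabs (path_moment (Im t0) n - 2 * Re I0))).
    { apply (is_lim_seq_abs (fun N => sq N - 2 * Re I0) (path_moment (Im t0) n - 2 * Re I0)).
      apply is_lim_seq_minus'; [exact G|apply is_lim_seq_const]. }
    destruct (nfloor_ex (exp (Re t0 + 1)) ltac:(left; apply exp_pos)) as [N0 HN0].
    match goal with |- Rabs ?a <= ?b => change (Rbar_le (Finite (Rabs a)) (Finite b)) end.
    apply (is_lim_seq_le_loc (fun N => Rabs (sq N - 2 * Re I0))
      (fun _ => 2 * (4 * 3 ^ n + A * ((2 * Re t0 + 8) * g)))) with (2 := G2).
    2:{ apply is_lim_seq_const. }
    exists (S N0). intros N HN.
    assert (HR : Re t0 + 1 <= right_end N).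
    { rewrite <- (ln_exp (Re t0 + 1)). unfold right_end. apply ln_le; [apply exp_pos|].
      apply le_INR in HN. rewrite S_INR in HN. lra. }
    unfold sq. rewrite <- Rmult_minus_distr_l, Rabs_mult, (Rabs_right 2) by lra.
    apply Rmult_le_compat_l; [lra|]. rewrite <- re_minus.
    eapply Rle_trans; [apply re_le_Cmod|]. unfold path_integral.
    match goal with |- Cmod (?X + ?Y - ?Z)%C <= _ => replace (X + Y - Z)%C with (X + (Y - Z))%C by ring end.
    eapply Rle_trans; [apply Cmod_triangle|]. apply Rplus_le_compat.
    - rewrite Cmod_mult, Cmod_Ci, Rmult_1_l.
      apply (left_integral_bound (fun t => t ^ n)%C); [apply preserves_Ccont_pow|exact Hv|apply left_pow].
    - apply line_split; assumption. }
  assert (Hlam : 0 <= left_end ^ S n / INR (S n) <= 3 ^ n).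
  { pose proof left_end_bounds. pose proof (inv_INR_le1 n).
    assert (0 <= left_end ^ S n <= 1).
    { split; [apply pow_le; lra|]. apply pow_le_1; lra. }
    assert (1 <= 3 ^ n) by (apply pow_R1_Rle; lra). unfold Rdiv. split; nra. }
  apply Rabs_le_between in Q. apply Rabs_le.
  assert (Hu : 20 <= Re t0) by apply F.
  lra.
Qed.

(** * Polar forms *)

Lemma polar z : z <> RtoC 0 -> z = (RtoC (Cmod z) * Cexp (Ci * RtoC (Carg z)))%C.
Proof.
  intros N. rewrite <- (Cexp_Clog z N) at 1. unfold Clog.
  pose proof (proj1 (Cmod_gt_0 z) N) as P.
  rewrite <- (exp_ln (Cmod z)) at 2 by exact P. rewrite <- Cexp_RtoC, <- Cexp_plus. f_equal.
  apply C_ext; unfold Re, Im; simpl; ring.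
Qed.

(** - psi t0 = log t0 - 1 / t0 has real part A and imaginary part a. *)
Lemma main_term_t0 n t0 : saddle n t0 -> main_term n t0 =
  (RtoC (exp (INR n * coefA t0)) * Cexp (Ci * RtoC (INR n * coefa t0)))%C.
Proof.
  intros Sd. pose proof (saddle_neq0 _ _ Sd) as N0. pose proof (saddle_exp _ _ Sd) as E.
  assert (NC : RtoC (INR n) <> RtoC 0) by (apply RtoC_neq0, not_0_INR; destruct Sd; lia).
  rewrite main_term_psi by (try exact N0; apply Sd).
  rewrite <- Cexp_RtoC, <- Cexp_plus. f_equal. unfold psi.
  replace (- (RtoC (INR n) * (- (RtoC (2 * PI) * Ci / RtoC (INR n)) * Cexp t0 - Clog t0)))%C with
    (RtoC (INR n) * (RtoC (2 * PI) * Ci / RtoC (INR n) * Cexp t0 + Clog t0))%C by ring.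
  rewrite E.
  destruct Sd as (Hn & Hu & Hv & _).
  assert (HA : (- / t0 + Clog t0)%C = (coefA t0, coefa t0)).
  { unfold coefA, coefa, Clog. rewrite Carg_atan by lra.
    assert (D : 0 < Re t0 ^ 2 + Im t0 ^ 2) by nra.
    assert (L : ln (Cmod t0) = 1 / 2 * ln (Re t0 ^ 2 + Im t0 ^ 2)).
    { rewrite <- Cmod_sqr, ln_pow by (apply Cmod_gt_0, N0). simpl. field. }
    rewrite L. apply C_ext.
    - change (- (Re t0 / (Re t0 ^ 2 + Im t0 ^ 2)) + 1 / 2 * ln (Re t0 ^ 2 + Im t0 ^ 2) =
       1 / 2 * ln (Re t0 ^ 2 + Im t0 ^ 2) - Re t0 / (Re t0 ^ 2 + Im t0 ^ 2)). ring.
    - change (- (- Im t0 / (Re t0 ^ 2 + Im t0 ^ 2)) + atan (Im t0 / Re t0) =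
       atan (Im t0 / Re t0) + Im t0 / (Re t0 ^ 2 + Im t0 ^ 2)). field. lra. }
  rewrite HA. apply C_ext; unfold Re, Im; simpl; ring.
Qed.

Lemma Cmod_Csqrt z : z <> RtoC 0 -> Cmod (Csqrt z) ^ 2 = Cmod z.
Proof.
  intros N. unfold Csqrt, Cpower. rewrite Cmod_Cexp.
  replace (Re (RtoC (1 / 2) * Clog z)%C) with (ln (Cmod z) / 2).
  - simpl. rewrite Rmult_1_r, <- exp_plus. replace (ln (Cmod z) / 2 + ln (Cmod z) / 2) with (ln (Cmod z)) by field.
    apply exp_ln, Cmod_gt_0, N.
  - rewrite re_mult, re_RtoC, im_RtoC, Re_Clog. field.
Qed.

Lemma saddle_1p_neq0 n t0 : saddle n t0 -> (1 + t0)%C <> RtoC 0.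
Proof. intros (_ & Hu & _). apply Cneq0_Re. rewrite re_plus, re_RtoC. lra. Qed.

Lemma coefB_sqr n t0 : saddle n t0 -> coefB t0 ^ 2 = 8 * PI * (Cmod t0 ^ 2 / Cmod (1 + t0)%C).
Proof.
  intros Sd. pose proof (saddle_1p_neq0 _ _ Sd) as N1. unfold coefB.
  assert (Ns : Csqrt (1 + t0)%C <> RtoC 0) by apply Cexp_neq0.
  rewrite Cmod_div by exact Ns. rewrite !Rpow_mult_distr.
  unfold Rdiv. rewrite Rpow_mult_distr, pow_inv, Cmod_Csqrt by exact N1.
  replace (sqrt (2 * PI) ^ 2) with (2 * PI); [ring|].
  rewrite pow2_sqrt; [reflexivity|]. generalize PI_RGT_0; lra.
Qed.

Lemma coefB_pos n t0 : saddle n t0 -> 0 < coefB t0.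
Proof.
  intros Sd. unfold coefB. generalize PI_RGT_0; intros HP.
  apply Rmult_lt_0_compat; [apply Rmult_lt_0_compat; [lra|apply sqrt_lt_R0; lra]|].
  rewrite Cmod_div by apply Cexp_neq0.
  apply Rmult_lt_0_compat; [apply Cmod_gt_0, (saddle_neq0 _ _ Sd)|].
  apply Rinv_0_lt_compat, Cmod_gt_0, Cexp_neq0.
Qed.

(** The square root of 1 / (n alpha_0) with positive real part, in the polar
    form that exhibits B and b. *)
Definition inv_root (n : nat) (t0 : C) : C :=
  (RtoC (coefB t0 / (2 * sqrt PI * sqrt (INR n))) * Cexp (Ci * RtoC (coefb t0)))%C.

(** u cos v = v sin v says that v / u is the cotangent of v. *)
Lemma saddle_arg n t0 : saddle n t0 -> Carg t0 = PI / 2 - Im t0.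
Proof.
  intros Sd. pose proof (saddle_cot _ _ Sd) as Ct. destruct Sd as (Hn & Hu & Hv & _).
  rewrite Carg_atan by lra.
  assert (Cv : 0 < cos (Im t0)) by (apply cos_gt_0; lra).
  assert (Sv : 0 < sin (Im t0)) by (apply sin_gt_0; lra).
  rewrite <- (atan_tan (PI / 2 - Im t0)) by lra. f_equal.
  unfold tan. rewrite sin_shift, cos_shift.
  apply Rmult_eq_reg_r with (Re t0 * sin (Im t0)); [|nra].
  replace (Im t0 / Re t0 * (Re t0 * sin (Im t0))) with (Im t0 * sin (Im t0)) by (field; lra).
  rewrite <- Ct. field. lra.
Qed.

(** n alpha_0 = n (1 + t0) / (2 t0^2), and b = arg t0 - arg (1 + t0) / 2 by
    [saddle_arg]. *)
Lemma inv_root_sqr n t0 : saddle n t0 -> (inv_root n t0 * inv_root n t0 * gauss_param n t0)%C = RtoC 1.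
Proof.
  intros Sd. pose proof (saddle_neq0 _ _ Sd) as N0. pose proof (saddle_1p_neq0 _ _ Sd) as N1.
  pose proof (coefB_sqr _ _ Sd) as B2. pose proof (saddle_arg _ _ Sd) as Ar.
  assert (Hn : 0 < INR n) by (apply lt_0_INR; destruct Sd; lia).
  generalize PI_RGT_0; intros HP.
  pose proof (polar t0 N0) as P0. pose proof (polar _ N1) as P1. rewrite Ar in P0.
  assert (Ar1 : Carg (1 + t0)%C = atan (Im t0 / (1 + Re t0))).
  { destruct Sd as (_ & Hu & Hv & _).
    rewrite Carg_atan; rewrite ?re_plus, ?im_plus, ?re_RtoC, ?im_RtoC, ?Rplus_0_l; [reflexivity|lra|lra]. }
  rewrite Ar1 in P1.
  assert (Eb : (Cexp (Ci * RtoC (coefb t0)) * Cexp (Ci * RtoC (coefb t0)) * Cexp (Ci * RtoC (atan (Im t0 / (1 + Re t0)))))%C =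
    (Cexp (Ci * RtoC (PI / 2 - Im t0)) * Cexp (Ci * RtoC (PI / 2 - Im t0)))%C).
  { rewrite <- !Cexp_plus. f_equal. unfold coefb. rewrite <- !Cmult_plus_distr_l, <- !RtoC_plus.
    do 2 f_equal. field. }
  set (eb := Cexp (Ci * RtoC (coefb t0))%C) in *. set (e1 := Cexp (Ci * RtoC (atan (Im t0 / (1 + Re t0))))%C) in *.
  set (e0 := Cexp (Ci * RtoC (PI / 2 - Im t0))%C) in *.
  assert (Ne1 : e1 <> RtoC 0) by apply Cexp_neq0.
  assert (M1 : 0 < Cmod (1 + t0)%C) by (apply Cmod_gt_0, N1).
  assert (M0 : 0 < Cmod t0) by (apply Cmod_gt_0, N0).
  set (k := coefB t0 / (2 * sqrt PI * sqrt (INR n))).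
  assert (K2 : k * k = 2 * (Cmod t0 ^ 2 / Cmod (1 + t0)%C) / INR n).
  { unfold k. assert (SP := sqrt_sqrt PI ltac:(lra)). assert (SN := sqrt_sqrt (INR n) ltac:(lra)).
    assert (0 < sqrt PI) by (apply sqrt_lt_R0; lra). assert (0 < sqrt (INR n)) by (apply sqrt_lt_R0; lra).
    replace (coefB t0 / (2 * sqrt PI * sqrt (INR n)) * (coefB t0 / (2 * sqrt PI * sqrt (INR n)))) with
      (coefB t0 ^ 2 / (4 * (sqrt PI * sqrt PI) * (sqrt (INR n) * sqrt (INR n)))) by (field; lra).
    rewrite B2, SP, SN. field. lra. }
  unfold inv_root. fold k. fold eb.
  assert (NC : RtoC (INR n) <> RtoC 0) by (apply RtoC_neq0; lra).
  assert (T2 : (t0 * t0)%C = (RtoC (Cmod t0 ^ 2) * (e0 * e0))%C).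
  { rewrite P0 at 1 2. replace (Cmod t0 ^ 2) with (Cmod t0 * Cmod t0) by ring. rewrite RtoC_mult. ring. }
  assert (Z : gauss_param n t0 = (RtoC (INR n) * (1 + t0) / (RtoC 2 * (t0 * t0)))%C).
  { unfold gauss_param, nu. rewrite phase_coef_0. field. exact N0. }
  rewrite Z, T2, <- Eb.
  assert (Neb : eb <> RtoC 0) by apply Cexp_neq0.
  replace (RtoC k * eb * (RtoC k * eb))%C with (RtoC (k * k) * (eb * eb))%C by (rewrite RtoC_mult; ring).
  rewrite K2. rewrite P1 at 2.
  unfold Rdiv. rewrite !RtoC_mult, !RtoC_inv by lra.
  assert (RtoC (Cmod (1 + t0)%C) <> RtoC 0) by (apply RtoC_neq0; lra).
  assert (RtoC (Cmod t0 ^ 2) <> RtoC 0) by (apply RtoC_neq0; nra).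
  assert (RtoC 2 <> RtoC 0) by (apply RtoC_neq0; lra).
  field. repeat split; assumption.
Qed.

Lemma inv_root_Re n t0 : saddle n t0 -> 0 < Re (inv_root n t0).
Proof.
  intros Sd. pose proof (coefB_pos _ _ Sd) as HB.
  assert (Hn : 0 < INR n) by (apply lt_0_INR; destruct Sd; lia).
  generalize PI_RGT_0; intros HP.
  unfold inv_root. rewrite re_mult, re_RtoC, im_RtoC, Rmult_0_l, Rminus_0_r.
  apply Rmult_lt_0_compat.
  - apply Rmult_lt_0_compat; [exact HB|]. apply Rinv_0_lt_compat.
    apply Rmult_lt_0_compat; [apply Rmult_lt_0_compat; [lra|]|]; apply sqrt_lt_R0; lra.
  - replace (Re (Cexp (Ci * RtoC (coefb t0)))) with (cos (coefb t0)).
    + destruct Sd as (_ & Hu & Hv & _).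
      pose proof (atan_bound (Im t0 / (1 + Re t0))) as B.
      assert (0 < atan (Im t0 / (1 + Re t0))).
      { rewrite <- atan_0. apply atan_increasing. apply Rmult_lt_0_compat; [lra|apply Rinv_0_lt_compat; lra]. }
      apply cos_gt_0; unfold coefb; lra.
    + unfold Cexp, Re, Im; simpl. replace (0 * coefb t0 - 1 * 0) with 0 by ring. rewrite exp_0.
      replace (0 * 0 + 1 * coefb t0) with (coefb t0) by ring. ring.
Qed.

(** * The asymptotic expansion *)

(** This is C_s + i D_s, including the prescribed value at s = 0. *)
Definition cprime1 (t0 : C) (alpha beta : nat -> C) (s : nat) : C :=
  match s with O => RtoC 1 | S _ => cprime t0 alpha beta s end.

Lemma chat_0 alpha beta : beta 0%nat <> RtoC 0 -> chat alpha beta 0 = RtoC 1.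
Proof.
  intros Nb. unfold chat. rewrite sum_n_m_Csum. simpl (2 * 0)%nat. simpl Csum.
  rewrite sum_n_m_Csum. simpl Csum.
  assert (P : pochhammer (INR 0 + 1 / 2) 0 = 1) by (rewrite pochhammer_half; simpl; field).
  simpl INR in P |- *. rewrite P. simpl. rewrite Rmult_1_l. field. exact Nb.
Qed.

(** Multiplication by t0 / n shifts the index: (t0 / n) (1/2)_s / n^s =
    (2 t0 / (2 s + 1)) (1/2)_(s+1) / n^(s+1), which is the second part of
    [cprime] at s + 1. The last shifted term is left over. *)
Lemma chat_telescope n t0 alpha beta N : (1 <= n)%nat -> beta 0%nat <> RtoC 0 ->
  ((1 - t0 / RtoC (INR n)) * Csum (fun s => RtoC (half_rising s / INR n ^ s) * chat alpha beta s) (N + 1))%C =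
  (Csum (fun s => RtoC (half_rising s / INR n ^ s) * cprime1 t0 alpha beta s) (N + 1) -
   t0 / RtoC (INR n) * (RtoC (half_rising N / INR n ^ N) * chat alpha beta N))%C.
Proof.
  intros Hn Nb. assert (Hn0 : 0 < INR n) by (apply lt_0_INR; lia).
  assert (NC : RtoC (INR n) <> RtoC 0) by (apply RtoC_neq0; lra).
  induction N as [|N IH].
  - simpl. rewrite chat_0 by exact Nb. ring.
  - replace (S N + 1)%nat with (S (N + 1)) by lia.
    change (Csum ?f (S (N + 1))) with (Csum f (N + 1) + f (N + 1)%nat)%C.
    rewrite Cmult_plus_distr_l, IH. replace (N + 1)%nat with (S N) by lia.
    simpl (cprime1 _ _ _ (S N)). unfold cprime. replace (S N - 1)%nat with N by lia.
    assert (E : RtoC (half_rising (S N) / INR n ^ S N) = (RtoC (half_rising N / INR n ^ N) * RtoC (2 * INR (S N) - 1) / (RtoC 2 * RtoC (INR n)))%C).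
    { rewrite <- !RtoC_mult, <- RtoC_div by (apply Rmult_integral_contrapositive_currified; lra).
      f_equal. rewrite S_INR. simpl. field. split; [apply pow_nonzero; lra|lra]. }
    assert (N2 : RtoC (2 * INR (S N) - 1) <> RtoC 0).
    { apply RtoC_neq0. rewrite S_INR. generalize (pos_INR N); lra. }
    rewrite E. field. split; assumption.
Qed.

Definition chat_const (N : nat) : R :=
  let M := (2 * N + 1)%nat in
  4 ^ N * Rabs (Rsum (fun j => half_rising (N + j) / half_rising N * 4 ^ j * ((1 + INR M) ^ 2 * (pow_const M (taylor_const N) j * taylor_const N))) M).

(** Only alpha_0^(-N) is large, of the order |t0|^N; hence the term left over
    in [chat_telescope] is O (|nu|^(-N-1)). *)
Lemma chat_bound n t0 alpha beta N : far n t0 -> is_psi_expansion n t0 alpha -> is_f_expansion n t0 beta ->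
  Cmod (chat alpha beta N) <= chat_const N * / Cmod (/ t0)%C ^ N.
Proof.
  intros F Hal Hbe. assert (Sd : saddle n t0) by apply F.
  destruct (far_inv _ _ F) as (_ & [W0 W1] & _ & _). destruct (phase_coef_0_bounds _ _ F) as [A1 A2].
  pose proof (saddle_neq0 _ _ Sd) as N0. pose proof (Cinv_neq0 _ N0) as Nw.
  assert (Na : phase_coef (/ t0)%C 0 <> RtoC 0) by (apply Cmod_gt_0; lra).
  pose proof (alpha_explicit _ _ _ F Hal) as Ea. pose proof (beta_explicit _ _ _ F Hbe) as Eb.
  rewrite (chat_formula (/ t0)%C (Defs.f n t0) alpha beta (ampl_coef n t0) N (2 * N + 1)) by
    (auto using f_t0_neq0, ampl_coef_0; lia).
  set (K := taylor_const N). set (M := (2 * N + 1)%nat).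
  assert (HK : 0 <= K) by apply taylor_const_ge0.
  pose proof (phase_tail_taylor n t0 N F) as Hgm. pose proof (ampl_ratio_taylor n t0 N F) as Hb.
  fold M K in Hgm, Hb.
  rewrite Cmod_mult. unfold chat_const. fold M K.
  assert (B1 : Cmod (/ alpha 0%nat ^ N)%C <= 4 ^ N * / Cmod (/ t0)%C ^ N).
  { rewrite Ea, Cmod_inv by (apply Cpow_nz, Cmult_neq_0; assumption).
    rewrite Cmod_pow, Cmod_mult, Rpow_mult_distr, Rinv_mult, Rmult_comm.
    apply Rmult_le_compat_r; [left; apply Rinv_0_lt_compat, pow_lt, W0|].
    rewrite <- pow_inv. apply pow_incr. split; [left; apply Rinv_0_lt_compat; lra|].
    replace 4 with (/ (1 / 4)) by field. apply Rinv_le_contravar; lra. }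
  rewrite (Rmult_comm (4 ^ N)), Rmult_assoc, Rmult_comm.
  apply Rmult_le_compat; try apply Cmod_ge_0; [|exact B1].
  eapply Rle_trans; [|apply Rle_abs]. apply Csum_Rbound. intros j Hj.
  pose proof (proj2 (proj2 (approx_mult _ _ _ _ _ _ _ (approx_pow _ _ M K j Hgm) Hb)) (2 * N)%nat ltac:(unfold M; lia)) as B.
  rewrite !Cmod_mult, Cmod_R.
  pose proof (half_rising_pos (N + j)) as H1. pose proof (half_rising_pos N) as H2.
  assert (H3 : 0 < half_rising (N + j) / half_rising N) by (apply Rmult_lt_0_compat; [exact H1|apply Rinv_0_lt_compat, H2]).
  apply Rmult_le_compat; [apply Rmult_le_pos; [apply Rabs_pos|apply Cmod_ge_0]|apply Cmod_ge_0| |exact B].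
  apply Rmult_le_compat; [apply Rabs_pos|apply Cmod_ge_0| |].
  - assert (R1 : Rabs (-1) = 1) by (rewrite Rabs_left; lra).
    unfold Rdiv at 1. rewrite Rabs_mult, (Rabs_mult ((-1) ^ j)), <- RPow_abs, R1, pow1, Rmult_1_l.
    rewrite (Rabs_right (half_rising (N + j) / half_rising N)) by lra.
    pose proof (inv_fact_le_1 j). rewrite Rabs_right; nra.
  - rewrite Cmod_inv by (apply Cpow_nz, Na). rewrite Cmod_pow, <- pow_inv. apply pow_incr.
    split; [left; apply Rinv_0_lt_compat; lra|].
    replace 4 with (/ (1 / 4)) by field. apply Rinv_le_contravar; lra.
Qed.

Definition prefactor (n : nat) (t0 : C) : R :=
  coefB t0 * exp (INR n * coefA t0) / sqrt (INR n).

Definition phase (n : nat) (t0 : C) : R := INR n * coefa t0 + coefb t0.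

Definition expansion (n : nat) (t0 : C) (alpha beta : nat -> C) (N : nat) : C :=
  Csum (fun s => RtoC (half_rising s / INR n ^ s) * cprime1 t0 alpha beta s)%C (N + 1).

Lemma prefactor_pos n t0 : saddle n t0 -> 0 < prefactor n t0.
Proof.
  intros Sd. unfold prefactor. apply Rmult_lt_0_compat.
  - apply Rmult_lt_0_compat; [apply (coefB_pos _ _ Sd)|apply exp_pos].
  - apply Rinv_0_lt_compat, sqrt_lt_R0, lt_0_INR. destruct Sd; lia.
Qed.

Lemma prefactor_eq n t0 : saddle n t0 ->
  (RtoC 2 * (main_term n t0 * (inv_root n t0 * RtoC (sqrt PI))))%C =
  (RtoC (prefactor n t0) * Cexp (Ci * RtoC (phase n t0)))%C.
Proof.
  intros Sd. assert (Hn : 0 < INR n) by (apply lt_0_INR; destruct Sd; lia).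
  rewrite (main_term_t0 _ _ Sd). unfold inv_root, prefactor, phase.
  assert (0 < sqrt (INR n)) by (apply sqrt_lt_R0, Hn). pose proof sqrt_PI_ge.
  rewrite RtoC_plus, Cmult_plus_distr_l, Cexp_plus.
  replace (coefB t0 * exp (INR n * coefA t0) / sqrt (INR n)) with
    (2 * (exp (INR n * coefA t0) * (coefB t0 / (2 * sqrt PI * sqrt (INR n)) * sqrt PI))) by (field; lra).
  rewrite !RtoC_mult. ring.
Qed.

Lemma sqrt_PI_le : sqrt PI <= 2.
Proof.
  replace 2 with (sqrt 4).
  - apply sqrt_le_1_alt, PI_4.
  - replace 4 with (2 ^ 2) by ring. apply sqrt_pow2. lra.
Qed.

(** The errors are bounded relative to |main_term n t0|, whereas the prefactor
    also contains the factor |inv_root n t0|, of the order |nu|^(-1/2); the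
    quotient costs sqrt |nu|. *)
Lemma remainder_bound (zeta : C -> C) (gamma : nat -> C) N :
  is_Riemann_zeta zeta -> is_Stieltjes zeta gamma ->
  exists C3, 0 <= C3 /\ forall n t0 alpha beta,
  far n t0 -> is_psi_expansion n t0 alpha -> is_f_expansion n t0 beta ->
  Rabs (Re (gamma n) / prefactor n t0 - Re (Cexp (Ci * RtoC (phase n t0)) * expansion n t0 alpha beta N)%C)
  <= C3 * sqrt (Cmod (nu n t0)) / Cmod (nu n t0) ^ (N + 1).
Proof.
  intros Hz Hg. destruct (chat_sum_local N) as (C0 & HC0 & HL).
  set (D := INR (fact (N + 2)) * 32 ^ (N + 2)). set (Cc := half_rising N * chat_const N).
  exists (D + 4 * C0 + 4 * Rabs Cc). split.
  { assert (0 <= D) by (apply Rmult_le_pos; [left; apply INR_fact_lt_0|apply pow_le; lra]).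
    generalize (Rabs_pos Cc); lra. }
  intros n t0 alpha beta F Hal Hbe. assert (Sd : saddle n t0) by apply F.
  destruct (far_inv _ _ F) as (Ew & [W0 W1] & _ & _). destruct (nu_large _ _ F) as [HH Hu6].
  assert (Hu : 20 <= Re t0) by apply F.
  pose proof (saddle_neq0 _ _ Sd) as N0.
  assert (Hn : 0 < INR n) by (apply lt_0_INR; destruct Sd; lia).
  assert (NC : RtoC (INR n) <> RtoC 0) by (apply RtoC_neq0; lra).
  pose proof (inv_root_sqr _ _ Sd) as Rs. pose proof (inv_root_Re _ _ Sd) as Rp.
  specialize (HL n t0 alpha beta (inv_root n t0) F Hal Hbe Rp Rs).
  pose proof (line_to_amplitude n t0 F) as L2.
  pose proof (stieltjes_saddle zeta gamma n t0 Hz Hg F) as L1.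
  pose proof (prefactor_eq _ _ Sd) as PE. pose proof (prefactor_pos _ _ Sd) as PP.
  assert (Nb : beta 0%nat <> RtoC 0).
  { rewrite (beta_explicit n t0 beta F Hbe), ampl_coef_0, Cmult_1_r. apply f_t0_neq0, Sd. }
  pose proof (chat_telescope n t0 alpha beta N ltac:(apply Sd) Nb) as CT.
  pose proof (chat_bound n t0 alpha beta N F Hal Hbe) as CB.
  destruct (gauss_param_bounds _ _ F) as [Z1 _]. destruct (phase_coef_0_bounds _ _ F) as [_ A2].
  set (H := Cmod (nu n t0)) in *. set (a := main_term n t0) in *. set (r := inv_root n t0) in *.
  set (I0 := Cint (peak n t0) (-1) 1) in *.
  set (I1 := Cint (fun x => peak n t0 x * ampl_ratio n t0 x)%C (-1) 1) in *.
  set (Sc := Csum (fun s => RtoC (half_rising s / INR n ^ s) * chat alpha beta s)%C (N + 1)) in *.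
  fold (expansion n t0 alpha beta N) in CT. set (S := expansion n t0 alpha beta N) in *.
  set (T := (t0 / RtoC (INR n) * (RtoC (half_rising N / INR n ^ N) * chat alpha beta N))%C) in *.
  set (g := exp (- (H / 32))) in *. assert (Hg0 : 0 < g) by apply exp_pos.
  assert (Hk : 0 < H ^ (N + 1)) by (apply pow_lt; lra).
  assert (Hik : 0 < / H ^ (N + 1)) by (apply Rinv_0_lt_compat, Hk).
  assert (R2 : Cmod r * Cmod r * Cmod (gauss_param n t0) = 1).
  { rewrite <- !Cmod_mult, Rs. apply Cmod_1. }
  pose proof (Cmod_ge_0 r) as R0.
  assert (Zle : Cmod (gauss_param n t0) <= H).
  { unfold gauss_param. rewrite Cmod_mult. fold H. rewrite <- (Rmult_1_r H) at 2. apply Rmult_le_compat_l; lra. }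
  assert (Zge : 1 <= Cmod (gauss_param n t0)) by (generalize (Cmod_ge_Re (gauss_param n t0)); lra).
  assert (R1 : Cmod r <= 1).
  { destruct (Rle_dec (Cmod r) 1); [assumption|exfalso]. assert (1 < Cmod r * Cmod r) by nra. nra. }
  assert (Rs1 : 1 <= Cmod r * sqrt H).
  { assert (Q : 1 <= (Cmod r * sqrt H) * (Cmod r * sqrt H)).
    { replace (Cmod r * sqrt H * (Cmod r * sqrt H)) with (Cmod r * Cmod r * (sqrt H * sqrt H)) by ring.
      rewrite sqrt_sqrt by lra. rewrite <- R2. apply Rmult_le_compat_l; [apply Rmult_le_pos; assumption|exact Zle]. }
    assert (0 <= Cmod r * sqrt H) by (apply Rmult_le_pos; [exact R0|apply sqrt_pos]). nra. }
  pose proof sqrt_PI_ge as SP1. pose proof sqrt_PI_le as SP2.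
  assert (BT : Cmod T <= Rabs Cc * / H ^ (N + 1)).
  { unfold T. rewrite !Cmod_mult, Cmod_div, !Cmod_R by exact NC.
    assert (Hnn : 0 < INR n ^ N) by (apply pow_lt, Hn). pose proof (half_rising_pos N) as Hh.
    rewrite (Rabs_right (INR n)) by lra.
    rewrite (Rabs_right (half_rising N / INR n ^ N)).
    2:{ left. apply Rmult_lt_0_compat; [exact Hh|apply Rinv_0_lt_compat, Hnn]. }
    assert (HT : Cmod t0 = / Cmod (/ t0)%C) by (rewrite Ew, Rinv_inv; reflexivity).
    rewrite HT. set (w := Cmod (/ t0)%C) in *.
    assert (EH : H = INR n * w) by (unfold H, w; apply Cmod_nu).
    apply Rle_trans with (/ w / INR n * (half_rising N / INR n ^ N * (chat_const N * / w ^ N))).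
    - apply Rmult_le_compat_l; [apply Rmult_le_pos; left; apply Rinv_0_lt_compat; lra|].
      apply Rmult_le_compat_l; [|exact CB].
      left. apply Rmult_lt_0_compat; [exact Hh|apply Rinv_0_lt_compat, Hnn].
    - assert (Hw : 0 < w ^ N) by (apply pow_lt, W0).
      replace (/ w / INR n * (half_rising N / INR n ^ N * (chat_const N * / w ^ N))) with (Cc * / H ^ (N + 1)).
      + apply Rmult_le_compat_r; [lra|apply Rle_abs].
      + rewrite EH, pow_add, pow_1, !Rpow_mult_distr. unfold Cc. field. repeat split; lra. }
  assert (B1m : Cmod (1 - t0 / RtoC (INR n))%C <= 2).
  { eapply Rle_trans; [apply Cmod_minus_le|]. rewrite Cmod_1, Cmod_div, Cmod_R, Rabs_right by (try exact NC; lra).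
    pose proof (far_n _ _ F). assert (Cmod t0 / INR n <= 1); [|lra].
    apply Rmult_le_reg_r with (INR n); [exact Hn|]. unfold Rdiv. rewrite Rmult_assoc, Rinv_l; generalize (Cmod_ge_0 t0); lra. }
  assert (BI : Cmod (I0 - r * RtoC (sqrt PI) * S)%C <= g + 2 * (C0 * / H ^ (N + 1)) + 2 * (Rabs Cc * / H ^ (N + 1))).
  { replace (I0 - r * RtoC (sqrt PI) * S)%C with
      ((I0 - (1 - t0 / RtoC (INR n)) * I1) + (1 - t0 / RtoC (INR n)) * (I1 - r * RtoC (sqrt PI) * Sc) -
       r * RtoC (sqrt PI) * T)%C.
    2:{ replace S with ((1 - t0 / RtoC (INR n)) * Sc + T)%C by (rewrite CT; ring). ring. }
    eapply Rle_trans; [apply Cmod_minus_le|]. apply Rplus_le_compat.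
    - eapply Rle_trans; [apply Cmod_triangle|]. apply Rplus_le_compat; [exact L2|].
      rewrite Cmod_mult. apply Rmult_le_compat; try apply Cmod_ge_0; [exact B1m|exact HL].
    - rewrite !Cmod_mult, Cmod_R, Rabs_right by lra.
      apply Rmult_le_compat; [apply Rmult_le_pos; lra|apply Cmod_ge_0|nra|exact BT]. }
  set (P := prefactor n t0) in *. set (eth := Cexp (Ci * RtoC (phase n t0))%C) in *.
  assert (Pmod : P = 2 * Cmod a * (Cmod r * sqrt PI)).
  { apply (f_equal Cmod) in PE. rewrite !Cmod_mult, !Cmod_R in PE.
    rewrite (Rabs_right 2), (Rabs_right P), (Rabs_right (sqrt PI)) in PE by lra.
    assert (Eth : Cmod eth = 1).
    { unfold eth. rewrite Cmod_Cexp. replace (Re (Ci * RtoC (phase n t0))%C) with 0 by (unfold Re; simpl; ring). apply exp_0. }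
    rewrite Eth in PE. lra. }
  assert (Ha : 0 <= Cmod a) by apply Cmod_ge_0.
  assert (BG : Rabs (Re (gamma n) - P * Re (eth * S)%C) <= Cmod a * ((D + 4 * C0 + 4 * Rabs Cc) * / H ^ (N + 1))).
  { assert (E1 : P * Re (eth * S)%C = 2 * Re (a * (r * RtoC (sqrt PI) * S))%C).
    { replace (P * Re (eth * S)%C) with (Re (RtoC P * eth * S)%C).
      - rewrite <- PE. replace (RtoC 2 * (a * (r * RtoC (sqrt PI))) * S)%C with (RtoC 2 * (a * (r * RtoC (sqrt PI) * S)))%C by ring.
        rewrite re_mult, re_RtoC, im_RtoC. ring.
      - rewrite <- Cmult_assoc, re_mult, re_RtoC, im_RtoC. ring. }
    rewrite E1.
    replace (Re (gamma n) - 2 * Re (a * (r * RtoC (sqrt PI) * S))%C) with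
      ((Re (gamma n) - 2 * Re (a * I0)%C) + 2 * Re (a * (I0 - r * RtoC (sqrt PI) * S))%C).
    2:{ rewrite Cmult_minus_distr_l, re_minus. ring. }
    eapply Rle_trans; [apply Rabs_triang|].
    rewrite Rabs_mult, (Rabs_right 2) by lra.
    pose proof (re_le_Cmod (a * (I0 - r * RtoC (sqrt PI) * S))%C) as Q. rewrite Cmod_mult in Q.
    assert (Q2 : Cmod a * Cmod (I0 - r * RtoC (sqrt PI) * S)%C <= Cmod a * (g + 2 * (C0 * / H ^ (N + 1)) + 2 * (Rabs Cc * / H ^ (N + 1))))
      by (apply Rmult_le_compat_l; assumption).
    (* The factors 4 Re t0 + 27 in front of exponentially small terms are at
       most H. *)
    assert (Eg : H * g <= D * / H ^ (N + 1)).
    { pose proof (exp_small (N + 2) H ltac:(lra)) as X. fold g in X. fold D in X.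
      apply Rle_trans with (H * (D / H ^ (N + 2))); [apply Rmult_le_compat_l; lra|].
      right. replace (N + 2)%nat with (N + 1 + 1)%nat by lia. rewrite (pow_add H (N + 1)), pow_1. field. lra. }
    assert (G27 : (4 * Re t0 + 27) * g <= H * g) by (apply Rmult_le_compat_r; lra).
    apply Rle_trans with (Cmod a * ((4 * Re t0 + 27) * g + 4 * (C0 * / H ^ (N + 1)) + 4 * (Rabs Cc * / H ^ (N + 1)))).
    - lra.
    - apply Rmult_le_compat_l; [exact Ha|]. lra. }
  replace (Re (gamma n) / P - Re (eth * S)%C) with ((Re (gamma n) - P * Re (eth * S)%C) / P) by (field; lra).
  unfold Rdiv at 1. rewrite Rabs_mult, (Rabs_right (/ P)) by (left; apply Rinv_0_lt_compat, PP).
  apply Rmult_le_reg_r with P; [exact PP|]. rewrite Rmult_assoc, Rinv_l, Rmult_1_r by lra.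
  eapply Rle_trans; [exact BG|].
  set (C3 := D + 4 * C0 + 4 * Rabs Cc) in *.
  assert (HC3 : 0 <= C3 * / H ^ (N + 1)).
  { apply Rmult_le_pos; [|lra]. unfold C3.
    assert (0 <= D) by (apply Rmult_le_pos; [left; apply INR_fact_lt_0|apply pow_le; lra]).
    generalize (Rabs_pos Cc); lra. }
  rewrite Pmod.
  replace (C3 * sqrt H / H ^ (N + 1) * (2 * Cmod a * (Cmod r * sqrt PI))) with
    (Cmod a * (C3 * / H ^ (N + 1)) * (2 * (Cmod r * sqrt H) * sqrt PI)) by (unfold Rdiv; ring).
  rewrite <- (Rmult_1_r (Cmod a * (C3 * / H ^ (N + 1)))) at 1.
  apply Rmult_le_compat_l; [apply Rmult_le_pos; assumption|]. nra.
Qed.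

Lemma sum_n_m_Rsum (a : nat -> R) N : sum_n_m a 0 N = Rsum a (N + 1).
Proof.
  induction N as [|N IH].
  - rewrite sum_n_n. simpl. eq_in_R. ring.
  - rewrite sum_n_Sm by lia. rewrite IH. replace (S N + 1)%nat with (S (N + 1)) by lia.
    simpl Rsum. replace (N + 1)%nat with (S N) by lia. reflexivity.
Qed.

Lemma sum_n_m_Rsum1 (a : nat -> R) N : a 0%nat = 0 -> sum_n_m a 1 N = Rsum a (N + 1).
Proof.
  intros H0. rewrite <- sum_n_m_Rsum. destruct N as [|N].
  - rewrite sum_n_m_zero by lia. rewrite sum_n_n. symmetry; exact H0.
  - rewrite (sum_n_m_Chasles a 0 0 (S N)) by lia. rewrite sum_n_n, H0.
    change (plus 0 (sum_n_m a 1 (S N))) with (0 + sum_n_m a 1 (S N)). symmetry. apply Rplus_0_l.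
Qed.

Lemma bracket_eq n t0 alpha beta N : (1 <= n)%nat ->
  Re (Cexp (Ci * RtoC (phase n t0)) * expansion n t0 alpha beta N)%C =
  cos (INR n * coefa t0 + coefb t0) *
    sum_n_m (fun s => coefC t0 alpha beta s * pochhammer (1 / 2) s / INR n ^ s) 0 N -
  sin (INR n * coefa t0 + coefb t0) *
    sum_n_m (fun s => coefD t0 alpha beta s * pochhammer (1 / 2) s / INR n ^ s) 1 N.
Proof.
  intros Hn. rewrite sum_n_m_Rsum, sum_n_m_Rsum1 by (simpl; unfold Rdiv; ring).
  assert (E : expansion n t0 alpha beta N =
    (Rsum (fun s => coefC t0 alpha beta s * pochhammer (1 / 2) s / INR n ^ s) (N + 1),
     Rsum (fun s => coefD t0 alpha beta s * pochhammer (1 / 2) s / INR n ^ s) (N + 1))).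
  { unfold expansion. induction (N + 1)%nat as [|M IH]; [reflexivity|].
    simpl Csum. rewrite IH. simpl Rsum. rewrite pochhammer_half0.
    set (x := Rsum _ M). set (y := Rsum _ M). clearbody x y.
    apply C_ext; rewrite ?re_plus, ?im_plus, ?re_mult, ?im_mult, ?re_RtoC, ?im_RtoC.
    - change (x + (half_rising M / INR n ^ M * Re (cprime1 t0 alpha beta M) - 0 * Im (cprime1 t0 alpha beta M)) =
        x + coefC t0 alpha beta M * half_rising M / INR n ^ M).
      replace (Re (cprime1 t0 alpha beta M)) with (coefC t0 alpha beta M) by (destruct M; reflexivity).
      unfold Rdiv; ring.
    - change (y + (half_rising M / INR n ^ M * Im (cprime1 t0 alpha beta M) + 0 * Re (cprime1 t0 alpha beta M)) =
        y + coefD t0 alpha beta M * half_rising M / INR n ^ M).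
      replace (Im (cprime1 t0 alpha beta M)) with (coefD t0 alpha beta M) by (destruct M; reflexivity).
      unfold Rdiv; ring. }
  rewrite E, re_mult. unfold phase, Cexp.
  replace (Re (Ci * RtoC (INR n * coefa t0 + coefb t0))%C) with 0 by (unfold Re; simpl; ring).
  replace (Im (Ci * RtoC (INR n * coefa t0 + coefb t0))%C) with (INR n * coefa t0 + coefb t0)
    by (unfold Im; simpl; ring).
  rewrite exp_0. unfold Re, Im; simpl. ring.
Qed.

Lemma stieltjes_real (zeta : C -> C) (gamma : nat -> C) n :
  is_Riemann_zeta zeta -> is_Stieltjes zeta gamma -> (1 <= n)%nat -> gamma n = RtoC (Re (gamma n)).
Proof.
  intros Hz Hg Hn. generalize PI2_3_2; intros HP.
  rewrite (stieltjes_path_integral zeta gamma 1 n Hz Hg ltac:(lra) Hn). reflexivity.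
Qed.

Lemma decay_in_u N : exists C4, 0 <= C4 /\ forall u, 0 < u -> (u + 2) ^ N * exp (- (u / 2)) <= C4 / u.
Proof.
  exists (2 ^ (N + 1) * (INR (fact (N + 1)) * exp 1)). split.
  { apply Rmult_le_pos; [apply pow_le; lra|]. apply Rmult_le_pos; [left; apply INR_fact_lt_0|left; apply exp_pos]. }
  intros u Hu. pose proof (pow_fact_le ((u + 2) / 2) (N + 1) ltac:(lra)) as P.
  apply Rmult_le_reg_r with u; [exact Hu|]. unfold Rdiv at 2. rewrite (Rmult_assoc _ (/ u)), Rinv_l, Rmult_1_r by lra.
  assert (Hp : 0 <= (u + 2) ^ N) by (apply pow_le; lra).
  assert (He := exp_pos (- (u / 2))).
  apply Rle_trans with ((u + 2) ^ (N + 1) * exp (- (u / 2))).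
  { rewrite pow_add, pow_1. replace ((u + 2) ^ N * exp (- (u / 2)) * u) with ((u + 2) ^ N * u * exp (- (u / 2))) by ring.
    apply Rmult_le_compat_r; [lra|]. apply Rmult_le_compat_l; lra. }
  replace ((u + 2) ^ (N + 1)) with (2 ^ (N + 1) * ((u + 2) / 2) ^ (N + 1)).
  2:{ rewrite <- Rpow_mult_distr. f_equal. field. }
  rewrite Rmult_assoc. apply Rmult_le_compat_l; [apply pow_le; lra|].
  apply Rle_trans with (INR (fact (N + 1)) * exp ((u + 2) / 2) * exp (- (u / 2))); [apply Rmult_le_compat_r; lra|].
  rewrite Rmult_assoc, <- exp_plus. replace ((u + 2) / 2 + - (u / 2)) with 1 by field. lra.
Qed.

Theorem theorem1
  (zeta : C -> C) (gamma : nat -> C)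
  (t0 : nat -> C) (alpha beta : nat -> nat -> C)
  (Hzeta : is_Riemann_zeta zeta)
  (Hgamma : is_Stieltjes zeta gamma)
  (Ht0 : forall n : nat, (1 <= n)%nat ->
     is_LambertW0 (RtoC (INR n) * Ci / RtoC (2 * PI))%C (t0 n))
  (Halpha : forall n : nat, (1 <= n)%nat ->
     is_psi_expansion n (t0 n) (alpha n))
  (Hbeta : forall n : nat, (1 <= n)%nat ->
     is_f_expansion n (t0 n) (beta n))
  (N : nat) :
  exists eps : nat -> R,
    is_lim_seq (fun n => eps n * INR n ^ N) 0 /\
    forall n : nat, (1 <= n)%nat ->
      gamma n = RtoC
        (coefB (t0 n) * exp (INR n * coefA (t0 n)) / sqrt (INR n) *
         (cos (INR n * coefa (t0 n) + coefb (t0 n)) *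
            sum_n_m (fun s => coefC (t0 n) (alpha n) (beta n) s
                              * pochhammer (1 / 2) s / INR n ^ s) 0 N
          - sin (INR n * coefa (t0 n) + coefb (t0 n)) *
            sum_n_m (fun s => coefD (t0 n) (alpha n) (beta n) s
                              * pochhammer (1 / 2) s / INR n ^ s) 1 N
          + eps n)).
Proof.
  assert (Sd : forall n, (1 <= n)%nat -> saddle n (t0 n)).
  { intros n Hn. apply lambert_saddle; [exact Hn|apply Ht0, Hn]. }
  set (br := fun n => Re (Cexp (Ci * RtoC (phase n (t0 n))) * expansion n (t0 n) (alpha n) (beta n) N)%C).
  exists (fun n => Re (gamma n) / prefactor n (t0 n) - br n). split.
  - destruct (remainder_bound zeta gamma N Hzeta Hgamma) as (C3 & HC3 & HB).
    destruct (decay_in_u N) as (C4 & HC4 & HD).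
    apply is_lim_seq_spec. intros [e He]. simpl pos.
    destruct (saddle_far t0 Sd (Rmax 20 (C3 * C4 / e + 1))) as [n0 Hn0].
    exists (S n0). intros n Hn. rewrite Rminus_0_r.
    assert (Hn1 : (1 <= n)%nat) by lia.
    specialize (Hn0 n ltac:(lia) Hn1).
    assert (H20 : 20 <= Re (t0 n)) by (eapply Rle_trans; [apply Rmax_l|exact Hn0]).
    assert (HU : C3 * C4 / e + 1 <= Re (t0 n)) by (eapply Rle_trans; [apply Rmax_r|exact Hn0]).
    assert (F : far n (t0 n)) by (split; [apply Sd, Hn1|exact H20]).
    specialize (HB n (t0 n) (alpha n) (beta n) F (Halpha n Hn1) (Hbeta n Hn1)).
    fold (br n) in HB.
    destruct (nu_large _ _ F) as [HH _]. destruct (far_inv _ _ F) as (Ew & [W0 W1] & _).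
    pose proof (nu_exp _ _ F) as NE. pose proof (saddle_Cmod_le _ _ (Sd n Hn1)) as TL.
    pose proof (Cmod_ge_Re (t0 n)) as TG.
    assert (EN : INR n = Cmod (nu n (t0 n)) * Cmod (t0 n)) by (rewrite Cmod_nu, Ew; field; lra).
    set (H := Cmod (nu n (t0 n))) in *. set (u := Re (t0 n)) in *.
    rewrite Rabs_mult, (Rabs_right (INR n ^ N)) by (apply Rle_ge, pow_le, pos_INR).
    assert (Hk : 0 < H ^ N) by (apply pow_lt; lra).
    assert (Hsq : 0 < sqrt H) by (apply sqrt_lt_R0; lra).
    apply Rle_lt_trans with (C3 * sqrt H / H ^ (N + 1) * INR n ^ N).
    { apply Rmult_le_compat_r; [apply pow_le, pos_INR|exact HB]. }
    rewrite EN, Rpow_mult_distr.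
    replace (C3 * sqrt H / H ^ (N + 1) * (H ^ N * Cmod (t0 n) ^ N)) with (C3 * (Cmod (t0 n) ^ N * / sqrt H)).
    2:{ assert (X : sqrt H / H = / sqrt H).
        { rewrite <- (sqrt_sqrt H) at 2 by lra. field. lra. }
        rewrite <- X, pow_add, pow_1. field. split; lra. }
    (* n = H |t0| with H = 2 pi e^u and |t0| <= u + 2, so the bound of
       [remainder_bound] times n^N is at most of the order (u + 2)^N e^(-u/2). *)
    assert (Hs : / sqrt H <= exp (- (u / 2))).
    { rewrite exp_Ropp. apply Rinv_le_contravar; [apply exp_pos|].
      rewrite <- (sqrt_pow2 (exp (u / 2))) by (left; apply exp_pos). apply sqrt_le_1_alt.
      simpl. rewrite Rmult_1_r, <- exp_plus. replace (u / 2 + u / 2) with u by field.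
      rewrite NE. generalize PI2_3_2 (exp_pos u); intros. nra. }
    assert (Hpow : Cmod (t0 n) ^ N <= (u + 2) ^ N) by (apply pow_incr; lra).
    apply Rle_lt_trans with (C3 * (C4 / u)).
    { apply Rmult_le_compat_l; [exact HC3|]. eapply Rle_trans; [|apply HD; lra].
      apply Rmult_le_compat; [apply pow_le; lra|left; apply Rinv_0_lt_compat, Hsq|exact Hpow|exact Hs]. }
    apply Rmult_lt_reg_r with u; [lra|].
    replace (C3 * (C4 / u) * u) with (C3 * C4) by (field; lra).
    assert (Q : C3 * C4 / e * e = C3 * C4) by (field; lra).
    assert (C3 * C4 / e < u) by lra. nra.
  - intros n Hn. rewrite (stieltjes_real zeta gamma n Hzeta Hgamma Hn) at 1. f_equal.
    rewrite <- bracket_eq by exact Hn. fold (br n).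
    pose proof (prefactor_pos _ _ (Sd n Hn)) as PP.
    change (coefB (t0 n) * exp (INR n * coefA (t0 n)) / sqrt (INR n)) with (prefactor n (t0 n)).
    field. lra.
Qed.
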